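(* Let $\Omega$, $H$, $\Sigma_\rho^\pm$, $\Gamma_D,\Gamma_N,\Gamma_M$, $\nu$, $\mathbb{H}$ and $a$ be as described in the context, and set $$G_{H}(y)=\frac{1}{4H(y)}\left(\int_R^yH(\tau)^{-1}\,d\tau\right)^{-2},\qquad y>R.$$ Suppose that the boundary conditions imposed contain the condition $u=0$ on $\Sigma_\rho^+$, or the condition $u=0$ on $\Sigma_\rho^-$, for some $\rho\ge R$ (for all $u\in\mathbb{H}$, in the sense of traces), and suppose that $$\lim_{y\to\infty}H(y)^{-3}G_H(y)=+\infty .$$ Then the Kirchhoff plate problem $\Delta^2u=\lambda u$ in $\Omega$ with these boundary conditions has only a discrete spectrum.
   Context: Write $x=(x_1,x_2)=(y,z)\in\mathbb{R}^2$. Let $R\in\mathbb{R}$ and let $H:[R,\infty)\to(0,\infty)$ be smooth and monotone decreasing, with $H'(y)\to 0$ as $y\to+\infty$ and $H''$ bounded. For $\rho\ge R$ put $\Pi_\rho=\{(y,z): y>\rho,\ -H(y)<z<H(y)\}$ and $\Sigma_\rho^\pm=\{(y,z): y>\rho,\ z=\pm H(y)\}$. Let $\Omega\subset\mathbb{R}^2$ be a domain with $C^\infty$ boundary $\Gamma=\partial\Omega$ such that $\Omega\cap\{x_1>R\}=\Pi_R$ and $\Omega\setminus\{x_1>R\}$ is bounded. Let $\Gamma_D,\Gamma_N,\Gamma_M\subset\Gamma$ be pairwise disjoint unions of finite families of open curves with $\Gamma=\overline{\Gamma_D}\cup\overline{\Gamma_N}\cup\overline{\Gamma_M}$ (some of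 them may be empty), and let $\nu\in[0,1/2)$. With $\partial_n,\partial_s$ the normal and tangential derivatives and $\varkappa$ the signed curvature of $\Gamma$ (positive on convex parts), the boundary conditions are: - on $\Gamma_D$ (clamped): $u=\partial_nu=0$; - on $\Gamma_N$ (traction-free): $\partial_n\Delta u-(1-\nu)(\partial_s\varkappa\partial_su-\partial_s^2\partial_nu)=0$ and $\Delta u-(1-\nu)(\partial_s^2u+\varkappa\partial_nu)=0$; - on $\Gamma_M$ (hinged): $u=0$ and $\Delta u-(1-\nu)\varkappa\partial_nu=0$. The problem is understood in variational form: $a(u,v)=\lambda(u,v)_{L_2(\Omega)}$ for all $v\in\mathbb{H}$, where $\mathbb{H}$ is the subspace of all $u\in H^2(\Omega)$ with $u=\partial_nu=0$ on $\Gamma_D$ and $u=0$ on $\Gamma_M$ in the sense of traces, and $a$ is the symmetric bilinear form with $$a(u,u)=\int_\Omega\Big(|\partial_{x_1}^2u|^2+|\partial_{x_2}^2u|^2+2(1-\nu)|\partial_{x_1}\partial_{x_2}u|^2+2\nu\,\partial_{x_1}^2u\,\partial_{x_2}^2u\Big)dx .$$ The conditions on $\Gamma_N$ and the second condition on $\Gamma_M$ are the natural boundary conditions of this formulation. The spectrum of the problem is the spectrum of the nonnegative self-adjoint operator $A$ in $L_2(\Omega)$ associated with (the closure of) the form $a$ with form domain $\mathbb{H}$. It is discrete if it consists only of isolated eigenvalues of finite multiplicity (with no finite accumulation point); equivalently, the embedding of the form domain, with norm $(a(u,u)+\|u\|_{L_2(\Omega)}^2)^{1/2}$, into $L_2(\Omega)$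 is compact. *)

(* Defs.v *)
From HB Require Import structures.
From mathcomp Require Import all_boot all_order all_algebra.
From mathcomp Require Import all_classical all_reals all_analysis.

Set Implicit Arguments.
Unset Strict Implicit.
Unset Printing Implicit Defensive.

Import Order.TTheory GRing.Theory Num.Theory.
Import numFieldNormedType.Exports.

Local Open Scope classical_set_scope.
Local Open Scope ring_scope.

Section Smoothness.
Context {R : realType}.

Definition smooth1 (f : R -> R) : Prop :=
  forall (n : nat) (x : R), derivable (derive1n n f) x 1.

(* C^oo on the closed half-line [y0, +oo[, including at y0; values of f to the
   left of y0 are junk. *)
Definition smooth_from (y0 : R) (f : R -> R) : Prop :=
  exists g : R -> R, smooth1 g /\ (forall y, y0 <= y -> f y = g y).

Definition pd1 (f : R * R -> R) : R * R -> R := fun x => 'D_((1, 0) : R * R) f x.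
Definition pd2 (f : R * R -> R) : R * R -> R := fun x => 'D_((0, 1) : R * R) f x.

(* The mixed partial derivative of order i in x_1 and j in x_2. *)
Definition pd (i j : nat) (f : R * R -> R) : R * R -> R :=
  iter i pd1 (iter j pd2 f).

Fixpoint cont_diff (k : nat) (f : R * R -> R) : Prop :=
  continuous f /\
  match k with
  | 0%N => True
  | k'.+1 =>
      [/\ forall x, derivable f x ((1, 0) : R * R),
          forall x, derivable f x ((0, 1) : R * R),
          cont_diff k' (pd1 f) & cont_diff k' (pd2 f)]
  end.

Definition smooth2 (f : R * R -> R) : Prop := forall k, cont_diff k f.

Definition test_function (Omega : set (R * R)) (phi : R * R -> R) : Prop :=
  smooth2 phi /\
  exists K : set (R * R), [/\ compact K, K `<=` Omega &
    forall x, ~ K x -> phi x = 0].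

End Smoothness.

Section Geometry.
Context {R : realType}.

Definition boundary (Omega : set (R * R)) : set (R * R) :=
  closure Omega `\` Omega°.

(* Near each of its boundary points, and after exchanging the coordinates
   (swap) and/or reflecting (flip) if necessary, Omega is the strict epigraph
   of a C^oo function. *)
Definition smooth_boundary (Omega : set (R * R)) : Prop :=
  forall p, boundary Omega p ->
  exists (e : R) (h : R -> R) (swap flip : bool),
    [/\ 0 < e, smooth1 h & forall x, ball p e x ->
       let s := if swap then x.2 else x.1 in
       let t := if swap then x.1 else x.2 in
       Omega x <-> (if flip then t < h s else h s < t)].

(* An open curve on Gamma is a connected, relatively open subset of Gamma;
   thus it contains none of its endpoints, if it has any. *)
Definition open_curve (Gamma C : set (R * R)) : Prop :=
  connected C /\ exists U : set (R * R), open U /\ C = U `&` Gamma.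

Definition finite_union_of_open_curves (Gamma S : set (R * R)) : Prop :=
  exists F : set (set (R * R)),
    [/\ finite_set F, (forall C, F C -> open_curve Gamma C) &
        S = \bigcup_(C in F) C].

Definition cusp (H : R -> R) (rho : R) : set (R * R) :=
  [set x | [/\ rho < x.1, - H x.1 < x.2 & x.2 < H x.1]].

Definition cusp_top (H : R -> R) (rho : R) : set (R * R) :=
  [set x | rho < x.1 /\ x.2 = H x.1].

Definition cusp_bottom (H : R -> R) (rho : R) : set (R * R) :=
  [set x | rho < x.1 /\ x.2 = - H x.1].

Definition G_ (y0 : R) (H : R -> R) (y : R) : R :=
  (4 * H y)^-1 *
  (\int[lebesgue_measure]_(tau in `[y0, y]%classic) (H tau)^-1) ^- 2.

End Geometry.

Section Sobolev.
Context {R : realType}.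

Local Notation plane := (measurableTypeR R * measurableTypeR R)%type.

Definition mu2 : {measure set plane -> \bar R} :=
  ((@lebesgue_measure R) \x (@lebesgue_measure R))%E.

(* Elements of L_2(Omega) are represented by real-valued functions on the whole
   plane; only their restriction to Omega matters, up to null sets. *)
Definition L2 (Omega : set (R * R)) (u : R * R -> R) : Prop :=
  measurable_fun (Omega : set plane) (u : plane -> R) /\
  mu2.-integrable Omega (fun x => ((u x) ^+ 2)%:E).

Definition ae_eq_on (Omega : set (R * R)) (u v : R * R -> R) : Prop :=
  {ae mu2, forall x, Omega x -> u x = v x}.

Definition dotL2 (Omega : set (R * R)) (u v : R * R -> R) : R :=
  \int[mu2]_(x in Omega) (u x * v x).

Definition sqdistL2 (A : set (R * R)) (u v : R * R -> R) : \bar R :=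
  (\int[mu2]_(x in A) ((u x - v x) ^+ 2)%:E)%E.

Definition is_weak_deriv (Omega : set (R * R)) (i j : nat)
    (u g : R * R -> R) : Prop :=
  forall phi, test_function Omega phi ->
    dotL2 Omega u (pd i j phi) = (-1) ^+ (i + j) * dotL2 Omega g phi.

Definition has_weak_deriv (Omega : set (R * R)) (i j : nat)
    (u : R * R -> R) : Prop :=
  exists g, L2 Omega g /\ is_weak_deriv Omega i j u g.

(* A representative of the weak derivative of order (i, j) of u, when the
   latter exists and is in L_2(Omega); junk otherwise. *)
Definition wD (Omega : set (R * R)) (i j : nat) (u : R * R -> R) : R * R -> R :=
  xget (cst 0) [set g | L2 Omega g /\ is_weak_deriv Omega i j u g].

Definition H2 (Omega : set (R * R)) (u : R * R -> R) : Prop :=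
  L2 Omega u /\ forall i j, (i + j <= 2)%N -> has_weak_deriv Omega i j u.

(* phi n --> u in H^2(Omega `&` B) for every bounded B (boundary included). *)
Definition cvg_H2loc (Omega : set (R * R)) (phi : nat -> R * R -> R)
    (u : R * R -> R) : Prop :=
  forall r : R, forall i j, (i + j <= 2)%N ->
    sqdistL2 (Omega `&` [set x | `|x| < r]) (pd i j (phi n)) (wD Omega i j u)
      @[n --> \oo] --> 0%E.

Definition speed (g1 g2 : R -> R) (t : R) : R :=
  Num.sqrt (derive1 g1 t ^+ 2 + derive1 g2 t ^+ 2).

Definition smooth_arc_in (S : set (R * R)) (g1 g2 : R -> R) : Prop :=
  [/\ smooth1 g1, smooth1 g2 &
      forall t, 0 <= t <= 1 -> S (g1 t, g2 t) /\ speed g1 g2 t != 0].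

(* The integral of f ^ 2 along the arc with respect to arc length, f being given
   as a function of the parameter. *)
Definition sqnorm_arc (g1 g2 : R -> R) (f : R -> R) : \bar R :=
  (\int[lebesgue_measure]_(t in `[0%R, 1%R]%classic)
     ((f t) ^+ 2 * speed g1 g2 t)%:E)%E.

(* The trace operators on H^2 are the continuous extensions, with values in L_2
   of compact arcs of the boundary, of the operators sending a function smooth
   up to the boundary to its boundary values, resp. to its normal derivative.
   The predicates trace0 and normal_trace0 say that these traces of u vanish a.e. on the
   relatively open part S of the boundary. *)
Definition trace0 (Omega S : set (R * R)) (u : R * R -> R) : Prop :=
  exists phi : nat -> R * R -> R,
    [/\ forall n, smooth2 (phi n), cvg_H2loc Omega phi u &
        forall g1 g2, smooth_arc_in S g1 g2 ->
          sqnorm_arc g1 g2 (fun t => phi n (g1 t, g2 t))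
            @[n --> \oo] --> 0%E].

(* (g2', - g1') / speed is a unit normal; its orientation is immaterial. *)
Definition normal_deriv (g1 g2 : R -> R) (phi : R * R -> R) (t : R) : R :=
  (derive1 g2 t * pd1 phi (g1 t, g2 t) - derive1 g1 t * pd2 phi (g1 t, g2 t))
    / speed g1 g2 t.

Definition normal_trace0 (Omega S : set (R * R)) (u : R * R -> R) : Prop :=
  exists phi : nat -> R * R -> R,
    [/\ forall n, smooth2 (phi n), cvg_H2loc Omega phi u &
        forall g1 g2, smooth_arc_in S g1 g2 ->
          sqnorm_arc g1 g2 (normal_deriv g1 g2 (phi n)) @[n --> \oo] --> 0%E].

End Sobolev.

Section Forms.
Context {R : realType}.

(* The form domain q is a set of elements of L_2(Omega), a is a symmetric
   nonnegative bilinear form on it; this is convergence with respect to a. *)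
Definition form_cvg (Omega : set (R * R)) (q : set (R * R -> R))
    (a : (R * R -> R) -> (R * R -> R) -> R)
    (u_ : nat -> R * R -> R) (u : R * R -> R) : Prop :=
  [/\ forall n, q (u_ n),
      sqdistL2 Omega (u_ n) u @[n --> \oo] --> 0%E &
      forall e : R, 0 < e -> exists N : nat, forall m n, (N <= m)%N ->
        (N <= n)%N ->
        a (fun x => u_ m x - u_ n x) (fun x => u_ m x - u_ n x) < e].

(* Domain of the closure of the form a, and (as a graph) the closure itself. *)
Definition closure_dom Omega q a : set (R * R -> R) :=
  [set u | L2 Omega u /\ exists u_, form_cvg Omega q a u_ u].

Definition closure_form Omega q a (u v : R * R -> R) (c : R) : Prop :=
  exists u_ v_, [/\ form_cvg Omega q a u_ u, form_cvg Omega q a v_ v &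
    a (u_ n) (v_ n) @[n --> \oo] --> c].

(* The graph of the self-adjoint operator A associated with the closure of a:
   u is in the domain of A and A u = f. *)
Definition form_operator Omega q a (u f : R * R -> R) : Prop :=
  [/\ closure_dom Omega q a u, L2 Omega f &
      forall v, closure_dom Omega q a v ->
        closure_form Omega q a u v (dotL2 Omega f v)].

(* Operators in L_2(Omega) are given by their graphs. A - lambda is onto, and
   injective with bounded inverse. *)
Definition in_resolvent_set (Omega : set (R * R))
    (A : (R * R -> R) -> (R * R -> R) -> Prop) (lambda : R) : Prop :=
  (forall f, L2 Omega f -> exists u, A u (fun x => lambda * u x + f x)) /\
  exists C : R, forall u f, L2 Omega f ->
    A u (fun x => lambda * u x + f x) -> dotL2 Omega u u <= C * dotL2 Omega f f.

Definition spectrum (Omega : set (R * R)) A : set R :=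
  [set lambda | ~ in_resolvent_set Omega A lambda].

Definition eigenfunction (A : (R * R -> R) -> (R * R -> R) -> Prop)
    (lambda : R) (u : R * R -> R) : Prop := A u (fun x => lambda * u x).

Definition eigenvalue_finite_mult (Omega : set (R * R)) A (lambda : R) : Prop :=
  (exists u, eigenfunction A lambda u /\ ~ ae_eq_on Omega u (cst 0)) /\
  exists (n : nat) (e : 'I_n -> R * R -> R), forall u, eigenfunction A lambda u ->
    exists c : 'I_n -> R, ae_eq_on Omega u (fun x => \sum_(k < n) c k * e k x).

Definition discrete_spectrum (Omega : set (R * R)) A : Prop :=
  (forall lambda, spectrum Omega A lambda ->
     isolated (spectrum Omega A) lambda /\
     eigenvalue_finite_mult Omega A lambda) /\
  limit_point (spectrum Omega A) = set0.

End Forms.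

Section Plate.
Context {R : realType}.

Definition plate_form (Omega : set (R * R)) (nu : R) (u v : R * R -> R) : R :=
  \int[mu2]_(x in Omega)
    (wD Omega 2 0 u x * wD Omega 2 0 v x
     + wD Omega 0 2 u x * wD Omega 0 2 v x
     + 2 * (1 - nu) * (wD Omega 1 1 u x * wD Omega 1 1 v x)
     + nu * (wD Omega 2 0 u x * wD Omega 0 2 v x
             + wD Omega 0 2 u x * wD Omega 2 0 v x)).

Definition plate_dom (Omega GammaD GammaM : set (R * R)) : set (R * R -> R) :=
  [set u | [/\ H2 Omega u, trace0 Omega GammaD u, normal_trace0 Omega GammaD u &
               trace0 Omega GammaM u]].

Definition plate_operator (Omega GammaD GammaM : set (R * R)) (nu : R) :=
  form_operator Omega (plate_dom Omega GammaD GammaM) (plate_form Omega nu).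

End Plate.

(* Main.v *)
(* Proof idea.  Compactness of the embedding of the form domain is used through
   an Ehrling inequality: for every e > 0 there are finitely many g_i in L_2 with
   |u|^2 <= e (a(u,u) + |u|^2) + sum_i (g_i, u)^2.  Adding a multiple of
   sum_i (g_i, .)^2 makes a - lambda coercive, so Riesz' theorem reduces
   A - lambda to a finite matrix (every spectral point is an eigenvalue of finite
   multiplicity), and a dimension count bounds the number of eigenvalues below
   any level.
   On the bounded part of Omega the inequality follows from Poincare's inequality
   on small squares and, near the boundary, from one-dimensional interpolation on
   thin strips transversal to it.
   In the cusp, the trace condition on Sigma^+ or Sigma^- gives
   int phi^2 <= C int H^2 (d_z phi)^2.  Along each curve y |-> (y, H(y) t) the
   weighted Hardy inequality for alpha = d_z phi with I(y) = int 1/H,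
     int I^-2 H^-1 alpha^2 <= 2 alpha(s)^2 / I(s) + 4 int H alpha'^2,
   combined with H^4 I^2 -> 0, which is the hypothesis on G_H, makes the tail
   small; H' bounded controls alpha' by the second derivatives of phi. *)

Require Import Defs.
From HB Require Import structures.
From mathcomp Require Import all_boot all_order all_algebra.
From mathcomp Require Import all_classical all_reals all_analysis.
From mathcomp Require Import measurable_realfun.
From mathcomp Require Import ring lra.
From mathcomp Require finmap.

Set Implicit Arguments.
Unset Strict Implicit.
Unset Printing Implicit Defensive.

Import Order.TTheory GRing.Theory Num.Theory.
Import numFieldNormedType.Exports.

Local Open Scope classical_set_scope.
Local Open Scope ring_scope.

(** * Semi-inner products *)

Section SemiInnerProduct.
Context {R : realType} {V : lmodType R}.
Implicit Types (S : set V) (b : V -> V -> R) (u v w : V).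

(** Members of L_2 are functions, not classes, and [wD] picks a weak derivative by choice. Hence
    everything is phrased in semi-inner products, where zero norm replaces equality, and [wD] is
    linear only almost everywhere; this rests on uniqueness of weak derivatives, proved with
    explicit bump functions. A function of the form domain is known through the smooth approximants
    inside [trace0] (supplied even by an empty clamped part). They converge only on bounded parts of
    [Omega], and their boundary values become small only along compact arcs. So each inequality is
    proved for smooth functions on a bounded piece, with constants that do not see the length of the
    piece, then passed to the limit along the approximants, and only then is the cusp exhausted.
    Approximants satisfy no boundary condition exactly: the trace enters as a boundary integral. As
    d_z phi is prescribed nowhere, Hardy's inequality keeps a starting term, which is averaged over
    a unit interval and interpolated. The weights fit because on the slices z = H t the integral of
    H^2 alpha^2 dx becomes that of H^3 alpha^2 dy, and H^3 = (H^4 I^2) I^-2 H^-1. *)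

Definition linsub S := S 0 /\ forall k u v, S u -> S v -> S (k *: u + v).

(** Only semidefinite, and all laws are restricted to [S]: integrals of functions that are not
    square integrable have default values, for which additivity can fail. *)
Definition sip S b := [/\ linsub S,
  (forall u v, S u -> S v -> b u v = b v u),
  (forall k u v w, S u -> S v -> S w -> b (k *: u + v) w = k * b u w + b v w) &
  forall u, S u -> 0 <= b u u].

Lemma linsubZ S k u : linsub S -> S u -> S (k *: u).
Proof. by move=> [S0 SD] Su; rewrite -[_ *: _]addr0; exact: SD. Qed.

Lemma linsubD S u v : linsub S -> S u -> S v -> S (u + v).
Proof. by move=> [S0 SD] Su Sv; rewrite -[u]scale1r; exact: SD. Qed.

Lemma linsubB S u v : linsub S -> S u -> S v -> S (u - v).
Proof. by move=> [S0 SD] Su Sv; rewrite addrC -scaleN1r; exact: SD. Qed.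

Lemma linsub_sum S (I : Type) (r : seq I) (P : pred I) (F : I -> V) :
  linsub S -> (forall i, S (F i)) -> S (\sum_(i <- r | P i) F i).
Proof.
move=> sS SF; elim/big_ind: _ => //; first by case: sS.
by move=> x y; exact: linsubD.
Qed.

Variables (S : set V) (b : V -> V -> R).
Hypothesis (bS : sip S b).

Let sS : linsub S. Proof. by case: bS. Qed.

Lemma sipC u v : S u -> S v -> b u v = b v u.
Proof. by case: bS => _ h _ _; exact: h. Qed.

Lemma sip_ge0 u : S u -> 0 <= b u u.
Proof. by case: bS => _ _ _; exact. Qed.

Lemma sipPl k u v w : S u -> S v -> S w -> b (k *: u + v) w = k * b u w + b v w.
Proof. by case: bS => _ _ h _; exact: h. Qed.

Lemma sip0l w : S w -> b 0 w = 0.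
Proof.
case: sS => S0 _ Sw.
by have := @sipPl 1 0 0 w S0 S0 Sw; rewrite scale1r add0r mul1r => h; lra.
Qed.

Lemma sipZl k u w : S u -> S w -> b (k *: u) w = k * b u w.
Proof.
move=> Su Sw; case: sS => S0 _.
by rewrite -[_ *: _]addr0 sipPl// sip0l// addr0.
Qed.

Lemma sipDl u v w : S u -> S v -> S w -> b (u + v) w = b u w + b v w.
Proof. by move=> Su Sv Sw; rewrite -[u]scale1r sipPl// scale1r mul1r. Qed.

Lemma sipBl u v w : S u -> S v -> S w -> b (u - v) w = b u w - b v w.
Proof.
by move=> Su Sv Sw; rewrite addrC -scaleN1r sipPl// mulN1r addrC.
Qed.

Lemma sipZr k u w : S u -> S w -> b u (k *: w) = k * b u w.
Proof.
move=> Su Sw; rewrite sipC ?sipZl//; last exact: linsubZ.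
by rewrite sipC.
Qed.

Lemma sipDr u v w : S u -> S v -> S w -> b w (u + v) = b w u + b w v.
Proof.
move=> Su Sv Sw; rewrite sipC ?sipDl//; last exact: linsubD.
by rewrite [b u w]sipC// [b v w]sipC.
Qed.

Lemma sipBr u v w : S u -> S v -> S w -> b w (u - v) = b w u - b w v.
Proof.
move=> Su Sv Sw; rewrite sipC ?sipBl//; last exact: linsubB.
by rewrite [b u w]sipC// [b v w]sipC.
Qed.

Lemma sip_suml (I : Type) (r : seq I) (P : pred I) (F : I -> V) w :
  (forall i, S (F i)) -> S w ->
  b (\sum_(i <- r | P i) F i) w = \sum_(i <- r | P i) b (F i) w.
Proof.
move=> SF Sw; elim: r => [|i r ih]; first by rewrite !big_nil sip0l.
rewrite !big_cons; case: ifP => // _.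
by rewrite sipDl// ?ih//; exact: linsub_sum.
Qed.

Lemma sip_sumr (I : Type) (r : seq I) (P : pred I) (F : I -> V) w :
  (forall i, S (F i)) -> S w ->
  b w (\sum_(i <- r | P i) F i) = \sum_(i <- r | P i) b w (F i).
Proof.
move=> SF Sw; rewrite sipC//; last exact: linsub_sum.
by rewrite sip_suml//; apply: eq_bigr => i _; rewrite sipC.
Qed.

Lemma sip_quad k u v : S u -> S v ->
  b (u + k *: v) (u + k *: v) = b u u + 2 * k * b u v + k ^+ 2 * b v v.
Proof.
move=> Su Sv; have Skv := linsubZ k sS Sv.
rewrite sipDl// ?sipDr// ?sipZl// ?sipZr//; last exact: linsubD.
rewrite [b v u]sipC//; ring.
Qed.

Lemma sip_CS u v : S u -> S v -> b u v ^+ 2 <= b u u * b v v.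
Proof.
move=> Su Sv.
have q k : 0 <= b u u + 2 * k * b u v + k ^+ 2 * b v v.
  rewrite -sip_quad//; apply: sip_ge0; apply: linsubD => //.
  exact: linsubZ.
have := sip_ge0 Sv; rewrite le_eqVlt => /orP[/eqP v0|v0].
  rewrite -v0 mulr0; have [->|buv] := eqVneq (b u v) 0; first by rewrite expr0n.
  (* With [b v v = 0] the quadratic is affine in [k]; this [k] gives it the value -1. *)
  have := q (- (b u u + 1) / (2 * b u v)).
  rewrite -v0 mulr0 addr0.
  have -> : 2 * (- (b u u + 1) / (2 * b u v)) * b u v = - (b u u + 1).
    by field.
  by move=> h; lra.
have := q (- b u v / b v v).
have -> : b u u + 2 * (- b u v / b v v) * b u v + (- b u v / b v v) ^+ 2 * b v v
  = (b u u * b v v - b u v ^+ 2) / b v v by field; rewrite gt_eqF.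
by rewrite pmulr_lge0 ?invr_gt0// subr_ge0.
Qed.

Lemma sip_eq0r u v : S u -> S v -> b u u = 0 -> b u v = 0.
Proof.
move=> Su Sv u0; have := sip_CS Su Sv; rewrite u0 mul0r => h.
by apply/eqP; rewrite -sqrf_eq0 eq_le h sqr_ge0.
Qed.

Lemma sipD2 u v : S u -> S v -> b (u + v) (u + v) <= 2 * b u u + 2 * b v v.
Proof.
move=> Su Sv; have := sip_quad 1 Su Sv; have := sip_quad (-1) Su Sv.
rewrite scaleN1r scale1r => h ->.
have := sip_ge0 (linsubB sS Su Sv); rewrite h; lra.
Qed.

Lemma sip_subC u v : S u -> S v -> b (u - v) (u - v) = b (v - u) (v - u).
Proof.
move=> Su Sv; have -> : u - v = -1 *: (v - u) by rewrite scaleN1r opprB.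
have Svu := linsubB sS Sv Su; have Svu' := linsubZ (-1) sS Svu.
rewrite sipZl// sipZr//; ring.
Qed.

Lemma sip_triangle u v w : S u -> S v -> S w ->
  b (u - w) (u - w) <= 2 * b (u - v) (u - v) + 2 * b (v - w) (v - w).
Proof.
move=> Su Sv Sw; have -> : u - w = (u - v) + (v - w) by rewrite addrA subrK.
by apply: sipD2; exact: linsubB.
Qed.

Lemma sq_cvg0 (x y : R^nat) : (forall n, x n ^+ 2 <= y n) -> y @ \oo --> 0 ->
  x @ \oo --> 0.
Proof.
move=> xy y0; apply/cvgr0Pnorm_lt => e e0.
have /cvgr0Pnorm_lt/(_ (e ^+ 2)) := y0.
rewrite exprn_gt0// => /(_ isT); apply: filterS => n.
rewrite (ger0_norm (le_trans (sqr_ge0 _) (xy n))).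
by move=> yn; rewrite -(@ltr_pXn2r _ 2%N)// ?nnegrE ?ltW// -normrX ger0_norm ?sqr_ge0//
  (le_lt_trans (xy n)).
Qed.

Lemma sip_cvg_l (u_ : nat -> V) u v : (forall n, S (u_ n)) -> S u -> S v ->
  b (u_ n - u) (u_ n - u) @[n --> \oo] --> 0 -> b (u_ n) v @[n --> \oo] --> b u v.
Proof.
move=> Su_ Su Sv h.
have : b (u_ n - u) v @[n --> \oo] --> (0 : R).
  apply: (@sq_cvg0 _ (fun n => b (u_ n - u) (u_ n - u) * b v v)).
    by move=> n; apply: sip_CS => //; exact: linsubB.
  by rewrite -[X in _ --> X](mul0r (b v v)); apply: cvgMl.
move=> h'; rewrite -[X in _ --> X](add0r (b u v)).
have -> : (fun n => b (u_ n) v) = (fun n => b (u_ n - u) v + b u v).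
  by apply/funext => n; rewrite sipBl// subrK.
by apply: cvgD => //; exact: cvg_cst.
Qed.

Lemma sip_cvg (u_ v_ : nat -> V) u v : (forall n, S (u_ n)) -> S u ->
  (forall n, S (v_ n)) -> S v ->
  b (u_ n - u) (u_ n - u) @[n --> \oo] --> 0 ->
  b (v_ n - v) (v_ n - v) @[n --> \oo] --> 0 ->
  b (u_ n) (v_ n) @[n --> \oo] --> b u v.
Proof.
move=> Su_ Su Sv_ Sv hu hv.
have SBu n : S (u_ n - u) by exact: linsubB.
have SBv n : S (v_ n - v) by exact: linsubB.
have h1 : b (u_ n - u) (v_ n - v) @[n --> \oo] --> (0 : R).
  apply: (@sq_cvg0 _ (fun n => b (u_ n - u) (u_ n - u) * b (v_ n - v) (v_ n - v))).
    by move=> n; exact: sip_CS.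
  by rewrite -[X in _ --> X](mul0r (0 : R)); apply: cvgM.
have h2 := sip_cvg_l Su_ Su Sv hu.
have h3 := sip_cvg_l Sv_ Sv Su hv.
have -> : (fun n => b (u_ n) (v_ n)) =
  (fun n => b (u_ n - u) (v_ n - v) + (b (u_ n) v + b (v_ n) u - b u v)).
  apply/funext => n; rewrite sipBl// ?sipBr// [b (v_ n) u]sipC//; ring.
have e : b u v = 0 + (b u v + b v u - b u v) by rewrite [b v u]sipC//; ring.
rewrite [X in _ --> X]e.
by apply: cvgD => //; apply: cvgB; [exact: cvgD|exact: cvg_cst].
Qed.

Lemma sip_Cauchy (u_ : nat -> V) u : (forall n, S (u_ n)) -> S u ->
  b (u_ n - u) (u_ n - u) @[n --> \oo] --> 0 ->
  forall e : R, 0 < e -> exists N : nat, forall m n, (N <= m)%N -> (N <= n)%N ->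
    b (u_ m - u_ n) (u_ m - u_ n) < e.
Proof.
move=> Su_ Su h e e0.
have e4 : 0 < e / 4 by rewrite divr_gt0.
have /cvgr0Pnorm_lt/(_ _ e4)[N _ hN] := h.
exists N => m n Nm Nn.
apply: (le_lt_trans (sip_triangle (Su_ m) Su (Su_ n))).
rewrite [b (u - _) _]sip_subC//.
have := hN m Nm; have := hN n Nn.
rewrite /= !ger0_norm ?sip_ge0//; try exact: linsubB.
move=> h1 h2; lra.
Qed.

End SemiInnerProduct.

(** * Riesz representation in a complete semi-inner product space *)

Section Riesz.
Context {R : realType} {V : lmodType R}.
Variables (D : set V) (B : V -> V -> R).
Hypothesis (BD : sip D B).
Let sD : linsub D. Proof. by case: BD. Qed.
Hypothesis complete : forall u_ : nat -> V, (forall n, D (u_ n)) ->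
  (forall e : R, 0 < e -> exists N : nat, forall m n, (N <= m)%N -> (N <= n)%N ->
    B (u_ m - u_ n) (u_ m - u_ n) < e) ->
  exists u, D u /\ B (u_ n - u) (u_ n - u) @[n --> \oo] --> 0.

(** Direct minimisation of [J v = B v v - 2 * l v], which works without dividing by the kernel of
    [B]; [w] is determined only up to elements of zero norm. *)
Lemma riesz (l : V -> R) (C : R) :
  (forall k u v, D u -> D v -> l (k *: u + v) = k * l u + l v) ->
  (forall v, D v -> l v ^+ 2 <= C * B v v) ->
  exists w, D w /\ forall v, D v -> B w v = l v.
Proof.
move=> lin bd.
have D0 : D 0 by case: sD.
(* [C] carries no sign; if it is negative, the bound forces [l] to vanish on [D]. *)
have C0 : 0 <= C \/ forall v, D v -> l v = 0.
  have [|C0] := leP 0 C; first by left.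
  right => v Dv; apply/eqP; rewrite -sqrf_eq0 eq_le sqr_ge0 andbT.
  by apply: (le_trans (bd v Dv)); rewrite nmulr_rle0// (sip_ge0 BD).
case: C0 => [C0|l0]; last first.
  by exists 0; split=> // v Dv; rewrite (sip0l BD)// l0.
pose J v := B v v - 2 * l v.
have Jlb v : D v -> - C <= J v.
  move=> Dv; rewrite /J; have := bd v Dv; have := sip_ge0 BD Dv.
  set x := B v v; set y := l v => x0 h.
  (* Here [4 * y ^+ 2 <= 4 * C * x <= (x + C) ^+ 2]; taking roots bounds [J] from below by [- C]. *)
  have : (2 * y) ^+ 2 <= (x + C) ^+ 2 by have := sqr_ge0 (x - C); nra.
  have xC0 := addr_ge0 x0 C0; move=> h'.
  suff : 2 * y <= x + C by lra.
  rewrite leNgt; apply/negP => h2.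
  have := ltr_pM xC0 xC0 h2 h2; nra.
pose m := inf (J @` D).
have infJ : has_inf (J @` D).
  split; first by exists (J 0), 0.
  by exists (- C) => _ [v Dv <-]; exact: Jlb.
have mJ v : D v -> m <= J v by move=> Dv; apply: ge_inf; [case: infJ|exists v].
have /choice[w_ w_P] (n : nat) : exists w, D w /\ J w < m + n.+1%:R^-1.
  have e0 : 0 < n.+1%:R^-1 :> R by rewrite invr_gt0.
  by have [_ [w Dw <-] h] := inf_adherent e0 infJ; exists w.
have Dw n : D (w_ n) by case: (w_P n).
have Jw n : J (w_ n) < m + n.+1%:R^-1 by case: (w_P n).
have JD k u v : D u -> D v ->
    J (u + k *: v) = J u + 2 * k * (B u v - l v) + k ^+ 2 * B v v.
  move=> Du Dv; rewrite /J (sip_quad BD)// [u + _]addrC lin//; ring.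
have [w [Dw0 wcvg]] : exists w, D w /\ B (w_ n - w) (w_ n - w) @[n --> \oo] --> 0.
  apply: complete => // e e0.
  have e8 : 0 < e / 8 by rewrite divr_gt0.
  have [N hN] : exists N : nat, N.+1%:R^-1 < e / 8.
    by have [N _ hN] := near_infty_natSinv_lt (PosNum e8); exists N; apply: hN => /=.
  exists N => i j Ni Nj.
  have hi k : (N <= k)%N -> J (w_ k) < m + e / 8.
    move=> Nk; apply: (lt_trans (Jw k)); rewrite ltrD2l; apply: le_lt_trans hN.
    by rewrite lef_pV2 ?posrE// ler_nat.
  have := hi i Ni; have := hi j Nj.
  have Dij := linsubB sD (Dw i) (Dw j).
  have e1 : w_ i = w_ j + 1 *: (w_ i - w_ j) by rewrite scale1r addrC subrK.
  have := JD 1 _ _ (Dw j) Dij; rewrite -e1 => ->.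
  (* The midpoint of [w_ i] and [w_ j] has [J] at least [m], while both ends are within [e / 8] of
     [m]; the parallelogram law bounds the distance. *)
  have := mJ _ (linsubD sD (Dw j) (linsubZ 2^-1 sD Dij)).
  rewrite JD//; set X := B (_ - _) _; set Y := B _ _ - l _; set Z := J _.
  move=> h1 h2 h3; have : X < e / 2; last by lra.
  have : 0 <= Z + Y + (1 / 4) * X - m by move: h1; rewrite -subr_ge0; congr (_ <= _); field.
  lra.
exists w; split=> // v Dv.
have ineq t : 0 <= 2 * t * (B w v - l v) + t ^+ 2 * B v v.
  have lim1 : (2 * t * (B (w_ n) v - l v) + t ^+ 2 * B v v + n.+1%:R^-1)
      @[n --> \oo] --> 2 * t * (B w v - l v) + t ^+ 2 * B v v + 0.
    apply: cvgD; last exact: cvg_harmonic.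
    apply: cvgD; last exact: cvg_cst.
    apply: cvgM; first exact: cvg_cst.
    apply: cvgB; last exact: cvg_cst.
    exact: (sip_cvg_l BD).
  rewrite addr0 in lim1.
  have : 0 <= limn (fun n : nat => 2 * t * (B (w_ n) v - l v) + t ^+ 2 * B v v + n.+1%:R^-1).
    apply: limr_ge; first by apply/cvg_ex; eexists; exact: lim1.
    apply: nearW => n.
    have := mJ _ (linsubD sD (Dw n) (linsubZ t sD Dv)).
    rewrite JD//; have := Jw n.
    set X := 2 * t * _; set Y := t ^+ 2 * _; set Z := _^-1; set U := J _.
    by move=> h1 h2; lra.
  by rewrite (cvg_lim _ lim1).
apply/eqP; rewrite -subr_eq0; set y := B w v - l v in ineq *.
have x0 := sip_ge0 BD Dv; set x := B v v in x0 ineq.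
apply/negPn/negP => y0.
(* Nearly the minimiser of the quadratic; the [+ 1] keeps the denominator positive when
   [B v v = 0]. *)
have := ineq (- y / (x + 1)).
have -> : 2 * (- y / (x + 1)) * y + (- y / (x + 1)) ^+ 2 * x =
  - (y ^+ 2 * (x + 2) / (x + 1) ^+ 2) by field; rewrite gt_eqF// ltr_wpDl.
rewrite oppr_ge0 => h.
have : 0 < y ^+ 2 * (x + 2) / (x + 1) ^+ 2.
  rewrite divr_gt0 ?exprn_gt0 ?ltr_wpDl//.
  by rewrite mulr_gt0 ?ltr_wpDl// lt_neqAle sqr_ge0 eq_sym sqrf_eq0 y0.
lra.
Qed.

End Riesz.

(** * Spectral alternative for an abstract form *)

Section SipMore.
Context {R : realType} {V : lmodType R}.
Implicit Types (S : set V) (b : V -> V -> R).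

Lemma sip_sub S (T : set V) b : sip S b -> linsub T -> T `<=` S -> sip T b.
Proof.
by move=> [_ h1 h2 h3] sT TS; split=> //; [move=> u v /TS ? /TS|
 move=> k u v w /TS ? /TS ? /TS|move=> u /TS]; auto.
Qed.

Lemma sip_add S b1 b2 : sip S b1 -> sip S b2 -> sip S (fun u v => b1 u v + b2 u v).
Proof.
move=> [sS h1 h2 h3] [_ k1 k2 k3]; split=> //.
- by move=> u v Su Sv; rewrite h1// k1.
- by move=> k u v w Su Sv Sw; rewrite h2// k2//; ring.
- by move=> u Su; rewrite addr_ge0 ?h3 ?k3.
Qed.

Lemma cvg0_nonneg2 (x y z : R^nat) : (forall n, 0 <= x n <= y n + z n) ->
  y @ \oo --> 0 -> z @ \oo --> 0 -> x @ \oo --> 0.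
Proof.
move=> h y0 z0; apply: (@squeeze_cvgr _ _ _ _ (fun=> 0) (y \+ z)).
- by apply: nearW.
- exact: cvg_cst.
- by rewrite -(addr0 0); apply: cvgD.
Qed.

Lemma sip_cvg_comb (S : set V) (b : V -> V -> R) k (u_ v_ : nat -> V) u v :
  sip S b -> (forall n, S (u_ n)) -> (forall n, S (v_ n)) -> S u -> S v ->
  b (u_ n - u) (u_ n - u) @[n --> \oo] --> 0 ->
  b (v_ n - v) (v_ n - v) @[n --> \oo] --> 0 ->
  b (k *: u_ n + v_ n - (k *: u + v)) (k *: u_ n + v_ n - (k *: u + v))
    @[n --> \oo] --> 0.
Proof.
move=> bS Su_ Sv_ Su Sv cu cv.
have sS : linsub S by case: bS.
have Su' n : S (u_ n - u) by exact: linsubB.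
have Sv' n : S (v_ n - v) by exact: linsubB.
have e n : k *: u_ n + v_ n - (k *: u + v) = k *: (u_ n - u) + (v_ n - v).
  by rewrite scalerBr opprD addrACA.
under eq_fun do rewrite e.
apply: (@cvg0_nonneg2 _ (fun n => 2 * k ^+ 2 * b (u_ n - u) (u_ n - u))
   (fun n => 2 * b (v_ n - v) (v_ n - v))).
- move=> n; have Sk := linsubZ k sS (Su' n).
  rewrite (sip_ge0 bS)/=; last exact: linsubD.
  apply: (le_trans (sipD2 bS Sk (Sv' n))).
  rewrite (sipZl bS)// (sipZr bS)//; lra.
- by rewrite -[X in _ --> X](mulr0 (2 * k ^+ 2)); apply: cvgMr.
- by rewrite -[X in _ --> X](mulr0 2); apply: cvgMr.
Qed.

End SipMore.

Section AbstractForm.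
Context {R : realType} {V : lmodType R}.
Variables (L : set V) (ip : V -> V -> R) (W : set V) (a : V -> V -> R)
  (q : set V).

Definition is_Cauchy (b : V -> V -> R) (u_ : nat -> V) :=
  forall e : R, 0 < e -> exists N : nat, forall m n, (N <= m)%N -> (N <= n)%N ->
    b (u_ m - u_ n) (u_ m - u_ n) < e.

(** [fcvg], [fdom] and [fop] copy [form_cvg], [closure_dom] and [form_operator], with a real-valued
    distance instead of an extended real integral; [form_operatorE] identifies the two. *)
Definition fcvg (u_ : nat -> V) (u : V) :=
  [/\ forall n, q (u_ n), ip (u_ n - u) (u_ n - u) @[n --> \oo] --> 0 &
      is_Cauchy a u_].

Definition fdom : set V := [set u | L u /\ exists u_, fcvg u_ u].

Definition fop u f := [/\ fdom u, L f & forall v, fdom v ->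
  exists u_ v_, [/\ fcvg u_ u, fcvg v_ v & a (u_ n) (v_ n) @[n --> \oo] --> ip f v]].

Definition fresolvent lam :=
  (forall f, L f -> exists u, fop u (lam *: u + f)) /\
  exists C, forall u f, L f -> fop u (lam *: u + f) -> ip u u <= C * ip f f.

Definition feigenvalue lam :=
  (exists u, fop u (lam *: u) /\ ip u u != 0).

Definition ffinite_mult lam :=
  exists (n : nat) (e : 'I_n -> V), (forall k, L (e k)) /\
    forall u, fop u (lam *: u) -> exists c : 'I_n -> R,
      ip (u - \sum_(k < n) c k *: e k) (u - \sum_(k < n) c k *: e k) = 0.

(** [W] is a space beyond [q] on which [a] is still given by its formula and closed. Limits in the
    sense of the form therefore stay in [W], and the closure of the form is the restriction of [a]
    to [fdom]; no abstract completion occurs. *)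
Hypotheses (ipL : sip L ip) (aW : sip W a) (WL : W `<=` L)
  (sq : linsub q) (qW : q `<=` W).
Hypothesis L_complete : forall u_ : nat -> V, (forall n, L (u_ n)) ->
  is_Cauchy ip u_ -> exists u, L u /\ ip (u_ n - u) (u_ n - u) @[n --> \oo] --> 0.
Hypothesis a_closed : forall (u_ : nat -> V) u, (forall n, W (u_ n)) -> L u ->
  ip (u_ n - u) (u_ n - u) @[n --> \oo] --> 0 -> is_Cauchy a u_ ->
  W u /\ a (u_ n - u) (u_ n - u) @[n --> \oo] --> 0.
Hypothesis ehrling : forall e : R, 0 < e -> exists (m : nat) (g : 'I_m -> V),
  (forall i, L (g i)) /\
  forall u, q u -> ip u u <= e * (a u u + ip u u) + \sum_(i < m) ip (g i) u ^+ 2.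

Let sL : linsub L. Proof. by case: ipL. Qed.
Let sW : linsub W. Proof. by case: aW. Qed.
Let N u v := a u v + ip u v.
Let qL u : q u -> L u. Proof. by move=> /qW/WL. Qed.

Lemma fdomW u : fdom u -> W u.
Proof.
by move=> [Lu [u_ [qu c1 c2]]]; case: (@a_closed u_ u) => // n; exact: qW.
Qed.

Lemma fcvg_a u_ u : L u -> fcvg u_ u -> a (u_ n - u) (u_ n - u) @[n --> \oo] --> 0.
Proof. by move=> Lu [qu c1 c2]; case: (@a_closed u_ u) => // n; exact: qW. Qed.

Lemma fdomL u : fdom u -> L u. Proof. by case. Qed.

Lemma fdomI u_ u : (forall n, q (u_ n)) -> W u ->
  ip (u_ n - u) (u_ n - u) @[n --> \oo] --> 0 ->
  a (u_ n - u) (u_ n - u) @[n --> \oo] --> 0 -> fcvg u_ u.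
Proof.
move=> qu Wu c1 c2; split=> //.
by apply: (sip_Cauchy aW _ Wu) => // n; exact: qW.
Qed.

Lemma qfdom u : q u -> fdom u.
Proof.
move=> qu; split; first exact: qL.
exists (fun=> u); apply: fdomI => //; first exact: qW.
  by rewrite subrr (sip0l ipL); [exact: cvg_cst|case: sL].
by rewrite subrr (sip0l aW); [exact: cvg_cst|case: sW].
Qed.

Lemma sub_fdom : linsub fdom.
Proof.
split; first by apply: qfdom; case: sq.
move=> k u v Du Dv.
have [Lu [u_ cu]] := Du; have [Lv [v_ cv]] := Dv.
have [_ cLD] := sL; have [_ cWD] := sW; have [_ cqD] := sq.
split; first exact: cLD.
have [qu iu _] := cu; have [qv iv _] := cv.
exists (fun n => k *: u_ n + v_ n); apply: fdomI.
- by move=> n; exact: cqD.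
- by apply: cWD; exact: fdomW.
- by apply: (sip_cvg_comb _ ipL) => // n; exact: qL.
- by apply: (sip_cvg_comb _ aW); try exact: fcvg_a; try exact: fdomW;
    move=> n; exact: qW.
Qed.

Let ipD : sip fdom ip. Proof. exact: (sip_sub ipL sub_fdom fdomL). Qed.
Let aD : sip fdom a. Proof. exact: (sip_sub aW sub_fdom fdomW). Qed.

Let ND : sip fdom N. Proof. exact: sip_add aD ipD. Qed.

(** Closedness yields a limit [u] in [W]. To place it in [fdom], each [u_ n] is replaced by some
    [w_ n] of [q] with error below [n.+1%:R^-1], so that [w_] tends to [u] as well. *)
Lemma fdom_complete (u_ : nat -> V) : (forall n, fdom (u_ n)) -> is_Cauchy N u_ ->
  exists u, fdom u /\ N (u_ n - u) (u_ n - u) @[n --> \oo] --> 0.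
Proof.
move=> Du cN.
have Dumn m n : fdom (u_ m - u_ n) by apply: linsubB => //; exact: sub_fdom.
have cip : is_Cauchy ip u_.
  move=> e /cN[k hk]; exists k => m n km kn.
  apply: le_lt_trans (hk _ _ km kn); rewrite lerDr; exact: (sip_ge0 aD).
have ca : is_Cauchy a u_.
  move=> e /cN[k hk]; exists k => m n km kn.
  apply: le_lt_trans (hk _ _ km kn); rewrite lerDl; exact: (sip_ge0 ipD).
have [u [Lu cu]] := L_complete (fun n => fdomL (Du n)) cip.
have [Wu cau] := a_closed (fun n => fdomW (Du n)) Lu cu ca.
have cNu : N (u_ n - u) (u_ n - u) @[n --> \oo] --> 0.
  by rewrite -(addr0 0); apply: cvgD.
have NW : sip W N by apply: sip_add => //; exact: (sip_sub ipL sW WL).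
exists u; split=> //; split=> //.
have /choice[w_ w_P] (n : nat) : exists w, q w /\ N (w - u_ n) (w - u_ n) < n.+1%:R^-1.
  have [Lun [v_ cv]] := Du n; have [qv iv _] := cv.
  have : N (v_ k - u_ n) (v_ k - u_ n) @[k --> \oo] --> 0.
    by rewrite -(addr0 0); apply: cvgD => //; exact: fcvg_a.
  have e0 : 0 < n.+1%:R^-1 :> R by rewrite invr_gt0.
  move=> /cvgr0Pnorm_lt/(_ _ e0)[k _ hk]; exists (v_ k); split=> //.
  by apply: le_lt_trans (hk k _) => //=; exact: ler_norm.
have qw n : q (w_ n) by case: (w_P n).
have Ww n : W (w_ n) by exact: qW.
have Wu_ n : W (u_ n) by exact: fdomW.
have cNw : N (w_ n - u) (w_ n - u) @[n --> \oo] --> 0.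
  apply: (@cvg0_nonneg2 _ _ (fun n => 2 * n.+1%:R^-1)
    (fun n => 2 * N (u_ n - u) (u_ n - u))).
  - move=> n; rewrite (sip_ge0 NW)/=; last exact: linsubB.
    apply: (le_trans (sip_triangle NW (Ww n) (Wu_ n) Wu)).
    by rewrite lerD2r ler_pM2l//; apply: ltW; case: (w_P n).
  - by rewrite -[X in _ --> X](mulr0 2); apply: cvgMr; exact: cvg_harmonic.
  - by rewrite -[X in _ --> X](mulr0 2); apply: cvgMr.
have WB n : W (w_ n - u) by exact: linsubB.
exists w_; apply: fdomI => //.
- apply: (@cvg0_nonneg2 _ _ (fun n => N (w_ n - u) (w_ n - u)) (fun=> 0)) => //.
    move=> n; rewrite addr0 (sip_ge0 ipL) ?lerDr ?(sip_ge0 aW)//.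
    exact: WL.
  exact: cvg_cst.
- apply: (@cvg0_nonneg2 _ _ (fun n => N (w_ n - u) (w_ n - u)) (fun=> 0)) => //.
    move=> n; rewrite addr0 (sip_ge0 aW) ?lerDl ?(sip_ge0 ipL)//.
    exact: WL.
  exact: cvg_cst.
Qed.

(** The sequences in the definition of [fop] disappear because [a_closed] makes form convergence a
    convergence to the limit for [a] itself, along which [a] is continuous. *)
Lemma fopE u f : fop u f <->
  [/\ fdom u, L f & forall v, fdom v -> a u v = ip f v].
Proof.
split=> -[Du Lf h]; split=> // v Dv.
  have [u_ [v_ [cu cv]]] := h v Dv.
  suff h' : a (u_ n) (v_ n) @[n --> \oo] --> a u v.
    by move=> h''; exact: (cvg_unique _ h' h'').
  have [qu _ _] := cu; have [qv _ _] := cv.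
  apply: (sip_cvg aW); try exact: fdomW; try by move=> n; exact: qW.
    by apply: fcvg_a => //; exact: fdomL.
  by apply: fcvg_a => //; exact: fdomL.
have [Lu [u_ cu]] := Du; have [Lv [v_ cv]] := Dv.
have [qu _ _] := cu; have [qv _ _] := cv.
exists u_, v_; split=> //; rewrite -h//.
by apply: (sip_cvg aW); try exact: fdomW; try (by move=> n; exact: qW);
  exact: fcvg_a.
Qed.

Lemma ehrling_fdom (e : R) : 0 < e -> exists (m : nat) (g : 'I_m -> V),
  (forall i, L (g i)) /\
  forall u, fdom u -> ip u u <= e * N u u + \sum_(i < m) ip (g i) u ^+ 2.
Proof.
move=> /ehrling[m [g [Lg h]]]; exists m, g; split=> // u Du.
have [Lu [u_ cu]] := Du; have [qu iu _] := cu; have au := fcvg_a Lu cu.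
have ciu := sip_cvg ipL (fun n => qL (qu n)) Lu (fun n => qL (qu n)) Lu iu iu.
have Wu := fdomW Du.
have cau := sip_cvg aW (fun n => qW (qu n)) Wu (fun n => qW (qu n)) Wu au au.
have c2 : (e * N (u_ n) (u_ n) + \sum_(i < m) ip (g i) (u_ n) ^+ 2) @[n --> \oo]
   --> e * N u u + \sum_(i < m) ip (g i) u ^+ 2.
  apply: cvgD; first by apply: cvgMr; exact: cvgD.
  apply: cvg_big => [|i _]; first exact: add_continuous.
  have c3 : ip (g i) (u_ n) @[n --> \oo] --> ip (g i) u.
    have -> : (fun n => ip (g i) (u_ n)) = (fun n => ip (u_ n) (g i)).
      by apply/funext => n; rewrite (sipC ipL)//; exact: qL.
    by rewrite (sipC ipL)//; apply: (sip_cvg_l ipL) => // n; exact: qL.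
  by rewrite expr2; under eq_fun do rewrite expr2; exact: cvgM.
rewrite -(cvg_lim _ ciu)// -(cvg_lim _ c2)//.
apply: ler_lim; [by apply/cvg_ex; eexists; exact: ciu|
  by apply/cvg_ex; eexists; exact: c2|].
by apply: nearW => n; exact: h.
Qed.

Lemma fopP lam u f : L f -> fop u (lam *: u + f) <->
  fdom u /\ forall v, fdom v -> a u v = lam * ip u v + ip f v.
Proof.
move=> Lf; rewrite fopE; split=> [[Du _ h]|[Du h]].
  split=> // v Dv; rewrite h// (sipPl ipL)//; exact: fdomL.
split=> //; first by apply: (proj2 sL) => //; exact: fdomL.
by move=> v Dv; rewrite (sipPl ipL)//; [exact: h|exact: fdomL|exact: fdomL].
Qed.

Lemma fop0P lam u : fop u (lam *: u) <->
  fdom u /\ forall v, fdom v -> a u v = lam * ip u v.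
Proof.
rewrite -[lam *: u]addr0 fopP; last by case: sL.
split=> -[Du h]; split=> // v Dv; rewrite h// (sip0l ipL) ?addr0//; exact: fdomL.
Qed.

(** The bound is uniform in the coefficients: it turns control of the finitely many numbers
    [ip (g i) (T f)] into the resolvent estimate. *)
Lemma ip_comb_bound (I : Type) (r : seq I) (h : I -> V) : (forall i, L (h i)) ->
  exists C : R, 0 <= C /\ forall (c : I -> R) F, (forall i, c i ^+ 2 <= F) ->
    ip (\sum_(i <- r) c i *: h i) (\sum_(i <- r) c i *: h i) <= C * F.
Proof.
move=> Lh; elim: r => [|i r [C [C0 ih]]].
  exists 0; split=> // c F _; rewrite big_nil mul0r (sip0l ipL)//.
  by case: sL.
exists (2 * ip (h i) (h i) + 2 * C); split.
  by rewrite addr_ge0 ?mulr_ge0 ?(sip_ge0 ipL).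
move=> c F cF; rewrite big_cons.
have Lci := linsubZ (c i) sL (Lh i).
apply: (le_trans (sipD2 ipL Lci _)).
  by apply: linsub_sum => // j; exact: linsubZ.
rewrite (mulrDl _ _ F); apply: lerD; last by rewrite -mulrA ler_pM2l// ih.
rewrite (sipZl ipL)// (sipZr ipL)//.
have := ler_wpM2r (sip_ge0 ipL (Lh i)) (cF i); lra.
Qed.

(** Let [T] be the solution operator of the coercive form [B]. The equation for [u] says that
    [B u v] is [ip f v] plus [K * \sum_i ip (g i) u * ip (g i) v]. Hence [u] is [T f] plus a
    combination of the [T (g j)], and the coefficients [c i = ip (g i) u] solve [A *m c = b].
    Invertibility of the matrix [A] decides between the two cases. *)
Theorem fspectrum_alt lam :
  fresolvent lam \/ (feigenvalue lam /\ ffinite_mult lam).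
Proof.
(* With the Ehrling constant [(2 * K)^-1] the added term of [B] is at least
   [K * ip u u - N u u / 2], and [K - lam >= 1] leaves [N u u <= 2 * B u u]. *)
pose K := 2 * `|lam| + 2.
have K0 : 0 < K by rewrite ltr_wpDl ?mulr_ge0.
have e0 : 0 < (2 * K)^-1 by rewrite invr_gt0 mulr_gt0.
have [m [g [Lg hg]]] := ehrling_fdom e0.
pose B u v := a u v - lam * ip u v + K * \sum_(i < m) ip (g i) u * ip (g i) v.
have DL := fdomL; have sD := sub_fdom.
have NB u : fdom u -> N u u <= 2 * B u u.
  move=> Du; have := hg u Du; rewrite /B /N.
  under [X in K * X]eq_bigr do rewrite -expr2.
  have := sip_ge0 aD Du; have := sip_ge0 ipD Du.
  set x := a u u; set y := ip u u; set S := \sum_(i < m) _ => y0 x0 h.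
  have : K * y <= K * ((2 * K)^-1 * (x + y) + S) by rewrite ler_pM2l.
  have -> : K * ((2 * K)^-1 * (x + y) + S) = (x + y) / 2 + K * S.
    by field; rewrite gt_eqF.
  have : (lam + 1) * y <= K * y - `|lam| * y - y.
    rewrite /K; have := ler_wpM2r y0 (ler_norm lam); lra.
  have := mulr_ge0 (normr_ge0 lam) y0; lra.
have B_sip : sip fdom B.
  split=> //.
  - move=> u v Du Dv; rewrite /B (sipC aD)// (sipC ipD)//.
    by congr (_ + _ * _); apply: eq_bigr => i _; rewrite mulrC.
  - move=> k u v w Du Dv Dw; rewrite /B (sipPl aD)// (sipPl ipD)//.
    have -> : \sum_(i < m) ip (g i) (k *: u + v) * ip (g i) w =
        k * (\sum_(i < m) ip (g i) u * ip (g i) w) +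
        \sum_(i < m) ip (g i) v * ip (g i) w.
      rewrite mulr_sumr -big_split/=; apply: eq_bigr => i _.
      rewrite (sipDr ipL) ?(sipZr ipL)//; try by auto.
        ring.
      by apply: DL; exact: linsubZ.
    ring.
  - move=> u Du; have := NB u Du; have := sip_ge0 ND Du; lra.
have [C C0 BN] : exists2 C, 0 <= C & forall u, fdom u -> B u u <= C * N u u.
  exists (1 + `|lam| + K * \sum_(i < m) ip (g i) (g i)).
    rewrite addr_ge0 ?addr_ge0 ?mulr_ge0 ?(ltW K0)// sumr_ge0// => i _.
    exact: (sip_ge0 ipL).
  move=> u Du; rewrite /B /N.
  have x0 := sip_ge0 aD Du; have y0 := sip_ge0 ipD Du.
  have h1 : - lam * ip u u <= `|lam| * ip u u.
    by apply: ler_wpM2r => //; rewrite -normrN; exact: ler_norm.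
  have h2 : K * (\sum_(i < m) ip (g i) u * ip (g i) u) <=
      K * (\sum_(i < m) ip (g i) (g i)) * ip u u.
    rewrite -mulrA ler_pM2l// mulr_suml; apply: ler_sum => i _.
    by rewrite -expr2; apply: (sip_CS ipL) => //; exact: DL.
  have h3 : 0 <= K * (\sum_(i < m) ip (g i) (g i)) * a u u.
    rewrite !mulr_ge0 ?(ltW K0)// sumr_ge0// => i _; exact: (sip_ge0 ipL).
  have h4 := mulr_ge0 (normr_ge0 lam) x0; lra.
have B_complete (u_ : nat -> V) : (forall n, fdom (u_ n)) -> is_Cauchy B u_ ->
    exists u, fdom u /\ B (u_ n - u) (u_ n - u) @[n --> \oo] --> 0.
  move=> Du cB.
  have [||u [Du0 cu]] := fdom_complete (u_ := u_); [by []| |].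
    move=> e e1; have e2 : 0 < e / 2 by rewrite divr_gt0.
    have [k hk] := cB _ e2; exists k => i j ki kj.
    have := NB _ (linsubB sD (Du i) (Du j)); have := hk i j ki kj; lra.
  exists u; split=> //.
  apply: (@cvg0_nonneg2 _ _ (fun n => C * N (u_ n - u) (u_ n - u)) (fun=> 0)).
  - move=> n; have Dn := linsubB sD (Du n) Du0.
    by rewrite addr0 (sip_ge0 B_sip)//= BN.
  - by rewrite -[X in _ --> X](mulr0 C); apply: cvgMr.
  - exact: cvg_cst.
have /choice[T TP] f : exists w, L f -> fdom w /\ forall v, fdom v -> B w v = ip f v.
  have [Lf|nLf] := pselect (L f); last by exists 0.
  have [||w hw] := @riesz _ _ _ _ B_sip B_complete (ip f) (2 * ip f f).
  - by move=> k u v Du Dv; rewrite (sipDr ipL) ?(sipZr ipL)//; try exact: DL;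
      apply: DL; exact: linsubZ.
  - move=> v Dv; apply: (le_trans (sip_CS ipL Lf (DL _ Dv))).
    rewrite mulrAC [2 * _]mulrC -mulrA mulrCA mulrC [X in _ <= X]mulrC.
    have f0 := sip_ge0 ipL Lf.
    have := NB v Dv; have := sip_ge0 aD Dv; rewrite /N => h1 h2.
    have := ler_wpM2l f0 (_ : ip v v <= 2 * B v v); rewrite -/(is_true _) => h3.
    have {h3} := h3 ltac:(lra); lra.
  - by exists w.
have TD f : L f -> fdom (T f) by move=> /TP[].
have TB f v : L f -> fdom v -> B (T f) v = ip f v by move=> /TP[_]; apply.
have Tbd f : L f -> ip (T f) (T f) <= 4 * ip f f.
  move=> Lf; have Df := TD f Lf.
  have := NB _ Df; rewrite TB// /N; have := sip_ge0 aD Df.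
  have := sip_CS ipL Lf (DL _ Df); have := sip_ge0 ipD Df; have := sip_ge0 ipL Lf.
  set x := ip (T f) _; set y := ip f (T f); set F := ip f f; set z := a _ _.
  move=> F0 x0 hy z0 hN.
  have xy : x <= 2 * y by lra.
  have [->|xn0] := eqVneq x 0; first by rewrite mulr_ge0.
  have xp : 0 < x by rewrite lt_neqAle eq_sym xn0.
  rewrite -(ler_pM2r xp); nra.
(* Any solution equals [w] up to a function of zero norm: [B (u - w) (u - w)] vanishes and [B]
   dominates [N]. *)
have uniq_sol u f t : fdom u -> L f -> fdom t ->
    (forall v, fdom v -> B t v = ip f v) ->
    (forall v, fdom v -> a u v = lam * ip u v + ip f v) ->
    let w := t + \sum_(j < m) (K * ip (g j) u) *: T (g j) in
    ip (u - w) (u - w) = 0.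
  move=> Du Lf Dt ht hu w.
  have DTg j : fdom (T (g j)) by exact: TD.
  have Dw : fdom w.
    by apply: linsubD => //; apply: linsub_sum => // j; exact: linsubZ.
  have Dx := linsubB sD Du Dw.
  have : B (u - w) (u - w) = 0.
    rewrite (sipBl B_sip)// {2}/w (sipDl B_sip)//; last first.
      by apply: linsub_sum => // j; exact: linsubZ.
    rewrite (sip_suml B_sip)//; last by move=> j; exact: linsubZ.
    rewrite ht// {1}/B hu// mulr_sumr.
    have -> : \sum_(i < m) B ((K * ip (g i) u) *: T (g i)) (u - w) =
       \sum_(i < m) K * (ip (g i) u * ip (g i) (u - w)).
      by apply: eq_bigr => i _; rewrite (sipZl B_sip)// TB// mulrA.
    ring.
  have := NB _ Dx => h1 h2; rewrite h2 mulr0 /N in h1.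
  have := sip_ge0 aD Dx; have := sip_ge0 ipD Dx => h3 h4.
  by apply/eqP; rewrite eq_le h3 andbT; lra.
pose M : 'M[R]_m := \matrix_(i, j) ip (g i) (T (g j)).
pose A := 1%:M - K *: M.
have AE (c : 'cV[R]_m) i : (A *m c) i 0 = c i 0 - K * \sum_(j < m) ip (g i) (T (g j)) * c j 0.
  rewrite /A mulmxBl mul1mx -scalemxAl !mxE; congr (_ - K * _).
  by apply: eq_bigr => j _; rewrite !mxE.
have ipcomb i t (c : 'cV[R]_m) : L t ->
    ip (g i) (t + \sum_(j < m) (K * c j 0) *: T (g j)) =
    ip (g i) t + K * \sum_(j < m) ip (g i) (T (g j)) * c j 0.
  move=> Lt; have LZ j : L ((K * c j 0) *: T (g j)).
    by apply: linsubZ => //; apply: DL; exact: TD.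
  rewrite (sipDr ipL)//; last exact: linsub_sum.
  rewrite (sip_sumr ipL)// mulr_sumr; congr (_ + _); apply: eq_bigr => j _.
  rewrite (sipZr ipL)//; last by apply: DL; exact: TD.
  by ring.
have Bcomb t f (c : 'cV[R]_m) u v : fdom t -> fdom v ->
    (B t v = ip f v) -> u = t + \sum_(j < m) (K * c j 0) *: T (g j) ->
    (forall i, ip (g i) u = c i 0) -> a u v = lam * ip u v + ip f v.
  move=> Dt Dv Bt uE uc.
  have DZ j : fdom ((K * c j 0) *: T (g j)) by apply: linsubZ => //; exact: TD.
  have : B u v = ip f v + K * \sum_(j < m) c j 0 * ip (g j) v.
    rewrite uE (sipDl B_sip)//; last exact: linsub_sum.
    rewrite Bt (sip_suml B_sip)// mulr_sumr; congr (_ + _).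
    by apply: eq_bigr => j _; rewrite (sipZl B_sip) ?TB ?mulrA//; exact: TD.
  rewrite /B; under eq_bigr do rewrite uc.
  by move=> h; lra.
have [Au|nAu] := boolP (A \in unitmx); [left; split|right; split].
- move=> f Lf.
  pose b : 'cV[R]_m := \col_i ip (g i) (T f).
  pose c := invmx A *m b.
  pose u := T f + \sum_(j < m) (K * c j 0) *: T (g j).
  have uc i : ip (g i) u = c i 0.
    rewrite /u ipcomb; last exact: DL (TD f Lf).
    have := AE c i; rewrite /c mulmxA mulmxV// mul1mx {1}/b mxE -/c => ->.
    by rewrite subrK.
  have Du : fdom u.
    apply: linsubD => //; first exact: TD.
    by apply: linsub_sum => // j; apply: linsubZ => //; exact: TD.
  exists u; apply/fopP => //; split=> // v Dv.
  by apply: (Bcomb (T f) f c) => //; [exact: TD|exact: TB].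
(* The vectors [h i] absorb [invmx A]: the solution is [T f] plus a combination of fixed vectors
   with coefficients [ip (g i) (T f)]. *)
- pose h i := \sum_(j < m) (K * invmx A j i) *: T (g j).
  have Lh i : L (h i).
    by apply: linsub_sum => // j; apply: linsubZ => //; apply: DL; exact: TD.
  have [C' [C'0 hC']] := ip_comb_bound (index_enum 'I_m) Lh.
  pose G := \sum_(i < m) ip (g i) (g i).
  have G0 : 0 <= G by apply: sumr_ge0 => i _; exact: (sip_ge0 ipL).
  exists (8 + 2 * C' * (G * 4)) => u f Lf /fopP -/(_ Lf)[Du hu].
  have Lu := DL _ Du; have LTf := DL _ (TD f Lf).
  have f0 := sip_ge0 ipL Lf.
  have := uniq_sol u f (T f) Du Lf (TD f Lf) (fun v => TB f v Lf) hu.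
  rewrite /=.
  pose c : 'cV[R]_m := \col_i ip (g i) u.
  have -> : \sum_(j < m) (K * ip (g j) u) *: T (g j) =
      \sum_(j < m) (K * c j 0) *: T (g j) by apply: eq_bigr => j _; rewrite mxE.
  set w := T f + _ => uw.
  have Lw : L w.
    apply: linsubD => //; apply: linsub_sum => // j; apply: linsubZ => //.
    by apply: DL; exact: TD.
  pose b : 'cV[R]_m := \col_i ip (g i) (T f).
  (* [ip (g i)] does not distinguish [u] from [w], since [u - w] has zero norm; applied to the
     formula for [w] this is the linear system. *)
  have Ac : A *m c = b.
    apply/matrixP => i j; rewrite ord1 AE.
    have -> : b i 0 = ip (g i) (T f) by rewrite mxE.
    apply/eqP; rewrite subr_eq -ipcomb// -/w.
    have -> : c i 0 = ip (g i) u by rewrite mxE.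
    rewrite -subr_eq0 -(sipBr ipL)//.
    by apply/eqP; rewrite (sipC ipL)//; last exact: linsubB;
       apply: (sip_eq0r ipL) => //; exact: linsubB.
  have cE : c = invmx A *m b by rewrite -Ac mulmxA mulVmx// mul1mx.
  have wE : w = T f + \sum_(i < m) ip (g i) (T f) *: h i.
    rewrite /w; congr (_ + _).
    under [RHS]eq_bigr do rewrite scaler_sumr.
    rewrite exchange_big/=; apply: eq_bigr => j _.
    rewrite cE mxE mulr_sumr scaler_suml; apply: eq_bigr => i _.
    by rewrite scalerA mxE; congr (_ *: _); ring.
  have uw2 : ip u u = ip w w.
    have Luw := linsubB sL Lu Lw.
    have e1 v : L v -> ip u v = ip w v.
      by move=> Lv; apply/eqP; rewrite -subr_eq0 -(sipBl ipL)// (sip_eq0r ipL).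
    by rewrite e1// (sipC ipL)// e1.
  rewrite uw2 wE.
  have Ls : L (\sum_(i < m) ip (g i) (T f) *: h i).
    by apply: linsub_sum => // i; exact: linsubZ.
  apply: (le_trans (sipD2 ipL LTf Ls)).
  have := Tbd f Lf.
  have := hC' (fun i => ip (g i) (T f)) (G * (4 * ip f f)).
  have hG i : ip (g i) (T f) ^+ 2 <= G * (4 * ip f f).
    apply: (le_trans (sip_CS ipL (Lg i) LTf)).
    apply: ler_pM; try exact: (sip_ge0 ipL).
      rewrite /G (bigD1 i)//= lerDl sumr_ge0// => j _; exact: (sip_ge0 ipL).
    exact: Tbd.
  move=> /(_ hG); set X := ip (\sum_(i < m) _) _; set F := ip f f.
  move=> h1 h2.
  have -> : (8 + 2 * C' * (G * 4)) * F = 8 * F + 2 * (C' * (G * (4 * F))) by ring.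
  lra.
(* [det0P] gives a row vector, so the kernel of [A] is read off from its transpose. *)
- have : \det A^T == 0 by move: nAu; rewrite det_tr unitmxE unitfE negbK.
  move=> /det0P[v v0 vA].
  pose c := v^T.
  have Ac : A *m c = 0 by apply: trmx_inj; rewrite trmx_mul trmxK vA trmx0.
  pose u := 0 + \sum_(j < m) (K * c j 0) *: T (g j).
  have [L0 D0] : L 0 /\ fdom 0 by split; [case: sL|case: sD].
  have uc i : ip (g i) u = c i 0.
    rewrite /u ipcomb// (sipC ipL)// (sip0l ipL)// add0r.
    have := AE c i; rewrite Ac mxE => /esym/eqP; rewrite subr_eq0 => /eqP ->.
    by [].
  have Du : fdom u.
    apply: linsubD => //.
    by apply: linsub_sum => // j; apply: linsubZ => //; exact: TD.
  exists u; split.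
    apply/fop0P; split=> // w Dw.
    have -> : lam * ip u w = lam * ip u w + ip 0 w.
      by rewrite (sip0l ipL) ?addr0//; exact: DL.
    by apply: (Bcomb 0 0 c) => //; rewrite (sip0l B_sip)// (sip0l ipL)//; exact: DL.
  (* If [u] had zero norm, all the coefficients [ip (g i) u = c i 0] would vanish. *)
  apply: contra v0 => /eqP u0; apply/eqP/matrixP => i j; rewrite ord1 [RHS]mxE.
  have -> : v 0 j = c j 0 by rewrite mxE.
  by rewrite -uc (sipC ipL)//; [apply: (sip_eq0r ipL) => //|]; exact: DL.
- exists m, (fun j => T (g j)); split; first by move=> j; apply: DL; exact: TD.
  move=> u /fop0P[Du hu]; exists (fun j => K * ip (g j) u).
  have [L0 D0] : L 0 /\ fdom 0 by split; [case: sL|case: sD].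
  have := uniq_sol u 0 0 Du L0 D0.
  rewrite /= add0r; apply.
    by move=> v Dv; rewrite (sip0l B_sip)// (sip0l ipL)//; exact: DL.
  by move=> v Dv; rewrite hu// (sip0l ipL) ?addr0//; exact: DL.
Qed.

(** Among [m.+1] eigenfunctions for distinct eigenvalues up to [Lam], a nonzero combination [w] is
    orthogonal to the [m] functions [g i]. Orthogonality of eigenfunctions bounds [a w w] by the
    absolute value of [Lam] times [ip w w], and the Ehrling inequality, its finite sum being zero,
    then reads [ip w w <= ip w w / 2]. *)
Theorem feigenvalue_finite Lam :
  finite_set [set lam | lam <= Lam /\ feigenvalue lam].
Proof.
apply: contrapT => inf.
pose e : R := (2 * (`|Lam| + 1))^-1.
have L1 : 0 < `|Lam| + 1 by rewrite ltr_wpDl.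
have e0 : 0 < e by rewrite invr_gt0 mulr_gt0.
have [m [g [Lg hg]]] := ehrling_fdom e0.
have [F FS cF] := @infinite_set_fset _ _ m.+1 inf.
pose lam (k : 'I_m.+1) := nth 0 (finmap.enum_fset F) k.
have kF (k : 'I_m.+1) : (k < size (finmap.enum_fset F))%N.
  by rewrite (leq_trans (ltn_ord k)).
have laminj (i j : 'I_m.+1) : i != j -> lam i != lam j.
  by rewrite /lam nth_uniq// ?finmap.fset_uniq// kF.
have lamP k : lam k <= Lam /\ feigenvalue (lam k).
  by apply: FS; rewrite /=; exact: mem_nth.
have /choice[u uP] (k : 'I_m.+1) : exists u, [/\ fdom u,
    forall v, fdom v -> a u v = lam k * ip u v & ip u u != 0].
  by have [_ [u [/fop0P[Du hu] u0]]] := lamP k; exists u.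
have DL := fdomL; have sD := sub_fdom.
have Du k : fdom (u k) by case: (uP k).
have Lu k : L (u k) by exact: DL.
have ua k v : fdom v -> a (u k) v = lam k * ip (u k) v.
  by case: (uP k) => _ h _ Dv; exact: h.
have orth i j : i != j -> ip (u i) (u j) = 0.
  move=> /laminj ij; have := ua i (u j) (Du j); rewrite (sipC aD)// ua//.
  rewrite (sipC ipL)// => /eqP; rewrite -subr_eq0 -mulrBl mulf_eq0 subr_eq0.
  by rewrite [lam j == _]eq_sym (negbTE ij)/= => /eqP.
pose P : 'M[R]_(m.+1, m) := \matrix_(k, i) ip (g i) (u k).
have : kermx P != 0.
  rewrite kermx_eq0 /row_free; apply/negP => /eqP rP.
  by have := rank_leq_col P; rewrite rP ltnn.
move=> /rowV0Pn[c /sub_kermxP cP c0].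
pose w := \sum_(k < m.+1) c 0 k *: u k.
have DZ k : fdom (c 0 k *: u k) by exact: linsubZ.
have LZ k : L (c 0 k *: u k) by exact: DL.
have Dw : fdom w by exact: linsub_sum.
have Lw := DL _ Dw.
have gw i : ip (g i) w = 0.
  rewrite /w (sip_sumr ipL)//.
  have := congr1 (fun A : 'rV[R]_m => A 0 i) cP; rewrite !mxE => e1; rewrite -[RHS]e1.
  by apply: eq_bigr => k _; rewrite (sipZr ipL)// !mxE.
have uw k : ip (u k) w = c 0 k * ip (u k) (u k).
  rewrite /w (sip_sumr ipL)// (bigD1 k)//= big1 ?addr0 ?(sipZr ipL)// => j jk.
  by rewrite (sipZr ipL)// orth ?mulr0// eq_sym.
have ww : ip w w = \sum_(k < m.+1) c 0 k ^+ 2 * ip (u k) (u k).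
  rewrite {1}/w (sip_suml ipL)//; apply: eq_bigr => k _.
  by rewrite (sipZl ipL)// uw mulrA -expr2.
have aw : a w w = \sum_(k < m.+1) lam k * (c 0 k ^+ 2 * ip (u k) (u k)).
  rewrite {1}/w (sip_suml aD)//; apply: eq_bigr => k _.
  rewrite (sipZl aD)// ua// uw; ring.
have u0 k : 0 <= ip (u k) (u k) by exact: (sip_ge0 ipL).
have awL : a w w <= `|Lam| * ip w w.
  rewrite aw ww mulr_sumr; apply: ler_sum => k _; apply: ler_wpM2r.
    by rewrite mulr_ge0// sqr_ge0.
  by apply: (le_trans _ (ler_norm _)); case: (lamP k).
have ww0 : 0 < ip w w.
  have [k ck] : exists k, c 0 k != 0.
    apply: contrapT => h; move/eqP: c0; apply; apply/matrixP => i j.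
    rewrite ord1 mxE; apply: contrapT => h'; apply: h; exists j; exact/eqP.
  rewrite ww (bigD1 k)//= ltr_pwDl//.
    rewrite mulr_gt0//; first by rewrite lt_neqAle sqr_ge0 eq_sym sqrf_eq0 ck.
    by rewrite lt_neqAle u0 eq_sym andbT; case: (uP k).
  by apply: sumr_ge0 => i _; rewrite mulr_ge0// sqr_ge0.
have := hg w Dw; rewrite big1 ?addr0; last by move=> i _; rewrite gw expr0n.
rewrite /N => h.
have : e * (a w w + ip w w) <= e * ((`|Lam| + 1) * ip w w).
  by rewrite ler_pM2l//; lra.
have -> : e * ((`|Lam| + 1) * ip w w) = ip w w / 2.
  by rewrite /e; field; rewrite gt_eqF.
lra.
Qed.

End AbstractForm.

(** * The space of square integrable functions *)

Section SquareIntegrable.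
Context d (T : measurableType d) (R : realType).
Variables (mu : {measure set T -> \bar R}) (D : set T).
Hypothesis mD : measurable D.
Implicit Types (u v : T -> R).

(** [sqint mu2 Omega] and [dot mu2 Omega] are convertible to [L2 Omega] and [dotL2 Omega]; with a
    general measure the same theory serves intervals, boxes and [Omega]. *)
Definition sqint : set (T -> R) := [set u | measurable_fun D (u : T -> R) /\
  mu.-integrable D (fun x => ((u x) ^+ 2)%:E)].

Definition dot u v : R := \int[mu]_(x in D) (u x * v x).

Lemma sqint_mul u v : sqint u -> sqint v ->
  mu.-integrable D (fun x => (u x * v x)%:E).
Proof.
move=> [mu_ iu] [mv iv]; apply: le_integrable (integrableD mD iu iv) => //.
  by apply/measurable_EFinP; exact: measurable_funM.
move=> x Dx.
rewrite [X in (_ <= X)%E](_ : _ = (`|u x ^+ 2 + v x ^+ 2|)%:E)// lee_fin.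
have := sqr_ge0 (`|u x| - `|v x|); rewrite normrM.
have -> : `|u x ^+ 2 + v x ^+ 2| = `|u x| ^+ 2 + `|v x| ^+ 2.
  by rewrite ger0_norm ?addr_ge0 ?sqr_ge0// -!normrX !ger0_norm ?sqr_ge0.
have := mulr_ge0 (normr_ge0 (u x)) (normr_ge0 (v x)); nra.
Qed.

Lemma sqint_linsub : linsub sqint.
Proof.
split.
  split; first exact: measurable_cst.
  by under eq_fun do rewrite expr0n/=; exact: integrable0.
move=> k u v Su Sv; have [mu_ iu] := Su; have [mv iv] := Sv.
have mf : measurable_fun D (k *: u + v : T -> R).
  by apply: measurable_funD => //; exact: measurable_funM.
split=> //.
have -> : (fun x => (((k *: u + v) x) ^+ 2)%:E) =
    ((fun x => (k ^+ 2)%:E * (u x ^+ 2)%:E) \+ ((fun x => (2 * k)%:E * (u x * v x)%:E) \+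
    (fun x => (v x ^+ 2)%:E)))%E.
  apply/funext => x /=; rewrite -!EFinM -!EFinD; congr _%:E.
  have -> : (k *: u + v) x = k * u x + v x by [].
  ring.
apply: integrableD => //; first exact: integrableZl.
by apply: integrableD => //; apply: integrableZl => //; exact: sqint_mul.
Qed.

Lemma dot_sip : sip sqint dot.
Proof.
split; first exact: sqint_linsub.
- by move=> u v _ _; apply: eq_Rintegral => x _; rewrite mulrC.
- move=> k u v w Su Sv Sw; rewrite /dot -RintegralZl//; last exact: sqint_mul.
  rewrite -RintegralD//; last 2 first.
  + under [X in integrable _ _ X]eq_fun do rewrite /= EFinM.
    by apply: integrableZl => //; exact: sqint_mul.
  + exact: sqint_mul.
  apply: eq_Rintegral => x _; rewrite mulrA -mulrDl; congr (_ * _).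
- by move=> u Su; apply: Rintegral_ge0 => x _; rewrite -expr2 sqr_ge0.
Qed.

Lemma dot_EFin u : sqint u ->
  ((dot u u)%:E = \int[mu]_(x in D) ((u x) ^+ 2)%:E)%E.
Proof.
move=> Su; rewrite /dot /Rintegral fineK.
  by apply: eq_integral => x _; rewrite expr2.
by apply: integrable_fin_num => //; exact: sqint_mul.
Qed.

Lemma sqintP u : measurable_fun D u ->
  sqint u <-> (\int[mu]_(x in D) ((u x) ^+ 2)%:E < +oo)%E.
Proof.
move=> mu_; split=> [[_ /integrableP[_]]|h].
  by under eq_integral do rewrite abse_EFin ger0_norm ?sqr_ge0//.
split=> //; apply/integrableP; split.
  by apply/measurable_EFinP; exact: measurable_funX.
by under eq_integral do rewrite abse_EFin ger0_norm ?sqr_ge0//.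
Qed.

Lemma dot_eq0 u : sqint u -> dot u u = 0 <-> {ae mu, forall x, D x -> u x = 0}.
Proof.
move=> Su; have [mu_ iu] := Su.
have mu2 : measurable_fun D (fun x => ((u x) ^+ 2)%:E).
  by apply/measurable_EFinP; exact: measurable_funX.
have e : (\int[mu]_(x in D) `|((u x) ^+ 2)%:E| = (dot u u)%:E)%E.
  rewrite dot_EFin//; apply: eq_integral => x _.
  by rewrite abse_EFin ger0_norm ?sqr_ge0.
have h := ae_eq_integral_abs mu mD mu2.
split=> [d0|ae0].
  have /h : (\int[mu]_(x in D) `|((u x) ^+ 2)%:E| = 0)%E by rewrite e d0.
  apply: filterS => x /[apply] -[/eqP].
  by rewrite sqrf_eq0 => /eqP.
have : (\int[mu]_(x in D) `|((u x) ^+ 2)%:E| = 0)%E.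
  by apply/h; apply: filterS ae0 => x /[apply] ->; rewrite expr0n.
by rewrite e => -[].
Qed.

Lemma eq_dot u u' v : sqint u -> sqint u' -> sqint v ->
  {ae mu, forall x, D x -> u x = u' x} -> dot u v = dot u' v.
Proof.
move=> Su Su' Sv ae0; apply/eqP; rewrite -subr_eq0 -(sipBl dot_sip)//.
rewrite (sip_eq0r dot_sip)//; first exact: (linsubB sqint_linsub).
apply/dot_eq0; first exact: (linsubB sqint_linsub).
by apply: filterS ae0 => x /[apply] e; rewrite /= -[LHS]/(u x - u' x) e subrr.
Qed.

(** Riesz-Fischer: a fast subsequence converges almost everywhere, and Fatou's lemma brings the
    whole sequence to that limit. *)
Lemma sqint_complete (u_ : nat -> T -> R) : (forall n, sqint (u_ n)) ->
  is_Cauchy dot u_ ->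
  exists u, sqint u /\ dot (u_ n - u) (u_ n - u) @[n --> \oo] --> 0.
Proof.
move=> Su C.
have /choice[N NP] (k : nat) : exists N : nat, forall m n, (N <= m)%N -> (N <= n)%N ->
    dot (u_ m - u_ n) (u_ m - u_ n) < (16 ^+ k)^-1.
  by apply: C; rewrite invr_gt0 exprn_gt0.
(* [n k] exceeds all [N j] with [j <= k], so consecutive terms have squared distance below
   [(16 ^+ k)^-1]; it is also at least [k], which the Fatou argument uses. *)
pose n k := maxn k (\max_(j < k.+1) N j).
have nN k j : (j <= k)%N -> (N j <= n k)%N.
  move=> jk; have jk' : (j < k.+1)%N by [].
  rewrite leq_max; apply/orP; right.
  exact: (@leq_bigmax _ (fun j : 'I_k.+1 => N j) (Ordinal jk')).
have nS k : (N k <= n k.+1)%N by apply: nN.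
pose dd k := u_ (n k.+1) - u_ (n k).
have sB m k : sqint (u_ m - u_ k) by exact: (linsubB sqint_linsub).
have ddS k : sqint (dd k) by exact: sB.
have ddb k : dot (dd k) (dd k) < (16 ^+ k)^-1 by apply: NP => //; exact: nN.
have mdd k : measurable_fun D (dd k) by case: (ddS k).
(* The weight [4 ^+ k] is absorbed by the decay [(16 ^+ k)^-1] of the integrals, while pointwise a
   finite sum of the [F k x] forces [dd k x] to decay like [2^-1 ^+ k]. *)
pose F k x : \bar R := (4 ^+ k * dd k x ^+ 2)%:E.
have F0 k x : D x -> (0 <= F k x)%E.
  by move=> _; rewrite lee_fin; apply: mulr_ge0; [exact: exprn_ge0|exact: sqr_ge0].
have mF k : measurable_fun D (F k).
  by apply/measurable_EFinP; apply: measurable_funM => //; exact: measurable_funX.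
have intF k : (\int[mu]_(x in D) F k x <= (geometric 1 4^-1 k)%:E)%E.
  rewrite /F; under eq_integral do rewrite EFinM.
  rewrite ge0_integralZl//; try first
    [by apply/measurable_EFinP; exact: measurable_funX
    |by move=> x _; rewrite lee_fin sqr_ge0|by rewrite lee_fin exprn_ge0].
  rewrite -dot_EFin// -EFinM lee_fin /geometric/= mul1r exprVn.
  have -> : (4 ^+ k)^-1 = 4 ^+ k * (16 ^+ k)^-1 :> R.
    have -> : 16 = 4 * 4 :> R by rewrite -natrM.
    by rewrite exprMn invfM mulrA divff ?mul1r// expf_neq0.
  by rewrite ler_pM2l ?exprn_gt0// ltW.
have sumF : (\int[mu]_(x in D) (\sum_(k <oo) F k x) < +oo)%E.
  rewrite integral_nneseries//.
  apply: (@le_lt_trans _ _ (\sum_(k <oo) (geometric 1 4^-1 k)%:E)%E).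
    apply: lee_nneseries => [k _ _|k _]; last exact: intF.
    by apply: integral_ge0 => x; exact: F0.
  have h4 : `|4^-1| < 1 :> R by rewrite ger0_norm ?invr_ge0// invf_lt1// ltr1n.
  have h5 : eseries (fun k => (geometric (1 : R) 4^-1 k)%:E) @ \oo -->
      (1 * (1 - 4^-1)^-1)%:E.
    apply: cvg_EFin; first by apply: nearW => k; rewrite /eseries/= sumEFin.
    rewrite [X in X @ _ --> _](_ : _ = series (geometric 1 4^-1)).
      exact: cvg_geometric_series.
    by apply/funext => k; rewrite /= /eseries/= sumEFin.
  by rewrite (cvg_lim _ h5)// ltry.
have aeF : {ae mu, forall x, D x -> (\sum_(k <oo) F k x)%E \is a fin_num}.
  apply: integrable_ae => //; apply/integrableP; split.
    apply: ge0_emeasurable_sum => [k x Dx _|k _]; [exact: F0|exact: mF].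
  under eq_integral => x /[!inE] Dx.
    rewrite gee0_abs; last by apply: nneseries_ge0 => k _ _; exact: F0.
    over.
  exact: sumF.
pose w k x := u_ (n k) x.
have aeC : {ae mu, forall x, D x -> cvgn (w ^~ x)}.
  apply: filterS aeF => x h Dx; have {h} := h Dx.
  set S := (\sum_(k <oo) F k x)%E => Sfin.
  have FS k : (F k x <= S)%E.
    apply: le_trans (nneseries_lim_ge k.+1 _); last by move=> j _ _; exact: F0.
    by rewrite big_nat_recr//= leeDr// sume_ge0// => j _; exact: F0.
  have s0 : 0 <= fine S by rewrite fine_ge0// nneseries_ge0// => k _ _; exact: F0.
  have ddx k : `|dd k x| <= geometric (fine S + 1) 2^-1 k.
    have := FS k; rewrite -(fineK Sfin) lee_fin => h.
    rewrite /geometric/= exprVn ler_pdivlMr ?exprn_gt0//.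
    rewrite -(@ler_pXn2r _ 2%N)// ?nnegrE ?mulr_ge0 ?exprn_ge0 ?addr_ge0//.
    rewrite exprMn real_normK ?num_real// -exprM mulnC exprM -natrX mulrC.
    by apply: (le_trans h); have := sqr_ge0 (fine S); nra.
  have : cvgn (series (dd ^~ x)).
    apply: normed_cvg; apply: series_le_cvg ddx _ => //.
      by move=> k; rewrite geometric_ge0 ?addr_ge0 ?invr_ge0.
    apply: is_cvg_geometric_series.
    by rewrite ger0_norm ?invr_ge0// invf_lt1// ltr1n.
  have -> : series (dd ^~ x) = (fun k => w k x - w 0%N x).
    by apply/funext => k; rewrite seriesEnat/= (telescope_sumr (w ^~ x)).
  move=> /cvg_ex[l hl]; apply/cvg_ex; exists (l + w 0%N x).
  have -> : w ^~ x = (fun k => (w k x - w 0%N x) + w 0%N x).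
    by apply/funext => k; rewrite subrK.
  by apply: cvgD => //; exact: cvg_cst.
pose wE k x := (w k x)%:E.
(* The upper limit is measurable in any case, and it agrees with the limit wherever the latter
   exists. *)
pose u x := fine (limn_esup (wE ^~ x)).
have mw k : measurable_fun D (w k) by case: (Su (n k)).
have mu_ : measurable_fun D u.
  apply: (@measurableT_comp _ _ _ _ _ _ fine) => //.
  by apply: measurable_fun_limn_esup => k; exact/measurable_EFinP.
have uw : {ae mu, forall x, D x -> w ^~ x @ \oo --> u x}.
  apply: filterS aeC => x h Dx; have {h}/cvg_ex[l hl] := h Dx.
  have hE : wE ^~ x @ \oo --> l%:E by apply: cvg_EFin hl; exact: nearW.
  have -> // : u x = l.
  by rewrite /u is_cvg_limn_esupE ?(cvg_lim _ hE)//; apply/cvg_ex; exists l%:E.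
have mdiff m : measurable_fun D (fun x => ((u_ m x - u x) ^+ 2)%:E).
  apply/measurable_EFinP; apply: measurable_funX; apply: measurable_funB => //.
  by case: (Su m).
have key (e : R) : 0 < e -> exists M : nat, forall m, (M <= m)%N ->
    (\int[mu]_(x in D) ((u_ m x - u x) ^+ 2)%:E <= e%:E)%E.
  move=> e0; have [M hM] := C e e0; exists M => m Mm.
  pose f k x : \bar R := ((u_ m x - w k x) ^+ 2)%:E.
  have mf k : measurable_fun D (f k).
    apply/measurable_EFinP; apply: measurable_funX; apply: measurable_funB => //.
    by case: (Su m).
  have f0 k x : D x -> (0 <= f k x)%E by rewrite lee_fin sqr_ge0.
  have mlim : measurable_fun D (fun x => limn_einf (f ^~ x)).
    under eq_fun do rewrite /limn_einf.
    apply: measurableT_comp => //; apply: measurable_fun_limn_esup => k.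
    exact: measurableT_comp.
  have lim0 x : D x -> (0 <= limn_einf (f ^~ x))%E.
    move=> Dx; rewrite limn_einf_lim; apply: lime_ge; first exact: is_cvg_einfs.
    by apply: nearW => k; apply: le_ereal_inf_tmp => _ [j _ <-]; exact: f0.
  apply: (@le_trans _ _ (\int[mu]_(x in D) limn_einf (f ^~ x))%E).
    apply: ae_ge0_le_integral => //; first by move=> x _; rewrite lee_fin sqr_ge0.
    apply: filterS uw => x h Dx; have {h}h := h Dx.
    have hE : f ^~ x @ \oo --> ((u_ m x - u x) ^+ 2)%:E.
      apply: cvg_EFin; first exact: nearW.
      rewrite /comp/= expr2; under eq_fun do rewrite expr2.
      by apply: cvgM; apply: cvgB => //; exact: cvg_cst.
    rewrite is_cvg_limn_einfE ?(cvg_lim _ hE)//.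
  apply: (le_trans (fatou _ _ _ _)) => //.
  rewrite limn_einf_lim; apply: lime_le; first exact: is_cvg_einfs.
  near=> k; apply: (@le_trans _ _ (\int[mu]_(x in D) f k x)%E).
    by apply: ereal_inf_lbound; exists k => /=.
  rewrite -[X in (X <= _)%E](dot_EFin (sB m (n k))) lee_fin ltW// hM//.
  apply: (@leq_trans k); last by rewrite leq_max leqnn.
  by near: k; exists M.
have Lu : sqint u.
  have [M hM] := key 1 ltr01.
  have Sd : sqint (fun x => u_ M x - u x).
    apply/sqintP; first by apply: measurable_funB => //; case: (Su M).
    by apply: le_lt_trans (hM M (leqnn M)) _; rewrite ltry.
  have -> : u = u_ M - (fun x => u_ M x - u x).
    by apply/funext => x; rewrite -[RHS]/(u_ M x - (u_ M x - u x)); ring.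
  exact: (linsubB sqint_linsub).
exists u; split=> //; apply/cvgr0Pnorm_lt => e e0.
have e2 : 0 < e / 2 by rewrite divr_gt0.
have [M hM] := key _ e2; exists M => // m /= Mm.
have Sm : sqint (u_ m - u) by exact: (linsubB sqint_linsub).
rewrite ger0_norm ?(sip_ge0 dot_sip)//.
have := hM m Mm; rewrite -[X in (X <= _)%E](dot_EFin Sm) lee_fin; lra.
Unshelve. all: by end_near. Qed.

End SquareIntegrable.

(** * Smooth functions on the plane *)

Section Plane.
Context {R : realType}.
Local Notation plane := (measurableTypeR R * measurableTypeR R)%type.
Implicit Types (phi psi : R * R -> R).

Lemma measurable_plane_ball (x : R * R) (e : R) : measurable (ball x e : set plane).
Proof.
have -> : ball x e = ball x.1 e `*` ball x.2 e by apply/seteqP; split=> y [].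
by apply: measurableX; exact: measurable_ball.
Qed.

Lemma rat_near (x e : R) : 0 < e -> exists q : rat, ball x e (ratr q).
Proof.
move=> e0; have : x - e < x + e by lra.
move=> /rat_in_itvoo[q]; rewrite in_itv/= => /andP[h1 h2]; exists q.
by rewrite /ball/= ltr_distl; apply/andP; split; lra.
Qed.

(** [plane] carries the product sigma-algebra, so an open set has to be written as a countable union
    of open squares, with rational centres and radii [n.+1%:R^-1]. *)
Lemma open_measurable_plane (A : set (R * R)) : open A -> measurable (A : set plane).
Proof.
move=> oA.
pose c (p q : rat) : R * R := (ratr p, ratr q).
pose B p q n := if `[< ball (c p q) n.+1%:R^-1 `<=` A >] then
  ball (c p q) n.+1%:R^-1 : set plane else set0.
have -> : A = \bigcup_p \bigcup_q \bigcup_n B p q n.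
  apply/seteqP; split=> [x Ax|x [p _ [q _ [n _]]]]; last first.
    by rewrite /B; case: asboolP => // h /h.
  have /nbhs_ballP[e /= e0 he] : nbhs x A by exact: open_nbhs_nbhs.
  have e2 : 0 < e / 2 by rewrite divr_gt0.
  have [n hn] : exists n : nat, n.+1%:R^-1 < e / 2.
    by have [n _ hn] := near_infty_natSinv_lt (PosNum e2); exists n; apply: hn => /=.
  have n0 : 0 < n.+1%:R^-1 :> R by rewrite invr_gt0.
  have [p hp] := rat_near x.1 n0; have [q hq] := rat_near x.2 n0.
  have xc : ball x n.+1%:R^-1 (c p q) by split.
  exists p => //; exists q => //; exists n => //; rewrite /B.
  case: asboolP => [_|[]]; first exact: ball_sym.
  move=> y hy; apply: he; rewrite [e]splitr.
  apply: (@ball_triangle _ _ (c p q)); apply: le_ball; try exact: (ltW hn).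
    exact: xc.
  exact: hy.
apply: bigcupT_measurable_rat => p; apply: bigcupT_measurable_rat => q.
apply: bigcupT_measurable => n; rewrite /B; case: ifP => // _.
exact: measurable_plane_ball.
Qed.

Lemma continuous_measurable_plane phi : continuous phi ->
  measurable_fun setT (phi : plane -> R).
Proof.
move=> /continuousP cf; apply: (measurability _ (RGenOpens.measurableE R)).
move=> _ [_ [a [b ->] <-]]; rewrite setTI; apply: open_measurable_plane.
exact/cf/interval_open.
Qed.

Lemma smooth2_continuous phi : smooth2 phi -> continuous phi.
Proof. by move=> /(_ 0%N) []. Qed.

Lemma smooth2_pd1 phi : smooth2 phi -> smooth2 (pd1 phi).
Proof. by move=> s k; case: (s k.+1) => _ []. Qed.

Lemma smooth2_pd2 phi : smooth2 phi -> smooth2 (pd2 phi).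
Proof. by move=> s k; case: (s k.+1) => _ []. Qed.

Lemma smooth2_pd i j phi : smooth2 phi -> smooth2 (pd i j phi).
Proof.
move=> s; elim: i => [|i ih]; last exact: smooth2_pd1.
by elim: j => // j ih; exact: smooth2_pd2.
Qed.

Lemma smooth2_derivable1 phi x : smooth2 phi -> derivable phi x ((1, 0) : R * R).
Proof. by move=> /(_ 1%N)[_ []]. Qed.

Lemma smooth2_derivable2 phi x : smooth2 phi -> derivable phi x ((0, 1) : R * R).
Proof. by move=> /(_ 1%N)[_ []]. Qed.

Lemma is_derive_line1 phi (s t : R) : derivable phi (s, t) ((1, 0) : R * R) ->
  is_derive s 1 (fun s => phi (s, t)) (pd1 phi (s, t)).
Proof.
move=> h; have e : (fun h : R => h^-1 *: (((fun s => phi (s, t)) \o shift s) (h *: 1) - phi (s, t))) =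
  (fun h : R => h^-1 *: ((phi \o shift (s, t)) (h *: ((1, 0) : R * R)) - phi (s, t))).
  apply/funext => k /=; congr (_ *: (phi _ - _)).
  by rewrite -[RHS]/(k * 1 + s, k * 0 + t) mulr0 add0r.
by split; [rewrite /derivable e|rewrite /derive e].
Qed.

Lemma is_derive_line2 phi (s t : R) : derivable phi (s, t) ((0, 1) : R * R) ->
  is_derive t 1 (fun t => phi (s, t)) (pd2 phi (s, t)).
Proof.
move=> h; have e : (fun h : R => h^-1 *: (((fun t => phi (s, t)) \o shift t) (h *: 1) - phi (s, t))) =
  (fun h : R => h^-1 *: ((phi \o shift (s, t)) (h *: ((0, 1) : R * R)) - phi (s, t))).
  apply/funext => k /=; congr (_ *: (phi _ - _)).
  by rewrite -[RHS]/(k * 0 + s, k * 1 + t) mulr0 add0r.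
by split; [rewrite /derivable e|rewrite /derive e].
Qed.

Lemma smooth2_line1 phi (s t : R) : smooth2 phi ->
  is_derive s 1 (fun s => phi (s, t)) (pd1 phi (s, t)).
Proof. by move=> h; apply: is_derive_line1; exact: smooth2_derivable1. Qed.

Lemma smooth2_line2 phi (s t : R) : smooth2 phi ->
  is_derive t 1 (fun t => phi (s, t)) (pd2 phi (s, t)).
Proof. by move=> h; apply: is_derive_line2; exact: smooth2_derivable2. Qed.

Lemma pd1_lin k phi psi x : derivable phi x ((1, 0) : R * R) ->
  derivable psi x ((1, 0) : R * R) ->
  derivable (k *: phi + psi) x ((1, 0) : R * R) /\
  pd1 (k *: phi + psi) x = k * pd1 phi x + pd1 psi x.
Proof.
move=> h1 h2; have h3 := derivableZ (k := k) h1.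
by split; [exact: derivableD|rewrite /pd1 deriveD// deriveZ].
Qed.

Lemma pd2_lin k phi psi x : derivable phi x ((0, 1) : R * R) ->
  derivable psi x ((0, 1) : R * R) ->
  derivable (k *: phi + psi) x ((0, 1) : R * R) /\
  pd2 (k *: phi + psi) x = k * pd2 phi x + pd2 psi x.
Proof.
move=> h1 h2; have h3 := derivableZ (k := k) h1.
by split; [exact: derivableD|rewrite /pd2 deriveD// deriveZ].
Qed.

Lemma cont_diff_lin n k phi psi : cont_diff n phi -> cont_diff n psi ->
  cont_diff n (k *: phi + psi).
Proof.
elim: n phi psi => [|n ih] phi psi [c1 h1] [c2 h2].
  by split=> // x; apply: cvgD; [apply: cvgZr; exact: c1|exact: c2].
split; first by move=> x; apply: cvgD; [apply: cvgZr; exact: c1|exact: c2].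
case: h1 => a1 a2 a3 a4; case: h2 => b1 b2 b3 b4; split.
- by move=> x; have [] := pd1_lin k (a1 x) (b1 x).
- by move=> x; have [] := pd2_lin k (a2 x) (b2 x).
- have -> : pd1 (k *: phi + psi) = k *: pd1 phi + pd1 psi.
    by apply/funext => x; have [_ ->] := pd1_lin k (a1 x) (b1 x).
  exact: ih.
- have -> : pd2 (k *: phi + psi) = k *: pd2 phi + pd2 psi.
    by apply/funext => x; have [_ ->] := pd2_lin k (a2 x) (b2 x).
  exact: ih.
Qed.

Lemma smooth2_lin k phi psi : smooth2 phi -> smooth2 psi -> smooth2 (k *: phi + psi).
Proof. by move=> h1 h2 n; exact: cont_diff_lin. Qed.

Lemma pd_lin i j k phi psi : smooth2 phi -> smooth2 psi ->
  pd i j (k *: phi + psi) = k *: pd i j phi + pd i j psi.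
Proof.
move=> h1 h2; elim: i => [|i ih]; last first.
  rewrite /pd/= -!/(pd _ _ _) ih; apply/funext => x.
  by have [] := pd1_lin k (smooth2_derivable1 (x := x) (smooth2_pd i j h1))
    (smooth2_derivable1 (x := x) (smooth2_pd i j h2)).
elim: j => // j ih; rewrite /pd/= in ih *; rewrite ih; apply/funext => x.
by have [] := pd2_lin k (smooth2_derivable2 (x := x) (smooth2_pd 0 j h1))
    (smooth2_derivable2 (x := x) (smooth2_pd 0 j h2)).
Qed.

Lemma smooth2_0 : smooth2 (0 : R * R -> R).
Proof.
move=> k; elim: k => [|k ih]; split => //; try exact: cst_continuous.
have p1 : pd1 (0 : R * R -> R) = 0.
  by apply/funext => x; rewrite /pd1 -[LHS]/('D__ (cst 0) x) derive_cst.
have p2 : pd2 (0 : R * R -> R) = 0.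
  by apply/funext => x; rewrite /pd2 -[LHS]/('D__ (cst 0) x) derive_cst.
by split; rewrite ?p1 ?p2// => x; exact: derivable_cst.
Qed.

(* Continuity of the partial derivatives is used at the corner (s + h, t) of the
   two-step path from (s, t) to (s + h, c (s + h)). *)
Lemma is_derive_curve phi (c : R -> R) (s dc : R) : smooth2 phi -> is_derive s 1 c dc ->
  is_derive s 1 (fun s => phi (s, c s)) (pd1 phi (s, c s) + dc * pd2 phi (s, c s)).
Proof.
move=> sphi dcs.
have cp2 : continuous (pd2 phi) by apply/smooth2_continuous/smooth2_pd2.
have cc : {for s, continuous c}.
  by apply/differentiable_continuous/derivable1_diffP; case: dcs.
have /choice[th thP] (h : R) : exists th : R,
    phi (h + s, c (h + s)) - phi (h + s, c s) =
      pd2 phi (h + s, th) * (c (h + s) - c s) /\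
    `|th - c s| <= `|c (h + s) - c s|.
  have der u v : {within `[u, v], continuous (fun t => phi (h + s, t))}.
    apply: continuous_subspaceT => x.
    apply/differentiable_continuous/derivable1_diffP.
    by have [] := smooth2_line2 (h + s) x sphi.
  have [le|lt] := leP (c s) (c (h + s)).
    have [x xin e] := MVT_segment le (fun x _ => smooth2_line2 (h + s) x sphi) (der _ _).
    move: xin; rewrite in_itv/= => /andP[h1 h2].
    by exists x; split=> //; rewrite !ger0_norm ?subr_ge0// lerD2r.
  have [x xin e] := MVT_segment (ltW lt) (fun x _ => smooth2_line2 (h + s) x sphi) (der _ _).
  move: xin; rewrite in_itv/= => /andP[h1 h2].
  exists x; split; first by rewrite -[LHS]opprB e; ring.
  by rewrite distrC [X in _ <= X]distrC !ger0_norm ?subr_ge0 ?(ltW lt)// lerD2l lerN2.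
have [d1 e1] := smooth2_line1 s (c s) sphi.
have [d2 e2] := dcs.
suff H : (fun h : R => h^-1 *: (((fun s => phi (s, c s)) \o shift s) (h *: 1) -
    phi (s, c s))) @ 0^' --> pd1 phi (s, c s) + dc * pd2 phi (s, c s).
  by split; [apply/cvg_ex; eexists; exact: H|exact: cvg_lim H].
have H1 : h^-1 *: (phi (h *: 1 + s, c s) - phi (s, c s)) @[h --> 0^'] --> pd1 phi (s, c s).
  by rewrite -e1; exact: d1.
have H2 : h^-1 *: (c (h *: 1 + s) - c s) @[h --> 0^'] --> dc.
  by rewrite -e2; exact: d2.
have ccs : c (h + s) @[h --> 0^'] --> c s.
  apply: cvg_within_filter.
  rewrite -{2}[s]add0r; apply: (@continuous_comp _ _ _ (fun h => h + s) c).
    by apply: cvgD; [exact: cvg_id|exact: cvg_cst].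
  by rewrite add0r.
have thc : th h @[h --> 0^'] --> c s.
  apply/cvgrPdist_lt => e e0; move/cvgrPdist_lt : ccs => /(_ e e0).
  apply: filterS => h; rewrite distrC => hh; rewrite distrC.
  by apply: le_lt_trans hh; case: (thP h).
have H3 : pd2 phi (h + s, th h) @[h --> 0^'] --> pd2 phi (s, c s).
  apply: (@cvg_comp _ _ _ (fun h => (h + s, th h)) (pd2 phi)); last exact: cp2.
  have A : h + s @[h --> 0^'] --> s.
    apply: cvg_within_filter.
    by rewrite -{2}[s]add0r; apply: cvgD; [exact: cvg_id|exact: cvg_cst].
  exact: (cvg_pair A thc).
have -> : (fun h : R => h^-1 *: (((fun s => phi (s, c s)) \o shift s) (h *: 1) -
    phi (s, c s))) = (fun h => h^-1 *: (phi (h *: 1 + s, c s) - phi (s, c s)) +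
    (h^-1 *: (c (h *: 1 + s) - c s)) * pd2 phi (h + s, th h)).
  apply/funext => h /=; have [e _] := thP h.
  have -> : h *: 1 = h by rewrite /GRing.scale/= mulr1.
  rewrite -[phi (h + s, c (h + s))](subrK (phi (h + s, c s))) e.
  rewrite /GRing.scale/=; ring.
exact: (cvgD H1 (cvgM H2 H3)).
Qed.

End Plane.

(** * Inequalities on an interval *)

Section OneDim.
Context {R : realType}.
Notation mu := (@lebesgue_measure R).
Implicit Types (a b c d : R) (f g F : R -> R).

Definition intv a b f : R := \int[mu]_(x in `[a, b]) f x.

Lemma cont_integrable a b f : continuous f -> mu.-integrable `[a, b] (EFin \o f).
Proof.
move=> cf; apply: continuous_compact_integrable; first exact: segment_compact.
exact: continuous_subspaceT.
Qed.

Lemma contM f g : continuous f -> continuous g -> continuous (fun x => f x * g x).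
Proof. by move=> cf cg x; apply: cvgM; [exact: cf|exact: cg]. Qed.

Lemma contX f : continuous f -> continuous (fun x => f x ^+ 2).
Proof.
move=> cf; have -> : (fun x => f x ^+ 2) = (fun x => f x * f x) by [].
exact: contM.
Qed.

Lemma contD f g : continuous f -> continuous g -> continuous (fun x => f x + g x).
Proof. by move=> cf cg x; apply: cvgD; [exact: cf|exact: cg]. Qed.

Lemma cont_cst c : continuous (fun _ : R => c : R).
Proof. by move=> x; exact: cvg_cst. Qed.

Lemma cont_sqint a b f : continuous f -> sqint mu `[a, b] f.
Proof.
move=> cf; split; first by apply: measurable_funTS; exact: continuous_measurable_fun.
by apply: (cont_integrable a b); exact: contX.
Qed.

Lemma intv_EFin a b f : continuous f ->
  ((intv a b f)%:E = \int[mu]_(x in `[a, b]) (f x)%:E)%E.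
Proof.
move=> cf; rewrite /intv /Rintegral fineK//.
by apply: integrable_fin_num => //; exact: cont_integrable.
Qed.

Lemma intv_ge0 a b f : (forall x, 0 <= f x) -> 0 <= intv a b f.
Proof. by move=> f0; exact: Rintegral_ge0. Qed.

Lemma le_intv a b f g : continuous f -> continuous g ->
  (forall x, a <= x <= b -> f x <= g x) -> intv a b f <= intv a b g.
Proof.
move=> cf cg fg; apply: le_Rintegral => //; try exact: cont_integrable.
Qed.

Lemma intvD a b f g : continuous f -> continuous g ->
  intv a b (fun x => f x + g x) = intv a b f + intv a b g.
Proof. by move=> cf cg; apply: RintegralD => //; exact: cont_integrable. Qed.

Lemma intvZ a b k f : continuous f -> intv a b (fun x => k * f x) = k * intv a b f.
Proof. by move=> cf; apply: RintegralZl => //; exact: cont_integrable. Qed.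

Lemma intv_cst a b c : a <= b -> intv a b (fun _ => c) = c * (b - a).
Proof.
move=> ab; rewrite /intv Rintegral_cst//=; congr (_ * _).
by rewrite lebesgue_measure_itv/= lte_fin; case: ltP => // ba; apply/eqP;
  rewrite eq_sym subr_eq0 eq_le ab ba.
Qed.

Lemma intv_CS a b f g : continuous f -> continuous g ->
  intv a b (fun x => f x * g x) ^+ 2 <=
  intv a b (fun x => f x ^+ 2) * intv a b (fun x => g x ^+ 2).
Proof.
move=> cf cg; have := sip_CS (dot_sip mu (measurable_itv `[a, b]))
  (cont_sqint a b cf) (cont_sqint a b cg).
rewrite /dot.
have e h : \int[mu]_(x in `[a, b]) (h x * h x) = intv a b (fun x => h x ^+ 2) :> R.
  by apply: eq_Rintegral => x _; rewrite expr2.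
by rewrite !e.
Qed.

Lemma intv_sqr a b f : a <= b -> continuous f ->
  intv a b f ^+ 2 <= (b - a) * intv a b (fun x => f x ^+ 2).
Proof.
move=> ab cf; have := intv_CS a b (@cont_cst 1) cf.
have -> : intv a b (fun x => 1 ^+ 2) = b - a :> R.
  by rewrite -[RHS]mul1r -intv_cst//; apply: eq_Rintegral => x _; rewrite expr1n.
have -> // : intv a b (fun x => 1 * f x) = intv a b f.
by apply: eq_Rintegral => x _; rewrite mul1r.
Qed.

Lemma intv_sub a b c d f : a <= c -> d <= b -> continuous f ->
  (forall x, 0 <= f x) -> intv c d f <= intv a b f.
Proof.
move=> ac db cf f0; rewrite -lee_fin !intv_EFin//.
apply: ge0_subset_integral => //.
- apply/measurable_EFinP; apply: measurable_funTS; exact: continuous_measurable_fun.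
- by move=> x _; rewrite lee_fin.
- move=> x /=; rewrite !in_itv/= => /andP[h1 h2].
  by rewrite (le_trans ac h1) (le_trans h2 db).
Qed.

Lemma intv_FTC a b F f : a <= b -> (forall x : R, is_derive x 1 F (f x)) -> continuous f ->
  intv a b f = F b - F a.
Proof.
move=> ab dF cf; apply: EFin_inj; rewrite intv_EFin//.
move: ab; rewrite le_eqVlt => /predU1P[<-|ab].
  by rewrite set_itv1 integral_set1 subrr.
have cF : continuous F.
  by move=> x; apply/differentiable_continuous/derivable1_diffP; case: (dF x).
rewrite (continuous_FTC2 (F := F) ab)//.
- exact: continuous_subspaceT.
- split; first by move=> x _; case: (dF x).
    by apply: cvg_at_right_filter; exact: cF.
  by apply: cvg_at_left_filter; exact: cF.
- by move=> x _; rewrite derive1E; case: (dF x).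
Qed.

Lemma sq_increment a b F f x y : (forall x : R, is_derive x 1 F (f x)) -> continuous f ->
  a <= x <= b -> a <= y <= b ->
  (F x - F y) ^+ 2 <= (b - a) * intv a b (fun x => f x ^+ 2).
Proof.
move=> dF cf; wlog xy : x y / y <= x.
  move=> h xab yab; have [|/ltW xy] := leP y x; first by move=> ?; exact: h.
  by rewrite -sqrrN opprB; exact: h.
move=> /andP[ax xb] /andP[ay yb].
rewrite -(intv_FTC xy dF cf); apply: (le_trans (intv_sqr xy cf)).
have h1 : intv y x (fun x => f x ^+ 2) <= intv a b (fun x => f x ^+ 2).
  by apply: intv_sub => //; [exact: contX|move=> z; exact: sqr_ge0].
have h0 : 0 <= intv y x (fun x => f x ^+ 2).
  by apply: intv_ge0 => z; exact: sqr_ge0.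
by apply: ler_pM => //; rewrite ?subr_ge0//; lra.
Qed.

Lemma exists_le_average c d f : c < d -> continuous f -> exists2 u, c <= u <= d &
  f u ^+ 2 <= (d - c)^-1 * intv c d (fun x => f x ^+ 2).
Proof.
move=> cd cf; have cf2 := contX cf.
have [u ucd umin] := EVT_min (ltW cd) (continuous_subspaceT cf2 (A := `[c, d])).
exists u; first by move: ucd; rewrite in_itv.
rewrite mulrC ler_pdivlMr ?subr_gt0// -intv_cst ?(ltW cd)//.
by apply: le_intv => //; exact: cont_cst.
Qed.

(** The constant that [interp1] produces: [216 / L ^+ 3] is twice the bound for the squared slope of
    a secant over at least [L / 3], and [2 * L] accounts for the variation of the first derivative.
    [C0] arises by integrating once more. *)
Definition C1 (L : R) := 216 / L ^+ 3 + 2 * L.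
Definition C0 (L : R) := 2 / L + 2 * L ^+ 2 * C1 L.

Lemma C1_ge0 L : 0 <= L -> 0 <= C1 L.
Proof. by move=> h; rewrite addr_ge0 ?divr_ge0 ?exprn_ge0 ?mulr_ge0. Qed.

Lemma C0_ge0 L : 0 <= L -> 0 <= C0 L.
Proof.
by move=> h; rewrite addr_ge0 ?divr_ge0 ?mulr_ge0 ?exprn_ge0 ?C1_ge0.
Qed.

Section Interpolation.
Variables (a b : R) (f f1 f2 : R -> R).
Hypotheses (ab : a < b) (d1 : forall x : R, is_derive x 1 f (f1 x))
  (d2 : forall x : R, is_derive x 1 f1 (f2 x)) (cf : continuous f)
  (cf1 : continuous f1) (cf2 : continuous f2).
Let I0 := intv a b (fun x => f x ^+ 2).
Let I2 := intv a b (fun x => f2 x ^+ 2).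
Let L := b - a.

Let L0 : 0 < L. Proof. by rewrite subr_gt0. Qed.

(* A secant through points of the first and of the last third of the interval
   at which |f| is at most average has slope controlled by the L2 norm of f. *)
Lemma interp1 x : a <= x <= b -> f1 x ^+ 2 <= C1 L * (I0 + I2).
Proof.
move=> xab.
pose c := a + L / 3; pose e := b - L / 3.
have ac : a < c by rewrite /c; have := L0; lra.
have ce : c < e by rewrite /c /e /L; have := L0; rewrite /L; lra.
have eb : e < b by rewrite /e; have := L0; lra.
have [u /andP[au uc] hu] := exists_le_average ac cf.
have [v /andP[ev vb] hv] := exists_le_average eb cf.
have nf x0 : 0 <= f x0 ^+ 2 by exact: sqr_ge0.
have I0a : intv a c (fun x => f x ^+ 2) <= I0.
  by apply: intv_sub => //; [lra|exact: contX].
have I0b : intv e b (fun x => f x ^+ 2) <= I0.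
  by apply: intv_sub => //; [lra|exact: contX].
have I00 : 0 <= I0 by exact: intv_ge0.
have I20 : 0 <= I2 by apply: intv_ge0 => z; exact: sqr_ge0.
have L3 : 0 < L / 3 by rewrite divr_gt0.
have hu' : f u ^+ 2 <= 3 / L * I0.
  apply: (le_trans hu); have -> : c - a = L / 3 by rewrite /c; ring.
  by rewrite invf_div ler_pM2l ?divr_gt0.
have hv' : f v ^+ 2 <= 3 / L * I0.
  apply: (le_trans hv); have -> : b - e = L / 3 by rewrite /e; ring.
  by rewrite invf_div ler_pM2l ?divr_gt0.
have uv : u < v by lra.
have [w wuv fw] := MVT uv (fun x _ => d1 x) (continuous_subspaceT cf (A := `[u, v])).
move: wuv; rewrite in_itv/= => /andP[uw wv].
have hw : f1 w ^+ 2 * L ^+ 2 <= 9 * (2 * (f v ^+ 2 + f u ^+ 2)).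
  have : (L / 3) ^+ 2 <= (v - u) ^+ 2.
    rewrite ler_pXn2r// ?nnegrE; [|lra|lra].
    by move: ev uc; rewrite /e /c /L; lra.
  move=> h; have : f1 w ^+ 2 * (L / 3) ^+ 2 <= (f v - f u) ^+ 2.
    by rewrite fw [X in _ <= X]exprMn ler_wpM2l// sqr_ge0.
  have := sqr_ge0 (f v + f u); nra.
have hxw := sq_increment d2 cf2 xab (_ : a <= w <= b).
have {}hxw : (f1 x - f1 w) ^+ 2 <= L * I2 by apply: hxw; lra.
have hx : f1 x ^+ 2 <= 2 * f1 w ^+ 2 + 2 * (L * I2).
  by have := sqr_ge0 (f1 x - 2 * f1 w); nra.
have hw2 : f1 w ^+ 2 <= 108 / L ^+ 3 * I0.
  have -> : 108 / L ^+ 3 * I0 = (9 * (2 * (3 / L * I0 + 3 / L * I0))) / L ^+ 2.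
    by field; rewrite gt_eqF.
  by rewrite ler_pdivlMr ?exprn_gt0//; lra.
have c0 : 0 <= 108 / L ^+ 3 by rewrite divr_ge0 ?exprn_ge0// ltW.
have m1 : 0 <= 108 / L ^+ 3 * I2 by rewrite mulr_ge0.
have m2 : 0 <= L * I0 by rewrite mulr_ge0// ltW.
have -> : C1 L * (I0 + I2) = 2 * (108 / L ^+ 3 * I0) + 2 * (108 / L ^+ 3 * I2) +
   2 * (L * I0) + 2 * (L * I2) by rewrite /C1; ring.
lra.
Qed.

Lemma interp1_int : intv a b (fun x => f1 x ^+ 2) <= L * C1 L * (I0 + I2).
Proof.
rewrite [L * _]mulrC -mulrA [L * _]mulrC mulrA -intv_cst ?(ltW ab)//.
apply: le_intv => //; [exact: contX|exact: cont_cst|exact: interp1].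
Qed.

(** Start from a point where f is at most average and add an increment controlled by [interp1_int].
    The bound is pointwise, which is what makes thin sets negligible in [strip_1D]. *)
Lemma interp0 x : a <= x <= b -> f x ^+ 2 <= C0 L * (I0 + I2).
Proof.
move=> xab; have [u uab hu] := exists_le_average ab cf.
have I00 : 0 <= I0 by apply: intv_ge0 => z; exact: sqr_ge0.
have I20 : 0 <= I2 by apply: intv_ge0 => z; exact: sqr_ge0.
have h1 := sq_increment d1 cf1 xab uab.
have h2 : L * intv a b (fun x => f1 x ^+ 2) <= L * (L * C1 L * (I0 + I2)).
  by rewrite ler_pM2l// interp1_int.
have h3 : f x ^+ 2 <= 2 * f u ^+ 2 + 2 * (f x - f u) ^+ 2.
  by have := sqr_ge0 (f x - 2 * f u); nra.
have h4 : 0 <= L^-1 * I2 by rewrite mulr_ge0 ?invr_ge0 ?(ltW L0).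
have -> : C0 L * (I0 + I2) = 2 * (L^-1 * I0) + 2 * (L^-1 * I2) +
  2 * (L * (L * C1 L * (I0 + I2))) by rewrite /C0; ring.
by rewrite -/L -/I0 in hu h1; lra.
Qed.

End Interpolation.

End OneDim.

(** * Slices, strips and squares *)

Section Slices.
Context {R : realType}.
Local Notation plane := (measurableTypeR R * measurableTypeR R)%type.
Local Notation mu := (@lebesgue_measure R).
Local Notation mu2 := (@mu2 R).
Implicit Types (E : set plane) (f : plane -> \bar R).

Lemma slice2 E f : measurable E -> measurable_fun setT f -> (forall x, (0 <= f x)%E) ->
  (\int[mu2]_(x in E) f x = \int[mu]_s \int[mu]_(t in xsection E s) f (s, t))%E.
Proof.
move=> mE mf f0; rewrite integral_mkcond.
have mp : measurable_fun setT (f \_ E).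
  by apply/(measurable_restrictT _ _).1 => //; exact: measurable_funTS.
rewrite fubini_tonelli1; [|exact: mp|by move=> x; rewrite patchE; case: ifP].
apply: eq_integral => s _; rewrite /fubini_F [RHS]integral_mkcond.
apply: eq_integral => t _; rewrite !patchE.
by rewrite mem_xsection.
Qed.

Lemma slice1 E f : measurable E -> measurable_fun setT f -> (forall x, (0 <= f x)%E) ->
  (\int[mu2]_(x in E) f x = \int[mu]_t \int[mu]_(s in ysection E t) f (s, t))%E.
Proof.
move=> mE mf f0; rewrite integral_mkcond.
have mp : measurable_fun setT (f \_ E).
  by apply/(measurable_restrictT _ _).1 => //; exact: measurable_funTS.
rewrite fubini_tonelli2; [|exact: mp|by move=> x; rewrite patchE; case: ifP].
apply: eq_integral => s _; rewrite /fubini_G [RHS]integral_mkcond.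
apply: eq_integral => t _; rewrite !patchE.
by rewrite mem_ysection.
Qed.

Lemma measurable_slice2 E f : measurable E -> measurable_fun setT f ->
  (forall x, (0 <= f x)%E) ->
  measurable_fun setT (fun s => \int[mu]_(t in xsection E s) f (s, t))%E.
Proof.
move=> mE mf f0.
have mp : measurable_fun setT (f \_ E).
  by apply/(measurable_restrictT _ _).1 => //; exact: measurable_funTS.
have p0 x : (0 <= (f \_ E) x)%E by rewrite patchE; case: ifP.
have := @measurable_fun_fubini_tonelli_F _ _ _ _ _ mu _ mp p0.
congr (measurable_fun _ _); apply/funext => s; rewrite /fubini_F [RHS]integral_mkcond.
by apply: eq_integral => t _; rewrite !patchE mem_xsection.
Qed.

Lemma measurable_slice1 E f : measurable E -> measurable_fun setT f ->
  (forall x, (0 <= f x)%E) ->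
  measurable_fun setT (fun t => \int[mu]_(s in ysection E t) f (s, t))%E.
Proof.
move=> mE mf f0.
have mp : measurable_fun setT (f \_ E).
  by apply/(measurable_restrictT _ _).1 => //; exact: measurable_funTS.
have p0 x : (0 <= (f \_ E) x)%E by rewrite patchE; case: ifP.
have := @measurable_fun_fubini_tonelli_G _ _ _ _ _ mu _ mp p0.
congr (measurable_fun _ _); apply/funext => s; rewrite /fubini_G [RHS]integral_mkcond.
by apply: eq_integral => t _; rewrite !patchE mem_ysection.
Qed.

Lemma slice_le2 E1 E2 f1 f2 : measurable E1 -> measurable E2 ->
  measurable_fun setT f1 -> measurable_fun setT f2 ->
  (forall x, (0 <= f1 x)%E) -> (forall x, (0 <= f2 x)%E) ->
  (forall s, \int[mu]_(t in xsection E1 s) f1 (s, t) <=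
             \int[mu]_(t in xsection E2 s) f2 (s, t))%E ->
  (\int[mu2]_(x in E1) f1 x <= \int[mu2]_(x in E2) f2 x)%E.
Proof.
move=> mE1 mE2 mf1 mf2 f10 f20 h; rewrite !slice2//.
apply: ge0_le_integral => //.
- by move=> s _; exact: integral_ge0.
- exact: measurable_slice2.
- exact: measurable_slice2.
Qed.

Lemma slice_le1 E1 E2 f1 f2 : measurable E1 -> measurable E2 ->
  measurable_fun setT f1 -> measurable_fun setT f2 ->
  (forall x, (0 <= f1 x)%E) -> (forall x, (0 <= f2 x)%E) ->
  (forall t, \int[mu]_(s in ysection E1 t) f1 (s, t) <=
             \int[mu]_(s in ysection E2 t) f2 (s, t))%E ->
  (\int[mu2]_(x in E1) f1 x <= \int[mu2]_(x in E2) f2 x)%E.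
Proof.
move=> mE1 mE2 mf1 mf2 f10 f20 h; rewrite !slice1//.
apply: ge0_le_integral => //.
- by move=> s _; exact: integral_ge0.
- exact: measurable_slice1.
- exact: measurable_slice1.
Qed.

Lemma cont_plane_sq (phi : R * R -> R) (k : R) : continuous phi ->
  measurable_fun setT ((fun x => (k * phi x ^+ 2)%:E) : plane -> \bar R).
Proof.
move=> /continuous_measurable_plane cf; apply/measurable_EFinP.
by apply: measurable_funM => //; exact: measurable_funX.
Qed.

Lemma line_continuous1 (phi : R * R -> R) (t : R) : continuous phi ->
  continuous (fun s => phi (s, t)).
Proof.
move=> c s; apply: (@continuous_comp _ _ _ (fun s : R => (s, t)) phi); last exact: c.
have A : (fun s : R => s) @ s --> s by exact: cvg_id.
have B : (fun _ : R => t) @ s --> t by exact: cvg_cst.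
exact: (cvg_pair A B).
Qed.

Lemma line_continuous2 (phi : R * R -> R) (s : R) : continuous phi ->
  continuous (fun t => phi (s, t)).
Proof.
move=> c t; apply: (@continuous_comp _ _ _ (fun t : R => (s, t)) phi); last exact: c.
have A : (fun t : R => t) @ t --> t by exact: cvg_id.
have B : (fun _ : R => s) @ t --> s by exact: cvg_cst.
exact: (cvg_pair B A).
Qed.

(** Free of first derivatives, as the plate form controls only the second ones; the first are
    recovered by interpolation wherever they occur. *)
Definition energy (phi : R * R -> R) (x : R * R) : R :=
  phi x ^+ 2 + pd 2 0 phi x ^+ 2 + pd 1 1 phi x ^+ 2 + pd 0 2 phi x ^+ 2.

Lemma energy_ge0 phi x : 0 <= energy phi x.
Proof. by rewrite !addr_ge0 ?sqr_ge0. Qed.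

Lemma measurable_energy phi : smooth2 phi ->
  measurable_fun setT ((energy phi) : plane -> R).
Proof.
move=> sphi; rewrite /energy.
by do 3 (apply: measurable_funD; last by apply: measurable_funX;
  apply: continuous_measurable_plane; apply: smooth2_continuous; exact: smooth2_pd);
  apply: measurable_funX; apply: continuous_measurable_plane;
  apply: smooth2_continuous.
Qed.

End Slices.

(** * Smallness of the norm on thin strips *)

Section Strips.
Context {R : realType}.
Local Notation plane := (measurableTypeR R * measurableTypeR R)%type.
Local Notation mu := (@lebesgue_measure R).
Local Notation mu2 := (@mu2 R).
Implicit Types (E : set plane) (f : plane -> \bar R).

(** [interp0] holds on an interval of length [L], however thin [S1] is; integrating the pointwise
    bound over [S1] gains the factor [de]. Only the open interval has to lie in [S2], since its ends
    may be boundary points. *)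
Lemma strip_1D (a L al de : R) (f f1 f2 : R -> R) (S1 S2 : set R) (g : R -> R) :
  0 < L -> 0 <= de ->
  (forall x : R, is_derive x 1 f (f1 x)) -> (forall x : R, is_derive x 1 f1 (f2 x)) ->
  continuous f -> continuous f1 -> continuous f2 ->
  measurable S1 -> measurable S2 ->
  S1 `<=` `[al, al + de] -> `[al, al + de] `<=` `[a, a + L] -> `]a, a + L[ `<=` S2 ->
  measurable_fun setT g -> (forall x, f x ^+ 2 + f2 x ^+ 2 <= g x) ->
  (\int[mu]_(x in S1) (f x ^+ 2)%:E <=
   \int[mu]_(x in S2) (de * C0 L * g x)%:E)%E.
Proof.
move=> L0 de0 d1 d2 cf cf1 cf2 mS1 mS2 S1al alL LS2 mg fg.
have aL : a < a + L by rewrite ltrDl.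
have g0 x : 0 <= g x by apply: le_trans (fg x); rewrite addr_ge0 ?sqr_ge0.
have k0 : 0 <= de * C0 L by apply: mulr_ge0 => //; apply: C0_ge0; exact: ltW.
pose I := intv a (a + L) (fun x => f x ^+ 2) + intv a (a + L) (fun x => f2 x ^+ 2).
have I0 : 0 <= I by rewrite addr_ge0// intv_ge0// => x; exact: sqr_ge0.
have CI0 : 0 <= C0 L * I by apply: mulr_ge0 => //; apply: C0_ge0; exact: ltW.
have h1 : (\int[mu]_(x in S1) (f x ^+ 2)%:E <= \int[mu]_(x in `[al, (al + de)%R]) (C0 L * I)%:E)%E.
  apply: (@le_trans _ _ (\int[mu]_(x in S1) (C0 L * I)%:E)%E).
    apply: ge0_le_integral => //.
    - by move=> x _; rewrite lee_fin sqr_ge0.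
    - by apply/measurable_EFinP; apply: measurable_funTS;
        apply: continuous_measurable_fun; exact: contX.
    - move=> x /S1al/alL; rewrite /= in_itv/= => xaL; rewrite lee_fin.
      have := interp0 aL d1 d2 cf cf1 cf2 xaL.
      by have -> : a + L - a = L by ring.
  by apply: ge0_subset_integral.
apply: (le_trans h1) => {h1}.
rewrite integral_cst// /= lebesgue_measure_itv/= lte_fin.
apply: (@le_trans _ _ (de * C0 L * I)%:E).
  case: ifPn => _; last by rewrite mule0 lee_fin mulr_ge0.
  by rewrite -EFinD -EFinM lee_fin le_eqVlt; apply/orP; left; apply/eqP; ring.
have -> : (de * C0 L * I)%:E = (\int[mu]_(x in `[a, (a + L)%R]) (de * C0 L * (f x ^+ 2 + f2 x ^+ 2))%:E)%E.
  have cs : continuous (fun x => f x ^+ 2 + f2 x ^+ 2).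
    by apply: contD; exact: contX.
  rewrite -intv_EFin; last by apply: contM => //; exact: cont_cst.
  by rewrite intvZ// intvD//; exact: contX.
have mff : measurable_fun setT (fun x => (de * C0 L * (f x ^+ 2 + f2 x ^+ 2))%:E).
  apply/measurable_EFinP; apply: continuous_measurable_fun.
  by apply: contM; [exact: cont_cst|apply: contD; exact: contX].
rewrite integral_itv_bndoo; last exact: measurable_funTS.
apply: (@le_trans _ _ (\int[mu]_(x in `]a, (a + L)%R[) (de * C0 L * g x)%:E)%E).
  apply: ge0_le_integral => //.
  - by move=> x _; rewrite lee_fin mulr_ge0// addr_ge0 ?sqr_ge0.
  - exact: measurable_funTS.
  - by apply/measurable_EFinP; apply: measurable_funM => //; exact: measurable_funTS.
  - by move=> x _; rewrite lee_fin ler_wpM2l.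
apply: ge0_subset_integral => //.
- by apply/measurable_EFinP; apply: measurable_funM => //; exact: measurable_funTS.
- by move=> x _; rewrite lee_fin mulr_ge0.
Qed.

Lemma le_sq24 (x y z w : R) : x ^+ 2 + w ^+ 2 <= x ^+ 2 + y ^+ 2 + z ^+ 2 + w ^+ 2.
Proof. have := sqr_ge0 y; have := sqr_ge0 z; lra. Qed.

Lemma le_sq14 (x y z w : R) : x ^+ 2 + y ^+ 2 <= x ^+ 2 + y ^+ 2 + z ^+ 2 + w ^+ 2.
Proof. have := sqr_ge0 w; have := sqr_ge0 z; lra. Qed.

Lemma strip2 E1 E2 (L de : R) (phi : R * R -> R) : 0 < L -> 0 <= de ->
  measurable E1 -> measurable E2 -> smooth2 phi ->
  (forall s, xsection E1 s = set0 \/ exists a al,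
    [/\ xsection E1 s `<=` `[al, al + de], `[al, al + de] `<=` `[a, a + L] &
        `]a, a + L[ `<=` xsection E2 s]) ->
  (\int[mu2]_(x in E1) (phi x ^+ 2)%:E <=
   \int[mu2]_(x in E2) (de * C0 L * energy phi x)%:E)%E.
Proof.
move=> L0 de0 mE1 mE2 sphi h.
have C00 : 0 <= de * C0 L by apply: mulr_ge0 => //; apply: C0_ge0; exact: ltW.
have en0 x : (0 <= (de * C0 L * energy phi x)%:E)%E.
  by rewrite lee_fin mulr_ge0 ?energy_ge0.
have men := measurable_energy sphi.
apply: slice_le2 => //.
- under eq_fun do rewrite -[_ ^+ 2]mul1r.
  by apply: cont_plane_sq; exact: smooth2_continuous.
- by apply/measurable_EFinP; exact: measurable_funM.
- by move=> x; rewrite lee_fin sqr_ge0.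
move=> s; case: (h s) => [->|[a [al [h1 h2 h3]]]].
  by rewrite integral_set0; exact: integral_ge0.
have sp2 := smooth2_pd2 sphi; have sp22 := smooth2_pd2 sp2.
have c0 := line_continuous2 (s := s) (smooth2_continuous sphi).
have c1 := line_continuous2 (s := s) (smooth2_continuous sp2).
have c2 := line_continuous2 (s := s) (smooth2_continuous sp22).
have D1 t := smooth2_line2 s t sphi.
have D2 t := smooth2_line2 s t sp2.
have mg : measurable_fun setT (fun t => energy phi (s, t)).
  exact: (measurableT_comp men (measurable_pair1 s)).
have fg t : phi (s, t) ^+ 2 + pd2 (pd2 phi) (s, t) ^+ 2 <= energy phi (s, t).
  exact: le_sq24.
have mS1 := measurable_xsection s mE1.
have mS2 := measurable_xsection s mE2.
exact: (strip_1D L0 de0 D1 D2 c0 c1 c2 mS1 mS2 h1 h2 h3 mg fg).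
Qed.

Lemma strip1 E1 E2 (L de : R) (phi : R * R -> R) : 0 < L -> 0 <= de ->
  measurable E1 -> measurable E2 -> smooth2 phi ->
  (forall t, ysection E1 t = set0 \/ exists a al,
    [/\ ysection E1 t `<=` `[al, al + de], `[al, al + de] `<=` `[a, a + L] &
        `]a, a + L[ `<=` ysection E2 t]) ->
  (\int[mu2]_(x in E1) (phi x ^+ 2)%:E <=
   \int[mu2]_(x in E2) (de * C0 L * energy phi x)%:E)%E.
Proof.
move=> L0 de0 mE1 mE2 sphi h.
have C00 : 0 <= de * C0 L by apply: mulr_ge0 => //; apply: C0_ge0; exact: ltW.
have en0 x : (0 <= (de * C0 L * energy phi x)%:E)%E.
  by rewrite lee_fin mulr_ge0 ?energy_ge0.
have men := measurable_energy sphi.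
apply: slice_le1 => //.
- under eq_fun do rewrite -[_ ^+ 2]mul1r.
  by apply: cont_plane_sq; exact: smooth2_continuous.
- by apply/measurable_EFinP; exact: measurable_funM.
- by move=> x; rewrite lee_fin sqr_ge0.
move=> t; case: (h t) => [->|[a [al [h1 h2 h3]]]].
  by rewrite integral_set0; exact: integral_ge0.
have sp2 := smooth2_pd1 sphi; have sp22 := smooth2_pd1 sp2.
have c0 := line_continuous1 (t := t) (smooth2_continuous sphi).
have c1 := line_continuous1 (t := t) (smooth2_continuous sp2).
have c2 := line_continuous1 (t := t) (smooth2_continuous sp22).
have D1 s := smooth2_line1 s t sphi.
have D2 s := smooth2_line1 s t sp2.
have mg : measurable_fun setT (fun s => energy phi (s, t)).
  exact: (measurableT_comp men (measurable_pair2 t)).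
have fg s : phi (s, t) ^+ 2 + pd1 (pd1 phi) (s, t) ^+ 2 <= energy phi (s, t).
  exact: le_sq14.
have mS1 := measurable_ysection t mE1.
have mS2 := measurable_ysection t mE2.
exact: (strip_1D L0 de0 D1 D2 c0 c1 c2 mS1 mS2 h1 h2 h3 mg fg).
Qed.

End Strips.

(** * Square integrable functions on sets of finite measure *)

Section Generic.
Context d (T : measurableType d) (R : realType).
Variables (mu : {measure set T -> \bar R}) (D : set T).
Hypothesis mD : measurable D.

Lemma int_affine (h : T -> R) (k l : R) : measurable_fun D h ->
  (forall x, 0 <= h x) -> 0 <= k -> 0 <= l ->
  (\int[mu]_(x in D) (k + l * h x)%:E = k%:E * mu D + l%:E * \int[mu]_(x in D) (h x)%:E)%E.
Proof.
move=> mh h0 k0 l0; under eq_integral do rewrite EFinD EFinM.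
rewrite ge0_integralD//.
- rewrite integral_cst//; congr (_ + _)%E; apply: ge0_integralZl => //.
  + exact/measurable_EFinP.
  + by move=> x _; rewrite lee_fin.
- by move=> x _; rewrite -EFinM lee_fin mulr_ge0.
- by apply/measurable_EFinP; exact: measurable_funM.
Qed.

Lemma sqint_cst (m k : R) : mu D = m%:E -> sqint mu D (cst k).
Proof.
move=> mE; apply/sqintP => //.
by rewrite (integral_cst mu mD (k ^+ 2)%:E) mE -EFinM ltry.
Qed.

(** Cauchy-Schwarz of [k - u] against the constant 1: the distance of [k] to the mean of [u] is
    controlled by the distance of [k] to [u]. *)
Lemma average_CS (u : T -> R) (m k : R) : sqint mu D u -> mu D = m%:E ->
  (k * m - \int[mu]_(x in D) u x) ^+ 2 <=
  m * dot mu D (fun x => k - u x) (fun x => k - u x).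
Proof.
move=> Su mE; have S1 := sqint_cst 1 mE; have Sk := sqint_cst k mE.
have cst1 c : dot mu D (cst c) (cst 1) = c * m.
  by rewrite /dot/= mulr1 Rintegral_cst// mE.
have Sku : sqint mu D (cst k - u) by exact: (linsubB (sqint_linsub mu mD)).
have := sip_CS (dot_sip mu mD) Sku S1.
rewrite (sipBl (dot_sip mu mD))// !cst1 mul1r (mulrC (dot _ _ _ _)).
have -> // : dot mu D u (cst 1) = \int[mu]_(x in D) u x.
by apply: eq_Rintegral => x _; rewrite mulr1.
Qed.

Lemma measure_bounded_sqint (u : T -> R) (m M : R) : measurable_fun D u ->
  mu D = m%:E -> (forall x, D x -> `|u x| <= M) -> sqint mu D u.
Proof.
move=> mu_ mE h; apply/sqintP => //.
apply: (@le_lt_trans _ _ (\int[mu]_(x in D) (M ^+ 2)%:E)%E).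
  apply: ge0_le_integral => //.
  - by move=> x _; rewrite lee_fin sqr_ge0.
  - by apply/measurable_EFinP; exact: measurable_funX.
  - move=> x /h hx; rewrite lee_fin -[X in X <= _]real_normK ?num_real//.
    by rewrite ler_pXn2r// nnegrE (le_trans _ hx).
by rewrite integral_cst// mE -EFinM ltry.
Qed.

End Generic.

(** * Poincare's inequality on a square *)

Section Squares.
Context {R : realType}.
Local Notation plane := (measurableTypeR R * measurableTypeR R)%type.
Local Notation mu := (@lebesgue_measure R).
Local Notation mu2 := (@mu2 R).

(** Half-open, so that a square is the exact disjoint union of its subsquares. *)
Definition box (a b c d : R) : set plane := `[a, b[%classic `*` `[c, d[%classic.

Lemma measurable_box a b c d : measurable (box a b c d).
Proof. by apply: measurableX; exact: measurable_itv. Qed.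

Lemma box_xsection a b c d (s : R) : xsection (box a b c d) s =
  if s \in `[a, b[ then `[c, d[%classic else set0.
Proof.
case: ifPn => h; first by rewrite in_xsectionX// inE.
by rewrite notin_xsectionX// notin_setE; apply/negP.
Qed.

Lemma box_ysection a b c d (t : R) : ysection (box a b c d) t =
  if t \in `[c, d[ then `[a, b[%classic else set0.
Proof.
case: ifPn => h; first by rewrite in_ysectionX// inE.
by rewrite notin_ysectionX// notin_setE; apply/negP.
Qed.

Lemma mu2_box a b c d : a <= b -> c <= d -> mu2 (box a b c d) = ((b - a) * (d - c))%:E.
Proof.
move=> ab cd; rewrite -[mu2 _]/((mu \x mu)%E (box a b c d)) /box product_measure1E//=.
rewrite !lebesgue_measure_itv/= !lte_fin EFinM.
congr (_ * _)%E; [case: ltP => h|case: ltP => h] => //; rewrite ?EFinB//.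
  by have -> : b = a by [apply/eqP; rewrite eq_le h ab]; rewrite -EFinB subrr.
by have -> : d = c by [apply/eqP; rewrite eq_le h cd]; rewrite -EFinB subrr.
Qed.

Lemma box_slice2 a b c d (f : plane -> \bar R) : measurable_fun setT f ->
  (forall x, (0 <= f x)%E) ->
  (\int[mu2]_(x in box a b c d) f x =
   \int[mu]_(s in `[a, b[) \int[mu]_(t in `[c, d[) f (s, t))%E.
Proof.
move=> mf f0; rewrite (slice2 (measurable_box a b c d) mf f0).
rewrite [RHS]integral_mkcond; apply: eq_integral => s _.
rewrite patchE box_xsection; case: ifPn => h.
  by rewrite mem_set.
by rewrite integral_set0 memNset//=; apply/negP.
Qed.

Lemma box_slice1 a b c d (f : plane -> \bar R) : measurable_fun setT f ->
  (forall x, (0 <= f x)%E) ->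
  (\int[mu2]_(x in box a b c d) f x =
   \int[mu]_(t in `[c, d[) \int[mu]_(s in `[a, b[) f (s, t))%E.
Proof.
move=> mf f0; rewrite (slice1 (measurable_box a b c d) mf f0).
rewrite [RHS]integral_mkcond; apply: eq_integral => s _.
rewrite patchE box_ysection; case: ifPn => h.
  by rewrite mem_set.
by rewrite integral_set0 memNset//=; apply/negP.
Qed.

Lemma measurable_phisq (phi : R * R -> R) : continuous phi ->
  measurable_fun setT ((fun x => (phi x ^+ 2)%:E) : plane -> \bar R).
Proof.
move=> /continuous_measurable_plane cf; apply/measurable_EFinP.
exact: measurable_funX.
Qed.

Lemma cont_bounded_box (phi : R * R -> R) a b c d : continuous phi ->
  exists M, forall x, box a b c d x -> `|phi x| <= M.
Proof.
move=> cphi.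
have cK : compact (`[a, b]%classic `*` `[c, d]%classic : set (R * R)).
  by apply: compact_setX; exact: segment_compact.
have cw : {within `[a, b]%classic `*` `[c, d]%classic, continuous phi}.
  exact: continuous_subspaceT.
have /compact_bounded[M [_ hM]] := continuous_compact cw cK.
exists (M + 1) => x [/= h1 h2]; apply: (hM (M + 1)); first by rewrite ltrDl.
exists x => //; split => /=.
  by move: h1; rewrite !in_itv/= => /andP[-> /ltW].
by move: h2; rewrite !in_itv/= => /andP[-> /ltW].
Qed.

Lemma cont_box_sqint (phi : R * R -> R) a b c d : a <= b -> c <= d -> continuous phi ->
  sqint mu2 (box a b c d) (phi : plane -> R).
Proof.
move=> ab cd cphi; have [M hM] := cont_bounded_box a b c d cphi.
apply: (measure_bounded_sqint (measurable_box a b c d) _ (mu2_box ab cd) hM).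
by apply: measurable_funTS; exact: continuous_measurable_plane.
Qed.

Lemma itv_cto_cc (x y : R) (f : R -> R) : continuous f ->
  (\int[mu]_(s in `[x, y[) (f s)%:E = (intv x y f)%:E)%E.
Proof.
move=> cf; rewrite intv_EFin// integral_itv_bndo_bndc//.
by apply/measurable_EFinP; apply: measurable_funTS; exact: continuous_measurable_fun.
Qed.

Lemma measurable_intv1 (phi : R * R -> R) a b : continuous phi ->
  measurable_fun setT (fun t : R => intv a b (fun s => phi (s, t) ^+ 2)).
Proof.
move=> cphi; apply/measurable_EFinP.
have sq0 x : (0 <= (phi x ^+ 2)%:E)%E by rewrite lee_fin sqr_ge0.
have mE : measurable (`[a, b[%classic `*` setT : set plane).
  by apply: measurableX; [exact: measurable_itv|exact: measurableT].
have := measurable_slice1 mE (measurable_phisq cphi) sq0.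
congr (measurable_fun _ _); apply/funext => t.
rewrite in_ysectionX ?inE//; apply: itv_cto_cc.
by apply: contX; exact: line_continuous1.
Qed.

Lemma measurable_intv2 (phi : R * R -> R) a b : continuous phi ->
  measurable_fun setT (fun s : R => intv a b (fun t => phi (s, t) ^+ 2)).
Proof.
move=> cphi; apply/measurable_EFinP.
have sq0 x : (0 <= (phi x ^+ 2)%:E)%E by rewrite lee_fin sqr_ge0.
have mE : measurable (setT `*` `[a, b[%classic : set plane).
  by apply: measurableX; [exact: measurableT|exact: measurable_itv].
have := measurable_slice2 mE (measurable_phisq cphi) sq0.
congr (measurable_fun _ _); apply/funext => t.
rewrite in_xsectionX ?inE//; apply: itv_cto_cc.
by apply: contX; exact: line_continuous2.
Qed.

Lemma int_box_fst a b c d (h : R -> R) : c <= d -> measurable_fun setT h ->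
  (forall s, 0 <= h s) ->
  (\int[mu2]_(x in box a b c d) (h x.1)%:E =
    (d - c)%:E * \int[mu]_(s in `[a, b[) (h s)%:E)%E.
Proof.
move=> cd mh h0; rewrite box_slice2; last 2 first.
- by apply/measurable_EFinP; exact: (measurableT_comp mh measurable_fst).
- by move=> x; rewrite lee_fin.
rewrite -ge0_integralZl//; last 3 first.
- by apply/measurable_EFinP; exact: measurable_funTS.
- by move=> s _; rewrite lee_fin.
- by rewrite lee_fin subr_ge0.
apply: eq_integral => s _; rewrite /= itv_cto_cc; last exact: cont_cst.
by rewrite intv_cst// -EFinM mulrC.
Qed.

Lemma int_box_snd a b c d (h : R -> R) : a <= b -> measurable_fun setT h ->
  (forall s, 0 <= h s) ->
  (\int[mu2]_(x in box a b c d) (h x.2)%:E =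
    (b - a)%:E * \int[mu]_(t in `[c, d[) (h t)%:E)%E.
Proof.
move=> ab mh h0; rewrite box_slice1; last 2 first.
- by apply/measurable_EFinP; exact: (measurableT_comp mh measurable_snd).
- by move=> x; rewrite lee_fin.
rewrite -ge0_integralZl//; last 3 first.
- by apply/measurable_EFinP; exact: measurable_funTS.
- by move=> s _; rewrite lee_fin.
- by rewrite lee_fin subr_ge0.
apply: eq_integral => s _; rewrite /= itv_cto_cc; last exact: cont_cst.
by rewrite intv_cst// -EFinM mulrC.
Qed.

Lemma square_poincare_alg (L m d1 d2 : R) : 0 < L ->
  (2 * m ^+ 2 + 4 * L ^+ 4 * d2) * L ^+ 2 + 4 * L ^+ 5 * (L * d1) <=
  L ^+ 4 * (2 / L ^+ 2 * m ^+ 2 + 4 * L ^+ 2 * (d1 + d2)).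
Proof.
by move=> L0; rewrite le_eqVlt; apply/orP; left; apply/eqP; field; rewrite gt_eqF.
Qed.

Section OneSquare.
Variables (a c L : R) (phi : R * R -> R).
Hypotheses (L0 : 0 < L) (sphi : smooth2 phi).
Let Q := box a (a + L) c (c + L).
Let mQ : measurable Q. Proof. exact: measurable_box. Qed.
Let cphi := smooth2_continuous sphi.
Let cphi1 := smooth2_continuous (smooth2_pd1 sphi).
Let cphi2 := smooth2_continuous (smooth2_pd2 sphi).
Let DD (f : R * R -> R) := dot mu2 Q (f : plane -> R) f.
Let M := \int[mu2]_(x in Q) phi x.
Let A (t : R) := intv a (a + L) (fun s => pd1 phi (s, t) ^+ 2).
Let B (s : R) := intv c (c + L) (fun t => pd2 phi (s, t) ^+ 2).
Let aL : a <= a + L. Proof. by rewrite lerDl ltW. Qed.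
Let cL : c <= c + L. Proof. by rewrite lerDl ltW. Qed.

Let muQ : mu2 Q = (L ^+ 2)%:E.
Proof. by rewrite (mu2_box aL cL); congr (_%:E); ring. Qed.

Let A0 t : 0 <= A t. Proof. by apply: intv_ge0 => s; exact: sqr_ge0. Qed.
Let B0 s : 0 <= B s. Proof. by apply: intv_ge0 => s'; exact: sqr_ge0. Qed.
Let mA : measurable_fun setT A. Proof. exact: measurable_intv1. Qed.
Let mB : measurable_fun setT B. Proof. exact: measurable_intv2. Qed.

Let SQ (f : R * R -> R) : continuous f -> sqint mu2 Q (f : plane -> R).
Proof. by move=> cf; exact: cont_box_sqint. Qed.

Let intA : (\int[mu2]_(x in Q) (A x.2)%:E = (L * DD (pd1 phi))%:E)%E.
Proof.
rewrite (int_box_snd _ _ aL mA A0) EFinM.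
have -> : a + L - a = L by ring.
congr (_ * _)%E; rewrite (dot_EFin mQ (SQ cphi1)) box_slice1.
- by apply: eq_integral => t _; rewrite itv_cto_cc//; apply: contX;
    exact: line_continuous1.
- exact: measurable_phisq.
- by move=> x; rewrite lee_fin sqr_ge0.
Qed.

Let intB : (\int[mu2]_(x in Q) (B x.1)%:E = (L * DD (pd2 phi))%:E)%E.
Proof.
rewrite (int_box_fst _ _ cL mB B0) EFinM.
have -> : c + L - c = L by ring.
congr (_ * _)%E; rewrite (dot_EFin mQ (SQ cphi2)) box_slice2.
- by apply: eq_integral => t _; rewrite itv_cto_cc//; apply: contX;
    exact: line_continuous2.
- exact: measurable_phisq.
- by move=> x; rewrite lee_fin sqr_ge0.
Qed.

(** The path runs horizontally at the height of [p] and then vertically at the abscissa of [p']. The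
    bound is thus a function of [p.2] plus a function of [p'.1], and each can be integrated over the
    square by [intA] and [intB]. *)
Let two_steps p p' : Q p -> Q p' ->
  (phi p - phi p') ^+ 2 <= 2 * L * A p.2 + 2 * L * B p'.1.
Proof.
case: p => s t; case: p' => s' t' [/= + +] [/= + +].
rewrite !in_itv/= => /andP[s1 s2] /andP[t1 t2] /andP[s1' s2'] /andP[t1' t2'].
have h1 := sq_increment (fun s => smooth2_line1 s t sphi)
  (line_continuous1 (t := t) cphi1) (_ : a <= s <= a + L) (_ : a <= s' <= a + L).
have h2 := sq_increment (fun t => smooth2_line2 s' t sphi)
  (line_continuous2 (s := s') cphi2) (_ : c <= t <= c + L) (_ : c <= t' <= c + L).
have {}h1 : (phi (s, t) - phi (s', t)) ^+ 2 <= L * A t.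
  by move: h1; have -> : a + L - a = L by [ring]; apply; rewrite ?s1 ?s1' ltW.
have {}h2 : (phi (s', t) - phi (s', t')) ^+ 2 <= L * B s'.
  by move: h2; have -> : c + L - c = L by [ring]; apply; rewrite ?t1 ?t1' ltW.
move: h1 h2; set x := phi (s, t); set y := phi (s', t); set z := phi (s', t').
set u := A t; set v := B s' => h1 h2.
by have := sqr_ge0 ((x - y) - (y - z)); nra.
Qed.

(** Integrating [two_steps] in [p'] bounds the distance of [phi] to the constant [phi p];
    [average_CS] turns this into a bound of [phi p] by the integral [M]; a second integration, in
    [p], finishes. *)
Lemma square_poincare :
  DD phi <= 2 / L ^+ 2 * M ^+ 2 + 4 * L ^+ 2 * (DD (pd1 phi) + DD (pd2 phi)).
Proof.
have D0 f : 0 <= DD f by apply: Rintegral_ge0 => x _; rewrite -expr2 sqr_ge0.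
have mphi := continuous_measurable_plane cphi.
have step1 p : Q p -> DD (fun x => phi p - phi x) <=
    2 * L ^+ 3 * A p.2 + 2 * L ^+ 2 * DD (pd2 phi).
  move=> Qp; have cd : continuous (fun x => phi p - phi x).
    by move=> x; apply: cvgB; [exact: cvg_cst|exact: cphi].
  rewrite -lee_fin (dot_EFin mQ (SQ cd)).
  have mBf : measurable_fun Q (fun x : plane => B x.1).
    by apply: measurable_funTS; exact: (measurableT_comp mB measurable_fst).
  have k1 : 0 <= 2 * L * A p.2 by rewrite !mulr_ge0// ltW.
  have l1 : 0 <= 2 * L by rewrite mulr_ge0// ltW.
  have := int_affine mu2 mQ mBf (fun x => B0 x.1) k1 l1.
  rewrite muQ intB => e.
  apply: (@le_trans _ _ (\int[mu2]_(x in Q) (2 * L * A p.2 + 2 * L * B x.1)%:E)%E).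
    apply: ge0_le_integral => //.
    - by move=> x _; rewrite lee_fin sqr_ge0.
    - by apply: measurable_funTS; exact: measurable_phisq.
    - apply/measurable_EFinP; apply: measurable_funD => //.
      exact: measurable_funM.
    - by move=> x Qx; rewrite lee_fin; exact: two_steps.
  rewrite e -!EFinM -EFinD lee_fin le_eqVlt; apply/orP; left; apply/eqP; ring.
pose K := 2 * M ^+ 2 + 4 * L ^+ 4 * DD (pd2 phi).
have step2 p : Q p -> L ^+ 4 * phi p ^+ 2 <= K + 4 * L ^+ 5 * A p.2.
  move=> Qp; have := average_CS mQ (phi p) (SQ cphi) muQ; rewrite -/M.
  have := step1 p Qp; rewrite /DD; set X := dot _ _ _ _; set Y := phi p => h1 h2.
  have h3 : L ^+ 2 * X <= L ^+ 2 * (2 * L ^+ 3 * A p.2 + 2 * L ^+ 2 * DD (pd2 phi)).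
    by rewrite ler_pM2l ?exprn_gt0.
  have h4 : (L ^+ 2 * Y) ^+ 2 <= 2 * M ^+ 2 + 2 * (Y * L ^+ 2 - M) ^+ 2.
    by have := sqr_ge0 (Y * L ^+ 2 - 2 * M); nra.
  rewrite /K; move: h1 h2 h3 h4; set U := A _; set V := DD _ => h1 h2 h3 h4.
  have e1 : (L ^+ 2 * Y) ^+ 2 = L ^+ 4 * Y ^+ 2 by ring.
  have e2 : L ^+ 2 * (2 * L ^+ 3 * U + 2 * L ^+ 2 * V) =
    2 * L ^+ 5 * U + 2 * L ^+ 4 * V by ring.
  rewrite e1 in h4; rewrite e2 in h3; lra.
have L4 : 0 <= L ^+ 4 by rewrite exprn_ge0// ltW.
have K0 : 0 <= K.
  apply: addr_ge0; first by rewrite mulr_ge0// sqr_ge0.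
  by apply: mulr_ge0 => //; exact: mulr_ge0.
have mAf : measurable_fun Q (fun x : plane => A x.2).
  by apply: measurable_funTS; exact: (measurableT_comp mA measurable_snd).
have l1 : 0 <= 4 * L ^+ 5 by rewrite mulr_ge0// exprn_ge0// ltW.
have e := int_affine mu2 mQ mAf (fun x => A0 x.2) K0 l1.
rewrite muQ intA in e.
have step3 : (\int[mu2]_(x in Q) (0 + L ^+ 4 * phi x ^+ 2)%:E <=
    \int[mu2]_(x in Q) (K + 4 * L ^+ 5 * A x.2)%:E)%E.
  apply: ge0_le_integral => //.
  - by move=> x _; rewrite add0r lee_fin mulr_ge0// sqr_ge0.
  - apply/measurable_EFinP; apply: measurable_funTS; apply: measurable_funD => //.
    by apply: measurable_funM => //; exact: measurable_funX.
  - apply/measurable_EFinP; apply: measurable_funD => //.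
    exact: measurable_funM.
  - by move=> x Qx; rewrite add0r lee_fin; exact: step2.
have mphi2 : measurable_fun Q (fun x : plane => phi x ^+ 2).
  by apply: measurable_funTS; exact: measurable_funX.
rewrite e (int_affine mu2 mQ mphi2 (fun x => sqr_ge0 (phi x)) (lexx 0) L4) in step3.
rewrite -(dot_EFin mQ (SQ cphi)) -/(DD phi) mul0e add0e in step3.
rewrite -!EFinM -EFinD lee_fin in step3.
rewrite -(ler_pM2l (exprn_gt0 4 L0)); apply: (le_trans step3).
rewrite /K; exact: square_poincare_alg.
Qed.

End OneSquare.
End Squares.

(** * The Ehrling inequality on one square *)

Section Tame.
Context {R : realType}.
Local Notation plane := (measurableTypeR R * measurableTypeR R)%type.
Local Notation mu := (@lebesgue_measure R).
Local Notation mu2 := (@mu2 R).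

Lemma interp_line (a l : R) (f f1 f2 g : R -> R) : 0 < l ->
  (forall x : R, is_derive x 1 f (f1 x)) -> (forall x : R, is_derive x 1 f1 (f2 x)) ->
  continuous f -> continuous f1 -> continuous f2 ->
  measurable_fun setT g -> (forall x, f x ^+ 2 + f2 x ^+ 2 <= g x) ->
  (\int[mu]_(x in `[a, (a + l)%R[) (f1 x ^+ 2)%:E <=
   \int[mu]_(x in `[a, (a + l)%R[) (l * C1 l * g x)%:E)%E.
Proof.
move=> l0 d1 d2 cf cf1 cf2 mg fg.
have al : a < a + l by rewrite ltrDl.
have k0 : 0 <= l * C1 l by apply: mulr_ge0; [exact: ltW|apply: C1_ge0; exact: ltW].
have cs : continuous (fun x => f x ^+ 2 + f2 x ^+ 2) by apply: contD; exact: contX.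
apply: (@le_trans _ _ (\int[mu]_(x in `[a, (a + l)%R[) (l * C1 l * (f x ^+ 2 + f2 x ^+ 2))%:E)%E).
  rewrite itv_cto_cc; last exact: contX.
  rewrite itv_cto_cc; last by apply: contM; [exact: cont_cst|exact: cs].
  rewrite intvZ// intvD; [|exact: contX|exact: contX].
  rewrite lee_fin; have := interp1_int al d1 d2 cf cf1 cf2.
  by have -> : a + l - a = l by ring.
apply: ge0_le_integral => //.
- by move=> x _; rewrite lee_fin mulr_ge0// addr_ge0 ?sqr_ge0.
- apply/measurable_EFinP; apply: measurable_funTS; apply: continuous_measurable_fun.
  by apply: contM; [exact: cont_cst|exact: cs].
- by apply/measurable_EFinP; apply: measurable_funM => //; exact: measurable_funTS.
- by move=> x _; rewrite lee_fin ler_wpM2l.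
Qed.

Section Interp.
Variables (a c l : R) (phi : R * R -> R).
Hypotheses (l0 : 0 < l) (sphi : smooth2 phi).
Let Q := box a (a + l) c (c + l).
Let k0 : 0 <= l * C1 l.
Proof. by apply: mulr_ge0; [exact: ltW|apply: C1_ge0; exact: ltW]. Qed.
Let c0 := smooth2_continuous sphi.
Let c1 := smooth2_continuous (smooth2_pd1 sphi).
Let c11 := smooth2_continuous (smooth2_pd1 (smooth2_pd1 sphi)).
Let c2 := smooth2_continuous (smooth2_pd2 sphi).
Let c22 := smooth2_continuous (smooth2_pd2 (smooth2_pd2 sphi)).
Let men := measurable_energy sphi.
Let mken : measurable_fun setT ((fun x => (l * C1 l * energy phi x)%:E) : plane -> \bar R).
Proof. by apply/measurable_EFinP; exact: measurable_funM. Qed.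
Let en0 (x : plane) : (0 <= (l * C1 l * energy phi x)%:E)%E.
Proof. by rewrite lee_fin; apply: mulr_ge0 => //; exact: energy_ge0. Qed.
Let sq0 (f : R * R -> R) (x : plane) : (0 <= (f x ^+ 2)%:E)%E.
Proof. by rewrite lee_fin sqr_ge0. Qed.

Lemma interp_box1 : (\int[mu2]_(x in Q) (pd1 phi x ^+ 2)%:E <=
  \int[mu2]_(x in Q) (l * C1 l * energy phi x)%:E)%E.
Proof.
rewrite (box_slice1 _ _ _ _ (measurable_phisq c1) (sq0 _)) (box_slice1 _ _ _ _ mken en0).
apply: ge0_le_integral.
- exact: measurable_itv.
- by move=> t _; apply: integral_ge0.
- apply: measurable_funTS.
  have := measurable_slice1 (measurableX (measurable_itv `[a, a + l[) measurableT)
    (measurable_phisq c1) (sq0 _).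
  by congr (measurable_fun _ _); apply/funext => t; rewrite in_ysectionX ?inE.
- apply: measurable_funTS.
  have := measurable_slice1 (measurableX (measurable_itv `[a, a + l[) measurableT) mken en0.
  by congr (measurable_fun _ _); apply/funext => t; rewrite in_ysectionX ?inE.
move=> t _.
have D1 s := smooth2_line1 s t sphi.
have D2 s := smooth2_line1 s t (smooth2_pd1 sphi).
apply: (interp_line a l0 D1 D2 (line_continuous1 (t := t) c0)
  (line_continuous1 (t := t) c1) (line_continuous1 (t := t) c11)).
  exact: (measurableT_comp men (measurable_pair2 t)).
by move=> s; exact: le_sq14.
Qed.

Lemma interp_box2 : (\int[mu2]_(x in Q) (pd2 phi x ^+ 2)%:E <=
  \int[mu2]_(x in Q) (l * C1 l * energy phi x)%:E)%E.
Proof.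
rewrite (box_slice2 _ _ _ _ (measurable_phisq c2) (sq0 _)) (box_slice2 _ _ _ _ mken en0).
apply: ge0_le_integral.
- exact: measurable_itv.
- by move=> t _; apply: integral_ge0.
- apply: measurable_funTS.
  have := measurable_slice2 (measurableX measurableT (measurable_itv `[c, c + l[))
    (measurable_phisq c2) (sq0 _).
  by congr (measurable_fun _ _); apply/funext => t; rewrite in_xsectionX ?inE.
- apply: measurable_funTS.
  have := measurable_slice2 (measurableX measurableT (measurable_itv `[c, c + l[)) mken en0.
  by congr (measurable_fun _ _); apply/funext => t; rewrite in_xsectionX ?inE.
move=> s _.
have D1 t := smooth2_line2 s t sphi.
have D2 t := smooth2_line2 s t (smooth2_pd2 sphi).
apply: (interp_line c l0 D1 D2 (line_continuous2 (s := s) c0)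
  (line_continuous2 (s := s) c2) (line_continuous2 (s := s) c22)).
  exact: (measurableT_comp men (measurable_pair1 s)).
by move=> t; exact: le_sq24.
Qed.

End Interp.

Lemma box_split1 (n : nat) (a h c d : R) (f : plane -> \bar R) : 0 <= h ->
  measurable_fun setT f -> (forall x, (0 <= f x)%E) ->
  (\int[mu2]_(x in box a (a + n%:R * h) c d) f x =
   \sum_(i < n) \int[mu2]_(x in box (a + i%:R * h) (a + i%:R * h + h) c d) f x)%E.
Proof.
move=> h0 mf f0; elim: n => [|n ih].
  rewrite big_ord0 mul0r addr0.
  suff -> : box a a c d = set0 by rewrite integral_set0.
  by apply/seteqP; split=> // x [/=]; rewrite in_itv/= => /andP[h1 h2]; lra.
rewrite big_ord_recr/= -ih -ge0_integral_setU.
- congr (integral _ _ _).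
  have e : a + n.+1%:R * h = a + n%:R * h + h by rewrite -natr1 mulrDl mul1r addrA.
  have n0 : 0 <= n%:R * h by rewrite mulr_ge0.
  apply/seteqP; split => -[x y] /=; rewrite /box/= !in_itv/= e.
    move=> [/andP[h1 h2] h4]; case: (ltP x (a + n%:R * h)) => h3; [left|right].
      by split=> //=; rewrite andbT.
    by split=> //=; rewrite ?andbT.
  by case=> -[/= /andP[h1 h2] h4]; split=> //; apply/andP; split; lra.
- exact: measurable_box.
- exact: measurable_box.
- exact: measurable_funTS.
- by move=> x _.
- apply/disj_setPS => x [[/= + _] [/= + _]].
  by rewrite !in_itv/= => /andP[h1 h2] /andP[h3 h4]; lra.
Qed.

Lemma box_split2 (n : nat) (a b h c : R) (f : plane -> \bar R) : 0 <= h ->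
  measurable_fun setT f -> (forall x, (0 <= f x)%E) ->
  (\int[mu2]_(x in box a b c (c + n%:R * h)) f x =
   \sum_(i < n) \int[mu2]_(x in box a b (c + i%:R * h) (c + i%:R * h + h)) f x)%E.
Proof.
move=> h0 mf f0; elim: n => [|n ih].
  rewrite big_ord0 mul0r addr0.
  suff -> : box a b c c = set0 by rewrite integral_set0.
  by apply/seteqP; split=> // x [/= _]; rewrite in_itv/= => /andP[h1 h2]; lra.
rewrite big_ord_recr/= -ih -ge0_integral_setU.
- congr (integral _ _ _).
  have e : c + n.+1%:R * h = c + n%:R * h + h by rewrite -natr1 mulrDl mul1r addrA.
  have n0 : 0 <= n%:R * h by rewrite mulr_ge0.
  apply/seteqP; split => -[x y] /=; rewrite /box/= !in_itv/= e.
    move=> [h4 /andP[h1 h2]]; case: (ltP y (c + n%:R * h)) => h3; [left|right].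
      by split=> //=; rewrite andbT.
    by split=> //=; rewrite ?andbT.
  by case=> -[/= h4 /andP[h1 h2]]; split=> //; apply/andP; split; lra.
- exact: measurable_box.
- exact: measurable_box.
- exact: measurable_funTS.
- by move=> x _.
- apply/disj_setPS => x [[/= _ +] [/= _ +]].
  by rewrite !in_itv/= => /andP[h1 h2] /andP[h3 h4]; lra.
Qed.

Definition subbox (a c h : R) (i j : nat) : set plane :=
  box (a + i%:R * h) (a + i%:R * h + h) (c + j%:R * h) (c + j%:R * h + h).

Lemma box_split (n : nat) (a c h : R) (f : plane -> \bar R) : 0 <= h ->
  measurable_fun setT f -> (forall x, (0 <= f x)%E) ->
  (\int[mu2]_(x in box a (a + n%:R * h) c (c + n%:R * h)) f x =
   \sum_(i < n) \sum_(j < n) \int[mu2]_(x in subbox a c h i j) f x)%E.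
Proof.
move=> h0 mf f0; rewrite box_split1//; apply: eq_bigr => i _.
by rewrite box_split2.
Qed.

Lemma sum2_lin (n : nat) (k : R) (P X1 X2 : 'I_n -> 'I_n -> \bar R) : 0 <= k ->
  (forall i j, 0 <= X1 i j)%E -> (forall i j, 0 <= X2 i j)%E ->
  (\sum_(i < n) \sum_(j < n) (P i j + (k%:E * X1 i j + k%:E * X2 i j)) =
   \sum_(i < n) \sum_(j < n) P i j + (k%:E * (\sum_(i < n) \sum_(j < n) X1 i j) +
     k%:E * (\sum_(i < n) \sum_(j < n) X2 i j)))%E.
Proof.
move=> k0 h1 h2.
have e (X : 'I_n -> 'I_n -> \bar R) : (forall i j, 0 <= X i j)%E ->
    (k%:E * (\sum_(i < n) \sum_(j < n) X i j) = \sum_(i < n) \sum_(j < n) k%:E * X i j)%E.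
  move=> X0; rewrite ge0_sume_distrr; last by move=> i _; exact: sume_ge0.
  by apply: eq_bigr => i _; rewrite ge0_sume_distrr.
rewrite !e// -!big_split/=; apply: eq_bigr => i _.
by rewrite -!big_split.
Qed.

Lemma lee_fin_comb (x0 x1 x2 m k : R) : x0 <= m + k * (x1 + x2) ->
  (x0%:E <= m%:E + (k%:E * x1%:E + k%:E * x2%:E))%E.
Proof. by rewrite mulrDr. Qed.

(** Poincare on the cells of side [h] gains [h ^+ 2], but the first derivatives are interpolated on
    the whole square: on a cell the constant [h * C1 h] grows like the inverse square of [h] and
    would cancel the gain. The factor 8 is 4 for each of the two partial derivatives. *)
Lemma square_ehrling (n : nat) (a c h l : R) (phi : R * R -> R) : 0 < h -> (0 < n)%N ->
  l = n%:R * h -> smooth2 phi ->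
  (\int[mu2]_(x in box a (a + l) c (c + l)) (phi x ^+ 2)%:E <=
   (2 / h ^+ 2 * \sum_(i < n) \sum_(j < n) (\int[mu2]_(x in subbox a c h i j) phi x) ^+ 2)%:E
   + (8 * h ^+ 2 * (l * C1 l))%:E * \int[mu2]_(x in box a (a + l) c (c + l)) (energy phi x)%:E)%E.
Proof.
move=> h0 n0 lE sphi; set Q := box _ _ _ _.
have l0 : 0 < l by rewrite lE mulr_gt0// ltr0n.
have hl := ltW h0.
have c0 := smooth2_continuous sphi.
have c1 := smooth2_continuous (smooth2_pd1 sphi).
have c2 := smooth2_continuous (smooth2_pd2 sphi).
have sq0 (f : R * R -> R) (x : plane) : (0 <= (f x ^+ 2)%:E)%E by rewrite lee_fin sqr_ge0.
have mQ : measurable Q by exact: measurable_box.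
have men := measurable_energy sphi.
have k0 : 0 <= l * C1 l by apply: mulr_ge0; [exact: ltW|apply: C1_ge0; exact: ltW].
have h20 : 0 <= 4 * h ^+ 2 by rewrite mulr_ge0// sqr_ge0.
have int0 (f : R * R -> R) (S : set plane) : (0 <= \int[mu2]_(x in S) (f x ^+ 2)%:E)%E.
  by apply: integral_ge0.
pose P i j := (2 / h ^+ 2 * (\int[mu2]_(x in subbox a c h i j) phi x) ^+ 2)%:E.
have cell i j : (\int[mu2]_(x in subbox a c h i j) (phi x ^+ 2)%:E <= P i j +
    ((4 * h ^+ 2)%:E * \int[mu2]_(x in subbox a c h i j) (pd1 phi x ^+ 2)%:E +
    (4 * h ^+ 2)%:E * \int[mu2]_(x in subbox a c h i j) (pd2 phi x ^+ 2)%:E))%E.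
  have h1 : a + i%:R * h <= a + i%:R * h + h by lra.
  have h2 : c + j%:R * h <= c + j%:R * h + h by lra.
  have mS : measurable (subbox a c h i j) by exact: measurable_box.
  rewrite -(dot_EFin mS (cont_box_sqint h1 h2 c0)) -(dot_EFin mS (cont_box_sqint h1 h2 c1)).
  rewrite -(dot_EFin mS (cont_box_sqint h1 h2 c2)) /P.
  by apply: lee_fin_comb; exact: (square_poincare (a + i%:R * h) (c + j%:R * h) h0 sphi).
have -> : (2 / h ^+ 2 * \sum_(i < n) \sum_(j < n) (\int[mu2]_(x in subbox a c h i j) phi x) ^+ 2)%:E =
    (\sum_(i < n) \sum_(j < n) P i j)%E.
  rewrite mulr_sumr -sumEFin; apply: eq_bigr => i _.
  by rewrite mulr_sumr -sumEFin.
rewrite {1}/Q {1 2}lE (box_split _ _ _ hl (measurable_phisq c0) (sq0 _)).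
apply: (@le_trans _ _ (\sum_(i < n) \sum_(j < n) (P i j +
    ((4 * h ^+ 2)%:E * \int[mu2]_(x in subbox a c h i j) (pd1 phi x ^+ 2)%:E +
    (4 * h ^+ 2)%:E * \int[mu2]_(x in subbox a c h i j) (pd2 phi x ^+ 2)%:E)))%E).
  by apply: lee_sum => i _; apply: lee_sum => j _; exact: cell.
have -> : (\sum_(i < n) \sum_(j < n) (P i j +
    ((4 * h ^+ 2)%:E * \int[mu2]_(x in subbox a c h i j) (pd1 phi x ^+ 2)%:E +
    (4 * h ^+ 2)%:E * \int[mu2]_(x in subbox a c h i j) (pd2 phi x ^+ 2)%:E)) =
  \sum_(i < n) \sum_(j < n) P i j +
   ((4 * h ^+ 2)%:E * \int[mu2]_(x in Q) (pd1 phi x ^+ 2)%:E +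
    (4 * h ^+ 2)%:E * \int[mu2]_(x in Q) (pd2 phi x ^+ 2)%:E))%E.
  rewrite /Q lE (box_split _ _ _ hl (measurable_phisq c1) (sq0 _)).
  rewrite (box_split _ _ _ hl (measurable_phisq c2) (sq0 _)).
  exact: (sum2_lin _ h20 (fun i j => int0 _ _) (fun i j => int0 _ _)).
apply: leeD2l.
have -> : (8 * h ^+ 2 * (l * C1 l))%:E = ((4 * h ^+ 2)%:E * (l * C1 l)%:E + (4 * h ^+ 2)%:E * (l * C1 l)%:E)%E.
  by rewrite -!EFinM -EFinD; congr (_%:E); ring.
have E0 : (0 <= \int[mu2]_(x in Q) (energy phi x)%:E)%E.
  by apply: integral_ge0 => x _; rewrite lee_fin energy_ge0.
have eE : (\int[mu2]_(x in Q) (l * C1 l * energy phi x)%:E = (l * C1 l)%:E * \int[mu2]_(x in Q) (energy phi x)%:E)%E.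
  under eq_integral do rewrite EFinM.
  apply: ge0_integralZl => //.
  - by apply/measurable_EFinP; exact: measurable_funTS.
  - by move=> x _; rewrite lee_fin energy_ge0.
rewrite ge0_muleDl; [|by rewrite -EFinM lee_fin mulr_ge0|by rewrite -EFinM lee_fin mulr_ge0].
rewrite -!muleA; apply: leeD; apply: lee_wpmul2l; rewrite ?lee_fin// -eE.
  exact: (interp_box1 _ _ l0 sphi).
exact: (interp_box2 _ _ l0 sphi).
Qed.

End Tame.

(** * Ehrling inequality on bounded pieces *)

Section Tame2.
Context {R : realType}.
Local Notation plane := (measurableTypeR R * measurableTypeR R)%type.
Local Notation mu2 := (@mu2 R).

(** The Ehrling inequality on [S] for one [e]. Its finite part consists of integrals over subsets of
    [E]; for bounded [E] these pass to the limit along approximants. The energy is taken over a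
    possibly larger [E], because interpolation near the edge of [S] reaches beyond [S]. With an
    arbitrary finite index type, a union is handled by a sum type. *)
Definition tame_at (E S : set plane) (e : R) := exists (I : finType) (B : I -> set plane) (K : R),
  [/\ forall i, measurable (B i) /\ B i `<=` E, 0 <= K &
  forall phi : R * R -> R, smooth2 phi ->
  (\int[mu2]_(x in S) (phi x ^+ 2)%:E <= e%:E * \int[mu2]_(x in E) (energy phi x)%:E +
    (K * \sum_i (\int[mu2]_(x in B i) phi x) ^+ 2)%:E)%E].

Definition tame (E S : set plane) := measurable S /\ forall e : R, 0 < e -> tame_at E S e.

Variable E : set plane.
Hypothesis mE : measurable E.

Lemma energy_int0 (phi : R * R -> R) (S : set plane) :
  (0 <= \int[mu2]_(x in S) (energy phi x)%:E)%E.
Proof. by apply: integral_ge0 => x _; rewrite lee_fin energy_ge0. Qed.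

Lemma phisq_sub (phi : R * R -> R) (S S' : set plane) : smooth2 phi -> measurable S ->
  measurable S' -> S' `<=` S ->
  (\int[mu2]_(x in S') (phi x ^+ 2)%:E <= \int[mu2]_(x in S) (phi x ^+ 2)%:E)%E.
Proof.
move=> sphi mS mS' SS; apply: ge0_subset_integral => //.
  by apply: measurable_funTS; apply: measurable_phisq; exact: smooth2_continuous.
by move=> x _; rewrite lee_fin sqr_ge0.
Qed.

Lemma phisq_setU (phi : R * R -> R) (S S' : set plane) : smooth2 phi -> measurable S ->
  measurable S' ->
  (\int[mu2]_(x in S `|` S') (phi x ^+ 2)%:E <=
   \int[mu2]_(x in S) (phi x ^+ 2)%:E + \int[mu2]_(x in S') (phi x ^+ 2)%:E)%E.
Proof.
move=> sphi mS mS'; have mp := measurable_phisq (smooth2_continuous sphi).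
have mD : measurable (S' `\` S) by exact: measurableD.
have -> : S `|` S' = S `|` (S' `\` S).
  apply/seteqP; split=> x; last by case=> [|[]]; [left|right].
  by case: (pselect (S x)) => Sx; [left|case=> // S'x; right].
rewrite ge0_integral_setU.
- by apply: leeD2l; apply: phisq_sub => //; exact: subDsetl.
- exact: mS.
- exact: mD.
- exact: measurable_funTS.
- by move=> x _; rewrite lee_fin sqr_ge0.
- by apply/disj_setPS => x [? []].
Qed.

Lemma tame_sub S S' : measurable S' -> S' `<=` S -> tame E S -> tame E S'.
Proof.
move=> mS' SS [mS h]; split=> // e e0; have [I [B [K [hB K0 hK]]]] := h e e0.
exists I, B, K; split=> // phi sphi; apply: le_trans (hK phi sphi).
exact: phisq_sub.
Qed.

Lemma tame_at_U S S' e e' : measurable S -> measurable S' -> 0 <= e -> 0 <= e' ->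
  tame_at E S e -> tame_at E S' e' -> tame_at E (S `|` S') (e + e').
Proof.
move=> mS mS' e0 e0' [I [B [K [hB K0 hK]]]] [I' [B' [K' [hB' K0' hK']]]].
exists (I + I')%type, (fun i => match i with inl i => B i | inr i => B' i end), (K + K').
split; [by case|by rewrite addr_ge0|].
move=> phi sphi; apply: (le_trans (phisq_setU sphi mS mS')).
apply: (le_trans (leeD (hK phi sphi) (hK' phi sphi))).
rewrite big_sumType/= EFinD ge0_muleDl ?lee_fin// addeACA; apply: leeD2l.
rewrite -EFinD lee_fin.
have s0 : 0 <= \sum_i (\int[mu2]_(x in B i) phi x) ^+ 2.
  by apply: sumr_ge0 => i _; exact: sqr_ge0.
have s0' : 0 <= \sum_i (\int[mu2]_(x in B' i) phi x) ^+ 2.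
  by apply: sumr_ge0 => i _; exact: sqr_ge0.
move: s0 s0'; set X := \sum_i _; set Y := \sum_i _ => X0 Y0.
have := mulr_ge0 K0 Y0; have := mulr_ge0 K0' X0; lra.
Qed.

Lemma tame_U S S' : tame E S -> tame E S' -> tame E (S `|` S').
Proof.
move=> [mS h] [mS' h']; split; first exact: measurableU.
move=> e e0; have e2 : 0 < e / 2 by rewrite divr_gt0.
rewrite [e]splitr; apply: tame_at_U => //; try exact: ltW.
  exact: h.
exact: h'.
Qed.

Lemma tame0 : tame E set0.
Proof.
split=> // e e0; exists void, (fun _ => set0), 0; split=> // phi _.
rewrite integral_set0 mul0r adde0; apply: mule_ge0; first by rewrite lee_fin ltW.
exact: energy_int0.
Qed.

(** The form used at the boundary: a layer [A], chosen after [e], is small because it is thin, and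
    the remainder [B] stays away from the boundary. *)
Lemma tame_approx S : measurable S -> (forall e : R, 0 < e -> exists A B,
    [/\ measurable A, tame E B, S `<=` A `|` B & forall phi : R * R -> R, smooth2 phi ->
    (\int[mu2]_(x in A) (phi x ^+ 2)%:E <= e%:E * \int[mu2]_(x in E) (energy phi x)%:E)%E]) ->
  tame E S.
Proof.
move=> mS h; split=> // e e0; have e2 : 0 < e / 2 by rewrite divr_gt0.
have [A [B [mA [mB tB] SAB hA]]] := h _ e2.
have tA : tame_at E A (e / 2).
  exists void, (fun _ => set0), 0; split=> // phi sphi.
  by rewrite mul0r adde0; exact: hA.
have := tame_at_U mA mB (ltW e2) (ltW e2) tA (tB _ e2); rewrite -splitr.
move=> [I [C [K [hC K0 hK]]]]; exists I, C, K; split=> // phi sphi.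
apply: le_trans (hK phi sphi); apply: phisq_sub => //; exact: measurableU.
Qed.

Lemma tame_box (a c l : R) : 0 < l -> box a (a + l) c (c + l) `<=` E ->
  tame E (box a (a + l) c (c + l)).
Proof.
move=> l0 QE; split; first exact: measurable_box.
move=> e e0; pose k := 8 * l ^+ 2 * (l * C1 l).
have k0 : 0 <= k.
  apply: mulr_ge0; first by rewrite mulr_ge0// sqr_ge0.
  by apply: mulr_ge0; [exact: ltW|apply: C1_ge0; exact: ltW].
(* This choice gives [k / n%:R ^+ 2 <= k / n%:R <= e]. *)
pose n := (Num.truncn (k / e)).+1.
have n0 : 0 < n%:R :> R by rewrite ltr0n.
have kn : k / n%:R ^+ 2 <= e.
  rewrite ler_pdivrMr ?exprn_gt0// mulrC -ler_pdivrMr//.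
  apply: (le_trans (ltW (truncnS_gt _))).
  by rewrite -/n expr2 ler_peMl ?(ltW n0)// ler1n.
pose h := l / n%:R; have h0 : 0 < h by rewrite divr_gt0.
have lE : l = n%:R * h by rewrite /h mulrC divfK// gt_eqF.
exists ('I_n * 'I_n)%type, (fun ij : 'I_n * 'I_n => subbox a c h ij.1 ij.2), (2 / h ^+ 2); split.
- move=> [i j]; split; first exact: measurable_box.
  apply: subset_trans QE => -[x y] [/=]; rewrite /box/= !in_itv/=.
  move=> /andP[h1 h2] /andP[h3 h4].
  have i0 : 0 <= i%:R * h by rewrite mulr_ge0// ltW.
  have j0 : 0 <= j%:R * h by rewrite mulr_ge0// ltW.
  have il : i%:R * h + h <= l.
    by rewrite lE -{2}[h]mul1r -mulrDl ler_pM2r// natr1 ler_nat.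
  have jl : j%:R * h + h <= l.
    by rewrite lE -{2}[h]mul1r -mulrDl ler_pM2r// natr1 ler_nat.
  by split; apply/andP; split; lra.
- by rewrite divr_ge0// sqr_ge0.
- move=> phi sphi; apply: (le_trans (square_ehrling a c h0 _ lE sphi)) => //.
  rewrite addeC pair_big/=; apply: leeD2r.
  have men := measurable_energy sphi.
  apply: (@le_trans _ _ (e%:E * \int[mu2]_(x in box a (a + l) c (c + l)) (energy phi x)%:E)%E).
    apply: lee_wpmul2r; first exact: energy_int0.
    rewrite lee_fin; apply: le_trans kn; rewrite /k /h expr_div_n.
    by rewrite le_eqVlt; apply/orP; left; apply/eqP; field; rewrite gt_eqF.
  apply: lee_wpmul2l; first by rewrite lee_fin ltW.
  apply: ge0_subset_integral => //; first exact: measurable_box.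
    by apply/measurable_EFinP; exact: measurable_funTS.
  by move=> x _; rewrite lee_fin energy_ge0.
Qed.

Lemma tame_seq (I : eqType) (s : seq I) (U : I -> set plane) :
  (forall i, i \in s -> tame E (U i)) -> tame E (\big[setU/set0]_(i <- s) U i).
Proof.
elim: s => [|i s ih] h; first by rewrite big_nil; exact: tame0.
rewrite big_cons; apply: tame_U; first by apply: h; rewrite mem_head.
by apply: ih => j js; apply: h; rewrite in_cons js orbT.
Qed.

Lemma compact_measurable_plane (K : set (R * R)) : compact K -> measurable (K : set plane).
Proof.
move=> cK; have clK : closed K by apply: compact_closed => //; exact: norm_hausdorff.
by rewrite -[K]setCK; apply: measurableC; apply: open_measurable_plane; exact: closed_openC.
Qed.

Lemma tame_compact_cover (K S : set (R * R)) : compact K -> measurable (S : set plane) ->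
  S `<=` K ->
  (forall x, K x -> exists U : set (R * R), [/\ open U, U x & tame E (S `&` U)]) ->
  tame E S.
Proof.
move=> cK mS SK h.
have /choice[U hU] (x : R * R) : exists U : set (R * R), K x -> [/\ open U, U x & tame E (S `&` U)].
  by have [/h[U hU]|nK] := pselect (K x); [exists U|exists setT].
(* [compact_cover] equates compactness with the covering property as predicates; [cK] is transported
   along this equality. *)
have cK' := eq_ind _ (fun P : set (set (R * R)) => P K) cK _ (@compact_cover ((R * R)%type : normedModType R)).
case: (cK' (R * R)%type K U); first by move=> x Kx; case: (hU x Kx).
  by move=> x Kx; exists x => //; case: (hU x Kx).
move=> F FK KF.
have tF : tame E (\big[setU/set0]_(x <- finmap.enum_fset F) (S `&` U x)).
  by apply: tame_seq => x /FK; rewrite inE => /hU[].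
apply: tame_sub tF => // x Sx; rewrite -bigcup_seq.
by have [y yF Uy] := KF x (SK x Sx); exists y.
Qed.

Lemma open_box (x : R * R) : open E -> E x -> exists a c l,
  [/\ 0 < l, box a (a + l) c (c + l) `<=` E & (box a (a + l) c (c + l) : set (R * R))° x].
Proof.
move=> oE Ex; have /nbhs_ballP[e /= e0 he] : nbhs x E by exact: open_nbhs_nbhs.
have e2 : 0 < e / 2 by rewrite divr_gt0.
exists (x.1 - e / 2), (x.2 - e / 2), e; split=> //.
  move=> [y z] [/=]; rewrite !in_itv/= => /andP[h1 h2] /andP[h3 h4].
  by apply: he; split; rewrite /ball/= ltr_distl; apply/andP; split; lra.
apply/nbhs_ballP; exists (e / 2) => // -[y z] [/=]; rewrite /ball/= !ltr_distl.
move=> /andP[h1 h2] /andP[h3 h4].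
by split; rewrite /= in_itv/=; apply/andP; split; lra.
Qed.

Lemma tame_compact (K : set (R * R)) : open E -> compact K -> K `<=` E -> tame E K.
Proof.
move=> oE cK KE; have mK := compact_measurable_plane cK.
apply: (tame_compact_cover cK mK) => // x Kx.
have [a [c [l [l0 bE bx]]]] := open_box oE (KE x Kx).
exists ((box a (a + l) c (c + l) : set (R * R))°); split=> //; first exact: open_interior.
apply: tame_sub (tame_box l0 bE).
  by apply: measurableI => //; apply: open_measurable_plane; exact: open_interior.
by move=> y [_ /interior_subset].
Qed.

End Tame2.

(** * Thin layers along a smooth boundary *)

Section Boundary.
Context {R : realType}.
Local Notation plane := (measurableTypeR R * measurableTypeR R)%type.
Local Notation mu2 := (@mu2 R).

(** [sw] plays the role of [swap] in [smooth_boundary]: [crd sw] is the variable of the local graph,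
    [crd (~~ sw)] the transversal one, and [secsw] takes the transversal sections. *)
Definition crd (sw : bool) (x : R * R) : R := if sw then x.2 else x.1.
Definition ptsw (sw : bool) (s t : R) : R * R := if sw then (t, s) else (s, t).
Definition secsw (sw : bool) (E : set plane) (s : R) : set R :=
  if sw then ysection E s else xsection E s.

Lemma secswP sw E s t : secsw sw E s t <-> E (ptsw sw s t).
Proof. by case: sw; rewrite /secsw /ptsw; [exact: ysectionP|exact: xsectionP]. Qed.

Lemma crd_ptsw sw s t : crd sw (ptsw sw s t) = s /\ crd (~~ sw) (ptsw sw s t) = t.
Proof. by case: sw. Qed.

Lemma crd_continuous sw : continuous (crd sw).
Proof. by case: sw => x; [exact: cvg_snd|exact: cvg_fst]. Qed.

Lemma ball_crd sw (p x : R * R) e :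
  ball p e x <-> `|crd sw p - crd sw x| < e /\ `|crd (~~ sw) p - crd (~~ sw) x| < e.
Proof. by case: sw; split=> -[]. Qed.

Lemma smooth1_continuous (h : R -> R) : smooth1 h -> continuous h.
Proof.
by move=> sh x; apply/differentiable_continuous/derivable1_diffP; exact: (sh 0%N x).
Qed.

Lemma strip_sw sw (E1 E2 : set plane) (L de : R) (phi : R * R -> R) :
  0 < L -> 0 <= de -> measurable E1 -> measurable E2 -> smooth2 phi ->
  (forall s, secsw sw E1 s = set0 \/ exists a al,
    [/\ secsw sw E1 s `<=` `[al, al + de], `[al, al + de] `<=` `[a, a + L] &
        `]a, a + L[ `<=` secsw sw E2 s]) ->
  (\int[mu2]_(x in E1) (phi x ^+ 2)%:E <=
   \int[mu2]_(x in E2) (de * C0 L * energy phi x)%:E)%E.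
Proof. by case: sw => L0 de0 m1 m2 sphi h; [exact: strip1|exact: strip2]. Qed.

Lemma open_setE (f : R * R -> R) (a : R) : continuous f -> open [set x | f x < a].
Proof.
move=> cf; have -> : [set x | f x < a] = f @^-1` [set y | y < a] by [].
by apply: open_comp => [x _|]; [exact: cf|exact: open_lt].
Qed.

Lemma closed_setE (f : R * R -> R) (a : R) : continuous f -> closed [set x | f x <= a].
Proof.
move=> cf; have -> : [set x | f x <= a] = f @^-1` [set y | y <= a] by [].
by apply: closed_comp => [x _|]; [exact: cf|exact: closed_le].
Qed.

Lemma compact_rect (a b c d : R) :
  compact (`[a, b]%classic `*` `[c, d]%classic : set (R * R)).
Proof. by apply: compact_setX; exact: segment_compact. Qed.

Lemma closed_rect_compact (A : set (R * R)) (a b c d : R) : closed A ->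
  A `<=` `[a, b]%classic `*` `[c, d]%classic -> compact A.
Proof. move=> cA Asub; have h := @subclosed_compact _ A _ cA (@compact_rect a b c d).
exact: h Asub. Qed.

Variables (Omega E : set (R * R)).
Hypotheses (oOm : open Omega) (oE : open E) (sOm : smooth_boundary Omega).

Lemma boundary_tame (p : R * R) (e0 : R) : boundary Omega p -> 0 < e0 ->
  Omega `&` ball p e0 `<=` E ->
  exists U : set (R * R), [/\ open U, U p & tame E (Omega `&` U)].
Proof.
move=> bp e00 OE; have mE := open_measurable_plane oE.
have [e [h [sw [flip [epos sh hO]]]]] := sOm bp.
pose e1 := Num.min e e0.
have e10 : 0 < e1 by rewrite lt_min epos.
have e1e : e1 <= e by rewrite ge_min lexx.
have e1e0 : e1 <= e0 by rewrite ge_min lexx orbT.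
have ch := smooth1_continuous sh.
(* With this sign, [Omega] is the set [0 < f] near [p] in all four cases of [smooth_boundary]. *)
pose sg : R := if flip then -1 else 1.
pose f x := sg * (crd (~~ sw) x - h (crd sw x)).
have cf : continuous f.
  move=> x; apply: cvgM; first exact: cvg_cst.
  apply: cvgB; first exact: crd_continuous.
  by apply: (@continuous_comp _ _ _ (crd sw) h); [exact: crd_continuous|exact: ch].
have Of x : ball p e1 x -> Omega x <-> 0 < f x.
  move=> /(le_ball e1e)/hO /= ->; rewrite /f /sg /crd.
  by case: (sw); case: (flip) => /=; rewrite ?mul1r ?mulN1r ?oppr_gt0 ?subr_lt0 ?subr_gt0.
(* [p] is not in the open set [Omega], so [f p <= 0]; a negative value would keep [Omega] away from
   a whole neighbourhood of [p]. *)
have fp : f p = 0.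
  have [clp nip] := bp.
  have Onp : ~ Omega p by move=> Op; apply: nip; rewrite /interior; exact: open_nbhs_nbhs.
  have pp : ball p e1 p by exact: ballxx.
  have fle : f p <= 0 by rewrite leNgt; apply/negP => /(Of _ pp).
  apply/eqP; rewrite eq_le fle leNgt; apply/negP => flt.
  have nV : nbhs p ([set x | f x < 0] `&` ball p e1).
    apply: filterI; last exact: nbhsx_ballx.
    by apply: open_nbhs_nbhs; split=> //; exact: open_setE.
  have [x [Ox [fx /Of]]] := clp _ nV.
  by move=> [/(_ Ox) fx0 _]; have := lt_trans fx0 fx; rewrite ltxx.
set s0 := crd sw p; set t0 := crd (~~ sw) p.
have th : t0 = h s0.
  apply/eqP; rewrite -subr_eq0; move/eqP: fp; rewrite /f mulf_eq0 => /orP[|//].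
  by rewrite /sg; case: (flip); rewrite ?oppr_eq0 oner_eq0.
have e14 : 0 < e1 / 4 by rewrite divr_gt0.
have [d [d0 hd]] : exists d, 0 < d /\ forall s, `|s0 - s| < d -> `|h s0 - h s| < e1 / 4.
  have /cvgrPdist_lt/(_ _ e14)/nbhs_ballP[d /= d0 hd] := ch s0.
  by exists d; split=> // s sd; exact: hd.
pose d1 := Num.min d (e1 / 4).
have d10 : 0 < d1 by rewrite lt_min d0.
have hd1 s : `|s0 - s| < d1 -> `|t0 - h s| < e1 / 4.
  by rewrite th => sd; apply: hd; apply: lt_le_trans sd _; rewrite ge_min lexx.
have d1e : d1 <= e1 / 4 by rewrite ge_min lexx orbT.
pose U0 := [set x : R * R | `|s0 - crd sw x| < d1 /\ `|t0 - crd (~~ sw) x| < e1 / 4].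
have U0e x : U0 x -> ball p e1 x.
  by move=> [h1 h2]; apply/(ball_crd sw); split; rewrite -/s0 -/t0; lra.
have U0p : nbhs p U0.
  apply/nbhs_ballP; exists d1 => //= x /(ball_crd sw)[h1 h2].
  by split=> //; exact: lt_le_trans h2 d1e.
exists U0°; split; [exact: open_interior|by []|].
have mU : measurable (Omega `&` U0° : set plane).
  by apply: measurableI; apply: open_measurable_plane => //; exact: open_interior.
apply: tame_approx => // ep ep0.
(* The graph stays within [e1 / 4] of [t0], so a transversal segment of length [e1 / 2] starting on
   it remains in the ball of radius [e1]. *)
pose L := e1 / 2; have L0 : 0 < L by rewrite divr_gt0.
have C00 : 0 <= C0 L by apply: C0_ge0; exact: ltW.
(* [de <= L] fits the layer into the segment; the other bound makes the factor [de * C0 L] at most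
   [ep]. *)
pose de := Num.min L (ep / (C0 L + 1)).
have C01 : 0 < C0 L + 1 by rewrite ltr_wpDl.
have de0 : 0 < de by rewrite lt_min L0 divr_gt0.
have deL : de <= L by rewrite ge_min lexx.
have deC : de * C0 L <= ep.
  apply: (@le_trans _ _ (ep / (C0 L + 1) * C0 L)).
    by rewrite ler_wpM2r// ge_min lexx orbT.
  rewrite mulrAC ler_pdivrMr//; apply: ler_wpM2l; [exact: ltW|by rewrite lerDl].
pose A := [set x : R * R | `|s0 - crd sw x| < d1] `&` [set x | 0 < f x <= de].
(* Closed conditions make [B] compact, and [de <= f] keeps it inside [Omega]. *)
pose B := [set x : R * R | [/\ `|s0 - crd sw x| <= d1, `|t0 - crd (~~ sw) x| <= e1 / 4 &
   de <= f x]].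
have cabs (k : R) b : continuous (fun x : R * R => `|k - crd b x|).
  move=> x; apply: (@continuous_comp _ _ _ (fun x => k - crd b x) (fun y : R => `|y|)).
    by apply: cvgB; [exact: cvg_cst|exact: crd_continuous].
  exact: norm_continuous.
have mA : measurable (A : set plane).
  apply: measurableI; first by apply: open_measurable_plane; exact: open_setE.
  have := continuous_measurable_plane cf => /(_ measurableT `]0, de]%classic (measurable_itv _)).
  by rewrite setTI; congr measurable; apply/seteqP; split=> x /=; rewrite in_itv.
have cB : compact B.
  apply: (@closed_rect_compact _ (p.1 - e1) (p.1 + e1) (p.2 - e1) (p.2 + e1)).
    have -> : B = [set x | `|s0 - crd sw x| <= d1] `&` [set x | `|t0 - crd (~~ sw) x| <= e1 / 4]
       `&` [set x | - f x <= - de].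
      by apply/seteqP; split=> x /=; rewrite lerN2; [case|case=> -[]].
    apply: closedI; last by apply: closed_setE => x; apply: cvgN; exact: cf.
    by apply: closedI; apply: closed_setE.
  move=> x [h1 h2 _].
  have : `|p.1 - x.1| <= e1 /\ `|p.2 - x.2| <= e1.
    by move: h1 h2; rewrite /s0 /t0 /crd; case: (sw) => /= h1 h2; split; lra.
  rewrite !ler_norml => -[/andP[k1 k2] /andP[k3 k4]].
  by split; rewrite /= in_itv/=; apply/andP; split; lra.
have BE : B `<=` E.
  move=> x [h1 h2 h3].
  have bx : ball p e1 x by apply/(ball_crd sw); split; rewrite -/s0 -/t0; lra.
  apply: OE; split; last exact: le_ball bx.
  by apply/Of => //; lra.
exists A, B; split=> //; first exact: tame_compact.
  move=> x [Ox /interior_subset Ux].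
  have fx : 0 < f x by apply/Of => //; exact: U0e.
  case: Ux => h1 h2; have [fd|fd] := leP (f x) de; first by left; split=> //=; rewrite fx.
  by right; split; apply: ltW.
move=> phi sphi.
have men := measurable_energy sphi.
apply: (@le_trans _ _ (\int[mu2]_(x in E) (de * C0 L * energy phi x)%:E)%E).
  apply: (@strip_sw sw A E L de phi L0 (ltW de0) mA mE sphi) => s.
  have [sd|sd] := ltP `|s0 - s| d1; last first.
    left; apply/seteqP; split=> // t /secswP[/=].
    by have [-> _] := crd_ptsw sw s t; rewrite ltNge sd.
  right; have hs := hd1 s sd.
  (* For [flip] the domain lies below the graph, and both intervals end at [h s] instead of starting
     there. *)
  exists (if flip then h s - L else h s), (if flip then h s - de else h s); split.
  - move=> t /secswP[/= _]; rewrite /f; have [-> ->] := crd_ptsw sw s t.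
    by rewrite /sg in_itv/=; case: (flip); rewrite ?mul1r ?mulN1r => /andP[k1 k2];
      apply/andP; split; lra.
  - move=> t; rewrite /= !in_itv/=; case: (flip) => /andP[k1 k2];
      by apply/andP; split; lra.
  - move=> t tin; apply/secswP.
    have [c1 c2] := crd_ptsw sw s t.
    have bx : ball p e1 (ptsw sw s t).
      apply/(ball_crd sw); rewrite c1 c2 -/s0 -/t0; split; first by lra.
      move: tin hs; rewrite /= in_itv/= !ltr_norml /L.
      by case: (flip) => /andP[k1 k2] /andP[k3 k4]; apply/andP; split; lra.
    apply: OE; split; last exact: le_ball bx.
    apply/Of => //; rewrite /f c1 c2.
    move: tin; rewrite /= in_itv/= /sg.
    by case: (flip) => /andP[k1 k2]; rewrite ?mul1r ?mulN1r; lra.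
under eq_integral do rewrite EFinM.
rewrite ge0_integralZl//.
- by apply: lee_wpmul2r; [exact: energy_int0|rewrite lee_fin].
- by apply/measurable_EFinP; exact: measurable_funTS.
- by move=> x _; rewrite lee_fin energy_ge0.
- by rewrite lee_fin mulr_ge0// ltW.
Qed.

End Boundary.

(** * The cusp *)

Section OneDimLocal.
Context {R : realType}.
Local Notation mu := (@lebesgue_measure R).

Lemma derive_continuous_at (F : R -> R) (x d : R) : is_derive x 1 F d -> {for x, continuous F}.
Proof. by move=> h; apply/differentiable_continuous/derivable1_diffP; case: h. Qed.

Lemma continuousX_at (T : topologicalType) (n : nat) (f : T -> R) (x : T) :
  {for x, continuous f} -> {for x, continuous (fun y => f y ^+ n)}.
Proof.
by move=> cf; apply: (@continuous_comp _ _ _ f (fun z : R => z ^+ n)) => //;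
  exact: exprn_continuous.
Qed.

Lemma within_integrable (a b : R) (f : R -> R) : {within `[a, b], continuous f} ->
  mu.-integrable `[a, b] (EFin \o f).
Proof. by apply: continuous_compact_integrable; exact: segment_compact. Qed.

(** The derivative is asked for on [[a, b]] only: the primitive of 1/H is differentiable only beyond
    its base point. *)
Lemma ftc_local (a b : R) (F f : R -> R) : a <= b ->
  (forall x, a <= x <= b -> is_derive x 1 F (f x)) ->
  {within `[a, b], continuous f} -> intv a b f = F b - F a.
Proof.
move=> ab dF cf; apply: EFin_inj; rewrite /intv /Rintegral fineK; last first.
  by apply: integrable_fin_num => //; exact: within_integrable.
move: ab; rewrite le_eqVlt => /predU1P[e|ab].
  by rewrite e set_itv1 integral_set1 subrr.
have cF x : a <= x <= b -> {for x, continuous F}.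
  by move=> /dF; exact: derive_continuous_at.
have ain : a <= a <= b by rewrite lexx ltW.
have bin : a <= b <= b by rewrite lexx ltW.
rewrite (continuous_FTC2 (F := F) ab)//.
- split.
  + by move=> x; rewrite in_itv/= => /andP[/ltW h1 /ltW h2]; case: (dF x) => //; rewrite h1.
  + by apply: cvg_at_right_filter; exact: cF.
  + by apply: cvg_at_left_filter; exact: cF.
- move=> x; rewrite in_itv/= => /andP[/ltW h1 /ltW h2]; rewrite derive1E.
  by case: (dF x) => //; rewrite h1.
Qed.

Lemma continuous_in_within (a b : R) (f : R -> R) :
  (forall x, a <= x <= b -> {for x, continuous f}) -> {within `[a, b], continuous f}.
Proof.
move=> h; apply: continuous_in_subspaceT => x; rewrite inE/= in_itv/=; exact: h.
Qed.

Lemma primitive_derive (a x : R) (f : R -> R) : a < x -> continuous f ->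
  is_derive x 1 (fun y => intv a y f) (f x).
Proof.
move=> ax cf.
have h1 : x < x + 1 by rewrite ltrDl.
have [d e] := @continuous_FTC1_closed R f a x (x + 1) h1
  (cont_integrable a (x + 1) cf) ax (cf x).
by apply: DeriveDef; [exact: d|rewrite -derive1E; exact: e].
Qed.

Lemma intv_scale (k : R) (f : R -> R) : 0 < k -> continuous f ->
  intv (-1) 1 (fun t => k * f (k * t)) = intv (- k) k f.
Proof.
(* The base point lies to the left of [- k], so that [P] has two-sided derivatives on all of
   [[- k, k]]. *)
move=> k0 cf; pose P y := intv (- k - 1) y f.
have dP (x : R) : - k <= x <= k -> is_derive x 1 P (f x).
  by move=> /andP[h1 h2]; apply: primitive_derive => //; lra.
have kk : - k <= k by lra.
have cP : {within `[- k, k], continuous f}.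
  by apply: continuous_in_within => x _; exact: cf.
rewrite (ftc_local kk dP cP).
have d1 (t : R) : -1 <= t <= 1 -> is_derive t 1 (fun t => P (k * t)) (k * f (k * t)).
  move=> /andP[h1 h2].
  have h3 : - k <= k * t <= k by apply/andP; split; nra.
  have dk : is_derive t 1 (fun t => k * t) k.
    have [h4 h5] := is_deriveZ (f := id) (x := t) (v := 1) k (is_derive_id t (1 : R)).
    by apply: DeriveDef; [exact: h4|rewrite [LHS]h5 /GRing.scale/= mulr1].
  by rewrite mulrC; exact: (is_derive1_comp (dP _ h3) dk).
have c1 : {within `[-1, 1], continuous (fun t => k * f (k * t))}.
  apply: continuous_in_within => x _.
  apply: cvgM; first exact: cvg_cst.
  apply: (@continuous_comp _ _ _ (fun t => k * t) f); last exact: cf.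
  by apply: cvgM; [exact: cvg_cst|exact: cvg_id].
have n11 : (-1 : R) <= 1 by lra.
by rewrite (ftc_local n11 d1 c1) mulr1 mulrN1.
Qed.

(** Differentiate [F], that is [- (al ^+ 2 / I)], and complete a square: the derivative plus
    [2 * (g * al1 ^+ 2)] is half of [al ^+ 2 / (I ^+ 2 * g)] plus half of a square with weight [g].
    No value of [al] is prescribed, so a term at [s] remains. The points [s] and [r] are separate
    because [g ^+ 4 * I ^+ 2 <= e] is assumed only from [r] on. *)
Lemma hardy (s r Y e : R) (I g al al1 : R -> R) : s <= r -> r <= Y -> 0 <= e ->
  (forall y, s <= y <= Y -> is_derive y 1 I (g y)^-1) ->
  (forall y, s <= y <= Y -> 0 < I y) -> (forall y, s <= y <= Y -> 0 < g y) ->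
  (forall y, r <= y <= Y -> g y ^+ 4 * I y ^+ 2 <= e) ->
  continuous g -> (forall y : R, is_derive y 1 al (al1 y)) -> continuous al1 ->
  intv r Y (fun y => g y ^+ 3 * al y ^+ 2) <=
  2 * e * ((I s)^-1 * al s ^+ 2 + 2 * intv s Y (fun y => g y * al1 y ^+ 2)).
Proof.
move=> sr rY e0 dI I0 g0 ge cg dal cal1.
have sY : s <= Y := le_trans sr rY.
have cal : continuous al by move=> y; exact: (derive_continuous_at (dal y)).
pose F y := - (al y ^+ 2 * (I y)^-1).
pose f y := al y ^+ 2 / (I y ^+ 2 * g y) - 2 * al y * al1 y / I y.
have ss : s <= s <= Y by rewrite lexx.
have YY : s <= Y <= Y by rewrite lexx sY.
have cI y : s <= y <= Y -> {for y, continuous I}.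
  by move=> /dI; exact: derive_continuous_at.
have dF y : s <= y <= Y -> is_derive y 1 F (f y).
  move=> yin; have Iy := I0 y yin; have gy := g0 y yin.
  have h1 : is_derive y 1 (fun y => al y ^+ 2) (2 * al y * al1 y).
    have [h4 h5] := is_deriveX 2 (dal y); apply: DeriveDef; first exact: h4.
    by rewrite [LHS]h5 /GRing.scale/= expr1 -mulr_natl.
  have h2 : is_derive y 1 (fun y => (I y)^-1) (- (I y) ^- 2 * (g y)^-1).
    have Iy0 : I y != 0 by rewrite gt_eqF.
    have [h4 h5] := is_deriveV Iy0 (dI y yin).
    by apply: DeriveDef; [exact: h4|rewrite [LHS]h5 /GRing.scale/= mulNr].
  have h3 := is_deriveM h1 h2; have [h4 h5] := is_deriveN h3.
  apply: DeriveDef; first exact: h4.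
  rewrite [LHS]h5 /GRing.scale/= /f; field.
  by rewrite !gt_eqF.
have cf : {within `[s, Y], continuous f}.
  apply: continuous_in_within => y yin; have Iy := I0 y yin; have gy := g0 y yin.
  have cI2 : {for y, continuous (fun y => I y ^+ 2 * g y)}.
    by apply: cvgM; [apply: continuousX_at; exact: cI|exact: cg].
  have calf : {for y, continuous (fun y => al y ^+ 2)} by apply: continuousX_at; exact: cal.
  apply: cvgB.
    by apply: cvgM => //; apply: cvgV => //; rewrite gt_eqF// mulr_gt0// exprn_gt0.
  apply: cvgM; last by apply: cvgV; [rewrite gt_eqF|exact: cI].
  by apply: cvgM; [apply: cvgM; [exact: cvg_cst|exact: cal]|exact: cal1].
have cga : continuous (fun y => g y * al1 y ^+ 2).
  by move=> y; apply: cvgM; [exact: cg|apply: continuousX_at; exact: cal1].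
pose k y := 2 * e * (f y + 2 * (g y * al1 y ^+ 2)).
have ck : {within `[s, Y], continuous k}.
  have cc (c : R) : {within `[s, Y], continuous (fun _ : R => c)}.
    by apply: continuous_subspaceT; exact: cont_cst.
  have cga' : {within `[s, Y], continuous (fun y => g y * al1 y ^+ 2)}.
    exact: continuous_subspaceT.
  move=> y; apply: cvgM; first exact: cc.
  (* The constant is continuous on the subspace as well, so [k] inherits continuity on the closed
     interval only, which suffices for its integrability. *)
  by apply: cvgD; [exact: cf|apply: cvgM; [exact: cc|exact: cga']].
have sqr_id y : s <= y <= Y ->
    f y + 2 * (g y * al1 y ^+ 2) = 2^-1 * (al y ^+ 2 / (I y ^+ 2 * g y)) +
      2^-1 * (g y * (al y / (I y * g y) - 2 * al1 y) ^+ 2).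
  by move=> yin; rewrite /f; field; rewrite !gt_eqF ?I0 ?g0.
have pos1 y : s <= y <= Y -> 0 <= al y ^+ 2 / (I y ^+ 2 * g y).
  by move=> yin; rewrite divr_ge0 ?sqr_ge0// mulr_ge0 ?sqr_ge0// ltW// g0.
have pos2 y : s <= y <= Y -> 0 <= g y * (al y / (I y * g y) - 2 * al1 y) ^+ 2.
  by move=> yin; rewrite mulr_ge0 ?sqr_ge0// ltW// g0.
(* By the completed square [sqr_id], [k] is nonnegative from [s] on and majorises the left integrand
   from [r] on; the majorant may then be integrated from [s]. *)
have k_ge0 y : s <= y <= Y -> 0 <= k y.
  move=> yin; rewrite /k sqr_id//.
  by have := pos1 y yin; have := pos2 y yin => h1 h2; rewrite !mulr_ge0//; lra.
have k_ge y : r <= y <= Y -> g y ^+ 3 * al y ^+ 2 <= k y.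
  move=> /andP[ry yY]; have yin : s <= y <= Y by rewrite yY (le_trans sr ry).
  have ryY : r <= y <= Y by rewrite ry.
  have Iy := I0 y yin; have gy := g0 y yin.
  (* The hypothesis on [g ^+ 4 * I ^+ 2] converts the Hardy weight into [g ^+ 3]. *)
  have -> : g y ^+ 3 * al y ^+ 2 = (g y ^+ 4 * I y ^+ 2) * (al y ^+ 2 / (I y ^+ 2 * g y)).
    by field; rewrite !gt_eqF.
  apply: (le_trans (ler_wpM2r (pos1 y yin) (ge y ryY))).
  rewrite /k sqr_id//; have := pos2 y yin.
  set A := _ / _; set B := g y * _ => B0; have := mulr_ge0 e0 B0; lra.
have ik : mu.-integrable `[s, Y] (EFin \o k) by exact: within_integrable.
have sub : `[r, Y]%classic `<=` `[s, Y]%classic.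
  by move=> y /=; rewrite !in_itv/= => /andP[h1 ->]; rewrite (le_trans sr h1).
have ikr : mu.-integrable `[r, Y] (EFin \o k) 
    by apply: within_integrable; exact: (continuous_subspaceW sub ck).
have cga3 : continuous (fun y => g y ^+ 3 * al y ^+ 2).
  by move=> y; apply: cvgM; apply: continuousX_at; [exact: cg|exact: cal].
have step1 : intv r Y (fun y => g y ^+ 3 * al y ^+ 2) <= intv r Y k.
  apply: le_Rintegral; [exact: measurable_itv|exact: cont_integrable|exact: ikr|].
  by move=> y; rewrite /= in_itv/=; exact: k_ge.
have step2 : intv r Y k <= intv s Y k.
  rewrite -lee_fin /intv /Rintegral !fineK; try exact: integrable_fin_num.
  apply: ge0_subset_integral; [exact: measurable_itv|exact: measurable_itv| | |exact: sub].
    exact: (measurable_int mu ik).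
  by move=> y; rewrite /= in_itv/= => yin; rewrite lee_fin; exact: k_ge0.
apply: (le_trans step1); apply: (le_trans step2).
have iff : mu.-integrable `[s, Y] (EFin \o f) by exact: within_integrable.
have ig := cont_integrable s Y cga.
have ig2 : mu.-integrable `[s, Y] (EFin \o (fun y => 2 * (g y * al1 y ^+ 2))).
  by apply: cont_integrable; apply: contM => //; exact: cont_cst.
have -> : intv s Y k = 2 * e * (intv s Y f + 2 * intv s Y (fun y => g y * al1 y ^+ 2)).
  rewrite /intv /k RintegralZl//; last exact: (integrableD _ iff ig2).
  by rewrite RintegralD// RintegralZl.
rewrite (ftc_local sY dF cf).
apply: ler_wpM2l; first by rewrite mulr_ge0.
(* The end point [Y] contributes a nonpositive term, which is dropped. *)
rewrite lerD2r /F opprK [X in _ <= X]mulrC addrC -[X in _ <= X]addr0 lerD2l oppr_le0.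
by rewrite mulr_ge0 ?sqr_ge0// invr_ge0 ltW// I0.
Qed.

End OneDimLocal.

Section HardyAverage.
Context {R : realType}.

(** The value [al s ^+ 2] is not controlled by integrals, but [hardy] holds for every [s] in
    [[r1, r1 + 1]]; averaging over this unit interval replaces the value by an integral. The
    absolute value of [g], which is [g] itself on this range, is the Jacobian occurring in
    [pull]. *)
Lemma hardy_average (r1 r Y e : R) (I g al al1 : R -> R) : r1 + 1 <= r -> r <= Y -> 0 <= e ->
  (forall y, r1 <= y <= Y -> is_derive y 1 I (g y)^-1) ->
  (forall y, r1 <= y <= Y -> 0 < g y) ->
  0 < I r1 -> (forall y, r1 <= y <= Y -> I r1 <= I y) ->
  (forall y, r1 <= y <= r1 + 1 -> g (r1 + 1) <= g y) ->
  (forall y, r <= y <= Y -> g y ^+ 4 * I y ^+ 2 <= e) ->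
  continuous g -> (forall y : R, is_derive y 1 al (al1 y)) -> continuous al1 ->
  intv r Y (fun y => `|g y| * (g y ^+ 2 * al y ^+ 2)) <=
  2 * e * ((I r1 * g (r1 + 1))^-1 * intv r1 (r1 + 1) (fun y => `|g y| * al y ^+ 2)
    + 2 * intv r1 Y (fun y => `|g y| * al1 y ^+ 2)).
Proof.
move=> r1r rY e0 dI g0 I0 Imono gdecr ge cg dal cal1.
have cal : continuous al by move=> y; exact: (derive_continuous_at (dal y)).
have cng : continuous (fun y => `|g y|).
  by move=> y; apply: (@continuous_comp _ _ _ g (fun z : R => `|z|)); [exact: cg|exact: norm_continuous].
have cga : continuous (fun y => `|g y| * al y ^+ 2) by apply: contM => //; exact: contX.
have cga1 : continuous (fun y => `|g y| * al1 y ^+ 2) by apply: contM => //; exact: contX.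
have cga1' : continuous (fun y => g y * al1 y ^+ 2) by apply: contM => //; exact: contX.
have r1r' : r1 <= r by lra.
have r11Y : r1 <= r1 + 1 <= Y by lra.
have g1 := g0 _ r11Y.
set X := intv r Y _; set Z := intv r1 Y _.
have XE : X = intv r Y (fun y => g y ^+ 3 * al y ^+ 2).
  apply: eq_Rintegral => y; rewrite inE/= in_itv/= => /andP[h1 h2].
  have gy : 0 < g y by apply: g0; rewrite h2 (le_trans r1r' h1).
  by rewrite gtr0_norm// mulrA -exprS.
have key s : r1 <= s <= r1 + 1 ->
    X <= 2 * e * ((I r1 * g (r1 + 1))^-1 * (`|g s| * al s ^+ 2) + 2 * Z).
  move=> /andP[s1 s2].
  have sr : s <= r by lra.
  have sY : r1 <= s <= Y by rewrite s1 (le_trans sr rY).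
  have sub y : s <= y <= Y -> r1 <= y <= Y by move=> /andP[h1 ->]; rewrite (le_trans s1 h1).
  have Ipos y : s <= y <= Y -> 0 < I y by move=> /sub/Imono; exact: lt_le_trans.
  rewrite XE; apply: (le_trans (hardy sr rY e0 (fun y h => dI y (sub y h)) Ipos
    (fun y h => g0 y (sub y h)) ge cg dal cal1)).
  apply: ler_wpM2l; first by rewrite mulr_ge0.
  apply: lerD.
    rewrite [X in _ <= X]mulrA; apply: ler_wpM2r; first exact: sqr_ge0.
    have Is : 0 < I s by exact: lt_le_trans I0 (Imono s sY).
    rewrite gtr0_norm ?g0// invfM -mulrA.
    rewrite -[X in X <= _]mulr1.
    apply: ler_pM; [by rewrite invr_ge0 ltW|exact: ler01|by rewrite lef_pV2 ?posrE// Imono|].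
    by rewrite mulrC ler_pdivlMr// mul1r gdecr// s1.
  apply: ler_wpM2l => //.
  have -> : intv s Y (fun y => g y * al1 y ^+ 2) = intv s Y (fun y => `|g y| * al1 y ^+ 2).
    apply: eq_Rintegral => y; rewrite inE/= in_itv/= => /sub h1.
    by rewrite gtr0_norm ?g0.
  apply: intv_sub => // y.
  by rewrite mulr_ge0 ?sqr_ge0.
have r11 : r1 <= r1 + 1 by rewrite lerDl.
have cX : continuous (fun s => 2 * e * ((I r1 * g (r1 + 1))^-1 * (`|g s| * al s ^+ 2) + 2 * Z)).
  apply: contM; first exact: cont_cst.
  by apply: contD; [apply: contM => //; exact: cont_cst|exact: cont_cst].
have h := le_intv (@cont_cst R X) cX key.
move: h; rewrite intv_cst// addrAC subrr add0r mulr1.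
rewrite intvZ; last first.
  by apply: contD; [apply: contM => //; exact: cont_cst|exact: cont_cst].
rewrite intvD; [|by apply: contM => //; exact: cont_cst|exact: cont_cst].
by rewrite intv_cst// (intvZ _ _ _ cga) addrAC subrr add0r mulr1.
Qed.

End HardyAverage.

Section CuspTail.
Context {R : realType}.
Local Notation plane := (measurableTypeR R * measurableTypeR R)%type.
Local Notation mu := (@lebesgue_measure R).
Local Notation mu2 := (@mu2 R).

Lemma le_int_comb d (T : measurableType d) (m : {measure set T -> \bar R}) (D : set T)
    (A B C : T -> \bar R) (k l : R) : measurable D ->
  measurable_fun D A -> measurable_fun D B -> measurable_fun D C ->
  (forall x, D x -> 0 <= A x)%E -> (forall x, D x -> 0 <= B x)%E ->
  (forall x, D x -> 0 <= C x)%E -> 0 <= k -> 0 <= l ->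
  (forall x, D x -> A x <= k%:E * B x + l%:E * C x)%E ->
  (\int[m]_(x in D) A x <= k%:E * \int[m]_(x in D) B x + l%:E * \int[m]_(x in D) C x)%E.
Proof.
move=> mD mA mB mC A0 B0 C0 k0 l0 h.
rewrite -!ge0_integralZl//; try by rewrite lee_fin.
rewrite -ge0_integralD//.
- apply: ge0_le_integral => //.
  apply: emeasurable_funD; apply: measurable_funeM => //.
- by move=> x Dx; rewrite mule_ge0 ?lee_fin ?B0.
- exact: measurable_funeM.
- by move=> x Dx; rewrite mule_ge0 ?lee_fin ?C0.
- exact: measurable_funeM.
Qed.

Lemma measurable_int_fst a b (f : plane -> \bar R) : measurable_fun setT f ->
  (forall x, (0 <= f x)%E) ->
  measurable_fun setT (fun t : R => \int[mu]_(s in `[a, b[) f (s, t))%E.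
Proof.
move=> mf f0.
have mE : measurable (`[a, b[%classic `*` setT : set plane).
  by apply: measurableX; [exact: measurable_itv|exact: measurableT].
have := measurable_slice1 mE mf f0.
by congr (measurable_fun _ _); apply/funext => t; rewrite in_ysectionX ?inE.
Qed.

Variable g : R -> R.
Hypothesis cg : continuous g.

(** Built from a function [g] continuous on the whole line, the smooth extension of [H] in the
    application, so that [pull] is globally continuous; half-open in the first variable to match
    [box]. *)
Definition tube a b : set plane := [set x | a <= x.1 < b /\ - g x.1 < x.2 < g x.1].

Lemma cg_fst : continuous (fun x : R * R => g x.1).
Proof. by move=> x; apply: (@continuous_comp _ _ _ fst g); [exact: cvg_fst|exact: cg]. Qed.

Lemma measurable_tube a b : measurable (tube a b).
Proof.
have -> : tube a b = (`[a, b[%classic `*` setT) `&`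
    ([set x | - g x.1 - x.2 < 0] `&` [set x | x.2 - g x.1 < 0]).
  apply/seteqP; split => x /=.
    by move=> [h1 /andP[h2 h3]]; rewrite in_itv/=; split=> //; split; lra.
  by rewrite in_itv/= => -[[h1 _] [h2 h3]]; split=> //; apply/andP; split; lra.
have c2 : continuous (fun x : R * R => x.2) by move=> x; exact: cvg_snd.
have o (f : R * R -> R) : continuous f -> open [set x | f x < 0].
  by move=> cf; apply: (open_comp (D := [set y | y < 0]) (f := f)) => //; exact: open_lt.
apply: measurableI.
  by apply: measurableX; [exact: measurable_itv|exact: measurableT].
apply: measurableI; apply: open_measurable_plane; apply: o => x.
  by apply: cvgB; [apply: cvgN; exact: cg_fst|exact: c2].
by apply: cvgB; [exact: c2|exact: cg_fst].
Qed.

Lemma tube_xsection a b (s : R) : xsection (tube a b) s =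
  if s \in `[a, b[ then `](- g s), (g s)[%classic else set0.
Proof.
apply/seteqP; split => t; rewrite /xsection/= inE/=.
  by move=> [h1 h2]; rewrite in_itv/= h1/= in_itv.
by case: ifPn => //; rewrite in_itv/= in_itv/= => h1 h2.
Qed.

Lemma tube_slice a b (F : R * R -> R) : continuous F -> (forall x, 0 <= F x) ->
  (\int[mu2]_(x in tube a b) (F x)%:E =
   \int[mu]_(s in `[a, b[) (intv (- g s) (g s) (fun t => F (s, t)))%:E)%E.
Proof.
move=> cF F0; rewrite slice2; last 3 first.
- exact: measurable_tube.
- by apply/measurable_EFinP; exact: continuous_measurable_plane.
- by move=> x; rewrite lee_fin.
rewrite [RHS]integral_mkcond; apply: eq_integral => s _.
rewrite tube_xsection patchE; case: ifPn => h.
  rewrite mem_set//; rewrite intv_EFin; last exact: line_continuous2.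
  rewrite integral_itv_bndoo//.
  apply/measurable_EFinP; apply: measurable_funTS; apply: continuous_measurable_fun.
  exact: line_continuous2.
by rewrite integral_set0 memNset//=; apply/negP.
Qed.

(** Pull-back under the map from [(y, t)] to [(y, g y * t)], Jacobian included; the absolute value
    keeps the pull-back of a nonnegative [F] nonnegative where [g] is not. *)
Definition pull (F : R * R -> R) (x : R * R) : R := `|g x.1| * F (x.1, g x.1 * x.2).

Lemma continuous_pull F : continuous F -> continuous (pull F).
Proof.
move=> cF x; apply: cvgM.
  apply: (@continuous_comp _ _ _ (fun x : R * R => g x.1) (fun z : R => `|z|)).
    exact: cg_fst.
  exact: norm_continuous.
apply: (@continuous_comp _ _ _ (fun x : R * R => (x.1, g x.1 * x.2)) F); last exact: cF.
have A : (fun x : R * R => x.1) @ x --> x.1 by exact: cvg_fst.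
have B : (fun x : R * R => g x.1 * x.2) @ x --> g x.1 * x.2.
  by apply: cvgM; [exact: cg_fst|exact: cvg_snd].
exact: (cvg_pair A B).
Qed.

Lemma pull_tube a b (F : R * R -> R) : (forall y, a <= y <= b -> 0 < g y) ->
  continuous F -> (forall x, 0 <= F x) ->
  (\int[mu2]_(x in box a b (-1) 1) (pull F x)%:E = \int[mu2]_(x in tube a b) (F x)%:E)%E.
Proof.
move=> g0 cF F0; rewrite tube_slice// box_slice2; last 2 first.
- by apply/measurable_EFinP; apply: continuous_measurable_plane; exact: continuous_pull.
- by move=> x; rewrite lee_fin mulr_ge0.
apply: eq_integral => s; rewrite inE/= in_itv/= => /andP[h1 /ltW h2].
have gs : 0 < g s by apply: g0; rewrite h1.
rewrite itv_cto_cc; last by apply: line_continuous2; exact: continuous_pull.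
rewrite -(intv_scale gs) /pull/=; last exact: line_continuous2.
by rewrite gtr0_norm.
Qed.

End CuspTail.

(** * The tail estimate in the cusp for smooth functions *)

Section TailEstimate.
Context {R : realType}.
Local Notation plane := (measurableTypeR R * measurableTypeR R)%type.
Local Notation mu := (@lebesgue_measure R).
Local Notation mu2 := (@mu2 R).

Lemma continuous_energy (phi : R * R -> R) : smooth2 phi -> continuous (energy phi).
Proof.
move=> sphi.
have c i j : continuous (fun x => pd i j phi x ^+ 2).
  by move=> x; apply: continuousX_at; apply: smooth2_continuous; exact: smooth2_pd.
by move=> x; apply: cvgD; [apply: cvgD; [apply: cvgD; [exact: (c 0%N 0%N)|exact: c]|exact: c]|exact: c].
Qed.

Variables (g g1 I : R -> R) (r1 M : R).
Hypotheses (dg : forall y : R, is_derive y 1 g (g1 y)) (cg1 : continuous g1).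
Hypotheses (g1M : forall y, r1 <= y -> `|g1 y| <= M) (g_gt0 : forall y, r1 <= y -> 0 < g y)
  (g_decr : forall x y, r1 <= x -> x <= y -> g y <= g x).
Hypotheses (dI : forall y, r1 <= y -> is_derive y 1 I (g y)^-1) (I0 : 0 < I r1)
  (I_mono : forall y, r1 <= y -> I r1 <= I y).

Let cg : continuous g.
Proof. by move=> y; exact: (derive_continuous_at (dg y)). Qed.

Let cgf : continuous (fun x : R * R => g x.1) := cg_fst cg.

(** For the chain rule along the curve [(y, g y * t)]: [d] stands for the derivative of [g], bounded
    by [m]. *)
Lemma sq_alg (a b d t m : R) : `|d| <= m -> -1 <= t <= 1 ->
  (a + d * t * b) ^+ 2 <= 2 * (a ^+ 2 + m ^+ 2 * b ^+ 2).
Proof.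
move=> dm /andP[t1 t2].
have m0 : 0 <= m by exact: le_trans dm.
have h : (d * t) ^+ 2 <= m ^+ 2.
  rewrite -real_normK ?num_real// ler_pXn2r ?nnegrE// normrM.
  rewrite -[m]mulr1 ler_pM//.
  by rewrite ler_norml t1.
have h2 := ler_wpM2r (sqr_ge0 b) h.
have h3 := sqr_ge0 (a - d * t * b).
rewrite exprMn in h2 *.
have -> : (a + d * t * b) ^+ 2 = 2 * a ^+ 2 + 2 * ((d * t) ^+ 2 * b ^+ 2) - (a - d * t * b) ^+ 2.
  by ring.
by rewrite exprMn; lra.
Qed.

(** On the curve [(y, g y * t)] the weight [g ^+ 2] and the Jacobian make [g ^+ 3], the weight of
    [hardy_average], which is applied for each [t] and integrated in [t]. The factor 8 is 4 from
    Hardy times 2 from [sq_alg]. *)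
Lemma hardy_tube (e r Y : R) (psi : R * R -> R) : 0 <= e -> r1 + 1 <= r -> r <= Y ->
  (forall y, r <= y <= Y -> g y ^+ 4 * I y ^+ 2 <= e) -> smooth2 psi ->
  (\int[mu2]_(x in tube g r Y) (g x.1 ^+ 2 * psi x ^+ 2)%:E <=
   (2 * e / (I r1 * g (r1 + 1)))%:E * \int[mu2]_(x in tube g r1 (r1 + 1)%R) (psi x ^+ 2)%:E +
   (8 * e)%:E * \int[mu2]_(x in tube g r1 Y) (pd1 psi x ^+ 2 + M ^+ 2 * pd2 psi x ^+ 2)%:E)%E.
Proof.
move=> e0 r1r rY ge sp.
have cp := smooth2_continuous sp.
have cp1 := smooth2_continuous (smooth2_pd1 sp).
have cp2 := smooth2_continuous (smooth2_pd2 sp).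
have g10 : 0 < g (r1 + 1) by apply: g_gt0; rewrite lerDl.
pose F1 x := g x.1 ^+ 2 * psi x ^+ 2.
pose F2 x := psi x ^+ 2.
pose F3 x := pd1 psi x ^+ 2 + M ^+ 2 * pd2 psi x ^+ 2.
have cF2 : continuous F2 by move=> x; apply: continuousX_at; exact: cp.
have cF1 : continuous F1.
  by move=> x; apply: cvgM; [apply: continuousX_at; exact: cgf|exact: cF2].
have cF3 : continuous F3.
  move=> x; apply: cvgD; first by apply: continuousX_at; exact: cp1.
  by apply: cvgM; [exact: cvg_cst|apply: continuousX_at; exact: cp2].
have F10 x : 0 <= F1 x by rewrite mulr_ge0 ?sqr_ge0.
have F20 x : 0 <= F2 x by exact: sqr_ge0.
have F30 x : 0 <= F3 x.
  by apply: addr_ge0; [exact: sqr_ge0|apply: mulr_ge0; exact: sqr_ge0].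
have r1r' : r1 <= r by lra.
have gp a b : r1 <= a -> forall y, a <= y <= b -> 0 < g y.
  by move=> h y /andP[h1 _]; apply: g_gt0; exact: le_trans h h1.
rewrite -(pull_tube cg (gp r Y r1r') cF1 F10) -(pull_tube cg (gp r1 (r1 + 1) (lexx r1)) cF2 F20).
rewrite -(pull_tube cg (gp r1 Y (lexx r1)) cF3 F30).
have mP (F : R * R -> R) : continuous F -> measurable_fun setT ((fun x => (pull g F x)%:E) : plane -> \bar R).
  move=> cF; apply/measurable_EFinP; apply: continuous_measurable_plane.
  exact: continuous_pull.
have P0 (F : R * R -> R) : (forall x, 0 <= F x) -> forall x : plane, (0 <= (pull g F x)%:E)%E.
  by move=> h x; rewrite lee_fin mulr_ge0.
rewrite (box_slice1 _ _ _ _ (mP _ cF1) (P0 _ F10)) (box_slice1 _ _ _ _ (mP _ cF2) (P0 _ F20)).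
rewrite (box_slice1 _ _ _ _ (mP _ cF3) (P0 _ F30)).
have k0 : 0 <= 2 * e / (I r1 * g (r1 + 1)) by rewrite divr_ge0 ?mulr_ge0// ltW.
have l0 : 0 <= 8 * e by rewrite mulr_ge0.
have mI (F : R * R -> R) (a b : R) : continuous F -> (forall x, 0 <= F x) ->
    measurable_fun (`[-1, 1[%classic : set (measurableTypeR R)) (fun t : measurableTypeR R => \int[mu]_(s in `[a, b[) (pull g F (s, t))%:E)%E.
  move=> cF F0; apply: measurable_funTS.
  exact: (measurable_int_fst a b (mP F cF) (P0 F F0)).
apply: le_int_comb.
- exact: measurable_itv.
- exact: mI.
- exact: mI.
- exact: mI.
- by move=> t _; apply: integral_ge0 => s _; exact: P0.
- by move=> t _; apply: integral_ge0 => s _; exact: P0.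
- by move=> t _; apply: integral_ge0 => s _; exact: P0.
- exact: k0.
- exact: l0.
move=> t; rewrite /= in_itv/= => /andP[t1 /ltW t2].
have cl F : continuous F -> continuous (fun s => pull g F (s, t)).
  by move=> cF; apply: line_continuous1; exact: continuous_pull.
rewrite !itv_cto_cc; [|exact: cl|exact: cl|exact: cl].
rewrite -!EFinM -EFinD lee_fin.
pose c y := g y * t.
have dc (y : R) : is_derive y 1 c (g1 y * t).
  have [h4 h5] := is_deriveZ t (dg y).
  have -> : c = (t \*: g)%R by apply/funext => z; rewrite /c mulrC.
  by apply: DeriveDef; [exact: h4|rewrite [LHS]h5 /GRing.scale/= mulrC].
have dal (y : R) := is_derive_curve sp (dc y).
have cc : continuous (fun y : R => (y, c y)).
  move=> y; have A : (fun y : R => y) @ y --> y by exact: cvg_id.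
  have B : c @ y --> c y by exact: (derive_continuous_at (dc y)).
  exact: (cvg_pair A B).
have ccF (F : R * R -> R) : continuous F -> continuous (fun y => F (y, c y)).
  by move=> cF y; apply: (@continuous_comp _ _ _ (fun y : R => (y, c y)) F); [exact: cc|exact: cF].
have cal1 : continuous (fun y => pd1 psi (y, c y) + g1 y * t * pd2 psi (y, c y)).
  apply: contD; first exact: ccF.
  by apply: contM; [apply: contM; [exact: cg1|exact: cont_cst]|exact: ccF].
have h1 y : r1 <= y <= Y -> is_derive y 1 I (g y)^-1 by move=> /andP[h _]; exact: dI.
have h2 y : r1 <= y <= Y -> 0 < g y by move=> /andP[h _]; exact: g_gt0.
have h3 y : r1 <= y <= Y -> I r1 <= I y by move=> /andP[h _]; exact: I_mono.
have h4 y : r1 <= y <= r1 + 1 -> g (r1 + 1) <= g y by move=> /andP[h h']; exact: g_decr.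
have hh := hardy_average r1r rY e0 h1 h2 I0 h3 h4 ge cg dal cal1.
apply: (le_trans hh) => {hh}.
pose B : R := intv r1 (r1 + 1) (fun s => pull g F2 (s, t)).
pose C : R := intv r1 Y (fun y => `|g y| * (pd1 psi (y, c y) + g1 y * t * pd2 psi (y, c y)) ^+ 2).
pose D : R := intv r1 Y (fun s => pull g F3 (s, t)).
change (2 * e * ((I r1 * g (r1 + 1))^-1 * B + 2 * C) <= 2 * e / (I r1 * g (r1 + 1)) * B + 8 * e * D).
have CD : C <= 2 * D.
  rewrite /C /D -intvZ; last exact: cl.
  have cng : continuous (fun y => `|g y|).
    by move=> y; apply: (@continuous_comp _ _ _ g (fun z : R => `|z|)); [exact: cg|exact: norm_continuous].
  apply: le_intv.
  - by apply: contM => //; exact: contX.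
  - by apply: contM; [exact: cont_cst|exact: cl].
  move=> y /andP[y1 _]; rewrite /pull/= [2 * _]mulrCA.
  apply: ler_wpM2l => //; apply: sq_alg; last by rewrite t1.
  exact: g1M.
have := ler_wpM2l e0 CD; move: k0 l0 CD; move: B C D => B C D _ _ _.
have -> : 2 * e * ((I r1 * g (r1 + 1))^-1 * B + 2 * C) =
  2 * e / (I r1 * g (r1 + 1)) * B + 4 * (e * C) by ring.
by rewrite lerD2l => hh; lra.
Qed.

Lemma measurable_tube_int (a b : R) (F : R * R -> R) : continuous F -> (forall x, 0 <= F x) ->
  measurable_fun (`[a, b[%classic : set (measurableTypeR R)) (fun s : measurableTypeR R => (intv (- g s) (g s) (fun t => F (s, t)))%:E).
Proof.
move=> cF F0.
have mF : measurable_fun setT ((fun x => (F x)%:E) : plane -> \bar R).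
  by apply/measurable_EFinP; exact: continuous_measurable_plane.
have F0' x : (0 <= (F x)%:E)%E by rewrite lee_fin.
have h := measurable_slice2 (measurable_tube cg a b) mF F0'.
apply: (eq_measurable_fun _ _ (measurable_funTS h)) => s sin.
rewrite tube_xsection ifT; last by move: sin; rewrite inE.
rewrite intv_EFin; last exact: line_continuous2.
rewrite integral_itv_bndoo//.
apply/measurable_EFinP; apply: measurable_funTS; apply: continuous_measurable_fun.
exact: line_continuous2.
Qed.

(** Controls the starting term of Hardy's inequality. The sections have length [2 * g s], between
    [2 * g (r1 + 1)] and [2 * g r1]; each summand of [l * C1 l = 216 / l ^+ 2 + 2 * l ^+ 2] is
    estimated at its worst end. *)
Lemma interp_tube (phi : R * R -> R) : smooth2 phi ->
  (\int[mu2]_(x in tube g r1 (r1 + 1)%R) (pd2 phi x ^+ 2)%:E <=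
   (216 / (2 * g (r1 + 1)) ^+ 2 + 2 * (2 * g r1) ^+ 2)%:E *
     \int[mu2]_(x in tube g r1 (r1 + 1)%R) (energy phi x)%:E)%E.
Proof.
move=> sphi; have sp2 := smooth2_pd2 sphi; have sp22 := smooth2_pd2 sp2.
have c0 := smooth2_continuous sphi; have c1 := smooth2_continuous sp2.
have c2 := smooth2_continuous sp22.
have cE := continuous_energy sphi.
have csq (f : R * R -> R) : continuous f -> continuous (fun x => f x ^+ 2).
  by move=> cf x; apply: continuousX_at; exact: cf.
have r11 : r1 <= r1 + 1 by rewrite lerDl.
have ga := g_gt0 (lexx r1); have gb := g_gt0 r11.
set K := 216 / (2 * g (r1 + 1)) ^+ 2 + 2 * (2 * g r1) ^+ 2.
have K0 : 0 <= K.
  by apply: addr_ge0; [apply: divr_ge0 => //; exact: sqr_ge0|apply: mulr_ge0 => //; exact: sqr_ge0].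
have kE (s : R) : continuous (fun t => K * energy phi (s, t)).
  by apply: contM; [exact: cont_cst|exact: line_continuous2].
rewrite -ge0_integralZl//; last 3 first.
- exact: measurable_tube.
- by apply/measurable_EFinP; apply: measurable_funTS; exact: continuous_measurable_plane.
- by move=> x _; rewrite lee_fin energy_ge0.
under [X in (_ <= X)%E]eq_integral do rewrite -EFinM.
have cKE : continuous (fun x => K * energy phi x).
  by move=> x; apply: cvgM; [exact: cvg_cst|exact: cE].
rewrite (tube_slice cg _ _ (csq _ c1)); last by move=> x; exact: sqr_ge0.
rewrite (tube_slice cg _ _ cKE); last by move=> x; rewrite mulr_ge0 ?energy_ge0.
apply: ge0_le_integral.
- exact: measurable_itv.
- by move=> s _; rewrite lee_fin intv_ge0// => t; exact: sqr_ge0.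
- have hh := measurable_tube_int (a := r1) (b := r1 + 1) (csq _ c1) (fun x => sqr_ge0 _).
  exact: hh.
- by apply: (measurable_tube_int cKE) => x; rewrite mulr_ge0 ?energy_ge0.
move=> s; rewrite /= in_itv/= => /andP[s1 /ltW s2]; rewrite lee_fin.
have gs := g_gt0 s1.
have gsb : g (r1 + 1) <= g s by exact: g_decr.
have gsa : g s <= g r1 by exact: g_decr.
have gg : - g s < g s by lra.
have l0 := line_continuous2 (s := s) c0.
have l1 := line_continuous2 (s := s) c1.
have l2 := line_continuous2 (s := s) c2.
have := interp1_int gg (fun t => smooth2_line2 s t sphi) (fun t => smooth2_line2 s t sp2) l0 l1 l2.
have -> : g s - - g s = 2 * g s by ring.
move=> hh; apply: (le_trans hh) => {hh}.
have I00 : 0 <= intv (- g s) (g s) (fun t => phi (s, t) ^+ 2).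
  by apply: intv_ge0 => t; exact: sqr_ge0.
have I20 : 0 <= intv (- g s) (g s) (fun t => pd2 (pd2 phi) (s, t) ^+ 2).
  by apply: intv_ge0 => t; exact: sqr_ge0.
have hK : 2 * g s * C1 (2 * g s) <= K.
  have -> : 2 * g s * C1 (2 * g s) = 216 / (2 * g s) ^+ 2 + 2 * (2 * g s) ^+ 2.
    by rewrite /C1; field; rewrite gt_eqF// mulr_gt0.
  apply: lerD.
    apply: ler_wpM2l => //; rewrite lef_pV2 ?posrE ?exprn_gt0 ?mulr_gt0//.
    by rewrite ler_pXn2r ?nnegrE ?mulr_ge0 ?(ltW gs) ?(ltW gb)// ler_pM2l.
  apply: ler_wpM2l => //.
  by rewrite ler_pXn2r ?nnegrE ?mulr_ge0 ?(ltW gs) ?(ltW ga)// ler_pM2l.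
apply: (le_trans (ler_wpM2r (addr_ge0 I00 I20) hK)).
rewrite (intvZ _ _ _ (line_continuous2 (s := s) cE)); apply: ler_wpM2l => //.
rewrite -intvD; [|exact: contX|exact: contX].
apply: le_intv; [by apply: contD; exact: contX|exact: line_continuous2|].
by move=> t _; exact: le_sq24.
Qed.

(** A value on the section differs from the boundary value [phi (y, sg * g y)] by an increment over
    a length of at most [2 * g y], and integrating over the section costs the same factor again. The
    boundary integral stays, because approximants need not vanish on the boundary. *)
Lemma trace_tube (r Y sg : R) (phi : R * R -> R) : r1 <= r -> sg = 1 \/ sg = -1 -> smooth2 phi ->
  (\int[mu2]_(x in tube g r Y) (phi x ^+ 2)%:E <=
   (4 * g r1)%:E * \int[mu]_(y in `[r, Y[) (phi (y, sg * g y) ^+ 2)%:E +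
   8%:E * \int[mu2]_(x in tube g r Y) (g x.1 ^+ 2 * pd2 phi x ^+ 2)%:E)%E.
Proof.
move=> r1r hsg sphi; have sp2 := smooth2_pd2 sphi.
have c0 := smooth2_continuous sphi; have c1 := smooth2_continuous sp2.
pose F1 x := phi x ^+ 2; pose F2 x := g x.1 ^+ 2 * pd2 phi x ^+ 2.
have cF1 : continuous F1 by move=> x; apply: continuousX_at; exact: c0.
have cF2 : continuous F2.
  move=> x; apply: cvgM; first by apply: continuousX_at; exact: cgf.
  by apply: continuousX_at; exact: c1.
have F10 x : 0 <= F1 x by exact: sqr_ge0.
have F20 x : 0 <= F2 x by rewrite mulr_ge0 ?sqr_ge0.
rewrite (tube_slice cg _ _ cF1 F10) (tube_slice cg _ _ cF2 F20).
have cb : continuous (fun y => phi (y, sg * g y) ^+ 2).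
  apply: contX => y.
  apply: (@continuous_comp _ _ _ (fun y : R => (y, sg * g y)) phi); last exact: c0.
  have A : (fun y : R => y) @ y --> y by exact: cvg_id.
  have B : (fun y => sg * g y) @ y --> sg * g y by apply: cvgM; [exact: cvg_cst|exact: cg].
  exact: (cvg_pair A B).
have gr1 := g_gt0 (lexx r1).
apply: le_int_comb.
- exact: measurable_itv.
- exact: (measurable_tube_int cF1 F10).
- by apply/measurable_EFinP; apply: measurable_funTS; exact: continuous_measurable_fun.
- exact: (measurable_tube_int cF2 F20).
- by move=> y _; rewrite lee_fin intv_ge0// => t; exact: F10.
- by move=> y _; rewrite lee_fin sqr_ge0.
- by move=> y _; rewrite lee_fin intv_ge0// => t; exact: F20.
- by rewrite mulr_ge0// ltW.
- by [].
move=> y; rewrite /= in_itv/= => /andP[y1 _]; rewrite -!EFinM -EFinD lee_fin.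
have ry : r1 <= y := le_trans r1r y1.
have gy := g_gt0 ry.
have gyr : g y <= g r1 by exact: g_decr.
have gg : - g y <= g y by lra.
have l0 := line_continuous2 (s := y) c0.
have l1 := line_continuous2 (s := y) c1.
pose J := intv (- g y) (g y) (fun t => pd2 phi (y, t) ^+ 2).
have -> : intv (- g y) (g y) (fun t => F2 (y, t)) = g y ^+ 2 * J.
  by rewrite /J -intvZ//; exact: contX.
pose b := phi (y, sg * g y).
have J0 : 0 <= J by apply: intv_ge0 => t; exact: sqr_ge0.
have pw t : - g y <= t <= g y -> F1 (y, t) <= 2 * b ^+ 2 + 2 * ((2 * g y) * J).
  move=> tin; have sin : - g y <= sg * g y <= g y.
    by case: hsg => ->; rewrite ?mul1r ?mulN1r lexx gg.
  have := sq_increment (fun t => smooth2_line2 y t sphi) l1 tin sin.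
  rewrite -/J -/b /F1 (_ : g y - - g y = 2 * g y); last by ring.
  set u := phi _; set Q := 2 * _ * _ => hQ.
  have := sqr_ge0 (u - 2 * b); have -> : u ^+ 2 = 2 * b ^+ 2 + 2 * (u - b) ^+ 2 - (u - 2 * b) ^+ 2 by ring.
  by move=> h; lra.
apply: (le_trans (le_intv (line_continuous2 (s := y) cF1) (@cont_cst _ _) pw)).
rewrite intv_cst// -/b.
have b2 := ler_wpM2r (sqr_ge0 b) gyr.
have -> : (2 * b ^+ 2 + 2 * ((2 * g y) * J)) * (g y - - g y) =
  4 * (g y * b ^+ 2) + 8 * (g y ^+ 2 * J) by ring.
by rewrite lerD2r -mulrA ler_pM2l.
Qed.

Lemma chain_ereal (X W P Q En B : \bar R) (c k l a b : R) : (0 <= En)%E ->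
  0 <= c -> 0 <= k -> 0 <= l -> 0 <= a -> 0 <= b ->
  (X <= B + c%:E * W -> W <= k%:E * P + l%:E * Q -> P <= a%:E * En -> Q <= b%:E * En ->
  X <= B + (c * (k * a + l * b))%:E * En)%E.
Proof.
move=> En0 c0 k0 l0 a0 b0 hX hW hP hQ; apply: (le_trans hX); apply: leeD2l.
rewrite EFinM -muleA; apply: lee_wpmul2l; first by rewrite lee_fin.
apply: (le_trans hW); rewrite EFinD ge0_muleDl ?lee_fin ?mulr_ge0//.
rewrite !EFinM -!muleA.
by apply: leeD; apply: lee_wpmul2l; rewrite ?lee_fin.
Qed.

(** [trace_tube], then [hardy_tube] for [pd2 phi], then [interp_tube] for its starting term. [K] is
    fixed before [r] and [Y]: all smallness sits in [e], and [Y] may later tend to infinity. *)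
Lemma tube_tail : exists2 K, 0 <= K & forall (e r Y sg : R) (phi : R * R -> R), 0 <= e ->
  r1 + 1 <= r -> r <= Y -> (forall y, r <= y <= Y -> g y ^+ 4 * I y ^+ 2 <= e) ->
  sg = 1 \/ sg = -1 -> smooth2 phi ->
  (\int[mu2]_(x in tube g r Y) (phi x ^+ 2)%:E <=
   (4 * g r1)%:E * \int[mu]_(y in `[r, Y[) (phi (y, sg * g y) ^+ 2)%:E +
   (e * K)%:E * \int[mu2]_(x in tube g r1 Y) (energy phi x)%:E)%E.
Proof.
have r11 : r1 <= r1 + 1 by rewrite lerDl.
have ga := g_gt0 (lexx r1); have gb := g_gt0 r11.
pose a := 216 / (2 * g (r1 + 1)) ^+ 2 + 2 * (2 * g r1) ^+ 2.
have a0 : 0 <= a.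
  by apply: addr_ge0; [apply: divr_ge0 => //; exact: sqr_ge0|apply: mulr_ge0 => //; exact: sqr_ge0].
pose k := 2 / (I r1 * g (r1 + 1)).
have k0 : 0 <= k by rewrite divr_ge0 ?mulr_ge0// ltW.
have b0 : 0 <= 1 + M ^+ 2 by rewrite addr_ge0 ?sqr_ge0.
exists (8 * (k * a + 8 * (1 + M ^+ 2))).
  by apply: mulr_ge0 => //; apply: addr_ge0; exact: mulr_ge0.
move=> e r Y sg phi e0 r1r rY ge hsg sphi.
have r1r' : r1 <= r by lra.
have -> : e * (8 * (k * a + 8 * (1 + M ^+ 2))) = 8 * ((2 * e / (I r1 * g (r1 + 1))) * a + 8 * e * (1 + M ^+ 2)).
  by rewrite /k; ring.
have sp2 := smooth2_pd2 sphi.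
have cE := continuous_energy sphi.
have mE : measurable_fun setT ((fun x => (energy phi x)%:E) : plane -> \bar R).
  by apply/measurable_EFinP; exact: measurable_energy.
apply: (chain_ereal (En := \int[mu2]_(x in tube g r1 Y) (energy phi x)%:E)
  _ _ _ _ a0 b0 (trace_tube Y r1r' hsg sphi) (hardy_tube e0 r1r rY ge sp2)).
- exact: energy_int0.
- by [].
- by rewrite divr_ge0 ?mulr_ge0// ltW.
- by rewrite mulr_ge0.
- apply: (le_trans (interp_tube sphi)); apply: lee_wpmul2l; first by rewrite lee_fin.
  apply: ge0_subset_integral.
  + exact: measurable_tube.
  + exact: measurable_tube.
  + exact: measurable_funTS.
  + by move=> x _; rewrite lee_fin energy_ge0.
  + move=> x [/andP[h1 h2] h3]; split=> //; rewrite h1/=.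
    by apply: (lt_le_trans h2); apply: le_trans rY.
rewrite -ge0_integralZl//; last 3 first.
- exact: measurable_tube.
- exact: measurable_funTS.
- by move=> x _; rewrite lee_fin energy_ge0.
apply: ge0_le_integral.
- exact: measurable_tube.
- by move=> x _; rewrite lee_fin; apply: addr_ge0; [exact: sqr_ge0|apply: mulr_ge0; exact: sqr_ge0].
- apply/measurable_EFinP; apply: measurable_funTS; apply: continuous_measurable_plane => x.
  apply: cvgD; first by apply: continuousX_at; apply: smooth2_continuous; exact: smooth2_pd1.
  apply: cvgM; first exact: cvg_cst.
  by apply: continuousX_at; apply: smooth2_continuous; exact: smooth2_pd2.
- apply: measurable_funTS; apply/measurable_EFinP; apply: continuous_measurable_plane => x.
  by apply: cvgM; [exact: cvg_cst|exact: cE].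
move=> x _; rewrite -EFinM lee_fin /energy.
have := sqr_ge0 (phi x); have := sqr_ge0 (pd 2 0 phi x).
have := sqr_ge0 (pd 1 1 phi x); have := sqr_ge0 (pd 0 2 phi x).
rewrite -[pd1 (pd2 phi)]/(pd 1 1 phi) -[pd2 (pd2 phi)]/(pd 0 2 phi).
have := sqr_ge0 M; move: (phi x) (pd 2 0 phi x) (pd 1 1 phi x) (pd 0 2 phi x).
move=> p1 p2 p3 p4 h0 h4 h3 h2 h1.
have := mulr_ge0 h0 h1; have := mulr_ge0 h0 h2; have := mulr_ge0 h0 h3; lra.
Qed.

End TailEstimate.

Section Cusp.
Context {R : realType}.
Local Notation plane := (measurableTypeR R * measurableTypeR R)%type.
Local Notation mu := (@lebesgue_measure R).
Local Notation mu2 := (@mu2 R).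

Lemma pinfty_ge (P : R -> Prop) (M : R) : (\forall y \near +oo, P y) ->
  exists2 r, M <= r & forall y, r <= y -> P y.
Proof.
move=> [A [_ hA]]; exists (Num.max M (A + 1)); first by rewrite le_max lexx.
move=> y; rewrite ge_max => /andP[_ h]; apply: hA; apply: lt_le_trans h.
by rewrite ltrDl.
Qed.

Lemma smooth1_derive (f : R -> R) (x : R) : smooth1 f -> is_derive x 1 f (derive1 f x).
Proof.
by move=> sf; apply: DeriveDef; [exact: (sf 0%N)|rewrite derive1E].
Qed.

Lemma smooth1_derive1 (f : R -> R) : smooth1 f -> smooth1 (derive1 f).
Proof.
move=> sf n x; have := sf n.+1 x.
by rewrite /derive1n iterSr.
Qed.

(** [H ^- 3 * G_] is the inverse of [4 * (g ^+ 4 * I ^+ 2)], so its divergence is the smallness that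
    [tube_tail] asks for. The lower bound [m] allows [r] to be pushed beyond the point where the
    trace condition starts. *)
Lemma cusp_tail (y0 : R) (H g : R -> R) :
  (forall y, y0 <= y -> 0 < H y) -> smooth1 g -> (forall y, y0 <= y -> H y = g y) ->
  (forall y1 y2, y0 <= y1 -> y1 <= y2 -> H y2 <= H y1) ->
  derive1 H y @[y --> +oo] --> (0 : R) ->
  H y ^- 3 * G_ y0 H y @[y --> +oo] --> +oo ->
  exists2 r1, y0 < r1 & forall e m, 0 < e -> exists2 r, r1 + 1 <= r /\ m <= r & forall (Y sg : R) phi,
    r <= Y -> sg = 1 \/ sg = -1 -> smooth2 phi ->
    (\int[mu2]_(x in tube g r Y) (phi x ^+ 2)%:E <=
     (4 * g r1)%:E * \int[mu]_(y in `[r, Y[) (phi (y, sg * g y) ^+ 2)%:E +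
     e%:E * \int[mu2]_(x in tube g r1 Y) (energy phi x)%:E)%E.
Proof.
move=> H0 sg_ Hg Hdecr Hd Gl.
have dg (y : R) : is_derive y 1 g (derive1 g y) := smooth1_derive y sg_.
have cg : continuous g by move=> y; exact: (derive_continuous_at (dg y)).
have cg1 : continuous (derive1 g).
  by move=> y; exact: (derive_continuous_at (smooth1_derive y (smooth1_derive1 sg_))).
have g0 y : y0 <= y -> 0 < g y by move=> h; rewrite -Hg//; exact: H0.
(* [r1] is taken strictly beyond [y0], where [H] and [g] have the same derivative and the integral
   [I r1] is positive. *)
have [r1 y0r1 hr1] : exists2 r1, y0 + 1 <= r1 & forall y, r1 <= y -> `|derive1 g y| <= 1.
  have [r hr1 hr2] := pinfty_ge (y0 + 1) ((cvgr0Pnorm_le _).1 Hd 1 ltr01).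
  exists r => // y ry; have := hr2 y ry.
  rewrite !derive1E (near_eq_derive (g := g))//.
  have y0y : y0 < y by lra.
  by near=> z; apply: Hg; apply: ltW; near: z; exact: lt_nbhsr.
have y0r : y0 < r1 by lra.
exists r1 => // e m e0.
(* Freezing the argument below [y0] makes the integrand continuous on the whole line, as
   [primitive_derive] requires, and does not change integrals starting at [y0]. *)
pose f t := (g (Num.max y0 t))^-1.
have f0 t : 0 <= f t by rewrite invr_ge0 ltW// g0// le_max lexx.
have cf : continuous f.
  move=> t; apply: cvgV; first by rewrite gt_eqF// g0// le_max lexx.
  apply: (@continuous_comp _ _ _ (fun t => Num.max y0 t) g); last exact: cg.
  by apply: continuous_max; [exact: cvg_cst|exact: cvg_id].
pose I y := intv y0 y f.
have IE y : intv y0 y (fun t => (H t)^-1) = I y.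
  apply: eq_Rintegral => t; rewrite inE/= in_itv/= => /andP[h _].
  by rewrite /f max_r// Hg.
have dI y : r1 <= y -> is_derive y 1 I (g y)^-1.
  move=> h; have hy : y0 < y by lra.
  by have := primitive_derive hy cf; rewrite /f max_r// ltW.
have I_mono y : r1 <= y -> I r1 <= I y by move=> h; exact: intv_sub.
have I0 : 0 < I r1.
  apply: (@lt_le_trans _ _ (intv y0 r1 (fun _ => (g y0)^-1))).
    by rewrite intv_cst ?(ltW y0r)// mulr_gt0 ?invr_gt0 ?g0 ?subr_gt0.
  apply: le_intv => //; first exact: cont_cst.
  move=> t /andP[h1 h2]; rewrite /f max_r// lef_pV2 ?posrE ?g0//.
  by rewrite -!Hg//; exact: Hdecr.
have g_gt0 y : r1 <= y -> 0 < g y by move=> h; apply: g0; lra.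
have g_decr x y : r1 <= x -> x <= y -> g y <= g x.
  by move=> h1 h2; have h3 : y0 <= x by [lra]; rewrite -!Hg//; [exact: Hdecr|lra].
have [K K0 hK] := tube_tail dg cg1 hr1 g_gt0 g_decr dI I0 I_mono.
pose d := e / (K + 1).
have d0 : 0 < d by rewrite divr_gt0// ltr_wpDl.
have [r hrm hr2] := pinfty_ge (Num.max (r1 + 1) m) ((cvgryPge _).1 Gl (4 * d)^-1).
move: hrm; rewrite ge_max => /andP[hr hm].
exists r => // Y sg phi rY hsg sphi.
have hd y : r <= y <= Y -> g y ^+ 4 * I y ^+ 2 <= d.
  move=> /andP[ry _]; have := hr2 y ry; rewrite /G_.
  have ry1 : r1 <= y by lra.
  have y0y : y0 <= y by lra.
  have Iy : 0 < I y by exact: lt_le_trans (I_mono y ry1).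
  have gy := g_gt0 y ry1.
  rewrite -[Rintegral _ _ _]/(intv y0 y (fun t => (H t)^-1)) IE Hg//.
  have -> : g y ^- 3 * ((4 * g y)^-1 * I y ^- 2) = (4 * (g y ^+ 4 * I y ^+ 2))^-1.
    by field; rewrite !gt_eqF.
  have p1 : 0 < 4 * (g y ^+ 4 * I y ^+ 2) by rewrite !mulr_gt0 ?exprn_gt0.
  have p2 : 0 < 4 * d by apply: mulr_gt0.
  by rewrite lef_pV2 ?posrE// ler_pM2l.
apply: (le_trans (hK d r Y sg phi (ltW d0) hr rY hd hsg sphi)).
apply: leeD2l; apply: lee_wpmul2r; first exact: energy_int0.
rewrite lee_fin /d mulrAC ler_pdivrMr ?ltr_wpDl//.
by apply: ler_wpM2l; [exact: ltW|rewrite lerDl].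
Unshelve. all: by end_near. Qed.

End Cusp.

(** * Test functions and uniqueness of weak derivatives *)

Section Bump.
Context {R : realType}.

Lemma quadratic_is_derive0 (f : R -> R) (C : R) : (forall h, `|f h| <= C * h ^+ 2) ->
  is_derive (0 : R) 1 f 0.
Proof.
move=> fC.
have f0 : f 0 = 0.
  by apply/eqP; rewrite -normr_eq0 eq_le normr_ge0 andbT; have := fC 0; rewrite expr0n/= mulr0.
have C0 : 0 <= C by have := fC 1; rewrite expr1n mulr1; exact: le_trans.
have lim0 : (fun h : R => h^-1 *: ((f \o shift 0) (h *: 1) - f 0)) @ 0^' --> (0 : R).
  apply/cvgr0Pnorm_le => e e0; near=> h.
  have h0 : h != 0 by near: h; exact: nbhs_dnbhs_neq.
  rewrite /= f0 subr0 addr0 /GRing.scale/= mulr1 normrM normfV.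
  rewrite mulrC ler_pdivrMr ?normr_gt0//.
  apply: (le_trans (fC h)); rewrite -real_normK ?num_real// expr2 mulrA.
  apply: ler_wpM2r => //.
  have hd : `|h| <= e / (C + 1).
    near: h; apply: dnbhs0_le; rewrite divr_gt0// ltr_wpDl//.
  apply: (le_trans (ler_wpM2l C0 hd)).
  by rewrite mulrA ler_pdivrMr ?ltr_wpDl// mulrC ler_wpM2l ?(ltW e0)// lerDl.
apply: DeriveDef; first by apply/cvg_ex; exists 0.
exact: (cvg_lim _ lim0).
Unshelve. all: by end_near. Qed.

(* The functions [x^-n exp(-1/x)], extended by [0], span a space stable under
   differentiation. *)
Definition flat (n : nat) (x : R) : R := if 0 < x then x ^- n * expR (- x^-1) else 0.

Lemma flat_ge0 n x : 0 <= flat n x.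
Proof.
rewrite /flat; case: ifP => // x0.
by rewrite mulr_ge0 ?expR_ge0// invr_ge0 exprn_ge0// ltW.
Qed.

Lemma flat0_le1 x : flat 0 x <= 1.
Proof.
rewrite /flat; case: ifP => // x0; rewrite expr0 invr1 mul1r.
by rewrite -[leRHS]expR0 ler_expR oppr_le0 invr_ge0 ltW.
Qed.

(** [expR x^-1] exceeds its Taylor term of order [n.+2]; the two powers beyond [n] leave [x ^+ 2],
    so that the derivative at the gluing point 0 vanishes. *)
Lemma flat_quadratic n x : `|flat n x| <= (n.+2)`!%:R * x ^+ 2.
Proof.
rewrite ger0_norm ?flat_ge0// /flat; case: ifP => x0; last by rewrite mulr_ge0 ?sqr_ge0.
have y0 : 0 <= x^-1 by rewrite invr_ge0 ltW.
have f0 : 0 < (n.+2)`!%:R :> R by rewrite ltr0n fact_gt0.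
have h := expR_ge1Dxn n.+1 y0.
have h1 : x^-1 ^+ n.+2 / (n.+2)`!%:R <= expR (x^-1) by apply: le_trans h; rewrite lerDr.
have e0 := expR_gt0 x^-1.
rewrite expRN ler_pdivrMr//.
rewrite ler_pdivrMr// in h1.
rewrite -exprVn -[leRHS]mulrA [leRHS]mulrCA [X in _ <= _ * X]mulrC.
have -> : x^-1 ^+ n = x ^+ 2 * x^-1 ^+ n.+2.
  by rewrite !exprS; field; rewrite gt_eqF.
by apply: ler_wpM2l; [exact: sqr_ge0|].
Qed.

Lemma flat_is_derive n (x : R) : is_derive x 1 (flat n) (flat n.+2 x - n%:R * flat n.+1 x).
Proof.
have [x0|x0|->] := ltgtP x 0.
- rewrite /flat ifF; last by apply/negbTE; rewrite -leNgt ltW.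
  rewrite ifF; last by apply/negbTE; rewrite -leNgt ltW.
  rewrite mulr0 subr0.
  apply: (near_eq_is_derive (f := cst 0) _ (is_derive_cst 0 x 1)).
  near=> y; rewrite ifF//; apply/negbTE; rewrite -leNgt ltW//.
  by near: y; exact: lt_nbhsl.
- rewrite /flat x0.
  have xn0 : x != 0 by rewrite gt_eqF.
  apply: (near_eq_is_derive (f := fun y : R => (y^-1) ^+ n * expR (- y^-1))).
    near=> y; rewrite ifT ?exprVn//.
    by near: y; exact: lt_nbhsr.
  have dv : is_derive x 1 (fun y : R => y^-1) (- x ^- 2).
    have [h4 h5] := is_deriveV (f := id) (x := x) (v := 1) xn0 (is_derive_id x 1).
    by apply: DeriveDef; [exact: h4|rewrite [LHS]h5 /GRing.scale/= mulr1].
  have dvn : is_derive x 1 (fun y : R => - y^-1) (x ^- 2).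
    have [h4 h5] := is_deriveN dv.
    by apply: DeriveDef; [exact: h4|rewrite [LHS]h5 opprK].
  have de : is_derive x 1 (fun y => expR (- y^-1)) (expR (- x^-1) * x ^- 2).
    exact: (is_derive1_comp (is_derive_expR _) dvn).
  have dp : is_derive x 1 (fun y : R => (y^-1) ^+ n) (n%:R * (x^-1) ^+ n.-1 * - x ^- 2).
    have [h4 h5] := is_deriveX n dv; rewrite exprfctE in h4 h5.
    by apply: DeriveDef; [exact: h4|rewrite [LHS]h5 /GRing.scale/= -mulr_natl].
  have [h4 h5] := is_deriveM dp de.
  apply: DeriveDef; first exact: h4.
  rewrite [LHS]h5 /GRing.scale/= {h4 h5 dp de dvn dv}.
  case: n => [|n].
    by rewrite !mul0r mulr0 addr0 subr0 expr0 mul1r mulrC.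
  rewrite -!exprVn /=; move: (x^-1) (expR _) => v E; rewrite !exprS; ring.
- rewrite /flat ltxx mulr0 subr0; apply: quadratic_is_derive0 => h; exact: flat_quadratic.
Unshelve. all: by end_near. Qed.

(** The affine argument allows rising and falling fronts, at any place and of any steepness. *)
Definition flat_aff (n : nat) (k c x : R) : R := flat n (k * x + c).

Lemma flat_aff_is_derive n k c (x : R) :
  is_derive x 1 (flat_aff n k c) (k * flat_aff n.+2 k c x - (k * n%:R) * flat_aff n.+1 k c x).
Proof.
have da : is_derive x 1 (fun x : R => k * x + c) k.
  have [h4 h5] := is_deriveD (is_deriveZ (f := id) (x := x) (v := 1) k (is_derive_id x (1 : R))) (is_derive_cst c x 1).
  by apply: DeriveDef; [exact: h4|rewrite [LHS]h5 addr0 /GRing.scale/= mulr1].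
have -> : k * flat_aff n.+2 k c x - k * n%:R * flat_aff n.+1 k c x =
  (flat_aff n.+2 k c x - n%:R * flat_aff n.+1 k c x) * k by ring.
exact: (is_derive1_comp (f := flat n) (g := fun x => k * x + c) (flat_is_derive n (k * x + c)) da).
Qed.

Lemma is_derive_fst1 (f : R -> R) (x : R * R) (d : R) : is_derive x.1 1 f d ->
  is_derive x ((1, 0) : R * R) (fun x : R * R => f x.1) d.
Proof. by case=> h1 h2; split; [exact: h1|exact: h2]. Qed.

Lemma is_derive_snd2 (f : R -> R) (x : R * R) (d : R) : is_derive x.2 1 f d ->
  is_derive x ((0, 1) : R * R) (fun x : R * R => f x.2) d.
Proof. by case=> h1 h2; split; [exact: h1|exact: h2]. Qed.

Lemma is_derive_invariant (f : R * R -> R) (x v : R * R) :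
  (forall h : R, f (h *: v + x) = f x) -> is_derive x v f 0.
Proof.
move=> h.
have e : (fun h : R => h^-1 *: ((f \o shift x) (h *: v) - f x)) = cst 0.
  by apply/funext => k /=; rewrite h subrr scaler0.
apply: DeriveDef; first by rewrite /derivable e; exact: is_cvg_cst.
by rewrite /derive e; exact: lim_cst.
Qed.

Lemma is_derive_fst2 (f : R -> R) (x : R * R) :
  is_derive x ((0, 1) : R * R) (fun x : R * R => f x.1) 0.
Proof.
apply: is_derive_invariant => h; congr f.
by rewrite -[LHS]/(h * 0 + x.1) mulr0 add0r.
Qed.

Lemma is_derive_snd1 (f : R -> R) (x : R * R) :
  is_derive x ((1, 0) : R * R) (fun x : R * R => f x.2) 0.
Proof.
apply: is_derive_invariant => h; congr f.
by rewrite -[LHS]/(h * 0 + x.2) mulr0 add0r.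
Qed.

Lemma continuous_flat_aff n k c : continuous (flat_aff n k c).
Proof. by move=> x; exact: (derive_continuous_at (flat_aff_is_derive n k c x)). Qed.

Lemma smooth2_flat_fst n k c : smooth2 (fun x : R * R => flat_aff n k c x.1).
Proof.
move=> m; elim: m n => [|m ih] n; split=> //.
- move=> x; apply: (@continuous_comp _ _ _ fst (flat_aff n k c)); first exact: cvg_fst.
  exact: continuous_flat_aff.
- move=> x; apply: (@continuous_comp _ _ _ fst (flat_aff n k c)); first exact: cvg_fst.
  exact: continuous_flat_aff.
have d1 x := is_derive_fst1 (flat_aff_is_derive n k c x.1).
have d2 x := is_derive_fst2 (flat_aff n k c) x.
split.
- by move=> x; have [] := d1 x.
- by move=> x; have [] := d2 x.
- have -> : pd1 (fun x : R * R => flat_aff n k c x.1) =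
     k *: (fun x : R * R => flat_aff n.+2 k c x.1) +
     ((- (k * n%:R)) *: (fun x : R * R => flat_aff n.+1 k c x.1) + 0).
    apply/funext => x; rewrite /pd1; have [_ ->] := d1 x.
    by rewrite -mulNr -[RHS]/(_ * _ + (_ * _ + 0)) addr0.
  by apply: cont_diff_lin; [exact: ih|apply: cont_diff_lin; [exact: ih|exact: smooth2_0]].
- have -> : pd2 (fun x : R * R => flat_aff n k c x.1) = 0.
    by apply/funext => x; rewrite /pd2; have [_ ->] := d2 x.
  exact: smooth2_0.
Qed.

Lemma smooth2_flat_snd n k c : smooth2 (fun x : R * R => flat_aff n k c x.2).
Proof.
move=> m; elim: m n => [|m ih] n; split=> //.
- move=> x; apply: (@continuous_comp _ _ _ snd (flat_aff n k c)); first exact: cvg_snd.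
  exact: continuous_flat_aff.
- move=> x; apply: (@continuous_comp _ _ _ snd (flat_aff n k c)); first exact: cvg_snd.
  exact: continuous_flat_aff.
have d1 x := is_derive_snd1 (flat_aff n k c) x.
have d2 x := is_derive_snd2 (flat_aff_is_derive n k c x.2).
split.
- by move=> x; have [] := d1 x.
- by move=> x; have [] := d2 x.
- have -> : pd1 (fun x : R * R => flat_aff n k c x.2) = 0.
    by apply/funext => x; rewrite /pd1; have [_ ->] := d1 x.
  exact: smooth2_0.
- have -> : pd2 (fun x : R * R => flat_aff n k c x.2) =
     k *: (fun x : R * R => flat_aff n.+2 k c x.2) +
     ((- (k * n%:R)) *: (fun x : R * R => flat_aff n.+1 k c x.2) + 0).
    apply/funext => x; rewrite /pd2; have [_ ->] := d2 x.
    by rewrite -mulNr -[RHS]/(_ * _ + (_ * _ + 0)) addr0.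
  by apply: cont_diff_lin; [exact: ih|apply: cont_diff_lin; [exact: ih|exact: smooth2_0]].
Qed.

Lemma cont_diff_le n (phi : R * R -> R) : cont_diff n.+1 phi -> cont_diff n phi.
Proof.
elim: n phi => [|n ih] phi; first by case=> c _; split.
case=> c [h1 h2 h3 h4]; split; first exact: c.
split; [exact: h1|exact: h2| |].
  exact: (ih _ h3).
exact: (ih _ h4).
Qed.

Lemma smooth2_mul (phi psi : R * R -> R) : smooth2 phi -> smooth2 psi ->
  smooth2 (fun x => phi x * psi x).
Proof.
suff h n : forall phi psi : R * R -> R, cont_diff n phi -> cont_diff n psi ->
    cont_diff n (fun x => phi x * psi x).
  by move=> h1 h2 n; apply: h.
elim: n => [|n ih] f g hf hg.
  by case: hf => c1 _; case: hg => c2 _; split=> // x; apply: cvgM; [exact: c1|exact: c2].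
have f' := cont_diff_le hf; have g' := cont_diff_le hg.
case: hf => c1 [a1 a2 a3 a4]; case: hg => c2 [b1 b2 b3 b4].
split; first by move=> x; apply: cvgM; [exact: c1|exact: c2].
have dM (v x : R * R) : derivable f x v -> derivable g x v ->
    is_derive x v (fun x => f x * g x) (f x * 'D_v g x + g x * 'D_v f x).
  by move=> h1 h2; have := is_deriveM (derivableP h1) (derivableP h2).
split.
- by move=> x; have [] := dM _ _ (a1 x) (b1 x).
- by move=> x; have [] := dM _ _ (a2 x) (b2 x).
- have -> : pd1 (fun x => f x * g x) = 1 *: (fun x => f x * pd1 g x) + (fun x => g x * pd1 f x).
    apply/funext => x; rewrite /pd1; have [_ ->] := dM _ _ (a1 x) (b1 x).
    by rewrite -[RHS]/(1 * _ + _) mul1r.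
  by apply: cont_diff_lin; exact: ih.
- have -> : pd2 (fun x => f x * g x) = 1 *: (fun x => f x * pd2 g x) + (fun x => g x * pd2 f x).
    apply/funext => x; rewrite /pd2; have [_ ->] := dM _ _ (a2 x) (b2 x).
    by rewrite -[RHS]/(1 * _ + _) mul1r.
  by apply: cont_diff_lin; exact: ih.
Qed.

(** One factor exp(-1/(k d)) per side, where d is the signed distance to that side. As [k] grows,
    the product tends boundedly to the indicator of the open box, so dominated convergence can take
    the place of mollification. *)
Definition box_bump (a b c d : R) (k : nat) (x : R * R) : R :=
  (flat_aff 0 k%:R (- (k%:R * a)) x.1 * flat_aff 0 (- k%:R) (k%:R * b) x.1) *
  (flat_aff 0 k%:R (- (k%:R * c)) x.2 * flat_aff 0 (- k%:R) (k%:R * d) x.2).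

Lemma smooth2_box_bump a b c d k : smooth2 (box_bump a b c d k).
Proof.
by apply: smooth2_mul; apply: smooth2_mul; (exact: smooth2_flat_fst || exact: smooth2_flat_snd).
Qed.

Lemma box_bump_ge0 a b c d k x : 0 <= box_bump a b c d k x.
Proof. by rewrite !mulr_ge0// flat_ge0. Qed.

Lemma box_bump_le1 a b c d k x : box_bump a b c d k x <= 1.
Proof.
by rewrite /box_bump !mulr_ile1 ?mulr_ge0 ?flat_ge0 ?flat0_le1.
Qed.

Lemma box_bump_out a b c d k x : ~ (a < x.1 < b /\ c < x.2 < d) -> box_bump a b c d k x = 0.
Proof.
move=> h; apply/eqP; rewrite !mulf_eq0.
have z (u : R) : u <= 0 -> flat 0 u == 0 by move=> u0; rewrite /flat ifF//; apply/negbTE; rewrite -leNgt.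
have k0 : 0 <= k%:R :> R by [].
have [h1|h1] := leP x.1 a.
  by rewrite z ?orTb// -mulrBr mulr_ge0_le0 ?subr_le0.
have [h2|h2] := leP b x.1.
  by rewrite [X in (_ || X) || _]z ?orbT// addrC mulNr -mulrBr mulr_ge0_le0 ?subr_le0.
have [h3|h3] := leP x.2 c.
  by rewrite [X in _ || (X || _)]z ?orbT// -mulrBr mulr_ge0_le0 ?subr_le0.
have [h4|h4] := leP d x.2.
  by rewrite [X in _ || (_ || X)]z ?orbT// addrC mulNr -mulrBr mulr_ge0_le0 ?subr_le0.
by exfalso; apply: h; rewrite h1 h2 h3 h4.
Qed.

Lemma flat_cvg1 (u : R) : 0 < u -> flat 0 (k%:R * u) @[k --> \oo] --> (1 : R).
Proof.
move=> u0.
have h : (fun k : nat => expR (- ((k.+1)%:R^-1 * u^-1))) @ \oo --> (1 : R).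
  have hz : (fun k : nat => - ((k.+1)%:R^-1 * u^-1)) @ \oo --> (0 : R).
    rewrite -[X in _ --> X]oppr0 -[X in - X](mul0r u^-1).
    apply: cvgN; apply: cvgM; last exact: cvg_cst.
    exact: cvg_harmonic.
  rewrite -[X in _ --> X]expR0.
  apply: (@cvg_comp _ _ _ (fun k : nat => - ((k.+1)%:R^-1 * u^-1)) (@expR R) \oo (nbhs (0 : R)) _ hz).
  exact: continuous_expR.
rewrite -(cvg_shiftS (fun k : nat => flat 0 (k%:R * u))).
apply: cvg_trans h; apply: near_eq_cvg; near=> k.
by rewrite /= /flat ifT ?mulr_gt0 ?ltr0n// expr0 invr1 mul1r invfM.
Unshelve. all: by end_near. Qed.

Lemma box_bump_cvg1 a b c d (x : R * R) : a < x.1 < b -> c < x.2 < d ->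
  box_bump a b c d k x @[k --> \oo] --> (1 : R).
Proof.
move=> /andP[h1 h2] /andP[h3 h4].
have -> : (1 : R) = (1 * 1) * (1 * 1) by rewrite !mul1r.
have e (u v : R) : u < v -> (fun k : nat => flat_aff 0 k%:R (- (k%:R * u)) v) @ \oo --> (1 : R).
  move=> uv; have -> : (fun k : nat => flat_aff 0 k%:R (- (k%:R * u)) v) = (fun k : nat => flat 0 (k%:R * (v - u))).
    by apply/funext => k; rewrite /flat_aff mulrBr.
  by apply: flat_cvg1; rewrite subr_gt0.
have e' (u v : R) : v < u -> (fun k : nat => flat_aff 0 (- k%:R) (k%:R * u) v) @ \oo --> (1 : R).
  move=> uv; have -> : (fun k : nat => flat_aff 0 (- k%:R) (k%:R * u) v) = (fun k : nat => flat 0 (k%:R * (u - v))).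
    by apply/funext => k; rewrite /flat_aff mulrBr addrC mulNr.
  by apply: flat_cvg1; rewrite subr_gt0.
by apply: cvgM; apply: cvgM; [exact: e|exact: e'|exact: e|exact: e'].
Qed.

End Bump.

(** * Functions whose integrals over a generating family vanish *)

Section DensityUniqueness.
Context d (T : measurableType d) (R : realType) (mu : {measure set T -> \bar R}).
Variables (G : set (set T)) (h : (set T)^nat).
Hypotheses (GE : @measurable d T = <<s G >>) (GI : setI_closed G) (Gh : forall k, G (h k))
  (hT : \bigcup_k h k = setT).

Section Density.
Variables (f : T -> \bar R).
Hypotheses (mf : measurable_fun setT f) (f0 : forall x, (0 <= f x)%E).

(** The two proofs are arguments so that the measure structure can be attached to the term
    [density mf f0] itself. *)
Definition density of measurable_fun setT f & forall x, (0 <= f x)%E := fun A => (\int[mu]_(x in A) f x)%E.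

Local Notation nu := (density mf f0).

Let nu0 : nu set0 = 0%E. Proof. exact: integral_set0. Qed.

Let nu_ge0 A : (0 <= nu A)%E. Proof. by apply: integral_ge0 => x _; exact: f0. Qed.

Let nu_sadd : semi_sigma_additive nu.
Proof. exact: semi_sigma_additive_nng_induced. Qed.

HB.instance Definition _ := isMeasure.Build _ _ _ nu nu0 nu_ge0 nu_sadd.

Definition density_measure : {measure set T -> \bar R} := nu.

End Density.

(** A finite integral of [f1] makes its measure finite on the exhausting sets [h k], as uniqueness
    of measures on a generating pi-system requires. *)
Lemma density_unique (f1 f2 : T -> \bar R) : measurable_fun setT f1 -> measurable_fun setT f2 ->
  (forall x, (0 <= f1 x)%E) -> (forall x, (0 <= f2 x)%E) ->
  (\int[mu]_x f1 x < +oo)%E ->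
  (forall A, G A -> (\int[mu]_(x in A) f1 x = \int[mu]_(x in A) f2 x)%E) ->
  forall A, measurable A -> (\int[mu]_(x in A) f1 x = \int[mu]_(x in A) f2 x)%E.
Proof.
move=> m1 m2 p1 p2 fin e A mA.
apply: (@measure_unique _ _ _ G h GE GI Gh hT (density_measure m1 p1)
  (density_measure m2 p2)) => // k.
have mhk : measurable (h k) by rewrite GE; exact: sub_sigma_algebra.
apply: le_lt_trans fin; apply: ge0_subset_integral => //.
Qed.

(** The positive and the negative part of [f] define two finite measures that agree on [G], hence on
    all measurable sets. *)
Lemma integral_zero_ae (f : T -> R) : measurable_fun setT f ->
  mu.-integrable setT (EFin \o f) ->
  (forall A, G A -> (\int[mu]_(x in A) (f x)%:E = 0)%E) ->
  {ae mu, forall x, f x = 0}.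
Proof.
move=> mf intf e.
have mF : measurable_fun setT (EFin \o f) by exact/measurable_EFinP.
have ip := integrable_funepos measurableT intf.
have im := integrable_funeneg measurableT intf.
have mG A : G A -> measurable A by move=> GA; rewrite GE; exact: sub_sigma_algebra.
have key A : measurable A -> (\int[mu]_(x in A) ((EFin \o f)^\+ x) = \int[mu]_(x in A) ((EFin \o f)^\- x))%E.
  apply: density_unique => //.
  - exact: measurable_funepos.
  - exact: measurable_funeneg.
  - move/integrableP: ip => [_].
    by under eq_integral do rewrite gee0_abs//.
  - move=> B GB; have mB := mG B GB; have := e B GB.
    rewrite integralE => /eqP; rewrite sube_eq ?add0e; first by move/eqP.
    + by apply: integrable_fin_num => //; exact: integrableS ip.
    + rewrite fin_num_adde_defl//.
      by apply: integrable_fin_num => //; exact: integrableS im.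
have h0 : ae_eq mu setT (EFin \o f) (cst 0%E).
  apply: integral_ae_eq => // E _ mE.
  rewrite integral0 integralE key// subee//.
  by apply: integrable_fin_num => //; exact: integrableS im.
by apply: filterS h0 => x /(_ I) [].
Qed.

End DensityUniqueness.

(** * Uniqueness of weak derivatives *)

Section PlaneBoxes.
Context {R : realType}.
Local Notation plane := (measurableTypeR R * measurableTypeR R)%type.
Local Notation mu := (@lebesgue_measure R).
Local Notation mu2 := (@mu2 R).

(** Open boxes match the supports of the bumps; they are stable under intersection and generate the
    sigma-algebra, as [integral_zero_ae] asks. *)
Definition obox (a b c d : R) : set plane := `]a, b[%classic `*` `]c, d[%classic.

Definition oboxes : set (set plane) := [set A | exists a b c d, A = obox a b c d].

Lemma oboxP a b c d (x : R * R) : obox a b c d x <-> (a < x.1 < b /\ c < x.2 < d).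
Proof. by rewrite /obox/= !in_itv/=. Qed.

Lemma measurable_obox a b c d : measurable (obox a b c d).
Proof. by apply: measurableX; exact: measurable_itv. Qed.

Lemma oboxI a b c d a' b' c' d' : obox a b c d `&` obox a' b' c' d' =
  obox (Num.max a a') (Num.min b b') (Num.max c c') (Num.min d d').
Proof.
apply/seteqP; split => x.
  move=> [/oboxP[/andP[h1 h2] /andP[h3 h4]] /oboxP[/andP[h5 h6] /andP[h7 h8]]].
  by apply/oboxP; rewrite !gt_max !lt_min h1 h2 h3 h4 h5 h6 h7 h8.
move=> /oboxP; rewrite !gt_max !lt_min.
move=> [/andP[/andP[h1 h2] /andP[h3 h4]] /andP[/andP[h5 h6] /andP[h7 h8]]].
by split; apply/oboxP; rewrite ?h1 ?h2 ?h3 ?h4 ?h5 ?h6 ?h7 ?h8.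
Qed.

Lemma setI_closed_oboxes : setI_closed oboxes.
Proof.
move=> _ _ [a [b [c [d ->]]]] [a' [b' [c' [d' ->]]]].
by rewrite oboxI; do 4 eexists.
Qed.

Lemma archi_norm (x : R) : exists n : nat, - n%:R < x < n%:R.
Proof.
by exists (Num.bound `|x|); rewrite -ltr_norml; apply: archi_boundP.
Qed.

Lemma bigcup_obox : \bigcup_k obox (- k%:R) k%:R (- k%:R) k%:R = setT.
Proof.
apply/seteqP; split => // x _.
have [n /andP[h1 h2]] := archi_norm x.1; have [m /andP[h3 h4]] := archi_norm x.2.
exists (maxn n m) => //; apply/oboxP.
have nn : n%:R <= (maxn n m)%:R :> R by rewrite ler_nat leq_maxl.
have mm : m%:R <= (maxn n m)%:R :> R by rewrite ler_nat leq_maxr.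
by split; apply/andP; split; lra.
Qed.

Lemma measurable_plane_oboxes : @measurable _ plane = <<s oboxes >>.
Proof.
apply/seteqP; split; last first.
  apply: smallest_sub; first exact: sigma_algebra_measurable.
  by move=> _ [a [b [c [d ->]]]]; exact: measurable_obox.
have m1 : measurable_fun setT (fst : g_sigma_algebraType oboxes -> measurableTypeR R).
  apply: (measurability _ (RGenOpens.measurableE R)).
  move=> _ [_ [x [y ->] <-]]; rewrite setTI.
  have -> : (fst @^-1` `]x, y[%classic : set plane) = \bigcup_k obox x y (- k%:R) k%:R.
    apply/seteqP; split => z.
      rewrite /= in_itv/= => h; have [n hn] := archi_norm z.2.
      by exists n => //; apply/oboxP.
    by move=> [k _ /oboxP[h _]]; rewrite /= in_itv.
  by apply: bigcupT_measurable => k; apply: sub_sigma_algebra; do 4 eexists.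
have m2 : measurable_fun setT (snd : g_sigma_algebraType oboxes -> measurableTypeR R).
  apply: (measurability _ (RGenOpens.measurableE R)).
  move=> _ [_ [x [y ->] <-]]; rewrite setTI.
  have -> : (snd @^-1` `]x, y[%classic : set plane) = \bigcup_k obox (- k%:R) k%:R x y.
    apply/seteqP; split => z.
      rewrite /= in_itv/= => h; have [n hn] := archi_norm z.1.
      by exists n => //; apply/oboxP.
    by move=> [k _ /oboxP[_ h]]; rewrite /= in_itv.
  by apply: bigcupT_measurable => k; apply: sub_sigma_algebra; do 4 eexists.
rewrite measurable_prod_measurableType.
apply: smallest_sub; first exact: smallest_sigma_algebra.
move=> _ [A mA [B mB <-]].
have := measurableI _ _ (m1 measurableT A mA) (m2 measurableT B mB).
rewrite !setTI => h.
by have -> : A `*` B = (fst @^-1` A) `&` (snd @^-1` B) by [].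
Qed.

Lemma box_bump_test (Omega : set (R * R)) a b c d k :
  `[a, b]%classic `*` `[c, d]%classic `<=` Omega -> test_function Omega (box_bump a b c d k).
Proof.
move=> sub; split; first exact: smooth2_box_bump.
exists (`[a, b]%classic `*` `[c, d]%classic); split=> //; first exact: compact_rect.
move=> x nx; apply: box_bump_out => -[/andP[h1 h2] /andP[h3 h4]]; apply: nx.
by split; rewrite /= in_itv/=; apply/andP; split; exact: ltW.
Qed.

Lemma sqint_subset (D E : set plane) (u : plane -> R) : measurable D -> measurable E -> E `<=` D ->
  sqint mu2 D u -> sqint mu2 E u.
Proof.
move=> mD mE ED [mu_ iu]; split; first exact: measurable_funS mu_.
exact: integrableS iu.
Qed.

Lemma mu2_obox a b c d : exists m, mu2 (obox a b c d) = m%:E.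
Proof.
rewrite -[mu2 _]/((mu \x mu)%E (obox a b c d)) product_measure1E//=.
rewrite !lebesgue_measure_itv/= !lte_fin.
by case: ifP => _; case: ifP => _; rewrite -?EFinD -?EFinM; eexists.
Qed.

Lemma sqint_integrable (D : set plane) (u : plane -> R) (m : R) : measurable D ->
  mu2 D = m%:E -> sqint mu2 D u -> mu2.-integrable D (EFin \o u).
Proof.
move=> mD mE su; have := sqint_mul mD su (sqint_cst mD 1 mE).
by congr (mu2.-integrable _ _); apply/funext => x; rewrite /= mulr1.
Qed.

(** Test with the bumps of the box and let them tend to its indicator; the closed box lies in
    [Omega], so the bumps are test functions. *)
Lemma weak_zero_obox (Omega : set plane) (g : plane -> R) a b c d : measurable Omega ->
  sqint mu2 Omega g -> (forall phi, test_function Omega phi -> dotL2 Omega g phi = 0) ->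
  `[a, b]%classic `*` `[c, d]%classic `<=` Omega ->
  (\int[mu2]_(x in obox a b c d) (g x)%:E = 0)%E.
Proof.
move=> mO sg tg sub; set B := obox a b c d.
have BO : B `<=` Omega.
  move=> x /oboxP[/andP[h1 h2] /andP[h3 h4]]; apply: sub.
  by split; rewrite /= in_itv/=; apply/andP; split; exact: ltW.
have mB : measurable B := measurable_obox a b c d.
have [m mE] := mu2_obox a b c d.
have sgB : sqint mu2 B g := sqint_subset mO mB BO sg.
have ig := sqint_integrable mB mE sgB.
have mbump k : measurable_fun setT (box_bump a b c d k : plane -> R).
  by apply: continuous_measurable_plane; apply: smooth2_continuous; exact: smooth2_box_bump.
pose f_ k x := (g x * box_bump a b c d k x)%:E.
have mf_ k : measurable_fun B (f_ k).
  apply/measurable_EFinP; apply: measurable_funM; first by case: sgB.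
  exact: measurable_funTS.
have iabs : mu2.-integrable B (fun x => `|(g x)%:E|%E) by exact: integrable_abse.
have cv x : B x -> f_ k x @[k --> \oo] --> (g x)%:E.
  move=> /oboxP[h1 h2]; rewrite /f_; apply: cvg_EFin; first by near=> k.
  rewrite -[X in _ --> X]mulr1; apply: cvgM; first exact: cvg_cst.
  exact: box_bump_cvg1.
have dom x k : B x -> (`|f_ k x| <= `|(g x)%:E|)%E.
  move=> _; rewrite /f_ lee_fin normrM ler_piMr//.
  by rewrite ger0_norm ?box_bump_ge0// box_bump_le1.
have mg : measurable_fun B (EFin \o g) by apply/measurable_EFinP; case: sgB.
have [_ _ lim] := dominated_convergence mB mf_ mg (aeW _ cv) iabs (aeW _ (fun x k => dom x k)).
(* The bump vanishes off [B], so this integral is the one over [Omega], a test of [g]. *)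
have zero k : (\int[mu2]_(x in B) f_ k x = 0)%E.
  have e : (\int[mu2]_(x in B) f_ k x = \int[mu2]_(x in Omega) f_ k x)%E.
    rewrite integral_mkcond [RHS]integral_mkcond; congr (integral _ _ _).
    apply/funext => x; rewrite !patchE; case: ifPn => xB.
      by rewrite mem_set//; apply: BO; move: xB; rewrite inE.
    case: ifP => // _; rewrite /f_ box_bump_out ?mulr0// => h.
    by move/negP: xB; apply; rewrite inE; exact/oboxP.
  have ifk : mu2.-integrable B (f_ k).
    exact: (le_integrable mB (mf_ k) (fun x Bx => dom x k Bx) ).
  have := tg _ (box_bump_test k sub).
  rewrite /dotL2 /Rintegral -[X in fine X]e => h.
  rewrite -[LHS]fineK; first by rewrite h.
  exact: integrable_fin_num.
have lim' : (fun=> 0%E : \bar R) @ \oo --> (\int[mu2]_(x in B) (g x)%:E)%E.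
  by move: lim; under eq_fun do rewrite zero.
exact: (cvg_unique (@ereal_hausdorff R) lim' (cvg_cst _)).
Unshelve. all: by end_near. Qed.

Lemma weak_zero_box_ae (Omega : set plane) (g : plane -> R) a b c d : measurable Omega ->
  sqint mu2 Omega g -> (forall phi, test_function Omega phi -> dotL2 Omega g phi = 0) ->
  `[a, b]%classic `*` `[c, d]%classic `<=` Omega ->
  {ae mu2, forall x, obox a b c d x -> g x = 0}.
Proof.
move=> mO sg tg sub; set B := obox a b c d.
have BO : B `<=` Omega.
  move=> x /oboxP[/andP[h1 h2] /andP[h3 h4]]; apply: sub.
  by split; rewrite /= in_itv/=; apply/andP; split; exact: ltW.
have mB : measurable B := measurable_obox a b c d.
have [m mE] := mu2_obox a b c d.
have sgB : sqint mu2 B g := sqint_subset mO mB BO sg.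
have ig := sqint_integrable mB mE sgB.
(* Cut off by [B], the function is integrable on the plane, and its integral over any open box is
   that of [g] over the intersection with [B], again a box covered by [weak_zero_obox]. *)
pose f x := if x \in B then g x else 0.
have fE : EFin \o f = (EFin \o g) \_ B.
  by apply/funext => x; rewrite /= patchE /f; case: ifP.
have fE' : f = g \_ B by apply/funext => x; rewrite patchE /f; case: ifP.
have mf : measurable_fun setT (f : plane -> R).
  by rewrite fE'; apply/(measurable_restrictT _ _).1 => //; case: sgB.
have intf : mu2.-integrable setT (EFin \o f).
  by rewrite fE; apply/(integrable_mkcond _ _).1.
have key : {ae mu2, forall x, f x = 0}.
  apply: (integral_zero_ae measurable_plane_oboxes setI_closed_oboxes _ bigcup_obox mf intf).
    by move=> k; do 4 eexists.
  move=> _ [a' [b' [c' [d' ->]]]].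
  have -> : (\int[mu2]_(x in obox a' b' c' d') (f x)%:E =
      \int[mu2]_(x in obox a' b' c' d') ((EFin \o g) \_ B) x)%E.
    by apply: eq_integral => x _; rewrite -fE.
  rewrite -integral_mkcondr /B oboxI.
  apply: (weak_zero_obox mO sg tg) => x [h1 h2]; apply: sub.
  move: h1 h2; rewrite /= !in_itv/= !ge_max !le_min.
  by move=> /andP[/andP[_ ->] /andP[_ ->]] /andP[/andP[_ ->] /andP[_ ->]].
by apply: filterS key => x + xB; rewrite /f mem_set.
Qed.

Lemma rational_obox (Omega : set (R * R)) (x : R * R) : open Omega -> Omega x ->
  exists q : rat * rat * (rat * rat),
    obox (ratr q.1.1) (ratr q.1.2) (ratr q.2.1) (ratr q.2.2) x /\
    `[ratr q.1.1, ratr q.1.2]%classic `*` `[ratr q.2.1, ratr q.2.2]%classic `<=` Omega.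
Proof.
move=> oO Ox; have /nbhs_ballP[e /= e0 eO] := open_nbhs_nbhs (conj oO Ox).
have rt (t : R) : exists a b : rat, [/\ t - e < ratr a, ratr a < t, t < ratr b & ratr b < t + e].
  have h1 : t - e < t by rewrite ltrBlDr ltrDl.
  have h2 : t < t + e by rewrite ltrDl.
  have [a] := rat_in_itvoo h1; have [b] := rat_in_itvoo h2.
  by rewrite !in_itv/= => /andP[h3 h4] /andP[h5 h6]; exists a, b.
have [a [b [a1 a2 b1 b2]]] := rt x.1; have [c [d [c1 c2 d1 d2]]] := rt x.2.
exists ((a, b), (c, d)); split; first by apply/oboxP; rewrite a2 b1 c2 d1.
move=> y [/=]; rewrite !in_itv/= => /andP[h1 h2] /andP[h3 h4]; apply: eO.
by split; rewrite /ball/= ltr_norml; apply/andP; split; lra.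
Qed.

Lemma weak_zero_ae (Omega : set plane) (g : plane -> R) : open (Omega : set (R * R)) ->
  sqint mu2 Omega g -> (forall phi, test_function Omega phi -> dotL2 Omega g phi = 0) ->
  {ae mu2, forall x, Omega x -> g x = 0}.
Proof.
move=> oO sg tg; have mO := open_measurable_plane oO.
(* Countably many rational boxes exhaust [Omega]; [unpickle] enumerates them, and each contributes a
   negligible set. *)
pose N (n : nat) : set plane := [set x | exists q : rat * rat * (rat * rat),
   [/\ unpickle n = Some q, obox (ratr q.1.1) (ratr q.1.2) (ratr q.2.1) (ratr q.2.2) x,
    `[ratr q.1.1, ratr q.1.2]%classic `*` `[ratr q.2.1, ratr q.2.2]%classic `<=` Omega & g x != 0]].
have neg n : mu2.-negligible (N n).
  case e : (unpickle n : option (rat * rat * (rat * rat))) => [q|]; last first.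
    have -> : N n = set0; last exact: negligible_set0.
    by apply/seteqP; split => // x [q []]; rewrite e.
  have [sub|nsub] := pselect (`[ratr q.1.1, ratr q.1.2]%classic `*` `[ratr q.2.1, ratr q.2.2]%classic `<=` Omega); last first.
    have -> : N n = set0; last exact: negligible_set0.
    by apply/seteqP; split => // x [q' []]; rewrite e => -[<-].
  have := weak_zero_box_ae mO sg tg sub; apply: negligibleS => x [q' []].
  by rewrite e => -[<-] h _ /eqP g0 h'; apply: g0; exact: h'.
have := negligible_bigcup neg; apply: negligibleS => x /= h.
have [Ox gx] : Omega x /\ g x != 0.
  by move: h => /not_implyP[h1 /eqP h2].
have [q [h1 h2]] := rational_obox oO Ox.
by exists (pickle q) => //; exists q; rewrite pickleK.
Qed.

Lemma compact_sub_box (K : set (R * R)) : compact K -> exists n : nat,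
  K `<=` box (- n%:R) n%:R (- n%:R) n%:R.
Proof.
move=> /compact_bounded[M [_ hM]]; have h := hM (M + 1) (ltac:(by rewrite ltrDl)).
have [n /andP[_ hn]] := archi_norm (M + 1).
exists n => x /h /=; rewrite prod_normE ge_max => /andP[h1 h2].
move: h1 h2; rewrite !ler_norml => /andP[h1 h2] /andP[h3 h4].
by split; rewrite /= in_itv/=; apply/andP; split; lra.
Qed.

Lemma compact_support_sqint (D : set plane) (K : set (R * R)) (phi : R * R -> R) : measurable D ->
  continuous phi -> compact K -> (forall x, ~ K x -> phi x = 0) -> sqint mu2 D (phi : plane -> R).
Proof.
move=> mD cphi cK zK; have [n Kn] := compact_sub_box cK.
have mphi : measurable_fun setT (phi : plane -> R) := continuous_measurable_plane cphi.
have mphi2 : measurable_fun setT ((fun x => (phi x ^+ 2)%:E) : plane -> \bar R) := measurable_phisq cphi.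
have nn : - n%:R <= n%:R :> R by apply: le_trans (ler0n R n); rewrite oppr_le0.
have [_ ib] := cont_box_sqint nn nn cphi.
have mf : measurable_fun D (phi : plane -> R) by exact: measurable_funTS.
apply/(sqintP mu2 mf).
apply: (@le_lt_trans _ _ (\int[mu2]_(x in box (- n%:R) n%:R (- n%:R) n%:R) (phi x ^+ 2)%:E)%E); last first.
  move/integrableP: ib => [_].
  by under eq_integral do rewrite abse_EFin ger0_norm ?sqr_ge0//.
have -> : (\int[mu2]_(x in box (- n%:R) n%:R (- n%:R) n%:R) (phi x ^+ 2)%:E = \int[mu2]_x (phi x ^+ 2)%:E)%E.
  rewrite integral_mkcond; apply: eq_integral => x _; rewrite patchE.
  case: ifPn => // /negP h; rewrite zK ?expr0n// => /Kn h'; apply: h; rewrite inE; exact: h'.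
apply: ge0_subset_integral => //.
by move=> x _; rewrite lee_fin sqr_ge0.
Qed.

Lemma test_pd (Omega : set (R * R)) i j phi : test_function Omega phi -> test_function Omega (pd i j phi).
Proof.
move=> tphi.
have loc (f : R * R -> R) (K : set (R * R)) (v x : R * R) : compact K -> (forall x, ~ K x -> f x = 0) ->
    ~ K x -> 'D_v f x = 0.
  move=> cK zK nKx; rewrite -[RHS](@derive_cst R _ _ (0 : R) x v).
  apply: near_eq_derive.
  have oC : open (~` K) by apply: closed_openC; apply: compact_closed => //; exact: norm_hausdorff.
  by near=> y; apply: zK; near: y; exact: open_nbhs_nbhs.
have t1 f : test_function Omega f -> test_function Omega (pd1 f).
  move=> [sf [K [cK KO zK]]]; split; first exact: smooth2_pd1.
  by exists K; split => // x; exact: loc.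
have t2 f : test_function Omega f -> test_function Omega (pd2 f).
  move=> [sf [K [cK KO zK]]]; split; first exact: smooth2_pd2.
  by exists K; split => // x; exact: loc.
elim: i => [|i ih]; last exact: t1.
by elim: j => // j ih; exact: t2.
Unshelve. all: by end_near. Qed.

Lemma test_sqint (Omega : set plane) (phi : R * R -> R) : measurable Omega ->
  test_function Omega phi -> sqint mu2 Omega (phi : plane -> R).
Proof.
move=> mO [sphi [K [cK _ zK]]].
exact: (compact_support_sqint mO (smooth2_continuous sphi) cK zK).
Qed.

Lemma weak_deriv_unique (Omega : set plane) i j (u g1 g2 : plane -> R) : open (Omega : set (R * R)) ->
  L2 Omega g1 -> L2 Omega g2 -> is_weak_deriv Omega i j u g1 -> is_weak_deriv Omega i j u g2 ->
  {ae mu2, forall x, Omega x -> g1 x = g2 x}.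
Proof.
move=> oO s1 s2 w1 w2; have mO := open_measurable_plane oO.
have s12 := linsubB (sqint_linsub mu2 mO) s1 s2.
have h : {ae mu2, forall x, Omega x -> (g1 - g2) x = 0}.
  apply: (weak_zero_ae oO s12) => phi tphi.
  have sphi := test_sqint mO tphi.
  have h1 := w1 _ tphi; have h2 := w2 _ tphi.
  have := sipBl (dot_sip mu2 mO) s1 s2 sphi; rewrite /dot -/(dotL2 _ _ _) -/(dotL2 _ _ _) -/(dotL2 _ _ _) => ->.
  move: h1; rewrite h2 => /(mulfI _) ->; first by rewrite subrr.
  by rewrite signr_eq0.
by apply: filterS h => x hx /hx /eqP; rewrite -[(g1 - g2) x]/(g1 x - g2 x) subr_eq0 => /eqP.
Qed.

End PlaneBoxes.

(** * The plate form *)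

Lemma Rintegral_comb5 d (T : measurableType d) (R : realType) (mu : {measure set T -> \bar R})
    (D : set T) (f1 f2 f3 f4 f5 : T -> R) (c k : R) : measurable D ->
  mu.-integrable D (fun x => (f1 x)%:E) -> mu.-integrable D (fun x => (f2 x)%:E) ->
  mu.-integrable D (fun x => (f3 x)%:E) -> mu.-integrable D (fun x => (f4 x)%:E) ->
  mu.-integrable D (fun x => (f5 x)%:E) ->
  \int[mu]_(x in D) (f1 x + f2 x + c * f3 x + k * (f4 x + f5 x)) =
  \int[mu]_(x in D) f1 x + \int[mu]_(x in D) f2 x + c * \int[mu]_(x in D) f3 x +
  k * (\int[mu]_(x in D) f4 x + \int[mu]_(x in D) f5 x).
Proof.
move=> mD i1 i2 i3 i4 i5.
have iD f g : mu.-integrable D (fun x => (f x)%:E) -> mu.-integrable D (fun x => (g x)%:E) ->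
    mu.-integrable D (fun x => (f x + g x)%:E) by move=> h1 h2; exact: (integrableD mD h1 h2).
have iZ (e : R) f : mu.-integrable D (fun x => (f x)%:E) -> mu.-integrable D (fun x => (e * f x)%:E).
  by move=> h1; exact: (integrableZl mD e h1).
have i45 := iD _ _ i4 i5; have i12 := iD _ _ i1 i2; have i3' := iZ c _ i3.
have i45' := iZ k _ i45; have i123 := iD _ _ i12 i3'.
rewrite (RintegralD mD i123 i45') (RintegralD mD i12 i3') (RintegralD mD i1 i2).
by rewrite (RintegralZl _ mD i3) (RintegralZl _ mD i45) (RintegralD mD i4 i5).
Qed.

Section WeakDerivatives.
Context {R : realType}.
Local Notation plane := (measurableTypeR R * measurableTypeR R)%type.
Local Notation mu2 := (@mu2 R).
Variable Omega : set (R * R).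
Hypothesis oO : open Omega.

Let mO : measurable (Omega : set plane) := open_measurable_plane oO.
Let ipL : sip (L2 Omega) (dot mu2 Omega) := dot_sip mu2 mO.

Lemma wD_spec i j u : has_weak_deriv Omega i j u ->
  L2 Omega (wD Omega i j u) /\ is_weak_deriv Omega i j u (wD Omega i j u).
Proof. by move=> h; exact: (xgetPex (cst 0) h). Qed.

Lemma wD_ae i j u g : L2 Omega g -> is_weak_deriv Omega i j u g ->
  {ae mu2, forall x, Omega x -> wD Omega i j u x = g x}.
Proof.
move=> Lg wg; have [h1 h2] := @wD_spec i j u (ex_intro _ g (conj Lg wg)).
exact: (weak_deriv_unique oO h1 Lg h2 wg).
Qed.

Lemma is_weak_deriv_lin i j k u v g h : L2 Omega u -> L2 Omega v -> L2 Omega g -> L2 Omega h ->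
  is_weak_deriv Omega i j u g -> is_weak_deriv Omega i j v h ->
  is_weak_deriv Omega i j (k *: u + v) (k *: g + h).
Proof.
move=> Lu Lv Lg Lh wg wh phi tphi.
have s0 := test_sqint mO tphi; have s1 := test_sqint mO (test_pd i j tphi).
have -> : dotL2 Omega (k *: u + v) (pd i j phi) = k * dotL2 Omega u (pd i j phi) + dotL2 Omega v (pd i j phi).
  exact: (sipPl ipL).
have -> : dotL2 Omega (k *: g + h) phi = k * dotL2 Omega g phi + dotL2 Omega h phi.
  exact: (sipPl ipL).
by rewrite (wg _ tphi) (wh _ tphi) mulrDr mulrCA.
Qed.

Lemma has_weak_deriv_lin i j k u v : L2 Omega u -> L2 Omega v ->
  has_weak_deriv Omega i j u -> has_weak_deriv Omega i j v -> has_weak_deriv Omega i j (k *: u + v).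
Proof.
move=> Lu Lv [g [Lg wg]] [h [Lh wh]]; exists (k *: g + h).
by split; [apply: (proj2 (sqint_linsub mu2 mO))|exact: is_weak_deriv_lin].
Qed.

Lemma wD_lin i j k u v : L2 Omega u -> L2 Omega v ->
  has_weak_deriv Omega i j u -> has_weak_deriv Omega i j v ->
  {ae mu2, forall x, Omega x -> wD Omega i j (k *: u + v) x = (k *: wD Omega i j u + wD Omega i j v) x}.
Proof.
move=> Lu Lv hu hv; have [u1 u2] := wD_spec hu; have [v1 v2] := wD_spec hv.
by apply: wD_ae; [apply: (proj2 (sqint_linsub mu2 mO))|exact: is_weak_deriv_lin].
Qed.

Lemma is_weak_deriv00 u : is_weak_deriv Omega 0 0 u u.
Proof. by move=> phi _; rewrite mul1r. Qed.

Lemma wD00 u : L2 Omega u -> {ae mu2, forall x, Omega x -> wD Omega 0 0 u x = u x}.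
Proof. by move=> Lu; apply: wD_ae => //; exact: is_weak_deriv00. Qed.

Lemma is_weak_deriv0 i j : is_weak_deriv Omega i j 0 0.
Proof.
move=> phi tphi; have L0 : L2 Omega 0 := proj1 (sqint_linsub mu2 mO).
rewrite -[dotL2 Omega 0 (pd i j phi)]/(dot mu2 Omega 0 _) -[dotL2 Omega 0 phi]/(dot mu2 Omega 0 _).
by rewrite !(sip0l ipL) ?mulr0//; [exact: (test_sqint mO tphi)|exact: (test_sqint mO (test_pd i j tphi))].
Qed.

(** The space [W] of the abstract form: convergence in L_2 and in the form controls a function and
    its second derivatives, which is what is recorded here. *)
Definition second_order : set (R * R -> R) := [set u | L2 Omega u /\
  [/\ has_weak_deriv Omega 2 0 u, has_weak_deriv Omega 1 1 u & has_weak_deriv Omega 0 2 u]].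

Lemma second_order_linsub : linsub second_order.
Proof.
have L0 : L2 Omega 0 := proj1 (sqint_linsub mu2 mO).
split.
  by split=> //; split; exists 0; split=> //; exact: is_weak_deriv0.
move=> k u v [Lu [u1 u2 u3]] [Lv [v1 v2 v3]].
split; first by apply: (proj2 (sqint_linsub mu2 mO)).
by split; exact: has_weak_deriv_lin.
Qed.

Variable nu : R.
Hypothesis nu_bounds : 0 <= nu < 1 / 2.

Lemma plate_formE u v : second_order u -> second_order v ->
  plate_form Omega nu u v = dot mu2 Omega (wD Omega 2 0 u) (wD Omega 2 0 v)
    + dot mu2 Omega (wD Omega 0 2 u) (wD Omega 0 2 v)
    + 2 * (1 - nu) * dot mu2 Omega (wD Omega 1 1 u) (wD Omega 1 1 v)
    + nu * (dot mu2 Omega (wD Omega 2 0 u) (wD Omega 0 2 v)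
            + dot mu2 Omega (wD Omega 0 2 u) (wD Omega 2 0 v)).
Proof.
move=> [Lu [/wD_spec[u1 _] /wD_spec[u2 _] /wD_spec[u3 _]]] [Lv [/wD_spec[v1 _] /wD_spec[v2 _] /wD_spec[v3 _]]].
rewrite /plate_form.
move: (wD Omega 2 0 u) (wD Omega 1 1 u) (wD Omega 0 2 u) u1 u2 u3 => f1 f2 f3 u1 u2 u3.
move: (wD Omega 2 0 v) (wD Omega 1 1 v) (wD Omega 0 2 v) v1 v2 v3 => g1 g2 g3 v1 v2 v3.
exact: (@Rintegral_comb5 _ _ _ mu2 Omega _ _ _ _ _ (2 * (1 - nu)) nu mO (sqint_mul mO u1 v1) (sqint_mul mO u3 v3) (sqint_mul mO u2 v2)
  (sqint_mul mO u1 v3) (sqint_mul mO u3 v1)).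
Qed.

(** [p] and [s] are the squared norms of the pure second derivatives, [t] is their product and [r]
    belongs to the mixed one; the first two hypotheses bound twice the absolute value of [t] by
    [p + s]. As [nu] stays below 1/2, the cross term costs at most half of [p + s], and
    [2 * (1 - nu) >= 1]. *)
Lemma plate_form_alg (p r s t : R) :
  0 <= p + 2 * 1 * t + 1 ^+ 2 * s -> 0 <= p + 2 * (-1) * t + (-1) ^+ 2 * s ->
  0 <= p -> 0 <= r -> 0 <= s ->
  p + r + s <= 2 * (p + s + 2 * (1 - nu) * r + nu * (t + t)) /\
  p + s + 2 * (1 - nu) * r + nu * (t + t) <= 2 * (p + r + s).
Proof.
move: nu_bounds => /andP[n0 n1]; rewrite sqrrN !expr1n => h1 h2 p0 r0 s0.
have nr : nu * r <= 1 / 2 * r by apply: ler_wpM2r; [|exact: ltW].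
have nr0 := mulr_ge0 n0 r0.
have a1 : 0 <= nu * (p + 2 * 1 * t + 1 * s) by rewrite mulr_ge0.
have a2 : 0 <= nu * (p + 2 * -1 * t + 1 * s) by rewrite mulr_ge0.
have a3 : nu * (p + s) <= 1 / 2 * (p + s).
  by apply: ler_wpM2r; [exact: addr_ge0|exact: ltW].
split; lra.
Qed.

Definition hessian_norm u : R := dot mu2 Omega (wD Omega 2 0 u) (wD Omega 2 0 u)
    + dot mu2 Omega (wD Omega 1 1 u) (wD Omega 1 1 u)
    + dot mu2 Omega (wD Omega 0 2 u) (wD Omega 0 2 u).

Lemma plate_form_bounds u : second_order u ->
  hessian_norm u <= 2 * plate_form Omega nu u u /\ plate_form Omega nu u u <= 2 * hessian_norm u.
Proof.
move=> Wu; rewrite plate_formE// /hessian_norm.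
case: Wu => [Lu [/wD_spec[u1 _] /wD_spec[u2 _] /wD_spec[u3 _]]].
move: (wD Omega 2 0 u) (wD Omega 1 1 u) (wD Omega 0 2 u) u1 u2 u3 => f1 f2 f3 u1 u2 u3.
have -> : dot mu2 Omega f3 f1 = dot mu2 Omega f1 f3 by exact: (sipC ipL u3 u1).
have h1 := sip_ge0 ipL (linsubD (sqint_linsub mu2 mO) u1 u3).
have h2 := sip_ge0 ipL (linsubB (sqint_linsub mu2 mO) u1 u3).
have hp := sip_quad ipL 1 u1 u3; have hm := sip_quad ipL (-1) u1 u3.
rewrite scale1r in hp; rewrite scaleN1r in hm; rewrite {}hp in h1; rewrite {}hm in h2.
have h11 := sip_ge0 ipL u1; have h22 := sip_ge0 ipL u2; have h33 := sip_ge0 ipL u3.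
move: h1 h2 h11 h22 h33 => {u1 u2 u3}.
move=> h1 h2 hp hr hs.
exact: plate_form_alg.
Qed.

End WeakDerivatives.

Lemma ae_sub {R : realType} (Omega : set (measurableTypeR R * measurableTypeR R)%type)
    (u v w : (measurableTypeR R * measurableTypeR R)%type -> R) : {ae (@mu2 R), forall x, Omega x -> v x = w x} ->
  {ae (@mu2 R), forall x, Omega x -> (u - v) x = (u - w) x}.
Proof.
by move=> h; apply: filterS h => x hx Ox; rewrite -[LHS]/(u x - v x) -[RHS]/(u x - w x) hx.
Qed.

Section PlateForm.
Context {R : realType}.
Local Notation plane := (measurableTypeR R * measurableTypeR R)%type.
Local Notation mu2 := (@mu2 R).
Variable Omega : set (R * R).
Hypothesis oO : open Omega.

Let mO : measurable (Omega : set plane) := open_measurable_plane oO.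
Let ipL : sip (L2 Omega) (dot mu2 Omega) := dot_sip mu2 mO.
Let LL : linsub (L2 Omega) := sqint_linsub mu2 mO.

Lemma eq_dotr (u v v' : R * R -> R) : L2 Omega u -> L2 Omega v -> L2 Omega v' ->
  {ae mu2, forall x, Omega x -> v x = v' x} -> dot mu2 Omega u v = dot mu2 Omega u v'.
Proof.
move=> Lu Lv Lv' e.
have -> : dot mu2 Omega u v = dot mu2 Omega v u by exact: (sipC ipL Lu Lv).
have -> : dot mu2 Omega u v' = dot mu2 Omega v' u by exact: (sipC ipL Lu Lv').
exact: (eq_dot mO Lv Lv' Lu e).
Qed.

Lemma eq_dot2 (u u' : R * R -> R) : L2 Omega u -> L2 Omega u' ->
  {ae mu2, forall x, Omega x -> u x = u' x} -> dot mu2 Omega u u = dot mu2 Omega u' u'.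
Proof.
move=> Lu Lu' e; transitivity (dot mu2 Omega u' u); first exact: (eq_dot mO Lu Lu' Lu e).
exact: (eq_dotr Lu' Lu Lu' e).
Qed.

Lemma dot_wD_lin i j k u v g : L2 Omega u -> L2 Omega v ->
  has_weak_deriv Omega i j u -> has_weak_deriv Omega i j v -> L2 Omega g ->
  dot mu2 Omega (wD Omega i j (k *: u + v)) g =
  k * dot mu2 Omega (wD Omega i j u) g + dot mu2 Omega (wD Omega i j v) g.
Proof.
move=> Lu Lv hu hv Lg; have [u1 _] := wD_spec hu; have [v1 _] := wD_spec hv.
have [w1 _] := wD_spec (has_weak_deriv_lin oO k Lu Lv hu hv).
have c1 : L2 Omega (k *: wD Omega i j u + wD Omega i j v) by exact: (proj2 LL).
transitivity (dot mu2 Omega (k *: wD Omega i j u + wD Omega i j v) g).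
  exact: (eq_dot mO w1 c1 Lg (wD_lin oO k Lu Lv hu hv)).
exact: (sipPl ipL).
Qed.

Lemma dot_wD_sub i j u v : L2 Omega u -> L2 Omega v ->
  has_weak_deriv Omega i j u -> has_weak_deriv Omega i j v ->
  dot mu2 Omega (wD Omega i j (u - v)) (wD Omega i j (u - v)) =
  dot mu2 Omega (wD Omega i j u - wD Omega i j v) (wD Omega i j u - wD Omega i j v).
Proof.
move=> Lu Lv hu hv; have [u1 _] := wD_spec hu; have [v1 _] := wD_spec hv.
have -> : u - v = (-1) *: v + u by rewrite scaleN1r addrC.
have -> : wD Omega i j u - wD Omega i j v = (-1) *: wD Omega i j v + wD Omega i j u.
  by rewrite scaleN1r addrC.
apply: eq_dot2.
- by have [] := wD_spec (has_weak_deriv_lin oO (-1) Lv Lu hv hu).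
- exact: (proj2 LL).
- exact: wD_lin.
Qed.

(** The derivatives have an L_2 limit [g] by completeness. The identity against each test function
    passes to the limit, so [g] is a weak derivative of [u] and agrees with the chosen one almost
    everywhere. *)
Lemma weak_deriv_closed i j (u_ : nat -> R * R -> R) u : (forall n, L2 Omega (u_ n)) ->
  L2 Omega u -> (forall n, has_weak_deriv Omega i j (u_ n)) ->
  dot mu2 Omega (u_ n - u) (u_ n - u) @[n --> \oo] --> 0 ->
  is_Cauchy (dot mu2 Omega) (fun n => wD Omega i j (u_ n)) ->
  has_weak_deriv Omega i j u /\
  dot mu2 Omega (wD Omega i j (u_ n - u)) (wD Omega i j (u_ n - u)) @[n --> \oo] --> 0.
Proof.
move=> Lu_ Lu h cu cD.
have Ld n : L2 Omega (wD Omega i j (u_ n)) by have [] := wD_spec (h n).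
have [g [Lg cg]] := sqint_complete mO Ld cD.
have wg : is_weak_deriv Omega i j u g.
  move=> phi tphi.
  have s0 := test_sqint mO tphi; have s1 := test_sqint mO (test_pd i j tphi).
  have c1 := sip_cvg_l ipL Lu_ Lu s1 cu.
  have c2 := sip_cvg_l ipL Ld Lg s0 cg.
  have c3 : (fun n => (-1) ^+ (i + j) * dot mu2 Omega (wD Omega i j (u_ n)) phi) @ \oo -->
      ((-1) ^+ (i + j) * dot mu2 Omega g phi : R) by apply: cvgM; [exact: cvg_cst|exact: c2].
  apply: (cvg_unique (@Rhausdorff R) c1).
  apply: cvg_trans c3; apply: near_eq_cvg; near=> n.
  by have [_ w] := wD_spec (h n); exact/esym/(w _ tphi).
have hu : has_weak_deriv Omega i j u by exists g.
have [u1 _] := wD_spec hu.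
split=> //; apply: cvg_trans cg; apply: near_eq_cvg; near=> n.
rewrite dot_wD_sub//; apply/esym/eq_dot2; [exact: (linsubB LL)|exact: (linsubB LL)|].
exact: (ae_sub _ (wD_ae oO Lg wg)).
Unshelve. all: by end_near. Qed.

Variable nu : R.
Hypothesis nu_bounds : 0 <= nu < 1 / 2.

Lemma hessian_norm_ge0 u : second_order Omega u -> 0 <= hessian_norm Omega u.
Proof.
move=> [Lu [/wD_spec[u1 _] /wD_spec[u2 _] /wD_spec[u3 _]]].
by apply: addr_ge0; [apply: addr_ge0|]; exact: (sip_ge0 ipL).
Qed.

Lemma plate_form_sip : sip (second_order Omega) (plate_form Omega nu).
Proof.
split; first exact: second_order_linsub.
- move=> u v _ _; apply: eq_Rintegral => x _.
  move: (wD Omega 2 0 u x) (wD Omega 1 1 u x) (wD Omega 0 2 u x) => a b c.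
  by move: (wD Omega 2 0 v x) (wD Omega 1 1 v x) (wD Omega 0 2 v x) => d e f; ring.
- move=> k u v w Wu Wv Ww.
  have Wkuv := proj2 (second_order_linsub oO) k u v Wu Wv.
  rewrite !(plate_formE oO)//.
  case: Wu => [Lu [u1 u2 u3]]; case: Wv => [Lv [v1 v2 v3]].
  case: Ww => [Lw [/wD_spec[w1 _] /wD_spec[w2 _] /wD_spec[w3 _]]].
  move: (dot_wD_lin k Lu Lv u1 v1 w1) (dot_wD_lin k Lu Lv u1 v1 w3) (dot_wD_lin k Lu Lv u3 v3 w1)
    (dot_wD_lin k Lu Lv u3 v3 w3) (dot_wD_lin k Lu Lv u2 v2 w2).
  move: (wD Omega 2 0 w) (wD Omega 1 1 w) (wD Omega 0 2 w) {w1 w2 w3} => w1 w2 w3.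
  move: (wD Omega 2 0 (k *: u + v)) (wD Omega 1 1 (k *: u + v)) (wD Omega 0 2 (k *: u + v)) => f1 f2 f3.
  move: (wD Omega 2 0 u) (wD Omega 1 1 u) (wD Omega 0 2 u) {u1 u2 u3} => u1 u2 u3.
  move: (wD Omega 2 0 v) (wD Omega 1 1 v) (wD Omega 0 2 v) {v1 v2 v3} => v1 v2 v3.
  by move=> -> -> -> -> ->; ring.
- move=> u Wu; have [h _] := plate_form_bounds oO nu_bounds Wu.
  by have := le_trans (hessian_norm_ge0 Wu) h; rewrite pmulr_rge0.
Qed.

Lemma le_sum3 (x y z : R) : 0 <= x -> 0 <= y -> 0 <= z ->
  [/\ x <= x + y + z, y <= x + y + z & z <= x + y + z].
Proof. by move=> h1 h2 h3; split; lra. Qed.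

Lemma cvg_comb3 (x y z : R^nat) : x @ \oo --> 0 -> y @ \oo --> 0 -> z @ \oo --> 0 ->
  (fun n => 2 * (x n + y n + z n)) @ \oo --> (0 : R).
Proof.
move=> hx hy hz; have -> : (0 : R) = 2 * (0 + 0 + 0) by rewrite !addr0 mulr0.
by apply: cvgM; [exact: cvg_cst|apply: cvgD; [apply: cvgD|]].
Qed.

(** [plate_form] and [hessian_norm] dominate each other, so a form-Cauchy sequence has Cauchy second
    derivatives, and [weak_deriv_closed] applies to each of the three. *)
Lemma plate_form_closed (u_ : nat -> R * R -> R) u : (forall n, second_order Omega (u_ n)) ->
  L2 Omega u -> dot mu2 Omega (u_ n - u) (u_ n - u) @[n --> \oo] --> 0 ->
  is_Cauchy (plate_form Omega nu) u_ ->
  second_order Omega u /\ plate_form Omega nu (u_ n - u) (u_ n - u) @[n --> \oo] --> 0.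
Proof.
move=> Wu_ Lu cu cA.
have Lu_ n : L2 Omega (u_ n) by case: (Wu_ n).
have WB := linsubB (second_order_linsub oO).
have nonneg i j v : has_weak_deriv Omega i j v -> 0 <= dot mu2 Omega (wD Omega i j v) (wD Omega i j v).
  by move=> /wD_spec[h _]; exact: (sip_ge0 ipL).
have cauchy i j : (forall n, has_weak_deriv Omega i j (u_ n)) ->
    (forall v, second_order Omega v -> dot mu2 Omega (wD Omega i j v) (wD Omega i j v) <= hessian_norm Omega v) ->
    is_Cauchy (dot mu2 Omega) (fun n => wD Omega i j (u_ n)).
  move=> hn hle e e0; have [N hN] := cA (e / 2) (ltac:(by rewrite divr_gt0)).
  exists N => m n Nm Nn; rewrite -dot_wD_sub//.
  apply: (le_lt_trans (hle _ (WB _ _ (Wu_ m) (Wu_ n)))).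
  have [h _] := plate_form_bounds oO nu_bounds (WB _ _ (Wu_ m) (Wu_ n)).
  apply: (le_lt_trans h).
  by rewrite mulrC -ltr_pdivlMr//; exact: hN.
have le1 v : second_order Omega v ->
    [/\ dot mu2 Omega (wD Omega 2 0 v) (wD Omega 2 0 v) <= hessian_norm Omega v,
        dot mu2 Omega (wD Omega 1 1 v) (wD Omega 1 1 v) <= hessian_norm Omega v &
        dot mu2 Omega (wD Omega 0 2 v) (wD Omega 0 2 v) <= hessian_norm Omega v].
  move=> [Lv [/nonneg h1 /nonneg h2 /nonneg h3]]; exact: le_sum3.
have [h20 c20] := weak_deriv_closed Lu_ Lu (fun n => let: conj _ (And3 h _ _) := Wu_ n in h) cu
  (cauchy _ _ (fun n => let: conj _ (And3 h _ _) := Wu_ n in h) (fun v Wv => let: And3 h _ _ := le1 v Wv in h)).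
have [h11 c11] := weak_deriv_closed Lu_ Lu (fun n => let: conj _ (And3 _ h _) := Wu_ n in h) cu
  (cauchy _ _ (fun n => let: conj _ (And3 _ h _) := Wu_ n in h) (fun v Wv => let: And3 _ h _ := le1 v Wv in h)).
have [h02 c02] := weak_deriv_closed Lu_ Lu (fun n => let: conj _ (And3 _ _ h) := Wu_ n in h) cu
  (cauchy _ _ (fun n => let: conj _ (And3 _ _ h) := Wu_ n in h) (fun v Wv => let: And3 _ _ h := le1 v Wv in h)).
have Wu : second_order Omega u by split.
split=> //.
have cH : (fun n => 2 * hessian_norm Omega (u_ n - u)) @ \oo --> (0 : R).
  exact: (cvg_comb3 c20 c11 c02).
have c0 : (fun _ : nat => 0 : R) @ \oo --> (0 : R) by exact: cvg_cst.
apply: (squeeze_cvgr _ c0 cH); near=> n.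
have Wn := WB _ _ (Wu_ n) Wu.
by rewrite (sip_ge0 plate_form_sip Wn)/=; have [_ ->] := plate_form_bounds oO nu_bounds Wn.
Unshelve. all: by end_near. Qed.

End PlateForm.

(** * The form domain *)

Lemma ae_lin_restrict {R : realType} (Omega A : set (measurableTypeR R * measurableTypeR R)%type)
    (p q u v w : (measurableTypeR R * measurableTypeR R)%type -> R) (k : R) : A `<=` Omega ->
  {ae (@mu2 R), forall x, Omega x -> w x = (k *: u + v) x} ->
  ae_eq (@mu2 R) A (fun x => (((k *: p + q) x - w x) ^+ 2)%:E)
    (fun x => ((k * (p x - u x) + (q x - v x)) ^+ 2)%:E).
Proof.
move=> AO h; apply: filterS h => x hx /AO Ox; rewrite hx//.
congr ((_ ^+ 2)%:E); rewrite -[(k *: p + q) x]/(k * p x + q x) -[(k *: u + v) x]/(k * u x + v x).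
by ring.
Qed.

Lemma ae_zero_restrict {R : realType} (Omega A : set (measurableTypeR R * measurableTypeR R)%type)
    (w : (measurableTypeR R * measurableTypeR R)%type -> R) : A `<=` Omega ->
  {ae (@mu2 R), forall x, Omega x -> w x = 0} ->
  ae_eq (@mu2 R) A (fun x => ((0 - w x) ^+ 2)%:E) (cst 0%E).
Proof.
by move=> AO h; apply: filterS h => x hx /AO Ox; rewrite hx// subr0 expr0n.
Qed.

Section TraceLinear.
Context {R : realType}.
Local Notation plane := (measurableTypeR R * measurableTypeR R)%type.
Local Notation mu := (@lebesgue_measure R).
Local Notation mu2 := (@mu2 R).

Lemma ereal_cvg0_comb (x y z : nat -> \bar R) (a b : R) :
  (forall n, 0 <= x n)%E -> (forall n, x n <= a%:E * y n + b%:E * z n)%E ->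
  y @ \oo --> 0%E -> z @ \oo --> 0%E -> x @ \oo --> 0%E.
Proof.
move=> x0 h cy cz.
have c : (fun n => a%:E * y n + b%:E * z n)%E @ \oo --> (a%:E * 0 + b%:E * 0)%E.
  by apply: cvgeD; [rewrite !mule0|apply: cvgeZl|apply: cvgeZl].
rewrite !mule0 adde0 in c.
have c0 : (fun _ : nat => 0%E : \bar R) @ \oo --> 0%E by exact: cvg_cst.
by apply: (squeeze_cvge _ c0 c); apply: nearW => n; rewrite x0 h.
Qed.

Lemma sq_comb_le (k x y : R) : (k * x + y) ^+ 2 <= 2 * k ^+ 2 * x ^+ 2 + 2 * y ^+ 2.
Proof.
have := sqr_ge0 (k * x - y).
have -> : 2 * k ^+ 2 * x ^+ 2 + 2 * y ^+ 2 = (k * x + y) ^+ 2 + (k * x - y) ^+ 2 by ring.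
by move=> h; rewrite lerDl.
Qed.

Lemma pd_0 i j : pd i j (0 : R * R -> R) = 0.
Proof.
have h := pd_lin i j 1 (@smooth2_0 R) (@smooth2_0 R).
rewrite !scale1r addr0 in h.
by apply: (addIr (pd i j 0)); rewrite add0r -h.
Qed.

Section Domain.
Variable Omega : set (R * R).
Hypothesis oO : open Omega.
Let mO : measurable (Omega : set plane) := open_measurable_plane oO.

Lemma H2_lin k u v : H2 Omega u -> H2 Omega v -> H2 Omega (k *: u + v).
Proof.
move=> [Lu hu] [Lv hv]; split; first exact: (proj2 (sqint_linsub mu2 mO)).
by move=> i j ij; apply: has_weak_deriv_lin => //; [exact: hu|exact: hv].
Qed.

Lemma H2_0 : H2 Omega 0.
Proof.
have L0 : L2 Omega 0 := proj1 (sqint_linsub mu2 mO).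
by split=> // i j _; exists 0; split=> //; exact: is_weak_deriv0.
Qed.

Lemma open_norm_lt (r : R) : open (Omega `&` [set x | `|x| < r]).
Proof.
apply: openI => //.
by apply: (open_comp (D := [set y : R | y < r]) (f := fun x : R * R => `|x|)); [move=> x _; exact: norm_continuous|exact: open_lt].
Qed.

Lemma cvg_H2loc_lin k (phi psi : nat -> R * R -> R) u v : H2 Omega u -> H2 Omega v ->
  (forall n, smooth2 (phi n)) -> (forall n, smooth2 (psi n)) ->
  cvg_H2loc Omega phi u -> cvg_H2loc Omega psi v ->
  cvg_H2loc Omega (fun n => k *: phi n + psi n) (k *: u + v).
Proof.
move=> [Lu hu] [Lv hv] sphi spsi cphi cpsi r i j ij.
have A1 := cphi r i j ij; have A2 := cpsi r i j ij.
set A := Omega `&` _ in A1 A2 *.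
have mA : measurable (A : set plane) := open_measurable_plane (@open_norm_lt r).
have AO : A `<=` Omega by move=> x [].
have [[mu1 _] _] := wD_spec (hu i j ij); have [[mv1 _] _] := wD_spec (hv i j ij).
have [[mw1 _] _] := wD_spec (has_weak_deriv_lin oO k Lu Lv (hu i j ij) (hv i j ij)).
have ae := wD_lin oO k Lu Lv (hu i j ij) (hv i j ij).
have mpd f : smooth2 f -> measurable_fun A (pd i j f : plane -> R).
  by move=> sf; apply: measurable_funTS; apply: continuous_measurable_plane;
    apply: smooth2_continuous; exact: smooth2_pd.
apply: (ereal_cvg0_comb _ _ A1 A2 (a := 2 * k ^+ 2) (b := 2)) => n.
  by apply: integral_ge0 => x _; rewrite lee_fin sqr_ge0.
have m1 := mpd _ (sphi n); have m2 := mpd _ (spsi n).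
have m3 := mpd _ (smooth2_lin k (sphi n) (spsi n)).
have mu1' := measurable_funS mO AO mu1; have mv1' := measurable_funS mO AO mv1.
have mw1' := measurable_funS mO AO mw1.
move: m3; rewrite /sqdistL2 (pd_lin i j k (sphi n) (spsi n)).
move: (pd i j (phi n)) (pd i j (psi n)) (wD Omega i j u) (wD Omega i j v)
  (wD Omega i j (k *: u + v)) m1 m2 mu1' mv1' mw1' ae {A1 A2 mu1 mv1 mw1} => p q f g h m1 m2 mf mg mh ae m3.
(* The three [wD] are chosen separately, so the linear relation between them is available only
   almost everywhere. *)
have e := ae_lin_restrict p q AO ae.
rewrite (ge0_ae_eq_integral mA _ _ _ _ e); last 4 first.
- by apply/measurable_EFinP; apply: measurable_funX; exact: measurable_funB.
- apply/measurable_EFinP; apply: measurable_funX; apply: measurable_funD; last exact: measurable_funB.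
  by apply: measurable_funM; [exact: measurable_cst|exact: measurable_funB].
- by move=> x _; rewrite lee_fin sqr_ge0.
- by move=> x _; rewrite lee_fin sqr_ge0.
apply: le_int_comb.
- exact: mA.
- apply/measurable_EFinP; apply: measurable_funX; apply: measurable_funD; last exact: measurable_funB.
  by apply: measurable_funM; [exact: measurable_cst|exact: measurable_funB].
- by apply/measurable_EFinP; apply: measurable_funX; exact: measurable_funB.
- by apply/measurable_EFinP; apply: measurable_funX; exact: measurable_funB.
- by move=> x _; rewrite lee_fin sqr_ge0.
- by move=> x _; rewrite lee_fin sqr_ge0.
- by move=> x _; rewrite lee_fin sqr_ge0.
- by rewrite mulr_ge0 ?sqr_ge0.
- by [].
by move=> x _; rewrite -!EFinM -EFinD lee_fin; exact: sq_comb_le.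
Qed.

Lemma sqnorm_arc_comb (g1 g2 f1 f2 f3 : R -> R) k :
  measurable_fun (`[0, 1]%classic : set (measurableTypeR R)) (f1 : measurableTypeR R -> R) ->
  measurable_fun (`[0, 1]%classic : set (measurableTypeR R)) (f2 : measurableTypeR R -> R) ->
  smooth1 g1 -> smooth1 g2 -> (forall t, f3 t = k * f1 t + f2 t) ->
  (sqnorm_arc g1 g2 f3 <= (2 * k ^+ 2)%:E * sqnorm_arc g1 g2 f1 + 2%:E * sqnorm_arc g1 g2 f2)%E.
Proof.
move=> m1 m2 s1 s2 e.
have cs : continuous (speed g1 g2).
  move=> t; apply: (@continuous_comp _ _ _ (fun t => derive1 g1 t ^+ 2 + derive1 g2 t ^+ 2) Num.sqrt); last exact: sqrt_continuous.
  by apply: cvgD; apply: continuousX_at; apply: smooth1_continuous; exact: smooth1_derive1.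
have ms : measurable_fun (`[0, 1]%classic : set (measurableTypeR R)) (speed g1 g2 : measurableTypeR R -> R).
  by apply: measurable_funTS; exact: continuous_measurable_fun.
have s0 t : 0 <= speed g1 g2 t by exact: sqrtr_ge0.
have f3E : f3 = (fun t => k * f1 t + f2 t) by apply/funext.
have m3 : measurable_fun (`[0, 1]%classic : set (measurableTypeR R)) (f3 : measurableTypeR R -> R).
  by rewrite f3E; apply: measurable_funD => //; apply: measurable_funM => //; exact: measurable_cst.
apply: le_int_comb.
- exact: measurable_itv.
- by apply/measurable_EFinP; apply: measurable_funM => //; exact: measurable_funX.
- by apply/measurable_EFinP; apply: measurable_funM => //; exact: measurable_funX.
- by apply/measurable_EFinP; apply: measurable_funM => //; exact: measurable_funX.
- by move=> t _; rewrite lee_fin mulr_ge0 ?sqr_ge0.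
- by move=> t _; rewrite lee_fin mulr_ge0 ?sqr_ge0.
- by move=> t _; rewrite lee_fin mulr_ge0 ?sqr_ge0.
- by rewrite mulr_ge0 ?sqr_ge0.
- by [].
move=> t _; rewrite -!EFinM -EFinD lee_fin e [X in _ <= X + _]mulrA [X in _ <= _ + X]mulrA -mulrDl.
by apply: ler_wpM2r => //; exact: sq_comb_le.
Qed.

Lemma continuous_arc (g1 g2 : R -> R) (phi : R * R -> R) : smooth1 g1 -> smooth1 g2 ->
  continuous phi -> continuous (fun t => phi (g1 t, g2 t)).
Proof.
move=> s1 s2 cphi t.
apply: (@continuous_comp _ _ _ (fun t : R => (g1 t, g2 t)) phi); last exact: cphi.
have A : g1 @ t --> g1 t by exact: smooth1_continuous.
have B : g2 @ t --> g2 t by exact: smooth1_continuous.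
exact: (cvg_pair A B).
Qed.

Lemma trace0_lin S k u v : H2 Omega u -> H2 Omega v ->
  trace0 Omega S u -> trace0 Omega S v -> trace0 Omega S (k *: u + v).
Proof.
move=> hu hv [phi [s1 c1 t1]] [psi [s2 c2 t2]].
exists (fun n => k *: phi n + psi n); split.
- by move=> n; exact: smooth2_lin.
- exact: cvg_H2loc_lin.
move=> g1 g2 arc; have [sg1 sg2 _] := arc.
apply: (ereal_cvg0_comb _ _ (t1 _ _ arc) (t2 _ _ arc) (a := 2 * k ^+ 2) (b := 2)) => n.
  by apply: integral_ge0 => t _; rewrite lee_fin mulr_ge0 ?sqr_ge0 ?sqrtr_ge0.
apply: sqnorm_arc_comb => //.
- apply: measurable_funTS; apply: continuous_measurable_fun; apply: continuous_arc => //.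
  exact: smooth2_continuous.
- apply: measurable_funTS; apply: continuous_measurable_fun; apply: continuous_arc => //.
  exact: smooth2_continuous.
Qed.

Lemma normal_deriv_lin (g1 g2 : R -> R) phi psi k t : smooth2 phi -> smooth2 psi ->
  normal_deriv g1 g2 (k *: phi + psi) t = k * normal_deriv g1 g2 phi t + normal_deriv g1 g2 psi t.
Proof.
move=> s1 s2; rewrite /normal_deriv -[pd1 _]/(pd 1 0 _) -[pd2 _]/(pd 0 1 _) !pd_lin//.
rewrite -[pd1 phi]/(pd 1 0 phi) -[pd2 phi]/(pd 0 1 phi) -[pd1 psi]/(pd 1 0 psi) -[pd2 psi]/(pd 0 1 psi).
move: (pd 1 0 phi) (pd 0 1 phi) (pd 1 0 psi) (pd 0 1 psi) (speed g1 g2 t)^-1 => a b c d e.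
rewrite -[(k *: a + c) _]/(k * a _ + c _) -[(k *: b + d) _]/(k * b _ + d _).
by move: (a _) (b _) (c _) (d _) => a' b' c' d'; ring.
Qed.

Lemma normal_deriv_measurable (g1 g2 : R -> R) phi : smooth1 g1 -> smooth1 g2 -> smooth2 phi ->
  (forall t, 0 <= t <= 1 -> speed g1 g2 t != 0) ->
  measurable_fun (`[0, 1]%classic : set (measurableTypeR R)) (normal_deriv g1 g2 phi : measurableTypeR R -> R).
Proof.
move=> s1 s2 sphi sp.
apply: subspace_continuous_measurable_fun; first exact: measurable_itv.
apply: continuous_in_within => t t01.
have c1 : continuous (derive1 g1) by apply: smooth1_continuous; exact: smooth1_derive1.
have c2 : continuous (derive1 g2) by apply: smooth1_continuous; exact: smooth1_derive1.
apply: cvgM; last first.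
  apply: cvgV; first exact: sp.
  apply: (@continuous_comp _ _ _ (fun t => derive1 g1 t ^+ 2 + derive1 g2 t ^+ 2) Num.sqrt); last exact: sqrt_continuous.
  by apply: cvgD; apply: continuousX_at; [exact: c1|exact: c2].
apply: cvgB; apply: cvgM; [exact: c2| |exact: c1|].
  by apply: continuous_arc => //; apply: smooth2_continuous; exact: smooth2_pd1.
by apply: continuous_arc => //; apply: smooth2_continuous; exact: smooth2_pd2.
Qed.

Lemma normal_trace0_lin S k u v : H2 Omega u -> H2 Omega v ->
  normal_trace0 Omega S u -> normal_trace0 Omega S v -> normal_trace0 Omega S (k *: u + v).
Proof.
move=> hu hv [phi [s1 c1 t1]] [psi [s2 c2 t2]].
exists (fun n => k *: phi n + psi n); split.
- by move=> n; exact: smooth2_lin.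
- exact: cvg_H2loc_lin.
move=> g1 g2 arc; have [sg1 sg2 sp] := arc.
have sp' t : 0 <= t <= 1 -> speed g1 g2 t != 0 by move=> /sp[].
apply: (ereal_cvg0_comb _ _ (t1 _ _ arc) (t2 _ _ arc) (a := 2 * k ^+ 2) (b := 2)) => n.
  by apply: integral_ge0 => t _; rewrite lee_fin mulr_ge0 ?sqr_ge0 ?sqrtr_ge0.
apply: sqnorm_arc_comb => //.
- exact: normal_deriv_measurable.
- exact: normal_deriv_measurable.
- by move=> t; exact: normal_deriv_lin.
Qed.

Lemma cvg_H2loc_0 : cvg_H2loc Omega (fun _ => 0) 0.
Proof.
move=> r i j ij.
set A := Omega `&` _.
have AO : A `<=` Omega by move=> x [].
have mA : measurable (A : set plane) := open_measurable_plane (@open_norm_lt r).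
have L0 : L2 Omega 0 := proj1 (sqint_linsub mu2 mO).
have [[mw _] _] := wD_spec (ex_intro _ 0 (conj L0 (is_weak_deriv0 oO i j)) : has_weak_deriv Omega i j 0).
have ae := wD_ae oO L0 (is_weak_deriv0 oO i j).
have mw' := measurable_funS mO AO mw.
have e : sqdistL2 A (pd i j 0) (wD Omega i j 0) = 0%E.
  rewrite /sqdistL2 pd_0.
  rewrite (ge0_ae_eq_integral mA _ _ _ _ (ae_zero_restrict AO ae)) ?integral0//.
  + by apply/measurable_EFinP; apply: measurable_funX; apply: measurable_funB => //; exact: measurable_cst.
  + by move=> x _; rewrite lee_fin sqr_ge0.
by rewrite e; exact: cvg_cst.
Qed.

Lemma plate_dom_linsub (GD GM : set (R * R)) : linsub (plate_dom Omega GD GM).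
Proof.
split; last first.
  move=> k u v [u1 u2 u3 u4] [v1 v2 v3 v4].
  by split; [exact: H2_lin|exact: trace0_lin|exact: normal_trace0_lin|exact: trace0_lin].
have t0 S : trace0 Omega S 0.
  exists (fun _ => 0); split; [by move=> _; exact: smooth2_0|exact: cvg_H2loc_0|].
  move=> g1 g2 _; have e : sqnorm_arc g1 g2 (fun t => (0 : R * R -> R) (g1 t, g2 t)) = 0%E.
    by rewrite /sqnorm_arc; under eq_integral do rewrite expr0n/= mul0r; rewrite integral0.
  by rewrite e; exact: cvg_cst.
split; [exact: H2_0|exact: t0| |exact: t0].
exists (fun _ => 0); split; [by move=> _; exact: smooth2_0|exact: cvg_H2loc_0|].
move=> g1 g2 _; have e : sqnorm_arc g1 g2 (normal_deriv g1 g2 0) = 0%E.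
  rewrite /sqnorm_arc /normal_deriv -[pd1 0]/(pd 1 0 0) -[pd2 0]/(pd 0 1 0) !pd_0.
  by under eq_integral do rewrite !mulr0 subrr mul0r expr0n/= mul0r; rewrite integral0.
by rewrite e; exact: cvg_cst.
Qed.

Lemma plate_dom_second_order (GD GM : set (R * R)) : plate_dom Omega GD GM `<=` second_order Omega.
Proof. by move=> u [[Lu hu] _ _ _]; split=> //; split; exact: hu. Qed.

End Domain.
End TraceLinear.

(** * Passing from smooth approximants to the form domain *)

Lemma ae_subset_eq {R : realType} (Omega D : set (measurableTypeR R * measurableTypeR R)%type)
    (v w : (measurableTypeR R * measurableTypeR R)%type -> R) : D `<=` Omega ->
  {ae (@mu2 R), forall x, Omega x -> v x = w x} -> {ae (@mu2 R), forall x, D x -> v x = w x}.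
Proof. by move=> DO h; apply: filterS h => x hx /DO; exact: hx. Qed.

Lemma dot_sum4 d (T : measurableType d) (R : realType) (mu : {measure set T -> \bar R})
    (D : set T) (f0 f1 f2 f3 : T -> R) : measurable D ->
  sqint mu D f0 -> sqint mu D f1 -> sqint mu D f2 -> sqint mu D f3 ->
  (\int[mu]_(x in D) (f0 x ^+ 2 + f1 x ^+ 2 + f2 x ^+ 2 + f3 x ^+ 2)%:E =
   (dot mu D f0 f0 + dot mu D f1 f1 + dot mu D f2 f2 + dot mu D f3 f3)%:E)%E.
Proof.
move=> mD s0 s1 s2 s3.
have m (f : T -> R) : sqint mu D f -> measurable_fun D (fun x => (f x ^+ 2)%:E).
  by move=> [mf _]; apply/measurable_EFinP; exact: measurable_funX.
have p (f : T -> R) x : D x -> (0 <= (f x ^+ 2)%:E)%E by move=> _; rewrite lee_fin sqr_ge0.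
have m0 := m _ s0; have m1 := m _ s1; have m2 := m _ s2; have m3 := m _ s3.
rewrite !EFinD (dot_EFin mD s0) (dot_EFin mD s1) (dot_EFin mD s2) (dot_EFin mD s3).
rewrite -(ge0_integralD mu mD (p f0) m0 (p f1) m1).
have m01 := emeasurable_funD m0 m1.
rewrite -(ge0_integralD mu mD _ m01 (p f2) m2); last first.
  by move=> x _; rewrite adde_ge0// lee_fin sqr_ge0.
rewrite -(ge0_integralD mu mD _ (emeasurable_funD m01 m2) (p f3) m3) //.
by move=> x _; rewrite !adde_ge0// lee_fin sqr_ge0.
Qed.

Section Approximation.
Context {R : realType}.
Local Notation plane := (measurableTypeR R * measurableTypeR R)%type.
Local Notation mu := (@lebesgue_measure R).
Local Notation mu2 := (@mu2 R).

Lemma dot_subset_le (D E : set plane) (u : plane -> R) : measurable D -> measurable E -> D `<=` E ->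
  sqint mu2 E u -> dot mu2 D u u <= dot mu2 E u u.
Proof.
move=> mD mE DE su; rewrite -lee_fin.
rewrite (dot_EFin mD (sqint_subset mE mD DE su)) (dot_EFin mE su).
apply: ge0_subset_integral => //.
- by apply/measurable_EFinP; apply: measurable_funX; case: su.
- by move=> x _; rewrite lee_fin sqr_ge0.
Qed.

Lemma norm_lt_box (rho : R) : exists n : nat, [set x : R * R | `|x| < rho] `<=` box (- n%:R) n%:R (- n%:R) n%:R.
Proof.
have [n /andP[_ hn]] := archi_norm rho.
exists n => x /=; rewrite prod_normE gt_max => /andP[h1 h2].
move: h1 h2; rewrite !ltr_norml => /andP[h1 h2] /andP[h3 h4].
by split; rewrite /= in_itv/=; apply/andP; split; lra.
Qed.

Lemma bounded_cont_sqint (D : set plane) (rho : R) (phi : R * R -> R) : measurable D ->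
  (forall x : R * R, D x -> `|x| < rho) -> continuous phi -> sqint mu2 D (phi : plane -> R).
Proof.
move=> mD Dr cphi; have [n hn] := norm_lt_box rho.
have nn : - n%:R <= n%:R :> R by apply: le_trans (ler0n R n); rewrite oppr_le0.
apply: (sqint_subset _ mD _ (cont_box_sqint nn nn cphi)); first exact: measurable_box.
by move=> x /Dr; exact: hn.
Qed.

Lemma bounded_mu2 (D : set plane) (rho : R) : measurable D ->
  (forall x : R * R, D x -> `|x| < rho) -> exists m, mu2 D = m%:E.
Proof.
move=> mD Dr; have [n hn] := norm_lt_box rho.
have nn : - n%:R <= n%:R :> R by apply: le_trans (ler0n R n); rewrite oppr_le0.
exists (fine (mu2 D)); rewrite fineK// ge0_fin_numE//.
apply: (@le_lt_trans _ _ (mu2 (box (- n%:R) n%:R (- n%:R) n%:R))).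
  by apply: le_measure; rewrite ?inE//; [exact: measurable_box|move=> x /Dr; exact: hn].
by rewrite mu2_box// ltry.
Qed.

Lemma Rintegral_dot1 (D : set plane) (u : plane -> R) : \int[mu2]_(x in D) u x = dot mu2 D u (cst 1).
Proof. by apply: eq_Rintegral => x _; rewrite mulr1. Qed.

Variable Omega : set (R * R).
Hypothesis oO : open Omega.
Let mO : measurable (Omega : set plane) := open_measurable_plane oO.

Variables (phi : nat -> R * R -> R) (u : R * R -> R).
Hypotheses (hu : H2 Omega u) (sphi : forall n, smooth2 (phi n)) (cphi : cvg_H2loc Omega phi u).
Variables (D : set plane) (rho : R).
Hypotheses (mD : measurable D) (DO : D `<=` Omega) (Dr : forall x : R * R, D x -> `|x| < rho).

Let wu i j : (i + j <= 2)%N -> L2 Omega (wD Omega i j u).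
Proof. by move=> ij; have [] := wD_spec (proj2 hu i j ij). Qed.

Let spd i j n (A : set plane) : measurable A -> (forall x : R * R, A x -> `|x| < rho) ->
  sqint mu2 A (pd i j (phi n) : plane -> R).
Proof.
by move=> mA Ar; apply: (bounded_cont_sqint mA Ar); apply: smooth2_continuous; exact: smooth2_pd.
Qed.

(** On a bounded [D] the extended real convergence of [cvg_H2loc] becomes convergence in a
    semi-inner product, to which the abstract lemmas apply. *)
Lemma approx_diff i j : (i + j <= 2)%N ->
  dot mu2 D (pd i j (phi n) - wD Omega i j u) (pd i j (phi n) - wD Omega i j u) @[n --> \oo] --> 0.
Proof.
move=> ij; have := cphi rho ij.
set A := Omega `&` _ => cA.
have mA : measurable (A : set plane) := open_measurable_plane (@open_norm_lt _ _ oO rho).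
have AO : A `<=` Omega by move=> x [].
have Ar (x : R * R) : A x -> `|x| < rho by case.
have DA : D `<=` A by move=> x Dx; split; [exact: DO|exact: Dr].
have sA n := linsubB (sqint_linsub mu2 mA) (spd i j n mA Ar) (sqint_subset mO mA AO (wu ij)).
have eA n : sqdistL2 A (pd i j (phi n)) (wD Omega i j u) =
    (dot mu2 A (pd i j (phi n) - wD Omega i j u) (pd i j (phi n) - wD Omega i j u))%:E.
  by rewrite (dot_EFin mA (sA n)).
have cA' : (fun n => dot mu2 A (pd i j (phi n) - wD Omega i j u) (pd i j (phi n) - wD Omega i j u)) @ \oo --> (0 : R).
  apply: cvg_trans (fine_cvg cA); apply: near_eq_cvg; apply: nearW => n.
  exact: (congr1 fine (eA n)).
have c0 : (fun _ : nat => 0 : R) @ \oo --> (0 : R) by exact: cvg_cst.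
apply: (squeeze_cvgr _ c0 cA'); apply: nearW => n.
rewrite (dot_subset_le mD mA DA (sA n)) andbT.
exact: (sip_ge0 (dot_sip mu2 mD) (sqint_subset mA mD DA (sA n))).
Qed.

Lemma approx_norm i j : (i + j <= 2)%N ->
  dot mu2 D (pd i j (phi n)) (pd i j (phi n)) @[n --> \oo] -->
  dot mu2 D (wD Omega i j u) (wD Omega i j u).
Proof.
move=> ij; have s n := spd i j n mD Dr.
have sw := sqint_subset mO mD DO (wu ij).
exact: (sip_cvg (dot_sip mu2 mD) s sw s sw (approx_diff ij) (approx_diff ij)).
Qed.

Lemma dot_wD00 : dot mu2 D (wD Omega 0 0 u) (wD Omega 0 0 u) = dot mu2 D u u.
Proof.
have su := sqint_subset mO mD DO (proj1 hu).
have sw := sqint_subset mO mD DO (wu (isT : (0 + 0 <= 2)%N)).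
have e : {ae mu2, forall x, D x -> wD Omega 0 0 u x = u x}.
  exact: (ae_subset_eq DO (wD00 oO (proj1 hu))).
transitivity (dot mu2 D u (wD Omega 0 0 u)); first exact: (eq_dot mD sw su sw e).
transitivity (dot mu2 D (wD Omega 0 0 u) u); first exact: (sipC (dot_sip mu2 mD) su sw).
exact: (eq_dot mD sw su su e).
Qed.

Lemma approx_norm0 : dot mu2 D (phi n) (phi n) @[n --> \oo] --> dot mu2 D u u.
Proof. by rewrite -dot_wD00; exact: (@approx_norm 0 0). Qed.

(** The integral is the product with the constant 1, which is square integrable because [D] is
    bounded. *)
Lemma approx_int : \int[mu2]_(x in D) (phi n x) @[n --> \oo] --> (\int[mu2]_(x in D) (u x) : R).
Proof.
have [m mE] := bounded_mu2 mD Dr.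
have s1 := sqint_cst mD 1 mE.
have s n := spd 0 0 n mD Dr.
have su := sqint_subset mO mD DO (proj1 hu).
have sw := sqint_subset mO mD DO (wu (isT : (0 + 0 <= 2)%N)).
have e : {ae mu2, forall x, D x -> wD Omega 0 0 u x = u x}.
  exact: (ae_subset_eq DO (wD00 oO (proj1 hu))).
rewrite Rintegral_dot1 -(eq_dot mD sw su s1 e).
under eq_fun do rewrite Rintegral_dot1.
exact: (sip_cvg_l (dot_sip mu2 mD) s sw s1 (@approx_diff 0 0 isT)).
Qed.

Lemma energy_dot n : (\int[mu2]_(x in D) (energy (phi n) x)%:E =
  (dot mu2 D (pd 0 0 (phi n)) (pd 0 0 (phi n)) + dot mu2 D (pd 2 0 (phi n)) (pd 2 0 (phi n)) +
   dot mu2 D (pd 1 1 (phi n)) (pd 1 1 (phi n)) + dot mu2 D (pd 0 2 (phi n)) (pd 0 2 (phi n)))%:E)%E.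
Proof.
exact: (dot_sum4 mD (spd 0 0 n mD Dr) (spd 2 0 n mD Dr) (spd 1 1 n mD Dr) (spd 0 2 n mD Dr)).
Qed.

End Approximation.

(** * The boundary of the cusp parametrised by smooth arcs *)

Section Arcs.
Context {R : realType}.
Local Notation plane := (measurableTypeR R * measurableTypeR R)%type.
Local Notation mu := (@lebesgue_measure R).
Local Notation mu2 := (@mu2 R).

Lemma is_derive_affine (a c t : R) : is_derive t 1 (fun t => a + c * t) c.
Proof.
have [h4 h5] := is_deriveD (is_derive_cst a t 1) (is_deriveZ (f := id) (x := t) (v := 1) c (is_derive_id t (1 : R))).
by apply: DeriveDef; [exact: h4|rewrite [LHS]h5 add0r /GRing.scale/= mulr1].
Qed.

(** All derivatives are given in closed form, because [smooth1] speaks of every [derive1n]. *)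
Lemma derive1n_affine (f : R -> R) (k a c : R) n : smooth1 f ->
  derive1n n (fun t => k * f (a + c * t)) = (fun t => k * c ^+ n * derive1n n f (a + c * t)) /\
  forall t : R, is_derive t 1 (fun t => k * c ^+ n * derive1n n f (a + c * t))
    (k * c ^+ n.+1 * derive1n n.+1 f (a + c * t)).
Proof.
move=> sf.
have D m (t : R) : is_derive t 1 (fun t => k * c ^+ m * derive1n m f (a + c * t))
    (k * c ^+ m.+1 * derive1n m.+1 f (a + c * t)).
  have d1 : is_derive (a + c * t) 1 (derive1n m f) (derive1n m.+1 f (a + c * t)).
    by apply: DeriveDef; [exact: (sf m)|rewrite /derive1n iterS derive1E].
  have [h4 h5] := is_deriveZ (k * c ^+ m) (is_derive1_comp (f := derive1n m f) (g := fun t => a + c * t) d1 (is_derive_affine a c t)).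
  apply: DeriveDef; first exact: h4.
  by rewrite [LHS]h5 /GRing.scale/= exprSr; ring.
split; last exact: D.
elim: n => [|n ih]; first by apply/funext => t; rewrite expr0 mulr1.
rewrite /derive1n iterS -/(derive1n n _) ih; apply/funext => t; rewrite derive1E.
by have [_ ->] := D n t.
Qed.

Lemma smooth1_scale_affine (f : R -> R) (k a c : R) : smooth1 f ->
  smooth1 (fun t => k * f (a + c * t)).
Proof.
move=> sf n t; have [e d] := derive1n_affine k a c n sf.
by rewrite e; case: (d t).
Qed.

Lemma smooth1_id : smooth1 (id : R -> R).
Proof.
have d1 : derive1 (id : R -> R) = cst 1 by apply/funext => x; rewrite derive1E derive_id.
have d2 n : derive1n n (cst 0 : R -> R) = cst 0.
  by elim: n => // n ih; rewrite /derive1n iterS -/(derive1n n _) ih; apply/funext => x; rewrite derive1E derive_cst.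
move=> [|[|n]] x; first exact: derivable_id.
  by rewrite /derive1n/= d1; exact: derivable_cst.
rewrite /derive1n !iterSr d1.
have -> : derive1 (cst 1 : R -> R) = cst 0 by apply/funext => y; rewrite derive1E derive_cst.
by rewrite -/(derive1n n _) d2; exact: derivable_cst.
Qed.

Lemma smooth1_affine (a c : R) : smooth1 (fun t : R => a + c * t).
Proof.
have := @smooth1_scale_affine id 1 a c smooth1_id.
by congr smooth1; apply/funext => t; rewrite mul1r.
Qed.

Lemma intv_affine (a b : R) (F : R -> R) : a < b -> continuous F ->
  intv 0 1 (fun t => (b - a) * F (a + (b - a) * t)) = intv a b F.
Proof.
move=> ab cF; pose P y := intv (a - 1) y F.
have dP (x : R) : a <= x <= b -> is_derive x 1 P (F x).
  by move=> /andP[h1 h2]; apply: primitive_derive => //; lra.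
have cP : {within `[a, b], continuous F} by apply: continuous_in_within => x _; exact: cF.
rewrite (ftc_local (ltW ab) dP cP).
have d1 (t : R) : 0 <= t <= 1 -> is_derive t 1 (fun t => P (a + (b - a) * t)) ((b - a) * F (a + (b - a) * t)).
  move=> /andP[h1 h2].
  have h3 : a <= a + (b - a) * t <= b by apply/andP; split; nra.
  rewrite mulrC.
  exact: (is_derive1_comp (f := P) (g := fun t => a + (b - a) * t) (dP _ h3) (is_derive_affine a (b - a) t)).
have c1 : {within `[0, 1], continuous (fun t => (b - a) * F (a + (b - a) * t))}.
  apply: continuous_in_within => x _.
  apply: cvgM; first exact: cvg_cst.
  apply: (@continuous_comp _ _ _ (fun t => a + (b - a) * t) F); last exact: cF.
  by apply: cvgD; [exact: cvg_cst|apply: cvgM; [exact: cvg_cst|exact: cvg_id]].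
by rewrite (ftc_local ler01 d1 c1) mulr0 addr0 mulr1 (addrC a) subrK.
Qed.

Variables (g : R -> R) (sg : R).
Hypothesis sm : smooth1 g.

(** With [arc2], the graph of [sg * g] over [[r, Y]], parametrised over [[0, 1]] as [smooth_arc_in]
    prescribes; it uses [g] because an arc must be smooth on the whole line. *)
Definition arc1 (r Y t : R) := r + (Y - r) * t.
Definition arc2 (r Y t : R) := sg * g (r + (Y - r) * t).

Lemma speed_arc (r Y t : R) : r < Y -> Y - r <= speed (arc1 r Y) (arc2 r Y) t.
Proof.
move=> rY; rewrite /speed.
have -> : derive1 (arc1 r Y) t = Y - r.
  by rewrite derive1E; have [_ ->] := is_derive_affine r (Y - r) t.
rewrite -[X in X <= _]ger0_norm ?subr_ge0 ?(ltW rY)// -sqrtr_sqr.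
by rewrite ler_sqrt ?addr_ge0 ?sqr_ge0// lerDl sqr_ge0.
Qed.

(** The speed is at least [Y - r]: arc length dominates dy, so a trace vanishing along the arc makes
    the boundary integral of [tube_tail] vanish. *)
Lemma trace_arc (r Y : R) (phi : R * R -> R) : r < Y -> smooth2 phi ->
  (\int[mu]_(y in `[r, Y[) (phi (y, sg * g y) ^+ 2)%:E <=
   sqnorm_arc (arc1 r Y) (arc2 r Y) (fun t => phi (arc1 r Y t, arc2 r Y t)))%E.
Proof.
move=> rY sphi.
have s1 : smooth1 (arc1 r Y) := @smooth1_affine r (Y - r).
have s2 : smooth1 (arc2 r Y) := @smooth1_scale_affine g sg r (Y - r) sm.
have cphi := smooth2_continuous sphi.
have cF : continuous (fun y => phi (y, sg * g y) ^+ 2).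
  apply: contX => y.
  apply: (@continuous_comp _ _ _ (fun y : R => (y, sg * g y)) phi); last exact: cphi.
  have A : (fun y : R => y) @ y --> y by exact: cvg_id.
  have B : (fun y => sg * g y) @ y --> sg * g y.
    by apply: cvgM; [exact: cvg_cst|exact: smooth1_continuous].
  exact: (cvg_pair A B).
have ca : continuous (fun t => phi (arc1 r Y t, arc2 r Y t) ^+ 2).
  by apply: contX; exact: continuous_arc.
rewrite itv_cto_cc// -(intv_affine rY cF) intv_EFin; last first.
  apply: contM; first exact: cont_cst.
  exact: ca.
have cs : continuous (speed (arc1 r Y) (arc2 r Y)).
  move=> t; apply: (@continuous_comp _ _ _ (fun t => derive1 (arc1 r Y) t ^+ 2 + derive1 (arc2 r Y) t ^+ 2) Num.sqrt); last exact: sqrt_continuous.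
  by apply: cvgD; apply: continuousX_at; apply: smooth1_continuous; exact: smooth1_derive1.
apply: ge0_le_integral.
- exact: measurable_itv.
- by move=> t _; rewrite lee_fin mulr_ge0 ?sqr_ge0// subr_ge0 ltW.
- apply/measurable_EFinP; apply: measurable_funTS; apply: continuous_measurable_fun.
  by apply: contM; [exact: cont_cst|exact: ca].
- apply/measurable_EFinP; apply: measurable_funTS; apply: continuous_measurable_fun.
  by apply: contM; [exact: ca|exact: cs].
move=> t _; rewrite lee_fin mulrC; apply: ler_wpM2l; first exact: sqr_ge0.
exact: speed_arc.
Qed.

End Arcs.

(** * Passing the inequalities from approximants to the form domain *)

Section Ehrling.
Context {R : realType}.
Local Notation plane := (measurableTypeR R * measurableTypeR R)%type.
Local Notation mu := (@lebesgue_measure R).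
Local Notation mu2 := (@mu2 R).
Variable Omega : set (R * R).
Hypothesis oO : open Omega.
Let mO : measurable (Omega : set plane) := open_measurable_plane oO.

Definition graph_norm (u : R * R -> R) : R := dot mu2 Omega u u + hessian_norm Omega u.

Lemma le_cvg_comb (x y z : R^nat) (a b l m p : R) : x @ \oo --> l -> y @ \oo --> m ->
  z @ \oo --> p -> (forall n, x n <= a * y n + b * z n) -> l <= a * m + b * p.
Proof.
move=> cx cy cz h.
have cR : (fun n => a * y n + b * z n) @ \oo --> a * m + b * p.
  by apply: cvgD; apply: cvgM => //; exact: cvg_cst.
exact: (ler_cvg_to cx cR (nearW _ h)).
Qed.

Section Limit.
Variables (phi : nat -> R * R -> R) (u : R * R -> R).
Hypotheses (hu : H2 Omega u) (sphi : forall n, smooth2 (phi n)) (cphi : cvg_H2loc Omega phi u).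

(** Takes a family of derivatives, so as to cover both the classical ones of an approximant and the
    weak ones of [u]. *)
Definition energy_on (D : set plane) (f : nat -> nat -> R * R -> R) : R :=
  dot mu2 D (f 0 0)%N (f 0 0)%N + dot mu2 D (f 2 0)%N (f 2 0)%N +
  dot mu2 D (f 1 1)%N (f 1 1)%N + dot mu2 D (f 0 2)%N (f 0 2)%N.

Lemma energy_limit (D : set plane) rho : measurable D -> D `<=` Omega ->
  (forall x : R * R, D x -> `|x| < rho) ->
  energy_on D (fun i j => pd i j (phi n)) @[n --> \oo] --> energy_on D (fun i j => wD Omega i j u).
Proof.
move=> mD DO Dr.
have h i j : (i + j <= 2)%N -> _ := @approx_norm R Omega oO phi u hu sphi cphi D rho mD DO Dr i j.
have h00 := h 0%N 0%N isT; have h20 := h 2%N 0%N isT; have h11 := h 1%N 1%N isT; have h02 := h 0%N 2%N isT.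
exact: (cvgD (cvgD (cvgD h00 h20) h11) h02).
Qed.

Lemma le_add4 (a b c d a' b' c' d' : R) : a <= a' -> b <= b' -> c <= c' -> d <= d' ->
  a + b + c + d <= a' + (b' + c' + d').
Proof. by move=> *; lra. Qed.

Lemma energy_le_graph_norm (D : set plane) : measurable D -> D `<=` Omega ->
  energy_on D (fun i j => wD Omega i j u) <= graph_norm u.
Proof.
move=> mD DO.
have h i j : (i + j <= 2)%N -> dot mu2 D (wD Omega i j u) (wD Omega i j u) <= dot mu2 Omega (wD Omega i j u) (wD Omega i j u).
  move=> ij; apply: dot_subset_le => //.
  by have [] := wD_spec (proj2 hu i j ij).
have h00 : dot mu2 D (wD Omega 0 0 u) (wD Omega 0 0 u) <= dot mu2 Omega u u.
  rewrite (dot_wD00 oO hu mD DO).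
  by apply: dot_subset_le => //; exact: (proj1 hu).
exact: (le_add4 h00 (h 2%N 0%N isT) (h 1%N 1%N isT) (h 0%N 2%N isT)).
Qed.

(** [Y] is fixed while [n] grows: on a bounded tube all terms converge, and the boundary integral
    tends to 0 because the arc over [[r, Y]] is compact. *)
Lemma tail_limit (g : R -> R) (C r1 r e sg Y rho : R) : smooth1 g -> r1 <= r -> r < Y -> 0 <= e ->
  (forall n, (\int[mu2]_(x in tube g r Y) (phi n x ^+ 2)%:E <=
     C%:E * \int[mu]_(y in `[r, Y[) (phi n (y, sg * g y) ^+ 2)%:E +
     e%:E * \int[mu2]_(x in tube g r1 Y) (energy (phi n) x)%:E)%E) ->
  sqnorm_arc (arc1 r Y) (arc2 g sg r Y) (fun t => phi n (arc1 r Y t, arc2 g sg r Y t))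
     @[n --> \oo] --> 0%E ->
  tube g r1 Y `<=` Omega -> (forall x : R * R, tube g r1 Y x -> `|x| < rho) ->
  dot mu2 (tube g r Y) u u <= e * graph_norm u.
Proof.
move=> sg1 r1r rY e0 hle carc TO Trho.
have cg := smooth1_continuous sg1.
have mT := measurable_tube cg r Y; have mT1 := measurable_tube cg r1 Y.
have TT : tube g r Y `<=` tube g r1 Y.
  by move=> x [/andP[h1 h2] h3]; split=> //; rewrite h2 (le_trans r1r h1).
have TO' : tube g r Y `<=` Omega by exact: subset_trans TO.
have Tr' (x : R * R) : tube g r Y x -> `|x| < rho by move=> /TT; exact: Trho.
pose F n y := phi n (y, sg * g y) ^+ 2.
have cF n : continuous (F n).
  apply: contX => y.
  apply: (@continuous_comp _ _ _ (fun y : R => (y, sg * g y)) (phi n)); last exact: smooth2_continuous.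
  have A : (fun y : R => y) @ y --> y by exact: cvg_id.
  have B : (fun y => sg * g y) @ y --> sg * g y by apply: cvgM; [exact: cvg_cst|exact: cg].
  exact: (cvg_pair A B).
have cy : (fun n => intv r Y (F n)) @ \oo --> (0 : R).
  have c0 : (fun _ : nat => 0%E : \bar R) @ \oo --> 0%E by exact: cvg_cst.
  have hE : (fun n => (intv r Y (F n))%:E) @ \oo --> (0%:E : \bar R).
    apply: (squeeze_cvge _ c0 carc); apply: nearW => n; apply/andP; split.
      by rewrite lee_fin intv_ge0// => y; exact: sqr_ge0.
    by rewrite -itv_cto_cc//; exact: trace_arc.
  exact: (fine_cvg hE).
have cx := approx_norm0 oO hu sphi cphi mT TO' Tr'.
have cz := energy_limit mT1 TO Trho.
have sT n : sqint mu2 (tube g r Y) (phi n : plane -> R).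
  by apply: (bounded_cont_sqint mT Tr'); exact: smooth2_continuous.
have real n : dot mu2 (tube g r Y) (phi n) (phi n) <= C * intv r Y (F n) +
    e * energy_on (tube g r1 Y) (fun i j => pd i j (phi n)).
  rewrite -lee_fin EFinD !EFinM (dot_EFin mT (sT n)).
  apply: (le_trans (hle n)).
  by rewrite (itv_cto_cc r Y (cF n)) (energy_dot sphi mT1 Trho).
have h := le_cvg_comb cx cy cz real.
apply: (le_trans h); rewrite mulr0 add0r.
by apply: ler_wpM2l => //; exact: energy_le_graph_norm.
Qed.

Lemma cvg_sum_sq (I : finType) (x : I -> nat -> R) (l : I -> R) : (forall i, x i @ \oo --> l i) ->
  (fun n => \sum_i x i n ^+ 2) @ \oo --> (\sum_i l i ^+ 2 : R).
Proof.
move=> h; apply: (cvg_big (op := +%R) (x0 := 0)) => [|i _]; first exact: add_continuous.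
have -> : (fun n => x i n ^+ 2) = (fun n => x i n * x i n) by apply/funext => n; rewrite expr2.
by rewrite expr2; apply: cvgM.
Qed.

Lemma bounded_limit (S E : set plane) (I : finType) (B : I -> set plane) (e K rho : R) :
  measurable S -> measurable E -> E `<=` Omega -> (forall x : R * R, E x -> `|x| < rho) -> S `<=` E -> 0 <= e ->
  (forall i, measurable (B i) /\ B i `<=` E) ->
  (forall f : R * R -> R, smooth2 f ->
  (\int[mu2]_(x in S) (f x ^+ 2)%:E <= e%:E * \int[mu2]_(x in E) (energy f x)%:E +
    (K * \sum_i (\int[mu2]_(x in B i) f x) ^+ 2)%:E)%E) ->
  dot mu2 S u u <= e * graph_norm u + K * \sum_i (\int[mu2]_(x in B i) u x) ^+ 2.
Proof.
move=> mS mE EO Er SE e0 hB hle.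
have SO : S `<=` Omega by exact: subset_trans EO.
have Sr (x : R * R) : S x -> `|x| < rho by move=> /SE; exact: Er.
have cx := approx_norm0 oO hu sphi cphi mS SO Sr.
have cz := energy_limit mE EO Er.
have cB i : \int[mu2]_(x in B i) (phi n x) @[n --> \oo] --> (\int[mu2]_(x in B i) (u x) : R).
  have [mB BE] := hB i.
  have BO : B i `<=` Omega by exact: subset_trans EO.
  have Br (x : R * R) : B i x -> `|x| < rho by move=> /BE; exact: Er.
  exact: (approx_int oO hu sphi cphi mB BO Br).
have sS n : sqint mu2 S (phi n : plane -> R).
  by apply: (bounded_cont_sqint mS Sr); exact: smooth2_continuous.
have real n : dot mu2 S (phi n) (phi n) <= e * energy_on E (fun i j => pd i j (phi n)) +
    K * \sum_i (\int[mu2]_(x in B i) (phi n x)) ^+ 2.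
  rewrite -lee_fin EFinD EFinM (dot_EFin mS (sS n)).
  apply: (le_trans (hle _ (sphi n))).
  by rewrite (energy_dot sphi mE Er).
have h := le_cvg_comb cx cz (cvg_sum_sq cB) real.
apply: (le_trans h); rewrite lerD2r.
by apply: ler_wpM2l => //; exact: energy_le_graph_norm.
Qed.

End Limit.
End Ehrling.

(** * Compactness *)

Section Functionals.
Context {R : realType}.
Local Notation plane := (measurableTypeR R * measurableTypeR R)%type.
Local Notation mu2 := (@mu2 R).

Lemma dot_setU (A B : set plane) (u : plane -> R) : measurable A -> measurable B -> [disjoint A & B] ->
  sqint mu2 (A `|` B) u -> dot mu2 (A `|` B) u u = dot mu2 A u u + dot mu2 B u u.
Proof.
move=> mA mB AB su; have mAB := measurableU _ _ mA mB.
have sA := sqint_subset mAB mA (@subsetUl _ A B) su.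
have sB := sqint_subset mAB mB (@subsetUr _ A B) su.
apply: EFin_inj; rewrite EFinD (dot_EFin mAB su) (dot_EFin mA sA) (dot_EFin mB sB).
rewrite ge0_integral_setU//.
- by apply/measurable_EFinP; apply: measurable_funX; case: su.
- by move=> x _; rewrite lee_fin sqr_ge0.
Qed.

Lemma patch_cst_sqint (D B : set plane) (k m : R) : measurable D -> measurable B ->
  mu2 B = m%:E -> sqint mu2 D (cst k \_ B).
Proof.
move=> mD mB mE.
have mf : measurable_fun setT (cst k \_ B : plane -> R).
  by apply/(measurable_restrictT _ _).1 => //; exact: measurable_cst.
apply/(sqintP mu2 (measurable_funTS mf)).
apply: (@le_lt_trans _ _ (\int[mu2]_x ((cst k \_ B) x ^+ 2)%:E)%E).
  apply: ge0_subset_integral => //.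
  - by apply/measurable_EFinP; exact: measurable_funX.
  - by move=> x _; rewrite lee_fin sqr_ge0.
have -> : (\int[mu2]_x ((cst k \_ B) x ^+ 2)%:E = \int[mu2]_(x in B) (k ^+ 2)%:E)%E.
  rewrite [RHS]integral_mkcond; apply: eq_integral => x _; rewrite !patchE.
  by case: ifP => // _; rewrite expr0n.
by rewrite integral_cst// mE -EFinM ltry.
Qed.

(** Writes the integral over [B] as the product with an element of L_2; with [k] the root of the
    constant of [tame_at], the squares add up to its finite part. *)
Lemma dot_patch_cst (D B : set plane) (k m : R) (u : plane -> R) : measurable D -> measurable B ->
  B `<=` D -> mu2 B = m%:E -> sqint mu2 D u ->
  dot mu2 D (cst k \_ B) u = k * \int[mu2]_(x in B) u x.
Proof.
move=> mD mB BD mE su.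
have iu := sqint_integrable mB mE (sqint_subset mD mB BD su).
rewrite -(RintegralZl k mB iu) /dot /Rintegral; congr fine.
rewrite integral_mkcond [RHS]integral_mkcond; congr (integral _ _ _).
apply/funext => x; rewrite !patchE; case: ifPn => [xD|xD]; case: ifPn => [xB|xB] //.
  by rewrite mul0r.
by exfalso; move/negP: xD; apply; rewrite inE; apply: BD; move: xB; rewrite inE.
Qed.

End Functionals.

(** * The bounded part of the domain and the boundary arcs of the cusp *)

Section Geometry.
Context {R : realType}.
Local Notation plane := (measurableTypeR R * measurableTypeR R)%type.
Local Notation mu := (@lebesgue_measure R).
Local Notation mu2 := (@mu2 R).
Variables (y0 : R) (H g : R -> R) (Omega : set (R * R)).
Hypotheses (H_pos : forall y, y0 <= y -> 0 < H y) (sg : smooth1 g)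
  (Hg : forall y, y0 <= y -> H y = g y)
  (H_decr : forall y1 y2, y0 <= y1 -> y1 <= y2 -> H y2 <= H y1)
  (oO : open Omega) (Omega_smooth : smooth_boundary Omega)
  (Omega_cusp : Omega `&` [set x | y0 < x.1] = cusp H y0)
  (Omega_bounded : bounded_set (Omega `\` [set x | y0 < x.1])).

Lemma Omega_cuspP (x : R * R) : y0 < x.1 -> Omega x <-> - g x.1 < x.2 < g x.1.
Proof.
move=> h; split.
  move=> Ox; have : cusp H y0 x by rewrite -Omega_cusp.
  by move=> [_ h1 h2]; rewrite -Hg ?(ltW h)// h1 h2.
move=> /andP[h1 h2]; have : cusp H y0 x by split; rewrite // Hg// ltW.
by rewrite -Omega_cusp => -[].
Qed.

Lemma tube_sub_Omega r Y : y0 < r -> tube g r Y `<=` Omega.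
Proof.
move=> yr x [/andP[h1 _] h2]; apply/Omega_cuspP => //; exact: lt_le_trans yr h1.
Qed.

Lemma cusp_norm (m : R) (x : R * R) : y0 < x.1 -> - g x.1 < x.2 < g x.1 -> x.1 < m ->
  `|x| <= `|y0| + `|m| + H y0.
Proof.
move=> h1 h2 h3.
have hH : g x.1 <= H y0 by rewrite -Hg ?(ltW h1)//; exact: H_decr (ltW h1).
have hp := H_pos (lexx y0).
move: h2 => /andP[h4 h5].
have n1 := ler_norm m; have n2 := ler_norm y0; have n3 := ler_norm (- y0); rewrite normrN in n3.
have p1 := normr_ge0 m; have p2 := normr_ge0 y0.
by rewrite prod_normE ge_max !ler_norml; apply/andP; split; apply/andP; split; lra.
Qed.

Lemma tube_bounded r Y : y0 < r -> forall x : R * R, tube g r Y x -> `|x| < `|y0| + `|Y| + H y0 + 1.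
Proof.
move=> yr x [/andP[h1 h2] h3].
by apply: (le_lt_trans (cusp_norm (lt_le_trans yr h1) h3 h2)); rewrite ltrDl.
Qed.

Definition truncated (r : R) : set (R * R) := Omega `&` [set x | x.1 < r].

Lemma truncated_bounded r : exists m, forall x, truncated r x -> `|x| <= m.
Proof.
have [M [_ hM]] := Omega_bounded; have hM1 := hM (M + 1) (ltac:(by rewrite ltrDl)).
exists (Num.max (M + 1) (`|y0| + `|r| + H y0)) => x [Ox xr]; rewrite le_max.
have [h|h] := ltP y0 x.1.
  by apply/orP; right; apply: cusp_norm => //; exact/Omega_cuspP.
by apply/orP; left; apply: hM1; split=> //= h'; move: h; rewrite leNgt h'.
Qed.

Lemma open_truncated r : open (truncated r).
Proof.
apply: openI => //.
by apply: (open_comp (D := [set y | y < r]) (f := fst)); [move=> x _; exact: cvg_fst|exact: open_lt].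
Qed.

(** Each point of the compact closure is either inside [Omega], where a square fits, or on its
    boundary, where [boundary_tame] applies. Points on the cut [x.1 = r] inside [Omega] are
    interior, which is why the energy is taken on a set reaching beyond the cut. *)
Lemma truncated_tame r : exists rho, (truncated r `<=` Omega `&` [set x | `|x| < rho]) /\
  tame (Omega `&` [set x | `|x| < rho]) (truncated r).
Proof.
(* Points of the closure have norm at most [m], and unit balls about them stay within norm
   [m + 2]. *)
have [m hm] := truncated_bounded r; exists (m + 2).
set E := Omega `&` _.
have oE : open E := @open_norm_lt _ _ oO (m + 2).
have SE : truncated r `<=` E.
  by move=> x hx; split; [case: hx|apply: (le_lt_trans (hm x hx)); rewrite ltrDl].
split=> //.
have mS : measurable (truncated r : set plane) := open_measurable_plane (@open_truncated r).
pose K := closure (truncated r).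
have Km x : K x -> `|x| <= m.
  have cm : closed [set x : R * R | `|x| <= m].
    by apply: (closed_comp (D := [set y : R | y <= m]) (f := fun x : R * R => `|x|)); [move=> y _; exact: norm_continuous|exact: closed_le].
  have := @closure_subset _ (truncated r) [set x : R * R | `|x| <= m] hm x.
  by rewrite -((closure_id _).1 cm).
have cK : compact K.
  apply: (closed_rect_compact (a := - m) (b := m) (c := - m) (d := m)); first exact: closed_closure.
  move=> x /Km; rewrite prod_normE ge_max !ler_norml => /andP[h1 h2].
  by split; rewrite /= in_itv/=.
have SK : truncated r `<=` K by exact: subset_closure.
apply: (tame_compact_cover cK mS SK) => x Kx.
have [Ox|nOx] := pselect (Omega x).
  have Ex : E x by split=> //=; apply: (le_lt_trans (Km x Kx)); rewrite ltrDl.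
  have [a [c [l [l0 bE bx]]]] := open_box oE Ex.
  exists ((box a (a + l) c (c + l) : set (R * R))°); split=> //; first exact: open_interior.
  apply: tame_sub (tame_box (open_measurable_plane oE) l0 bE).
  - by apply: measurableI => //; apply: open_measurable_plane; exact: open_interior.
  - by move=> y [_ /interior_subset].
have bx : boundary Omega x.
  split; last by move=> /interior_subset.
  by apply: (closure_subset _ Kx) => y [].
have sub : Omega `&` ball x 1 `<=` E.
  move=> y [Oy [b1 b2]]; split=> //=.
  have hx := Km x Kx; move: hx b1 b2; rewrite /ball/= !prod_normE ge_max gt_max !ltr_norml !ler_norml.
  move=> /andP[/andP[h1 h2] /andP[h3 h4]] /andP[h5 h6] /andP[h7 h8].
  by apply/andP; split; apply/andP; split; lra.
have [U [oU Ux tU]] := boundary_tame oO oE Omega_smooth bx ltr01 sub.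
exists U; split=> //.
apply: tame_sub tU.
- by apply: measurableI => //; exact: open_measurable_plane.
- by move=> y [[]].
Qed.

Lemma arc_in_cusp (sgn r Y rho : R) : sgn = 1 \/ sgn = -1 -> y0 <= rho -> rho < r -> r < Y ->
  smooth_arc_in (if sgn == 1 then cusp_top H rho else cusp_bottom H rho) (arc1 r Y) (arc2 g sgn r Y).
Proof.
move=> hs y0rho rhor rY; split.
- exact: smooth1_affine.
- exact: smooth1_scale_affine.
move=> t /andP[t0 t1]; split; last first.
  rewrite gt_eqF//; apply: lt_le_trans (speed_arc g sgn t rY).
  by rewrite subr_gt0.
have rt : r <= arc1 r Y t by rewrite /arc1 lerDl mulr_ge0// subr_ge0 ltW.
have h1 : rho < arc1 r Y t by exact: lt_le_trans rt.
have h2 : y0 <= arc1 r Y t by apply: le_trans y0rho _; exact: ltW.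
have e : H (arc1 r Y t) = g (r + (Y - r) * t) by rewrite Hg.
case: hs => ->.
  by rewrite eqxx; split; rewrite //= e /arc2 mul1r.
rewrite ifF; first by split; rewrite //= e /arc2 mulN1r.
by apply/negbTE; rewrite eq_sym -subr_eq0 opprK gt_eqF// addr_gt0.
Qed.

End Geometry.

(** * The Ehrling inequality for the plate form *)

Section PlateEhrling.
Context {R : realType}.
Local Notation plane := (measurableTypeR R * measurableTypeR R)%type.
Local Notation mu := (@lebesgue_measure R).
Local Notation mu2 := (@mu2 R).
Variables (y0 : R) (H g : R -> R) (Omega : set (R * R)).
Hypotheses (H_pos : forall y, y0 <= y -> 0 < H y) (sg : smooth1 g)
  (Hg : forall y, y0 <= y -> H y = g y)
  (H_decr : forall y1 y2, y0 <= y1 -> y1 <= y2 -> H y2 <= H y1)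
  (H_deriv : derive1 H y @[y --> +oo] --> (0 : R))
  (G_lim : H y ^- 3 * G_ y0 H y @[y --> +oo] --> +oo)
  (oO : open Omega) (Omega_smooth : smooth_boundary Omega)
  (Omega_cusp : Omega `&` [set x | y0 < x.1] = cusp H y0)
  (Omega_bounded : bounded_set (Omega `\` [set x | y0 < x.1])).
Variables (sgn rho0 : R).
Hypotheses (hsgn : sgn = 1 \/ sgn = -1) (y0rho0 : y0 <= rho0).
Let mO : measurable (Omega : set plane) := open_measurable_plane oO.

(** The estimate on [tube g r Y] does not depend on [Y], so monotone convergence extends it to the
    whole tail. The approximants are those of the trace on the cusp boundary: one and the same
    sequence must converge locally and have vanishing boundary values. *)
Lemma tail_small e m : 0 < e -> exists2 r, m <= r & forall u, H2 Omega u ->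
  trace0 Omega (if sgn == 1 then cusp_top H rho0 else cusp_bottom H rho0) u ->
  dot mu2 (Omega `&` [set x : R * R | r <= x.1]) u u <= e * graph_norm Omega u.
Proof.
move=> e0.
have [r1 y0r1 htail] := cusp_tail H_pos sg Hg H_decr H_deriv G_lim.
(* [r] is pushed beyond [rho0], so that the arcs over [[r, Y]] lie where the trace condition
   holds. *)
have [r [r1r]] := htail e (Num.max m (rho0 + 1)) e0.
rewrite ge_max => /andP[mr rhor] hr; exists r => // u hu [phi [sphi cphi arcphi]].
have r1r' : r1 <= r by apply: le_trans r1r; rewrite lerDl.
have rho0r : rho0 < r by apply: lt_le_trans rhor; rewrite ltrDl.
have y0r : y0 < r by exact: lt_le_trans r1r'.
have cg := smooth1_continuous sg.
have key Y : r < Y -> dot mu2 (tube g r Y) u u <= e * graph_norm Omega u.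
  move=> rY.
  apply: (tail_limit oO hu sphi cphi sg r1r' rY (ltW e0)
    (fun n => hr Y sgn (phi n) (ltW rY) hsgn (sphi n)) _
    (tube_sub_Omega Hg Omega_cusp y0r1 (Y := Y))
    (tube_bounded H_pos Hg H_decr y0r1 (Y := Y))).
  exact: (arcphi _ _ (arc_in_cusp sg Hg hsgn y0rho0 rho0r rY)).
pose F (n : nat) := tube g r (r + n.+1%:R).
have rF n : r < r + n.+1%:R by rewrite ltrDl ltr0n.
have mF n : measurable (F n) := measurable_tube cg r (r + n.+1%:R).
have FO n : F n `<=` Omega := tube_sub_Omega Hg Omega_cusp y0r (Y := _).
have UE : \bigcup_n F n = Omega `&` [set x : R * R | r <= x.1].
  apply/seteqP; split => x.
    by move=> [n _ Fx]; split; [exact: (FO n)|case: Fx => /andP[]].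
  move=> [Ox rx]; have y0x : y0 < x.1 by exact: lt_le_trans rx.
  have [n /andP[_ hn]] := archi_norm (x.1 - r).
  exists n => //; split; last exact/(Omega_cuspP Hg Omega_cusp y0x).
  rewrite rx/= -ltrBlDl; apply: (lt_le_trans hn).
  by rewrite ler_nat.
have ndF : nondecreasing_seq F.
  move=> n k nk; apply/subsetPset => x [/andP[h1 h2] h3]; split=> //.
  by rewrite h1 (lt_le_trans h2)// lerD2l ler_nat ltnS.
have sF n : sqint mu2 (F n) u := sqint_subset mO (mF n) (FO n) (proj1 hu).
have lim := @ge0_nondecreasing_set_cvg_integral _ _ _ F (fun x => (u x ^+ 2)%:E) mu2 ndF mF
  (fun n => measurable_int _ (proj2 (sF n))) (fun n x _ => ltac:(by rewrite lee_fin sqr_ge0)).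
have mU : measurable (\bigcup_n F n) := bigcupT_measurable _ mF.
have UO : \bigcup_n F n `<=` Omega by move=> x [n _]; exact: FO.
have sU : sqint mu2 (\bigcup_n F n) u := sqint_subset mO mU UO (proj1 hu).
rewrite -UE -lee_fin (dot_EFin mU sU).
apply: (cvge_le _ lim); apply: nearW => n.
by rewrite -(dot_EFin (mF n) (sF n)) lee_fin; exact: key.
Qed.

Variable nu : R.
Hypothesis nu_bounds : 0 <= nu < 1 / 2.
Variables (GD GM : set (R * R)).
Hypothesis Sigma : forall u, plate_dom Omega GD GM u ->
  trace0 Omega (if sgn == 1 then cusp_top H rho0 else cusp_bottom H rho0) u.

(** The tail and the bounded part cost [e / 4] each; [e / 2 * (d + h)] with [h <= 2 * a] is at most
    [e * (a + d)]. *)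
Lemma combine_alg (e a d h t s f : R) : d = s + t -> 0 <= e -> 0 <= a -> 0 <= d -> h <= 2 * a ->
  t <= e / 4 * (d + h) -> s <= e / 4 * (d + h) + f -> d <= e * (a + d) + f.
Proof.
move=> -> e0 a0 d0 ha ht hs.
have := ler_wpM2l e0 ha; have := mulr_ge0 e0 d0; lra.
Qed.

Lemma plate_ehrling e : 0 < e -> exists (m : nat) (f : 'I_m -> R * R -> R),
  (forall i, L2 Omega (f i)) /\ forall u, plate_dom Omega GD GM u ->
  dot mu2 Omega u u <= e * (plate_form Omega nu u u + dot mu2 Omega u u) +
    \sum_(i < m) dot mu2 Omega (f i) u ^+ 2.
Proof.
move=> e0; have e4 : 0 < e / 4 by rewrite divr_gt0.
have [r y0r hr] := tail_small (y0 + 1) e4.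
have [rho [SE [mS tS]]] := truncated_tame H_pos Hg H_decr oO Omega_smooth Omega_cusp Omega_bounded r.
have [I [B [K [hB K0 hle]]]] := tS _ e4.
set E := Omega `&` _ in SE tS hB hle.
have oE : open E := @open_norm_lt _ _ oO rho.
have mE : measurable (E : set plane) := open_measurable_plane oE.
have EO : E `<=` Omega by move=> x [].
have Er (x : R * R) : E x -> `|x| < rho by case.
have BO i : B i `<=` Omega by apply: subset_trans EO; case: (hB i).
have mB i : measurable (B i) by case: (hB i).
have Bm i : exists m, mu2 (B i) = m%:E.
  by apply: (bounded_mu2 (rho := rho) (mB i)) => x Bx; apply: Er; case: (hB i) => _; apply.
(* The functionals enter squared and must reproduce the factor [K]. *)
pose k := Num.sqrt K.
exists #|I|, (fun i => cst k \_ (B (enum_val i))); split.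
  by move=> i; have [m hm] := Bm (enum_val i); exact: (patch_cst_sqint k mO (mB _) hm).
(* On the bounded part any approximants will do; those that come with the trace on [GD] are taken,
   and they exist for empty [GD] too. *)
move=> u qu; have [hu [phi [sphi cphi _]] _ _] := qu.
have Wu : second_order Omega u by exact: (plate_dom_second_order qu).
have ipL := dot_sip mu2 mO.
have -> : \sum_(i < #|I|) dot mu2 Omega (cst k \_ (B (enum_val i))) u ^+ 2 =
    K * \sum_i (\int[mu2]_(x in B i) u x) ^+ 2.
  rewrite mulr_sumr.
  transitivity (\sum_(i in I) K * (\int[mu2]_(x in B i) u x) ^+ 2); last exact: eq_bigl.
  rewrite (big_enum_val (fun i : I => K * (\int[mu2]_(x in B i) u x) ^+ 2)).
  apply: eq_bigr => i _; have [m hm] := Bm (enum_val i).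
  by rewrite (dot_patch_cst k mO (mB _) (@BO _) hm (proj1 hu)) exprMn sqr_sqrtr.
have hs := bounded_limit oO hu sphi cphi mS mE EO Er SE (ltW e4) hB hle.
have ht := hr u hu (Sigma qu).
have [hh _] := plate_form_bounds oO nu_bounds Wu.
apply: (combine_alg _ (ltW e0) _ _ hh ht hs).
- have mT : measurable (Omega `&` [set x : R * R | r <= x.1] : set plane).
    apply: measurableI => //.
    have -> : [set x : R * R | r <= x.1] = `[r, +oo[%classic `*` setT.
      by apply/seteqP; split => x; rewrite /= in_itv/= andbT => // -[].
    by apply: measurableX; [exact: measurable_itv|exact: measurableT].
  have UE : truncated Omega r `|` (Omega `&` [set x : R * R | r <= x.1]) = Omega.
    apply/seteqP; split => x; first by case=> -[].
    by move=> Ox; have [h|h] := ltP x.1 r; [left|right].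
  have := @dot_setU R (truncated Omega r) (Omega `&` [set x : R * R | r <= x.1]) u mS mT.
  rewrite UE => -> //; last exact: (proj1 hu).
  apply/disj_setPS => x [[_ h1] [_ h2]]; move: h2; rewrite /= leNgt => /negP; apply; exact: h1.
- exact: (sip_ge0 (plate_form_sip oO nu_bounds) Wu).
- exact: (sip_ge0 ipL (proj1 hu)).
Qed.

End PlateEhrling.

(** * Discreteness of the spectrum *)

Lemma ae_eq_of_sub {R : realType} (Omega : set (measurableTypeR R * measurableTypeR R)%type)
    (v s w : (measurableTypeR R * measurableTypeR R)%type -> R) : (forall x, s x = w x) ->
  {ae (@mu2 R), forall x, Omega x -> (v - s) x = 0} -> {ae (@mu2 R), forall x, Omega x -> v x = w x}.
Proof.
move=> e h; apply: filterS h => x hx /hx; rewrite -[(v - s) x]/(v x - s x) -e => /eqP.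
by rewrite subr_eq0 => /eqP.
Qed.

(** Finitely many points lie below [t + 1]. Without [t] they form a closed set, and its complement
    below [t + 1] is a neighbourhood of [t] that meets [A] in [t] at most. *)
Lemma limit_point_eq0 {R : realType} (A : set R) :
  (forall t : R, finite_set [set s | s <= t /\ A s]) -> limit_point A = set0.
Proof.
move=> fin; apply/seteqP; split => // t ht.
pose F := [set s | s <= t + 1 /\ A s] `\ t.
have fF : finite_set F by apply: finite_setD; exact: fin.
have cF : closed F.
  by apply: accessible_finite_set_closed.1 => //; exact: hausdorff_accessible (@Rhausdorff R).
have nb : nbhs t (~` F `&` [set s | s < t + 1]).
  apply: filterI.
    by apply: open_nbhs_nbhs; split; [exact: closed_openC|move=> -[_]; apply].
  by apply: open_nbhs_nbhs; split; [exact: open_lt|rewrite /= ltrDl].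
have [s [st As [nFs slt]]] := ht _ nb.
by apply: nFs; split; [split=> //; exact: ltW|move=> e; move/eqP: st; apply].
Qed.

Section Spectrum.
Context {R : realType}.
Local Notation plane := (measurableTypeR R * measurableTypeR R)%type.
Local Notation mu2 := (@mu2 R).
Variable Omega : set (R * R).
Hypothesis oO : open Omega.
Let mO : measurable (Omega : set plane) := open_measurable_plane oO.
Let ip : (R * R -> R) -> (R * R -> R) -> R := dot mu2 Omega.
Let L : set (R * R -> R) := L2 Omega.
Let ipL : sip L ip := dot_sip mu2 mO.
Variables (a : (R * R -> R) -> (R * R -> R) -> R) (q : set (R * R -> R)).
Hypothesis qL : q `<=` L.

(** Inside L_2 the extended real distance is finite, so the two notions of convergence differ only
    by [fine]. *)
Lemma form_cvgE (u_ : nat -> R * R -> R) u : L u ->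
  form_cvg Omega q a u_ u <-> fcvg ip a q u_ u.
Proof.
move=> Lu.
have e n : q (u_ n) -> sqdistL2 Omega (u_ n) u = (ip (u_ n - u) (u_ n - u))%:E.
  by move=> /qL Ln; rewrite /ip (dot_EFin mO (linsubB (sqint_linsub mu2 mO) Ln Lu)).
split=> -[qu c1 c2]; split=> //.
- apply: cvg_trans (fine_cvg c1); apply: near_eq_cvg; apply: nearW => n.
  exact: (congr1 fine (e n (qu n))).
- have c3 : (fun n => (ip (u_ n - u) (u_ n - u))%:E) @ \oo --> (0%:E : \bar R).
    by apply: cvg_EFin => //; apply: nearW.
  by apply: cvg_trans c3; apply: near_eq_cvg; apply: nearW => n; rewrite e.
Qed.

Lemma closure_domE u : closure_dom Omega q a u <-> fdom L ip a q u.
Proof.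
split=> -[Lu [u_ cu]]; split=> //; exists u_; first exact: (form_cvgE _ Lu).1.
exact: (form_cvgE _ Lu).2.
Qed.

Lemma form_operatorE u f : form_operator Omega q a u f <-> fop L ip a q u f.
Proof.
split=> -[Du Lf h].
  have [Lu _] := Du; split; [exact: (closure_domE u).1|by []|].
  move=> v Dv; have [Lv _] := Dv; have [u_ [v_ [cu cv c]]] := h v ((closure_domE v).2 Dv).
  by exists u_, v_; split; [exact: (form_cvgE _ Lu).1|exact: (form_cvgE _ Lv).1|exact: c].
have [Lu _] := Du; split; [exact: (closure_domE u).2|by []|].
move=> v Dv; have [Lv _] := Dv; have [u_ [v_ [cu cv c]]] := h v ((closure_domE v).1 Dv).
by exists u_, v_; split; [exact: (form_cvgE _ Lu).2|exact: (form_cvgE _ Lv).2|exact: c].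
Qed.

Lemma in_resolvent_setE lam : fresolvent L ip a q lam ->
  in_resolvent_set Omega (form_operator Omega q a) lam.
Proof.
move=> [h1 [C hC]]; split.
  by move=> f Lf; have [u hu] := h1 f Lf; exists u; apply/form_operatorE.
by exists C => u f Lf /form_operatorE; exact: hC.
Qed.

Lemma eigenvalue_finite_multE lam : feigenvalue L ip a q lam -> ffinite_mult L ip a q lam ->
  eigenvalue_finite_mult Omega (form_operator Omega q a) lam.
Proof.
move=> [u [fu u0]] [n [e [Le he]]]; split.
  exists u; split; first exact/form_operatorE.
  have Lu : L u by case: fu => -[].
  move=> h; move/eqP: u0; apply; apply/(dot_eq0 mO Lu); exact: h.
exists n, e => v /form_operatorE fv; have [c hc] := he v fv.
have Lv : L v by case: fv => -[].
exists c.
have LL := sqint_linsub mu2 mO.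
have Ls : L (\sum_(k < n) c k *: e k).
  by apply: (linsub_sum _ _ LL) => k; apply: (linsubZ _ LL); exact: Le.
have := (dot_eq0 mO (linsubB LL Lv Ls)).1 hc.
apply: ae_eq_of_sub => x; rewrite fct_sumE; apply: eq_bigr => k _.
by [].
Qed.

End Spectrum.

Theorem theorem10 (R : realType) (y0 : R) (H : R -> R)
  (H_pos : forall y, y0 <= y -> 0 < H y)
  (H_smooth : smooth_from y0 H)
  (H_decr : forall y1 y2, y0 <= y1 -> y1 <= y2 -> H y2 <= H y1)
  (H_deriv : derive1 H y @[y --> +oo] --> (0 : R))
  (H_deriv2 : exists M : R, forall y, y0 < y -> `|derive1n 2 H y| <= M)
  (Omega : set (R * R))
  (Omega_open : open Omega)
  (Omega_connected : connected Omega)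
  (Omega_smooth : smooth_boundary Omega)
  (Omega_cusp : Omega `&` [set x | y0 < x.1] = cusp H y0)
  (Omega_bounded : bounded_set (Omega `\` [set x | y0 < x.1]))
  (GammaD GammaN GammaM : set (R * R))
  (GammaD_curves : finite_union_of_open_curves (boundary Omega) GammaD)
  (GammaN_curves : finite_union_of_open_curves (boundary Omega) GammaN)
  (GammaM_curves : finite_union_of_open_curves (boundary Omega) GammaM)
  (GammaDN : GammaD `&` GammaN = set0)
  (GammaDM : GammaD `&` GammaM = set0)
  (GammaNM : GammaN `&` GammaM = set0)
  (Gamma_cover : boundary Omega =
     closure GammaD `|` closure GammaN `|` closure GammaM)
  (nu : R) (nu_bounds : 0 <= nu < 1 / 2)
  (Sigma_cond : exists rho : R, y0 <= rho /\
     ((forall u, plate_dom Omega GammaD GammaM u ->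
         trace0 Omega (cusp_top H rho) u) \/
      (forall u, plate_dom Omega GammaD GammaM u ->
         trace0 Omega (cusp_bottom H rho) u)))
  (G_lim : H y ^- 3 * G_ y0 H y @[y --> +oo] --> +oo) :
  discrete_spectrum Omega (plate_operator Omega GammaD GammaM nu).
Proof.
have [g [sg Hg]] := H_smooth.
have [rho [y0rho hrho]] := Sigma_cond.
(* A sign treats the upper and the lower boundary at once, as the curve [z = sgn * g y]. *)
have [sgn [hsgn Sigma]] : exists sgn : R, (sgn = 1 \/ sgn = -1) /\
    forall u, plate_dom Omega GammaD GammaM u ->
    trace0 Omega (if sgn == 1 then cusp_top H rho else cusp_bottom H rho) u.
  case: hrho => h; [exists 1; split; [by left|by rewrite eqxx]|exists (-1); split; first by right].
  rewrite ifF//; apply/negbTE; rewrite eq_sym -subr_eq0 opprK gt_eqF// addr_gt0//.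
have mO := open_measurable_plane Omega_open.
have aW := plate_form_sip Omega_open nu_bounds.
have WL : second_order Omega `<=` L2 Omega by move=> u [].
have sq := plate_dom_linsub Omega_open GammaD GammaM.
have qW := @plate_dom_second_order R Omega GammaD GammaM.
have qL : plate_dom Omega GammaD GammaM `<=` L2 Omega by exact: subset_trans WL.
have clo := fun u_ u => @plate_form_closed R Omega Omega_open nu nu_bounds u_ u.
have ehr := fun e => @plate_ehrling R y0 H g Omega H_pos sg Hg H_decr H_deriv G_lim
  Omega_open Omega_smooth Omega_cusp Omega_bounded sgn rho hsgn y0rho nu nu_bounds
  GammaD GammaM Sigma e.
have ipL := dot_sip (@mu2 R) mO.
have alt := fspectrum_alt ipL aW WL sq qW (fun u_ => @sqint_complete _ _ _ (@mu2 R) Omega mO u_) clo ehr.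
have fin := feigenvalue_finite ipL aW WL sq qW clo ehr.
(* A point outside the resolvent set falls under the second case of [alt]; with [fin], only finitely
   many such points lie below any level. *)
have key lam : spectrum Omega (plate_operator Omega GammaD GammaM nu) lam ->
    feigenvalue (L2 Omega) (dot (@mu2 R) Omega) (plate_form Omega nu) (plate_dom Omega GammaD GammaM) lam /\
    eigenvalue_finite_mult Omega (plate_operator Omega GammaD GammaM nu) lam.
  move=> hlam; have [hr|[h1 h2]] := alt lam.
    by exfalso; apply: hlam; exact: in_resolvent_setE.
  by split; [exact: h1|exact: eigenvalue_finite_multE].
have lim0 : limit_point (spectrum Omega (plate_operator Omega GammaD GammaM nu)) = set0.
  apply: limit_point_eq0 => t; apply: sub_finite_set (fin t) => s [st /key[h _]].
  by split.
split=> // lam hlam; split; last by have [] := key lam hlam.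
(* A point of a set without limit points is isolated in it. *)
have := subset_closure hlam; rewrite closure_isolated_limit_point lim0 setU0; exact.
Qed.
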